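(* Fix any $\epsilon\in(0,1)$. For each $n$, let $X_1,\dots,X_n$ be centered i.i.d. random elements of a real separable Hilbert space $\mathbb H$ (which may vary with $n$) with a compact covariance operator $\Sigma=\mathbf E(X_1\otimes X_1)$ whose spectral decomposition is $\Sigma=\sum_{j\in\mathcal J}\lambda_j(\Sigma)\,\phi_j\otimes\phi_j$ with $\|\phi_j\|=1$ for all $j\in\mathcal J$, and suppose the following three conditions hold. (a) There is a parameter $\nu>0$, fixed with respect to $n$, such that the random variables $\zeta_{1j}=\langle X_1,\phi_j\rangle/\|\langle X_1,\phi_j\rangle\|_{L^2}$, $j\in\mathcal J$, satisfy $\sup_{j\in\mathcal J}\sup_{q\ge 2}q^{-\nu}\|\zeta_{1j}\|_{L^q}\lesssim 1$. (b) There is a parameter $\beta>1/2$, fixed with respect to $n$, such that $1\lesssim \inf_{j\in\mathcal J}\lambda_j(\Sigma)j^{2\beta}\le\sup_{j\in\mathcal J}\lambda_j(\Sigma)j^{2\beta}\lesssim 1$. (c) For each $d\in\mathcal J$, let $\mathsf J_d:\mathbb S^{d\times d}\to\mathbb S^{d\times d}$ be the covariance operator of $(\zeta_{11},\dots,\zeta_{1d})\otimes(\zeta_{11},\dots,\zeta_{1d})$, viewed as a random element of $\mathbb S^{d\times d}$. Then $1\lesssim\inf_{d\in\mathcal J}\lambda_{\min}(\mathsf J_d)\le\sup_{d\in\mathcal J}\lambda_{\max}(\mathsf J_d)\lesssim 1$. Let $\widehat\Sigma=\frac1n\sum_{i=1}^nX_i\otimes X_i$, and let $\widehat\Sigma^*=\frac1n\sum_{i=1}^nX_i^*\otimes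 X_i^*$, where $X_1^*,\dots,X_n^*$ are sampled with replacement from $X_1,\dots,X_n$. Then there is a constant $c>0$ not depending on $n$ such that the event $$\sup_{t\in\mathbb R}\Big|\mathbf P\big(\sqrt n\|\widehat\Sigma-\Sigma\|_{\mathrm{op}}\le t\big)-\mathbf P\big(\sqrt n\|\widehat\Sigma^*-\widehat\Sigma\|_{\mathrm{op}}\le t\,\big|\,X\big)\Big|\ \le\ c\,n^{-\frac{\beta-1/2}{2\beta+4+\epsilon}}$$ holds with probability at least $1-c/n$.
   Context: All objects form a triangular array with rows indexed by the sample size $n$: the space $\mathbb H$ and all model parameters may vary freely with $n$, except when stated to be fixed. For sequences of non-negative real numbers, $a_n\lesssim b_n$ means that there is a constant $c>0$ not depending on $n$ such that $a_n\le c\,b_n$ for all large $n$. The constant $c$ in the conclusion may depend on $\epsilon,\beta,\nu$ and on the constants implicit in the relations $\lesssim$ of the hypotheses. $\mathbb H$ has inner product $\langle\cdot,\cdot\rangle$ and norm $\|\cdot\|$. $\mathcal J=\{1,\dots,\dim(\mathbb H)\}$ if $\dim(\mathbb H)<\infty$, and $\mathcal J=\{1,2,\dots\}$ otherwise. For $x,y\in\mathbb H$, $x\otimes y$ is the operator $z\mapsto\langle y,z\rangle x$; for Euclidean vectors $x\otimes y=xy^\top$. Eigenvalues are sorted as $\lambda_1\ge\lambda_2\ge\cdots$. $\|\cdot\|_{\mathrm{op}}$ is the operator norm, and $\|U\|_{L^q}=(\mathbf E|U|^q)^{1/q}$ for a scalar random variable $U$. $\mathbb S^{d\times d}$ is the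 Hilbert space of real symmetric $d\times d$ matrices with inner product $\langle\!\langle A,B\rangle\!\rangle=\mathrm{tr}(AB)$. The covariance operator of a random element $W$ of $\mathbb S^{d\times d}$ is the linear operator $\mathsf K$ on $\mathbb S^{d\times d}$ satisfying $\langle\!\langle A,\mathsf K(B)\rangle\!\rangle=\mathrm{cov}(\langle\!\langle A,W\rangle\!\rangle,\langle\!\langle B,W\rangle\!\rangle)$ for all $A,B\in\mathbb S^{d\times d}$; $\lambda_{\min},\lambda_{\max}$ denote its smallest and largest eigenvalues. $\mathbf P(\cdot\,|X)$ denotes probability conditional on $X_1,\dots,X_n$. ''Sampled with replacement'' means that, conditionally on $X_1,\dots,X_n$, the $X_i^*$ are i.i.d. uniform draws from $X_1,\dots,X_n$. *)

(* Defs.v *)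
From HB Require Import structures.
From mathcomp Require Import all_boot all_order all_algebra sesquilinear.
From mathcomp Require Import all_classical all_reals all_analysis.

Set Implicit Arguments.
Unset Strict Implicit.
Unset Printing Implicit Defensive.

Import Order.TTheory GRing.Theory Num.Theory.
Import numFieldNormedType.Exports.

Local Open Scope classical_set_scope.
Local Open Scope ring_scope.

(* The implicit constant and the threshold are arguments, so that a conclusion
   can be required to depend on nothing else. *)
Definition lesssim (R : realType) (K : R) (n0 : nat) (a b : nat -> \bar R) :=
  forall n, (n0 <= n)%N -> (a n <= K%:E * b n)%E.

HB.mixin Record NormedModule_isHilbert (R : realType) H
    & CompleteNormedModule R H := {
  inner : {dot H for idfun} ;
  inner_normE : forall x : H, inner x x = `|x| ^+ 2
}.

#[short(type="hilbertType")]
HB.structure Definition Hilbert (R : realType) :=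
  {H of CompleteNormedModule R H & NormedModule_isHilbert R H}.

Notation "'<< x , y >>" := (inner x y)
  (at level 0, x at level 99, y at level 99, format "''<<'  x ,  y  '>>'")
  : ring_scope.

Section hilbert.
Context {R : realType} {H : hilbertType R}.
Implicit Types (x y z : H) (A : H -> H).

Definition separable_space (U : topologicalType) :=
  exists2 D : set U, countable D & dense D.

Definition tensor x y : H -> H := fun z => '<<y, z>> *: x.

Definition opnorm A : R := sup [set `|A x| | x in [set x | `|x| <= 1]].

Definition compact_operator A := compact (closure (A @` [set x | `|x| <= 1])).

Definition has_dim N := exists e : 'I_N -> H,
  forall x, exists! a : 'rV[R]_N, x = \sum_i a 0 i *: e i.

(* {1, ..., dim H} when dim H is finite, {1, 2, ...} otherwise *)
Definition dim_index : set nat :=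
  [set j | (1 <= j)%N /\ forall N, has_dim N -> (j <= N)%N].

(* The phi_j need not be complete: the sum may omit part of the kernel of S when
   H has infinite dimension. *)
Definition spectral_decomposition (S : H -> H)
    (lambda : nat -> R) (phi : nat -> H) :=
  [/\ forall i j, dim_index i -> dim_index j -> (i <= j)%N ->
        lambda j <= lambda i,
      forall j, dim_index j -> `|phi j| = 1,
      forall i j, dim_index i -> dim_index j -> i <> j ->
        '<<phi i, phi j>> = 0 &
      forall x, (\sum_(1 <= j < N.+1 | j \in dim_index)
                   lambda j *: tensor (phi j) (phi j) x) @[N --> \oo] --> S x].

Definition borel : set (set H) := <<s [set U : set H | open U] >>.

Definition empirical_cov n (x : 'I_n.+1 -> H) : H -> H :=
  fun z => n.+1%:R^-1 *: \sum_i tensor (x i) (x i) z.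

End hilbert.
Arguments has_dim {R} H N.
Arguments dim_index {R} H.
Arguments borel {R} H.

Section random_elements.
Context {R : realType} {d : measure_display} {T : measurableType d}.
Variable P : probability T R.

Section hilbert_valued.
Context {H : hilbertType R}.

Definition random_element (Y : T -> H) :=
  forall A, borel H A -> measurable (Y @^-1` A).

(* Expectations in H and of operators on H are taken in the weak sense. *)
Definition centered (Y : T -> H) := forall x,
  P.-integrable setT (fun w => '<<x, Y w>>%:E) /\
  ('E_P[fun w => ('<<x, Y w>>)%R] = 0)%E.

(* S = E (Y (x) Y) *)
Definition second_moment_operator (Y : T -> H) (S : H -> H) := forall x y,
  P.-integrable setT (fun w => '<<x, tensor (Y w) (Y w) y>>%:E) /\
  ('E_P[fun w => ('<<x, tensor (Y w) (Y w) y>>)%R] = ('<<x, S y>>)%R%:E)%E.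

Variable n : nat.
Implicit Types X Xs : 'I_n.+1 -> T -> H.

Definition identically_distributed X := forall i j A, borel H A ->
  P (X i @^-1` A) = P (X j @^-1` A).

(* The product rule over subfamilies is the case where some A i are setT. *)
Definition independent X := forall A : 'I_n.+1 -> set H,
  (forall i, borel H (A i)) ->
  P (\bigcap_i (X i @^-1` A i)) = (\prod_i P (X i @^-1` A i))%E.

Definition sigma_generated X : set (set T) :=
  <<s [set B | exists i A, borel H A /\ B = X i @^-1` A] >>.

End hilbert_valued.

Definition cond_prob_version (G : set (set T)) (E : set T) (f : T -> R) :=
  [/\ forall B : set R, measurable B -> G (f @^-1` B),
      P.-integrable setT (EFin \o f) &
      forall A, G A -> (\int[P]_(w in A) (f w)%:E)%E = P (A `&` E)].

Definition regular_cond_distribution (G : set (set T)) (S : T -> R)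
    (kappa : T -> probability (measurableTypeR R) R) :=
  forall B : set R, measurable B ->
    cond_prob_version G (S @^-1` B) (fun w => fine (kappa w B)).

(* Conditionally on X, the joint law of Xs is the product of n.+1 copies of the
   empirical measure of X. *)
Definition sampled_with_replacement (H : hilbertType R) n
    (X Xs : 'I_n.+1 -> T -> H) :=
  forall A : 'I_n.+1 -> set H, (forall i, borel H (A i)) ->
    cond_prob_version (sigma_generated X) (\bigcap_i (Xs i @^-1` A i))
      (fun w => \prod_i (#|[pred j | X j w \in A i]|%:R / n.+1%:R)).

Definition standardized (H : hilbertType R) (Y : T -> H) (phi : nat -> H)
    (j : nat) (w : T) : R :=
  '<<Y w, phi j>> / fine ('N[P]_2%:E [EFin \o (fun v => '<<Y v, phi j>>)])%E.

End random_elements.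

Definition symv (R : realType) (d : nat) : {vspace 'M[R]_d} :=
  fixedSpace (linfun (@trmx R d d)).

Notation symmx R d := (subvs_of (symv R d)).

Lemma symvP (R : realType) d (A : 'M[R]_d) : reflect (A^T = A) (A \in symv R d).
Proof. by apply: (iffP fixedSpaceP); rewrite lfunE. Qed.

Lemma outer_symv (R : realType) d (x : 'cV[R]_d) : x *m x^T \in symv R d.
Proof. by apply/symvP; rewrite trmx_mul trmxK. Qed.

Definition outer (R : realType) d (x : 'cV[R]_d) : symmx R d :=
  Subvs (outer_symv x).

Definition mxinner (R : realType) d (A B : symmx R d) : R :=
  \tr (vsval A *m vsval B).

Definition covariance_operator (R : realType) (d : measure_display)
    (T : measurableType d) (P : probability T R) (k : nat)
    (W : T -> symmx R k) (K : 'End(symmx R k)) :=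
  forall A B : symmx R k, (mxinner A (K B))%:E =
    covariance P (fun w => mxinner A (W w)) (fun w => mxinner B (W w)).

Definition lambda_min (R : realType) (V : vectType R) (K : 'End(V)) : \bar R :=
  ereal_inf [set a%:E | a in [set a : R | passmx.leigenvalue K a]].

Definition lambda_max (R : realType) (V : vectType R) (K : 'End(V)) : \bar R :=
  ereal_sup [set a%:E | a in [set a : R | passmx.leigenvalue K a]].

(* Main.v *)
Require Import Defs.
From HB Require Import structures.
From mathcomp Require Import all_boot all_order all_algebra sesquilinear.
From mathcomp Require Import all_classical all_reals all_analysis.
From mathcomp Require Import measurable_realfun ring lra zify.

Set Implicit Arguments.
Unset Strict Implicit.
Unset Printing Implicit Defensive.

Import Order.TTheory GRing.Theory Num.Theory.
Import numFieldNormedType.Exports.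

Local Open Scope classical_set_scope.
Local Open Scope ring_scope.

(** The squared scores decay polynomially, so that the operator norm of the fluctuation of the
    sample covariance is governed by polynomially few products of scores.

    In the eigenbasis of [Sigma] the form of [Sigmah - Sigma] at a pair of vectors is a linear
    functional of the centred averages of the products of standardized scores, one for each
    unordered pair of indices. The operator norm is the supremum of these forms over the unit ball,
    hence a seminorm of a sum of independent centred vectors, and the bootstrap counterpart is the
    same seminorm of the resampled sum. Two facts about this seminorm matter: its square is at most
    a sum of squared coordinates with weights that decay polynomially, and each single weighted
    coordinate is bounded by a multiple of it. The covariance of the products is bounded below by
    condition (c).

    The supremum is approximated by finitely many forms of finitely many scores, rounded to finitely
    many values ([finite_description]). This reduces the theorem to samples from a law on a finite
    set, uniformly in the size of that set and in the dimensions ([rounded_admissible], [AT]). The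
    approximation errors vanish for each fixed sample size, so they do not enter the rate; the
    passage back to the conditional law given the sample is [transfer].

    For a finite law, the coordinates are split at a level that is a power of the sample size.
    The tail is negligible by moment bounds. The head is whitened and both the sum and the bootstrap
    sum are compared with one Gaussian vector: a Berry-Esseen bound for balls of a seminorm, proved
    by replacing the summands one at a time. The Gaussian summands already present smooth the law of
    the one being replaced, and the chi-square distance of the smoothed laws is a double sum of
    Mehler kernels, so that only powers of the dimension of the head are lost. Anti-concentration of
    the Gaussian seminorm, obtained by rescaling its first coordinates, turns errors in the radius
    into errors in
    probability; the bootstrap covariance is close to the true one outside an event of probability
    of order [1/n]. Balancing the tail against the dimension of the head gives an exponent
    [alpha / (2 * alpha + 4)] with [alpha = beta - 1/2]; its distance to the slightly smaller
    [alpha / (2 * alpha + 5)] pays for all losses that are small powers of [n]. *)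

Ltac mreal := repeat first [ exact: measurable_cst | exact: measurable_id | assumption | done
  | apply: measurable_funD | apply: measurable_funB | apply: measurable_funM
  | apply: measurable_funX
  | apply: (measurableT_comp (@measurable_expR _))
  | apply: (measurableT_comp (@oppr_measurable _ _)) ].
Section Gauss1.
Context {R : realType}.
Notation mu := (@lebesgue_measure R).
Implicit Types (h : R -> \bar R) (s b r x y t l m : R).

Lemma measurable_affine s b : measurable_fun [set: R] (fun z : R => b + s * z).
Proof. by apply: measurable_funD => //; apply: measurable_funM. Qed.

Lemma lebesgue_measure_affine s b (s0 : 0 < s) (A : set R) : measurable A ->
  mu A = (s%:E * mu ((fun z : R => b + s * z)%R @^-1` A))%E.
Proof.
move=> mA.
have mf := measurable_affine s b.
pose f := (fun z : R => b + s * z) : measurableTypeR R -> measurableTypeR R.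
apply: (@lebesgue_measure_unique R (mscale (NngNum (ltW s0)) (pushforward mu f))) => //.
move=> X [[a c] _ <-].
rewrite /mscale /pushforward /=.
rewrite {}/f /mscale /=.
pose I : set R := `](a - b) / s, (c - b) / s]%classic.
have E : (fun z : R => b + s * z) @^-1` `]a, c] = I.
  apply/seteqP; split=> z; rewrite /I /= !in_itv /= => /andP[az zc]; apply/andP; split.
  - by rewrite ltr_pdivrMr // ltrBlDl mulrC.
  - by rewrite ler_pdivlMr // lerBrDl mulrC.
  - by rewrite -ltrBlDl mulrC -ltr_pdivrMr.
  - by rewrite -lerBrDl mulrC -ler_pdivlMr.
transitivity (s%:E * mu I)%E; last first.
  by rewrite -E.
rewrite /I !lebesgue_measure_itv /= !lte_fin ltr_pM2r ?invr_gt0 // ltrD2r.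
case: ifP => _; last by rewrite mule0.
by rewrite -!EFinD -EFinM; congr EFin; field; rewrite gt_eqF.
Qed.

Lemma lebesgue_affine s b (s0 : 0 < s) h : measurable_fun setT h ->
  (forall z, 0 <= h z)%E ->
  (\int[mu]_z h z = s%:E * \int[mu]_z h (b + s * z)%R)%E.
Proof.
move=> mh h0.
have mf := measurable_affine s b.
pose f := (fun z : R => b + s * z) : measurableTypeR R -> measurableTypeR R.
rewrite (eq_measure_integral (mscale (NngNum (ltW s0)) (pushforward mu f))); last first.
  by move=> A mA _; exact: (lebesgue_measure_affine b s0 mA).
rewrite ge0_integral_mscale //=.
by rewrite ge0_integral_pushforward.
Qed.

Definition pk : R := normal_peak 1.

Lemma pk_gt0 : 0 < pk.
Proof. by rewrite /pk normal_peak_gt0 ?oner_eq0. Qed.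

Lemma pk_le_half : pk <= 2^-1.
Proof.
have p2 : 4 <= pi *+ 2 :> R by have := @pi_ge2 R; rewrite -mulr_natr; lra.
have p0 : 0 < pi *+ 2 :> R by lra.
rewrite /pk /normal_peak expr1n mul1r lef_pV2 ?posrE ?sqrtr_gt0 //.
have -> : (2 : R) = Num.sqrt (2 ^+ 2) by rewrite sqrtr_sqr ger0_norm.
by rewrite ler_wsqrtr //; apply: le_trans p2; lra.
Qed.

Lemma normal_pdf_formula m s x : 0 < s ->
  normal_pdf m s x = s^-1 * pk * expR (- (x - m) ^+ 2 / (2 * s ^+ 2)).
Proof.
move=> s0; rewrite normal_pdfE ?gt_eqF // /normal_fun mulr_natl.
congr (_ * _); rewrite /pk /normal_peak -mulrnAr sqrtrM ?sqr_ge0 //.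
by rewrite sqrtr_sqr gtr0_norm // invfM expr1n mul1r.
Qed.

Definition gam : probability (measurableTypeR R) R := normal_prob 0 1.

Lemma integral_normal_probE m s h : s != 0 -> measurable_fun setT h ->
  (forall x, 0 <= h x)%E ->
  (\int[normal_prob m s]_x h x = \int[mu]_x (h x * (normal_pdf m s x)%:E))%E.
Proof.
move=> s0 mh h0.
have dom := @normal_prob_dominates R m s.
have mpdf : measurable_fun [set: measurableTypeR R] (EFin \o normal_pdf m s).
  by apply/measurable_EFinP; exact: measurable_normal_pdf.
have mRN := measurable_int _ (Radon_Nikodym_SigmaFinite.f_integrable dom).
rewrite -(Radon_Nikodym_SigmaFinite.change_of_variables dom) //.
apply: ae_eq_integral => //.
- exact: emeasurable_funM.
- exact: emeasurable_funM.
apply: ae_eqe_mul2l; apply: integral_ae_eq => //.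
  exact: Radon_Nikodym_SigmaFinite.f_integrable.
by move=> A _ mA; rewrite -Radon_Nikodym_SigmaFinite.f_integral.
Qed.

Lemma integral_gamE h : measurable_fun setT h -> (forall x, 0 <= h x)%E ->
  (\int[gam]_x h x = \int[mu]_x (h x * (normal_pdf 0 1 x)%:E))%E.
Proof. by move=> mh h0; rewrite -(integral_normal_probE _ (oner_neq0 _) mh h0). Qed.

Lemma normal_prob_affine b s h : 0 < s -> measurable_fun setT h ->
  (forall x, 0 <= h x)%E ->
  (\int[gam]_x h (b + s * x)%R = \int[normal_prob b s]_x h x)%E.
Proof.
move=> s0 mh h0; have s0' : s != 0 by rewrite gt_eqF.
rewrite (integral_normal_probE _ s0' mh h0).
have mh' : measurable_fun setT (fun x => h (b + s * x)).
  by apply: measurableT_comp => //; exact: measurable_affine.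
have h0' x : (0 <= h (b + s * x)%R)%E by [].
rewrite (integral_gamE mh' h0').
rewrite [RHS](lebesgue_affine b s0) //; last 2 first.
- apply: emeasurable_funM => //; apply/measurable_EFinP.
  exact: measurable_normal_pdf.
- by move=> z; rewrite mule_ge0 // lee_fin normal_pdf_ge0.
rewrite -ge0_integralZl //.
- apply: eq_integral => x _; rewrite muleCA -EFinM; congr (_ * _%:E)%E.
  rewrite !normal_pdf_formula // invr1 mul1r !mulrA mulfV // mul1r.
  congr (_ * expR _); field; rewrite s0'; done.
- apply: emeasurable_funM.
    by apply: measurableT_comp => //; exact: measurable_affine.
  apply/measurable_EFinP; apply: measurableT_comp; first exact: measurable_normal_pdf.
  exact: measurable_affine.
- by move=> x _; rewrite mule_ge0 // lee_fin normal_pdf_ge0.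
- by rewrite lee_fin ltW.
Qed.

(** The total mass of an unnormalized Gaussian density. *)
Lemma integral_expR_sqr m s : 0 < s ->
  (\int[mu]_x (expR (- (x - m) ^+ 2 / (2 * s ^+ 2)))%:E = (s / pk)%:E)%E.
Proof.
move=> s0; have p0 := pk_gt0; have sp0 : 0 < s / pk by rewrite divr_gt0.
transitivity (\int[mu]_x ((s / pk)%:E * (normal_pdf m s x)%:E))%E.
  apply: eq_integral => x _; rewrite -EFinM normal_pdf_formula //; congr EFin.
  by field; rewrite !gt_eqF.
rewrite ge0_integralZl //.
- by rewrite integral_normal_pdf mule1.
- by apply/measurable_EFinP; exact: measurable_normal_pdf.
- by move=> x _; rewrite lee_fin normal_pdf_ge0.
- by rewrite lee_fin ltW.
Qed.

Lemma gam_small_ball x (L t l : R) : 0 < l -> l <= L -> 0 <= t ->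
  (gam [set z | `|x + L * z| <= t]%R <= (t / l)%:E)%E.
Proof.
move=> l0 lL t0.
have L0 : 0 < L by exact: lt_le_trans lL.
apply: (@le_trans _ _ (t / L)%:E); last first.
  by rewrite lee_fin ler_wpM2l // lef_pV2.
pose I : set R := `[(- t - x) / L, (t - x) / L]%classic.
have -> : [set z | `|x + L * z| <= t] = I.
  apply/seteqP; split => z; rewrite /I /= in_itv /= ler_pdivrMr // ler_pdivlMr // ler_norml.
    by move=> /andP[h1 h2]; apply/andP; split; lra.
  by move=> /andP[h1 h2]; apply/andP; split; lra.
have ab : (- t - x) / L <= (t - x) / L by rewrite ler_pM2r ?invr_gt0 //; lra.
have mI : measurable I by rewrite /I.
rewrite /gam /= /normal_prob.
apply: (@le_trans _ _ (\int[mu]_(z in I) (2^-1)%:E)%E).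
  apply: ge0_le_integral => //.
  - by move=> z _; rewrite lee_fin normal_pdf_ge0.
  - by apply/measurable_EFinP/measurable_funTS; exact: measurable_normal_pdf.
  - move=> z _; rewrite lee_fin; apply: (le_trans (normal_pdf_ub _ _ (oner_neq0 _))).
    exact: pk_le_half.
rewrite integral_cst //= /I lebesgue_measure_itv /= lte_fin.
case: ifP => _; last by rewrite mule0 lee_fin divr_ge0 // ltW.
rewrite -EFinB -EFinM lee_fin -mulrBl; lra.
Qed.

Lemma gam_scale h s : 0 <= s -> measurable_fun setT h -> (forall x, 0 <= h x)%E ->
  (\int[gam]_x h x <= (1 + s)%:E * \int[gam]_x h ((1 + s) * x)%R)%E.
Proof.
move=> s0 mh h0; have s1 : 0 < 1 + s by rewrite ltr_wpDr.
have -> : (\int[gam]_x h ((1 + s) * x)%R = \int[gam]_x h (0 + (1 + s) * x)%R)%E.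
  by apply: eq_integral => x _; rewrite add0r.
have s1' : 1 + s != 0 by rewrite gt_eqF.
rewrite (integral_gamE mh h0) (normal_prob_affine _ s1 mh h0) (integral_normal_probE _ s1' mh h0).
rewrite -ge0_integralZl //; last 3 first.
- apply: emeasurable_funM => //; apply/measurable_EFinP; exact: measurable_normal_pdf.
- by move=> x _; rewrite mule_ge0 // lee_fin normal_pdf_ge0.
- by rewrite lee_fin ltW.
apply: ge0_le_integral => //.
- by move=> x _; rewrite mule_ge0 // lee_fin normal_pdf_ge0.
- apply: emeasurable_funM => //; apply/measurable_EFinP; exact: measurable_normal_pdf.
- apply: emeasurable_funM => //; apply: emeasurable_funM => //; apply/measurable_EFinP; exact: measurable_normal_pdf.
- move=> x _; rewrite muleCA lee_wpmul2l // -EFinM lee_fin.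
  rewrite !normal_pdf_formula // invr1 mul1r !mulrA mulfV // mul1r.
  rewrite ler_pM2l ?pk_gt0 // ler_expR !mulNr lerN2 !subr0.
  apply: ler_wpM2l; first exact: sqr_ge0.
  rewrite lef_pV2 ?posrE; [|by rewrite !mulr_gt0..].
  by rewrite !mulr1 -mulrA ler_peMr // -expr2 exprn_ege1 // lerDl.
Qed.


(** The Mehler kernel: the density of the law of [r x + sqrt (1 - r^2) Z] with
    respect to that of [Z], for a standard normal [Z]. *)
Definition mehler (r x z : R) : R :=
  (Num.sqrt (1 - r ^+ 2))^-1 * expR (- (z - r * x) ^+ 2 / (2 * (1 - r ^+ 2)) + z ^+ 2 / 2).

Lemma mehler_gt0 r x z : r ^+ 2 < 1 -> 0 < mehler r x z.
Proof. by move=> r1; rewrite mulr_gt0 ?expR_gt0 // invr_gt0 sqrtr_gt0 subr_gt0. Qed.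

Lemma measurable_mehler r x : measurable_fun [set: R] (mehler r x).
Proof.
rewrite /mehler; mreal.
Qed.

Lemma mehler_density r x h : r ^+ 2 < 1 -> measurable_fun setT h ->
  (forall x, 0 <= h x)%E ->
  (\int[gam]_z h (r * x + Num.sqrt (1 - r ^+ 2) * z)%R =
   \int[gam]_z (h z * (mehler r x z)%:E))%E.
Proof.
move=> r1 mh h0; set s := Num.sqrt _.
have s0 : 0 < s by rewrite sqrtr_gt0 subr_gt0.
have s0' : s != 0 by rewrite gt_eqF.
have s2 : s ^+ 2 = 1 - r ^+ 2 by rewrite sqr_sqrtr // subr_ge0 ltW.
have mhm : measurable_fun setT (fun z => (h z * (mehler r x z)%:E)%E).
  by apply: emeasurable_funM => //; apply/measurable_EFinP; exact: measurable_mehler.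
have hm0 z : (0 <= h z * (mehler r x z)%:E)%E.
  by rewrite mule_ge0 // lee_fin ltW // mehler_gt0.
rewrite (integral_gamE mhm hm0) (normal_prob_affine _ s0 mh h0) (integral_normal_probE _ s0' mh h0).
apply: eq_integral => z _; rewrite -muleA -EFinM; congr (_ * _%:E)%E.
rewrite !normal_pdf_formula // invr1 mul1r /mehler -/s -s2.
set e1 := expR _; set e2 := expR _; set e3 := expR _.
rewrite (_ : s^-1 * e2 * (pk * e3) = s^-1 * pk * (e2 * e3)); last by ring.
by congr (_ * _); rewrite /e1 /e2 /e3 -expRD; congr expR; field.
Qed.

Lemma mehler_int1 r x : r ^+ 2 < 1 -> (\int[gam]_z (mehler r x z)%:E = 1)%E.
Proof.
move=> r1; transitivity (\int[gam]_z (cst 1 z * (mehler r x z)%:E))%E.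
  by apply: eq_integral => z _; rewrite mul1e.
rewrite -(@mehler_density r x (cst 1%E) r1 (measurable_cst _) (fun=> lee01)).
by rewrite integral_cst // mul1e; exact: probability_setT.
Qed.

Lemma mehler_int2 r x y : r ^+ 2 < 1 ->
  (\int[gam]_z (mehler r x z * mehler r y z)%:E =
   ((Num.sqrt (1 - r ^+ 4))^-1 *
    expR (r ^+ 2 * (2 * (x * y) - r ^+ 2 * (x ^+ 2 + y ^+ 2)) / (2 * (1 - r ^+ 4))))%:E)%E.
Proof.
move=> r1; have [t tE] : exists t, t = r ^+ 2 by exists (r ^+ 2).
have t0 : 0 <= t by rewrite tE sqr_ge0.
have r4 : r ^+ 4 = t ^+ 2 by rewrite tE -exprM.
have [t1 t2] : 0 < 1 - t /\ 0 < 1 + t by rewrite -tE in r1; split; lra.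
rewrite r4 -tE.
have t12 : 0 < 1 - t ^+ 2 by rewrite (_ : 1 - t ^+ 2 = (1 - t) * (1 + t)); [exact: mulr_gt0|ring].
set s := Num.sqrt ((1 - t) / (1 + t)).
have s0 : 0 < s by rewrite sqrtr_gt0 divr_gt0.
have s2 : s ^+ 2 = (1 - t) / (1 + t) by rewrite sqr_sqrtr // ltW // divr_gt0.
pose c := r * (x + y) / (1 + t).
pose K := expR (t * (2 * (x * y) - t * (x ^+ 2 + y ^+ 2)) / (2 * (1 - t ^+ 2))).
have mm : measurable_fun setT (fun z => (mehler r x z * mehler r y z)%:E).
  by apply/measurable_EFinP; apply: measurable_funM; exact: measurable_mehler.
have m0 z : (0 <= (mehler r x z * mehler r y z)%:E)%E.
  by rewrite lee_fin mulr_ge0 // ltW // mehler_gt0.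
rewrite (integral_gamE mm m0).
transitivity (\int[mu]_z ((pk / (1 - t) * K)%:E * (expR (- (z - c) ^+ 2 / (2 * s ^+ 2)))%:E))%E.
  apply: eq_integral => z _; rewrite -!EFinM; congr EFin.
  rewrite normal_pdf_formula // /mehler -tE /K invr1 mul1r.
  have q : (Num.sqrt (1 - t))^-1 * (Num.sqrt (1 - t))^-1 = (1 - t)^-1.
    by rewrite -invfM -expr2 sqr_sqrtr // ltW.
  rewrite (_ : _ * _ * _ = ((Num.sqrt (1 - t))^-1 * (Num.sqrt (1 - t))^-1) * pk *
    (expR (- (z - r * x) ^+ 2 / (2 * (1 - t)) + z ^+ 2 / 2) *
     expR (- (z - r * y) ^+ 2 / (2 * (1 - t)) + z ^+ 2 / 2) *
     expR (- (z - 0) ^+ 2 / (2 * 1 ^+ 2)))); last by ring.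
  rewrite q -!mulrA [RHS]mulrCA; congr (_ * _); congr (_ * _).
  rewrite -!expRD; congr expR; rewrite s2 /c.
  have rt : r * r = t by rewrite tE -expr2.
  have -> : (z - r * x) ^+ 2 = z ^+ 2 - 2 * r * z * x + t * x ^+ 2 by rewrite -rt; ring.
  have -> : (z - r * y) ^+ 2 = z ^+ 2 - 2 * r * z * y + t * y ^+ 2 by rewrite -rt; ring.
  have -> : (z - r * (x + y) / (1 + t)) ^+ 2 =
    z ^+ 2 - 2 * r * z * (x + y) / (1 + t) + t * (x + y) ^+ 2 / (1 + t) ^+ 2.
    by rewrite -rt; field; rewrite rt gt_eqF.
  by field; rewrite !gt_eqF.
rewrite ge0_integralZl //=; last 2 first.
- by apply/measurable_EFinP; mreal.
- by rewrite lee_fin mulr_ge0 ?expR_ge0 // divr_ge0 ?ltW ?pk_gt0.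
rewrite integral_expR_sqr // -EFinM; congr EFin.
rewrite (_ : _ * _ = s / (1 - t) * K); last by field; rewrite !gt_eqF ?pk_gt0.
congr (_ * _); apply: (@pexpIrn _ 2) => //; rewrite ?nnegrE ?divr_ge0 ?invr_ge0 ?sqrtr_ge0 ?ltW //.
rewrite [RHS]exprVn [Num.sqrt _ ^+ 2]sqr_sqrtr ?(ltW t12) // exprMn s2 exprVn; field.
by rewrite !gt_eqF.
Qed.

Lemma gam_mgf l : (\int[gam]_z (expR (l * z))%:E = (expR (l ^+ 2 / 2))%:E)%E.
Proof.
have mm : measurable_fun setT (fun z => (expR (l * z))%:E).
  by apply/measurable_EFinP; apply: measurableT_comp => //; exact: measurable_funM.
rewrite (integral_gamE mm) //.
transitivity (\int[mu]_z ((pk * expR (l ^+ 2 / 2))%:E * (expR (- (z - l) ^+ 2 / (2 * 1 ^+ 2)))%:E))%E.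
  apply: eq_integral => z _; rewrite -!EFinM normal_pdf_formula //; congr EFin.
  rewrite invr1 mul1r mulrCA -!mulrA; congr (_ * _); rewrite -!expRD; congr expR.
  by field.
rewrite ge0_integralZl //=; last 2 first.
- by apply/measurable_EFinP; mreal.
- by rewrite lee_fin mulr_ge0 ?expR_ge0 // ltW ?pk_gt0.
rewrite integral_expR_sqr // -EFinM; congr EFin.
by field; rewrite !gt_eqF ?pk_gt0.
Qed.

End Gauss1.

(** * Powers of the standard normal law *)
Section GaussPower.
Context {R : realType}.
Notation RM := (measurableTypeR R).
Notation gam := (@gam R).

Section prodprob.
Context d (T : measurableType d) (m : probability T R).
Definition gprod : set (RM * T) -> \bar R := (gam \x m)%E.
HB.instance Definition _ := Measure.on gprod.
Let gprod_setT : gprod setT = 1%E.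
Proof.
rewrite /gprod -setXTT product_measure1E //.
by rewrite [X in (X * _)%E]probability_setT [X in (_ * X)%E]probability_setT mule1.
Qed.
HB.instance Definition _ := Measure_isProbability.Build _ _ _ gprod gprod_setT.
End prodprob.

Definition tcons D (x : RM * D.-tuple RM) : D.+1.-tuple RM := [tuple of x.1 :: x.2].

Lemma measurable_tcons D : measurable_fun [set: RM * D.-tuple RM] (@tcons D).
Proof. exact: (measurable_cons measurable_fst measurable_snd). Qed.

HB.instance Definition _ D := isMeasurableFun.Build _ _ _ _ (@tcons D) (@measurable_tcons D).

Fixpoint gpow D : probability (D.-tuple RM) R :=
  match D with
  | 0 => dirac [tuple]
  | D.+1 => distribution (gprod (gpow D)) (@tcons D)
  end.

Lemma gpow_integralS D (F : D.+1.-tuple RM -> \bar R) :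
  measurable_fun setT F -> (forall z, 0 <= F z)%E ->
  (\int[gpow D.+1]_z F z = \int[gam]_x \int[gpow D]_z F [tuple of x :: z])%E.
Proof.
move=> mF F0.
rewrite [gpow D.+1]/= ge0_integral_distribution //.
rewrite (_ : \int[_]_z _ = \int[(gam \x gpow D)%E]_z (F \o @tcons D) z)%E //.
rewrite fubini_tonelli1 //; last by move=> x; exact: F0.
by apply: measurableT_comp => //; exact: measurable_tcons.
Qed.

Lemma gpow_integral0 (F : 0.-tuple RM -> \bar R) :
  measurable_fun setT F -> (\int[gpow 0]_z F z = F [tuple])%E.
Proof. by move=> mF; rewrite integral_dirac // diracT mul1e. Qed.


Lemma measurable_nth D i : measurable_fun [set: D.-tuple RM] (fun z : D.-tuple RM => nth 0 z i : R).
Proof.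
have [iD|iD] := ltnP i D.
  rewrite (_ : (fun z => _) = (fun z : D.-tuple RM => tnth z (Ordinal iD))); first exact: measurable_tnth.
  by apply/funext => z; rewrite (tnth_nth 0).
rewrite (_ : (fun z => _) = cst 0); first exact: measurable_cst.
by apply/funext => z; rewrite nth_default // size_tuple.
Qed.

Lemma measurable_tuple_cons D (x : R) :
  measurable_fun [set: D.-tuple RM] (fun z : D.-tuple RM => [tuple of x :: z] : D.+1.-tuple RM).
Proof. exact: (@measurable_cons _ _ _ RM (cst x) _ id). Qed.

Lemma measurable_cons_section D (F : D.+1.-tuple RM -> \bar R) x :
  measurable_fun setT F -> measurable_fun setT (fun z : D.-tuple RM => F [tuple of x :: z]).
Proof. by move=> mF; apply: measurableT_comp => //; exact: measurable_tuple_cons. Qed.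

Lemma measurable_gpow_section D (F : D.+1.-tuple RM -> \bar R) :
  measurable_fun setT F -> (forall z, 0 <= F z)%E ->
  measurable_fun [set: RM] (fun x => \int[gpow D]_z F [tuple of x :: z])%E.
Proof.
move=> mF F0; apply: (@measurable_fun_fubini_tonelli_F _ _ _ _ _ (gpow D) (F \o @tcons D)).
  by apply: measurableT_comp => //; exact: measurable_tcons.
by move=> x; exact: F0.
Qed.

Definition tmap D (g : nat -> R -> R) (z : D.-tuple RM) : D.-tuple RM :=
  [tuple of mkseq (fun i => g i (nth 0 z i)) D].

Lemma nth_tmap D g (z : D.-tuple RM) i : (i < D)%N -> nth 0 (tmap g z) i = g i (nth 0 z i).
Proof. by move=> iD; rewrite nth_mkseq. Qed.

Lemma tmap_cons D g x (z : D.-tuple RM) :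
  tmap g [tuple of x :: z] = [tuple of g 0 x :: tmap (fun i => g i.+1) z].
Proof.
apply/val_inj.
change (mkseq (fun i => g i (nth 0 (x :: tval z) i)) D.+1 =
        g 0 x :: mkseq (fun i => g i.+1 (nth 0 (tval z) i)) D).
by rewrite /mkseq /= (iotaDl 1 0 D) -map_comp.
Qed.

Lemma measurable_tmap D (g : nat -> R -> R) : (forall i, measurable_fun [set: R] (g i)) ->
  measurable_fun [set: D.-tuple RM] (tmap g : D.-tuple RM -> D.-tuple RM).
Proof.
move=> mg; apply/measurable_fun_tnthP => i.
rewrite (_ : _ \o _ = g i \o (fun z : D.-tuple RM => nth 0 z i)).
  by apply: measurableT_comp; [exact: mg|exact: measurable_nth].
by apply/funext => z /=; rewrite (tnth_nth 0) nth_tmap.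
Qed.

Lemma measurable_prod_nth D (h : nat -> R -> R) : (forall i, measurable_fun setT (h i)) ->
  measurable_fun [set: D.-tuple RM] (fun z : D.-tuple RM => (\prod_(i < D) h i (nth 0 z i))).
Proof.
move=> mh; rewrite (_ : (fun z => _) = (fun z => \prod_(i <- enum 'I_D) h i (nth 0 (tval z) i))).
  apply: measurable_prod => i _.
  by apply: measurableT_comp; [exact: mh|exact: measurable_nth].
by apply/funext => z; rewrite big_enum.
Qed.

Lemma gpow_prod D (h : nat -> R -> R) (c : nat -> R) :
  (forall i, measurable_fun setT (h i)) -> (forall i x, 0 <= h i x) ->
  (forall i, \int[gam]_x (h i x)%:E = (c i)%:E)%E ->
  (\int[gpow D]_z (\prod_(i < D) h i (nth 0 z i))%:E = (\prod_(i < D) c i)%:E)%E.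
Proof.
elim: D h c => [|D IH] h c mh h0 hc.
  rewrite gpow_integral0 ?big_ord0 //.
  by under eq_fun do rewrite big_ord0; exact: measurable_cst.
rewrite gpow_integralS; last 2 first.
- by apply/measurable_EFinP; exact: measurable_prod_nth.
- by move=> z; rewrite lee_fin prodr_ge0.
transitivity (\int[gam]_x ((\prod_(i < D) c i.+1)%:E * (h 0 x)%:E))%E.
  apply: eq_integral => x _.
  rewrite -(IH (fun i => h i.+1) (fun i => c i.+1)) // muleC -ge0_integralZl //.
  - by apply: eq_integral => z _; rewrite -EFinM big_ord_recl.
  - by apply/measurable_EFinP; exact: (@measurable_prod_nth D (fun i => h i.+1)).
  - by move=> z _; rewrite lee_fin prodr_ge0.
  - by rewrite lee_fin.
rewrite ge0_integralZl //.
- by rewrite hc -EFinM big_ord_recl mulrC.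
- by apply/measurable_EFinP; exact: mh.
- by move=> z _; rewrite lee_fin.
- rewrite lee_fin prodr_ge0 // => i _; rewrite -lee_fin -hc.
  by apply: integral_ge0 => x _; rewrite lee_fin.
Qed.

Lemma gpow_density D (g h : nat -> R -> R) (F : D.-tuple RM -> \bar R) :
  (forall i, measurable_fun setT (g i)) -> (forall i, measurable_fun setT (h i)) ->
  (forall i x, 0 <= h i x) ->
  (forall i f, measurable_fun setT f -> (forall x, 0 <= f x)%E ->
     (\int[gam]_x f (g i x) = \int[gam]_x (f x * (h i x)%:E))%E) ->
  measurable_fun setT F -> (forall z, 0 <= F z)%E ->
  (\int[gpow D]_z F (tmap g z) =
   \int[gpow D]_z (F z * (\prod_(i < D) h i (nth 0 z i))%:E))%E.
Proof.
elim: D g h F => [|D IH] g h F mg mh h0 gh mF F0.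
  rewrite !gpow_integral0 //.
  - by rewrite big_ord0 mule1; congr F; apply/val_inj.
  - by apply: emeasurable_funM => //; apply/measurable_EFinP; exact: measurable_prod_nth.
  - by apply: measurableT_comp => //; exact: measurable_tmap.
rewrite gpow_integralS //; last by apply: measurableT_comp => //; exact: measurable_tmap.
rewrite gpow_integralS; last 2 first.
- by apply: emeasurable_funM => //; apply/measurable_EFinP; exact: measurable_prod_nth.
- by move=> z; rewrite mule_ge0 // lee_fin prodr_ge0.
pose G x := (\int[gpow D]_z (F [tuple of x :: z] * (\prod_(i < D) h i.+1 (nth 0 z i))%:E))%E.
have G0 x : (0 <= G x)%E.
  by apply: integral_ge0 => z _; rewrite mule_ge0 // lee_fin prodr_ge0.
have mG : measurable_fun setT G.
  apply: (@measurable_gpow_section D (fun z => F z * (\prod_(i < D) h i.+1 (nth 0 (behead z) i))%:E)%E).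
    apply: emeasurable_funM => //; apply/measurable_EFinP.
    exact: (measurableT_comp (@measurable_prod_nth D (fun i => h i.+1) _) (@measurable_behead _ RM D)).
  by move=> z; rewrite mule_ge0 // lee_fin prodr_ge0.
transitivity (\int[gam]_x G (g 0%N x))%E.
  apply: eq_integral => x _; rewrite /G -(IH (fun i => g i.+1) (fun i => h i.+1) (fun z => F [tuple of g 0%N x :: z])) //.
  - by apply: eq_integral => z _; rewrite tmap_cons.
  - by move=> i; exact: (gh i.+1).
  - exact: measurable_cons_section.
rewrite (gh 0%N) //; apply: eq_integral => x _; rewrite muleC -ge0_integralZl //.
- by apply: eq_integral => z _; rewrite big_ord_recl /= EFinM muleCA.
- apply: emeasurable_funM; first exact: measurable_cons_section.
  by apply/measurable_EFinP; exact: (@measurable_prod_nth D (fun i => h i.+1)).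
- by move=> z _; rewrite mule_ge0 // lee_fin prodr_ge0.
- by rewrite lee_fin.
Qed.

Lemma gpow_dominate D (g : nat -> R -> R) (c : nat -> R) (F : D.-tuple RM -> \bar R) :
  (forall i, measurable_fun setT (g i)) -> (forall i, 0 <= c i) ->
  (forall i f, measurable_fun setT f -> (forall x, 0 <= f x)%E ->
     (\int[gam]_x f x <= (c i)%:E * \int[gam]_x f (g i x))%E) ->
  measurable_fun setT F -> (forall z, 0 <= F z)%E ->
  (\int[gpow D]_z F z <= (\prod_(i < D) c i)%:E * \int[gpow D]_z F (tmap g z))%E.
Proof.
elim: D g c F => [|D IH] g c F mg c0 gc mF F0.
  rewrite !gpow_integral0 //.
  - by rewrite big_ord0 mul1e le_eqVlt; apply/orP; left; apply/eqP; congr F; apply/val_inj.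
  - by apply: measurableT_comp => //; exact: measurable_tmap.
rewrite gpow_integralS // gpow_integralS //; last by apply: measurableT_comp => //; exact: measurable_tmap.
pose G x := (\int[gpow D]_z F [tuple of x :: z])%E.
have G0 x : (0 <= G x)%E by apply: integral_ge0.
have mG : measurable_fun setT G by exact: measurable_gpow_section.
apply: (le_trans (gc 0%N G mG G0)).
rewrite big_ord_recl EFinM -muleA; apply: lee_wpmul2l; first by rewrite lee_fin.
have p0 : 0 <= \prod_(i < D) c (lift ord0 i) by apply: prodr_ge0.
have mT : measurable_fun setT (fun z : D.+1.-tuple RM => F (tmap g z)).
  by apply: measurableT_comp => //; exact: measurable_tmap.
rewrite -ge0_integralZl //.
- apply: ge0_le_integral => //.
  + by apply: (measurableT_comp mG); exact: mg.
  + apply: emeasurable_funM => //.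
    exact: (@measurable_gpow_section D (fun z => F (tmap g z))).
  + move=> x _; apply: (le_trans (IH (fun i => g i.+1) (fun i => c i.+1) (fun z => F [tuple of g 0%N x :: z]) _ _ _ _ _)) => //.
      by move=> i; exact: (gc i.+1).
      exact: measurable_cons_section.
    rewrite le_eqVlt; apply/orP; left; apply/eqP; congr (_ * _)%E.
    by apply: eq_integral => z _; rewrite tmap_cons.
- exact: (@measurable_gpow_section D (fun z => F (tmap g z))).
- by move=> x _; apply: integral_ge0.
Qed.


Definition tri_apply (L : nat -> nat -> R) (j : nat) (z : seq R) : R :=
  \sum_(i < j.+1) L j i * nth 0 z i.

Lemma measurable_lin D (l : nat -> R) m :
  measurable_fun [set: D.-tuple RM] (fun z : D.-tuple RM => \sum_(i < m) l i * nth 0 z i).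
Proof.
apply: measurable_sum => i; apply: measurable_funM; first exact: measurable_cst.
exact: measurable_nth.
Qed.

Lemma measurable_set_le d (T : measurableType d) (f : T -> R) (t : R) :
  measurable_fun setT f -> measurable [set z | f z <= t].
Proof.
move=> mf; rewrite -[X in measurable X]setTI.
have -> : [set z | f z <= t] = f @^-1` `]-oo, t]%classic.
  by apply/seteqP; split => z; rewrite /= in_itv.
exact: mf.
Qed.

Lemma measurable_set_all d (T : measurableType d) r (A : nat -> set T) :
  (forall i, measurable (A i)) -> measurable [set z | forall j, (j < r)%N -> A j z].
Proof.
move=> mA; have -> : [set z | forall j, (j < r)%N -> A j z] = \bigcap_(j in [set j | (j < r)%N]) A j.
  by apply/seteqP; split => z /= h j; exact: h.
by apply: bigcap_measurableType => k _.
Qed.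

Definition small_box r (L : nat -> nat -> R) (x : nat -> R) (t : R) : set (seq R) :=
  [set z | forall j, (j < r)%N -> `|x j + tri_apply L j z| <= t].

Lemma measurable_small_box D r L x t :
  measurable [set z : D.-tuple RM | small_box r L x t (tval z)].
Proof.
apply: (@measurable_set_all _ (D.-tuple RM) r (fun j => [set z | `|x j + tri_apply L j z| <= t])) => j.
apply: measurable_set_le; apply: measurableT_comp => //; apply: measurable_funD => //.
exact: measurable_lin.
Qed.

(** Conditioning on all but the last coordinate in a triangular system, the last
    one has a density bounded by the inverse of its diagonal coefficient. *)
Lemma gpow_small_box D r (L : nat -> nat -> R) (x : nat -> R) (t l : R) :
  (r <= D)%N -> 0 < l -> 0 <= t -> (forall j, (j < r)%N -> l <= L j j) ->
  (gpow D [set z | small_box r L x t (tval z)] <= ((t / l) ^+ r)%:E)%E.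
Proof.
move=> rD l0 t0; elim: r D L x rD => [|r IH] [|D] L x rD Ll //.
- by rewrite expr0; apply: probability_le1; exact: measurable_small_box.
- by rewrite expr0; apply: probability_le1; exact: measurable_small_box.
have tl0 : 0 <= t / l by rewrite divr_ge0 // ltW.
have mB : measurable [set z : D.+1.-tuple RM | small_box r.+1 L x t (tval z)].
  exact: measurable_small_box.
have -> : gpow D.+1 [set z : D.+1.-tuple RM | small_box r.+1 L x t (tval z)] =
   (\int[gpow D.+1]_z (\1_[set z : D.+1.-tuple RM | small_box r.+1 L x t (tval z)] z)%:E)%E.
  by rewrite integral_indic ?setIT.
rewrite gpow_integralS //; last first.
  by apply/measurable_EFinP; exact: measurable_indic.
pose A : set RM := [set y | `|x 0%N + L 0%N 0%N * y| <= t].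
have mA : measurable A.
  apply: measurable_set_le; apply: measurableT_comp => //.
  by apply: measurable_funD => //; apply: measurable_funM.
apply: (@le_trans _ _ (\int[gam]_y (((t / l) ^+ r)%:E * (\1_A y)%:E))%E).
  apply: ge0_le_integral => //.
  - by move=> y _; apply: integral_ge0.
  - apply: (@measurable_gpow_section D (fun z => (\1_[set z0 : D.+1.-tuple RM | small_box r.+1 L x t (tval z0)] z)%:E)) => //.
    by apply/measurable_EFinP; exact: measurable_indic.
  - by apply: emeasurable_funM => //; apply/measurable_EFinP; exact: measurable_indic.
  move=> y _.
  pose x' j := x j.+1 + L j.+1 0%N * y.
  pose L' j i := L j.+1 i.+1.
  have -> : (\int[gpow D]_z (\1_[set z0 : D.+1.-tuple RM | small_box r.+1 L x t (tval z0)] [tuple of y :: z])%:E =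
     \int[gpow D]_z ((\1_A y)%:E * (\1_[set z : D.-tuple RM | small_box r L' x' t (tval z)] z)%:E))%E.
    apply: eq_integral => z _; rewrite -EFinM !indicE; congr EFin.
    have E : small_box r.+1 L x t (y :: tval z) <-> A y /\ small_box r L' x' t (tval z).
      have T j : x j.+1 + tri_apply L j.+1 (y :: tval z) = x' j + tri_apply L' j (tval z).
        by rewrite /tri_apply big_ord_recl /= /x' addrA.
      split=> [h|[h1 h2] [|j] jr].
      + split; first by have := h 0%N isT; rewrite /A /= /tri_apply big_ord1.
        by move=> j jr; rewrite -T; exact: (h j.+1).
      + by rewrite /tri_apply big_ord1.
      + by rewrite T; exact: h2.
    have -> : ([tuple of y :: z] \in [set z0 : D.+1.-tuple RM | small_box r.+1 L x t (tval z0)]) =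
       (y \in A) && (z \in [set z : D.-tuple RM | small_box r L' x' t (tval z)]).
      apply/idP/idP.
        by rewrite inE => /E[h1 h2]; apply/andP; split; apply/mem_set.
      by move=> /andP[/set_mem h1 /set_mem h2]; apply/mem_set/E.
    by rewrite -natrM mulnb.
  rewrite ge0_integralZl //; last first.
    by apply/measurable_EFinP; apply: measurable_indic; exact: measurable_small_box.
  rewrite muleC; apply: lee_wpmul2r; first by rewrite lee_fin.
  rewrite integral_indic ?setIT; last 2 first.
  - exact: measurableT.
  - exact: measurable_small_box.
  by apply: IH => // j jr; exact: (Ll j.+1).
rewrite ge0_integralZl //; last 2 first.
- by apply/measurable_EFinP; apply: measurable_indic.
- by rewrite lee_fin exprn_ge0.
rewrite integral_indic // setIT exprSr EFinM lee_wpmul2l ?lee_fin ?exprn_ge0 //.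
by apply: gam_small_ball => //; exact: Ll.
Qed.

Lemma gpow_mgf D (l : nat -> R) :
  (\int[gpow D]_z (expR (\sum_(i < D) l i * nth 0 z i))%:E =
   (expR (2^-1 * \sum_(i < D) l i ^+ 2))%:E)%E.
Proof.
transitivity (\int[gpow D]_z (\prod_(i < D) expR (l i * nth 0 z i))%:E)%E.
  by apply: eq_integral => z _; rewrite expR_sum.
rewrite (@gpow_prod D (fun i x => expR (l i * x)) (fun i => expR (2^-1 * l i ^+ 2))).
- by rewrite mulr_sumr expR_sum.
- by move=> i; apply: measurableT_comp => //; exact: measurable_funM.
- by move=> i x; exact: expR_ge0.
- by move=> i; rewrite gam_mgf mulrC.
Qed.

Lemma exprn_le_fact_expR (x : R) n : `|x| ^+ n <= n`!%:R * (expR x + expR (- x)).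
Proof.
have e1 : expR `|x| <= expR x + expR (- x).
  have [ex enx] := (expR_ge0 x, expR_ge0 (- x)).
  by case: (lerP 0 x) => x0; [rewrite ger0_norm|rewrite ltr0_norm]; lra.
case: n => [|n].
  by rewrite expr0 fact0 mul1r; apply: le_trans e1; rewrite -expR0 ler_expR.
have n0 : 0 < (n.+1)`!%:R :> R by rewrite ltr0n fact_gt0.
rewrite mulrC -ler_pdivrMr //; apply: le_trans e1.
by apply: le_trans (expR_ge1Dxn n (normr_ge0 x)); rewrite lerDr.
Qed.

Lemma gpow_moment D (l : nat -> R) p :
  (\int[gpow D]_z ((\sum_(i < D) l i * nth 0 z i) ^+ (2 * p))%:E <=
   ((2 * p)`!%:R * (2 * expR (2^-1 * \sum_(i < D) l i ^+ 2)))%:E)%E.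
Proof.
have me (l' : nat -> R) : measurable_fun [set: D.-tuple RM]
    (fun z : D.-tuple RM => (expR (\sum_(i < D) l' i * nth 0 z i))%:E).
  by apply/measurable_EFinP; apply: measurableT_comp => //; exact: measurable_lin.
have f0 : 0 <= (2 * p)`!%:R :> R by [].
have mS := emeasurable_funD (me l) (me (fun i => - l i)).
apply: (@le_trans _ _ (\int[gpow D]_z ((2 * p)`!%:R%:E *
   ((expR (\sum_(i < D) l i * nth 0 z i))%:E + (expR (\sum_(i < D) (- l i) * nth 0 z i))%:E)))%E).
  apply: ge0_le_integral => //.
  - by move=> z _; rewrite lee_fin exprM exprn_ge0 // sqr_ge0.
  - by apply/measurable_EFinP; apply: measurable_funX; exact: measurable_lin.
  - exact: (emeasurable_funM (measurable_cst _) mS).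
  - move=> z _; rewrite -EFinD -EFinM lee_fin.
    rewrite -[X in X <= _]ger0_norm; last by rewrite exprM exprn_ge0 // sqr_ge0.
    rewrite normrX; apply: le_trans (exprn_le_fact_expR _ _) _.
    rewrite ler_wpM2l // -sumrN; rewrite lerD2l ler_expR.
    by apply: ler_sum => i _; rewrite mulNr.
rewrite (ge0_integralZl (gpow D) measurableT mS); last 2 first.
- by move=> z _; rewrite adde_ge0 // lee_fin expR_ge0.
- by rewrite lee_fin.
rewrite ge0_integralD //; last exact: (me (fun i => - l i)).
rewrite (gpow_mgf D l) (gpow_mgf D (fun i => - l i)) -EFinD -EFinM lee_fin ler_wpM2l //.
rewrite mulr_natl mulr2n lerD2l ler_expR ler_wpM2l ?invr_ge0 //.
by apply: ler_sum => i _; rewrite sqrrN.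
Qed.

End GaussPower.

(** * Elementary inequalities *)
Section Elem.
Context {R : realType}.

Lemma expR_le_cubic (u : R) : `|u| <= 1 -> expR u <= 1 + u + u ^+ 2 / 2 + `|u| ^+ 3.
Proof.
move=> u1; rewrite expRE.
have cv : cvgn (series (exp_coeff u)) by exact: is_cvg_series_exp_coeff.
have key N : series (exp_coeff u) (N + 3)%N <= 1 + u + u ^+ 2 / 2 + `|u| ^+ 3 * (1 - 2^-1 ^+ N).
  elim: N => [|N IH].
    rewrite add0n expr0 subrr mulr0 addr0 /series /= !big_nat_recr //= big_geq // /exp_coeff /=.
    by rewrite !expr0 expr1 fact0 /= !divr1 add0r (_ : 2`! = 2)%N.
  rewrite addSn seriesSr -[in leRHS]/(N.+1).
  apply: (le_trans (lerD IH (ler_norm _))).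
  rewrite -!addrA lerD2l lerD2l lerD2l /exp_coeff /= normrM normrX.
  rewrite [`|_^-1|]ger0_norm; last by rewrite invr_ge0.
  have h1 : `|u| ^+ (N + 3) <= `|u| ^+ 3.
    by rewrite exprD ler_piMl // ?exprn_ge0 // exprn_ile1.
  have h2 : ((N + 3)`!%:R)^-1 <= 2^-1 ^+ N.+1 :> R.
    rewrite exprVn lef_pV2 ?posrE ?exprn_gt0 ?ltr0n ?fact_gt0 // -natrX ler_nat.
    elim: N {IH h1} => // N IHN; rewrite addSn factS expnS leq_mul //; lia.
  apply: (@le_trans _ _ (`|u| ^+ 3 * (1 - 2^-1 ^+ N) + `|u| ^+ 3 * 2^-1 ^+ N.+1)).
    rewrite lerD2l; apply: ler_pM => //; by rewrite ?exprn_ge0 ?invr_ge0.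
  by rewrite -mulrDr ler_wpM2l ?exprn_ge0 // exprS; lra.
have -> : pseries (fun n => n`!%:R^-1) u = series (exp_coeff u).
  by apply/funext => n; rewrite /pseries /series /=; apply: eq_bigr => i _; rewrite mulrC.
apply: limr_le => //; near=> n.
have n3 : (3 <= n)%N by near: n; exact: nbhs_infty_ge.
rewrite -(subnK n3); apply: (le_trans (key _)); by rewrite lerD2l ler_piMr ?exprn_ge0 // gerBl exprn_ge0.
Unshelve. all: by end_near. Qed.

(** For standard normal vectors the law of [xi + sqrt (1/t - 1) Z] is compared to that
    of [Z / sqrt t] through the kernel below; the expansion is exact to second order in [t]. *)
Lemma kernel_expansion (t g x y d B : R) : 0 < t -> 1 <= B -> t * B <= 4^-1 ->
  `|g| <= B -> 0 <= x <= B -> 0 <= y <= B -> 0 <= d <= B ->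
  expR (t * (2 * g - t * (x + y)) / (2 * (1 - t ^+ 2)) + d * (t ^+ 2 + 2 * t ^+ 4) / 2) <=
  1 + t * g - t ^+ 2 * (x + y) / 2 + d * t ^+ 2 / 2 + t ^+ 2 * g ^+ 2 / 2 + 20 * (t ^+ 3 * B * (1 + g ^+ 2)).
Proof.
move=> t0 B1 tB gB /andP[x0 xB] /andP[y0 yB] /andP[d0 dB].
have t4 : t <= 4^-1 by apply: le_trans tB; rewrite ler_peMr // ltW.
have t2 : t ^+ 2 <= 16^-1.
  by rewrite expr2; apply: le_trans (ler_pM (ltW t0) (ltW t0) t4 t4) _; lra.
have t20 : 0 < t ^+ 2 by rewrite exprn_gt0.
set c := (1 - t ^+ 2)^-1.
have cE : c = 1 + t ^+ 2 * c by rewrite /c; field; rewrite gt_eqF //; lra.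
have c0 : 0 < c by rewrite invr_gt0; lra.
have c2 : c <= 16 / 15.
  by rewrite /c (_ : 16 / 15 = (15 / 16)^-1) ?lef_pV2 ?posrE //; [lra|lra|field].
set U := _ / _ + _.
pose W := (t * (2 * g - t * (x + y)) / 2) * c + d * (t ^+ 2 + 2 * t ^+ 4) / 2.
have UW : U = W by rewrite /U /W /c; field; rewrite gt_eqF //; lra.
pose V := U - t * g.
pose T := t ^+ 3 * B.
have T0 : 0 <= T by rewrite mulr_ge0 ?exprn_ge0 ?ltW //; lra.
have gl := ler_norm g; have gl' := ler_norm (- g); rewrite normrN in gl'.
have tB0 : 0 <= t * B by rewrite mulr_ge0 ?ltW //; lra.
pose b := t ^+ 2 * B.
have b0 : 0 <= b by rewrite mulr_ge0 ?ltW //; lra.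
(* main deviation from the quadratic model *)
pose Q := t * g - t ^+ 2 * (x + y) / 2 + d * t ^+ 2 / 2.
have UQ : U - Q = (t ^+ 3 * c) * g - (t ^+ 4 * c) * ((x + y) / 2) + d * t ^+ 4.
  by rewrite UW /W /Q {1}cE; field.
have Tt : t ^+ 4 * B <= T / 4.
  by rewrite /T (_ : t ^+ 4 * B = t ^+ 3 * B * t); [rewrite ler_wpM2l //|ring].
have Tb : T <= b / 4.
  by rewrite /T /b (_ : t ^+ 3 * B = t ^+ 2 * B * t); [rewrite ler_wpM2l //|ring].
have bb : b ^+ 2 <= T / 4.
  by rewrite /b /T (_ : (t ^+ 2 * B) ^+ 2 = t ^+ 3 * B * (t * B)); [rewrite ler_wpM2l //|ring].
have bt : b <= 16^-1.
  rewrite /b (_ : t ^+ 2 * B = t * (t * B)); last by ring.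
  by apply: le_trans (ler_pM (ltW t0) tB0 t4 tB) _; lra.
have b3 : b ^+ 3 <= T / 4.
  rewrite exprSr; apply: le_trans (ler_pM _ b0 bb bt) _; rewrite ?sqr_ge0 //; lra.
have e1 : `|(t ^+ 3 * c) * g| <= 16 / 15 * T.
  rewrite normrM ger0_norm; last by rewrite mulr_ge0 ?exprn_ge0 ?ltW.
  rewrite /T (_ : 16 / 15 * (t ^+ 3 * B) = t ^+ 3 * (16 / 15) * B); last by ring.
  by apply: ler_pM => //; rewrite ?mulr_ge0 ?exprn_ge0 ?(ltW t0) ?(ltW c0) // ler_wpM2l ?exprn_ge0 // ltW.
have e2 : 0 <= (t ^+ 4 * c) * ((x + y) / 2) <= 4 / 15 * T.
  apply/andP; split; first by rewrite !mulr_ge0 ?exprn_ge0 ?(ltW t0) ?(ltW c0) // addr_ge0.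
  apply: (@le_trans _ _ (t ^+ 4 * (16 / 15) * B)); last first.
    by rewrite mulrAC; lra.
  apply: ler_pM; rewrite ?mulr_ge0 ?exprn_ge0 ?(ltW t0) ?(ltW c0) //; try lra.
  by rewrite ler_wpM2l ?exprn_ge0 // ltW.
have e3 : 0 <= d * t ^+ 4 <= T / 4.
  rewrite mulr_ge0 ?exprn_ge0 ?(ltW t0) //=; apply: le_trans Tt.
  by rewrite mulrC ler_wpM2l ?exprn_ge0 // ltW.
have e4 : `|U - Q| <= 2 * T.
  by rewrite UQ; move: e1 e2 e3; rewrite ler_norml => /andP[? ?] /andP[? ?] /andP[? ?]; rewrite ler_norml; apply/andP; split; lra.
have e5 : 0 <= t ^+ 2 * (x + y) / 2 <= b.
  rewrite -mulrA; apply/andP; split; first by apply: mulr_ge0; [exact: ltW|lra].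
  by rewrite /b ler_wpM2l ?(ltW t20) //; lra.
have e6 : 0 <= d * t ^+ 2 / 2 <= b / 2.
  have k1 : 0 <= d * t ^+ 2 by apply: mulr_ge0 => //; exact: ltW.
  have k2 : d * t ^+ 2 <= b by rewrite [leLHS]mulrC /b; apply: ler_wpM2l => //; exact: ltW.
  by apply/andP; split; lra.
have VE : V = (U - Q) - t ^+ 2 * (x + y) / 2 + d * t ^+ 2 / 2 by rewrite /V /Q; ring.
have Vb : `|V| <= 3 / 2 * b.
  by rewrite VE; move: e4 e5 e6; rewrite ler_norml => /andP[? ?] /andP[? ?] /andP[? ?]; rewrite ler_norml; apply/andP; split; lra.
have tg : `|t * g| <= t * B by rewrite normrM gtr0_norm // ler_wpM2l // ltW.
have UV : U = t * g + V by rewrite /V; ring.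
have U1 : `|U| <= 1.
  by rewrite UV; apply: le_trans (ler_normD _ _) _; lra.
apply: (le_trans (expR_le_cubic U1)).
have g2 : `|g| <= (1 + g ^+ 2) / 2.
  have := sqr_ge0 (`|g| - 1); rewrite sqrrB real_normK ?num_real // expr1n mulr1 -mulr_natr; lra.
have h1 : U <= Q + 2 * T by move: e4; rewrite ler_norml => /andP[_]; lra.
have h2 : U ^+ 2 / 2 <= t ^+ 2 * g ^+ 2 / 2 + 3 / 4 * (T * (1 + g ^+ 2)) + 9 / 32 * T.
  have -> : U ^+ 2 / 2 = t ^+ 2 * g ^+ 2 / 2 + t * g * V + V ^+ 2 / 2 by rewrite UV; field.
  have k1 : t * g * V <= 3 / 4 * (T * (1 + g ^+ 2)).
    apply: le_trans (ler_norm _) _; rewrite !normrM (gtr0_norm t0).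
    apply: (@le_trans _ _ (t * ((1 + g ^+ 2) / 2) * (3 / 2 * b))).
      apply: ler_pM => //; first by rewrite mulr_ge0 // ltW.
      by rewrite ler_wpM2l // ltW.
    by rewrite /b /T le_eqVlt; apply/orP; left; apply/eqP; field.
  have k2 : V ^+ 2 / 2 <= 9 / 32 * T.
    have : V ^+ 2 <= (3 / 2 * b) ^+ 2.
      by rewrite -(real_normK (num_real V)) ler_pXn2r ?nnegrE //; lra.
    by rewrite exprMn; lra.
  lra.
have h3 : `|U| ^+ 3 <= 4 * (T * g ^+ 2) + 27 / 8 * T.
  have a0 : 0 <= t * `|g| by rewrite mulr_ge0 // ltW.
  have b'0 : 0 <= 3 / 2 * b by lra.
  apply: (@le_trans _ _ ((t * `|g| + 3 / 2 * b) ^+ 3)).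
    rewrite ler_pXn2r ?nnegrE ?addr_ge0 // UV; apply: le_trans (ler_normD _ _) _.
    by rewrite normrM gtr0_norm // lerD2l.
  apply: (@le_trans _ _ (4 * ((t * `|g|) ^+ 3 + (3 / 2 * b) ^+ 3))).
    set a := t * _ in a0 *; set e := 3 / 2 * b in b'0 *.
    rewrite -subr_ge0 (_ : _ - _ = 3 * (a + e) * (a - e) ^+ 2); last by ring.
    apply: mulr_ge0; last exact: sqr_ge0.
    by apply: mulr_ge0 => //; exact: addr_ge0.
  have k1 : (t * `|g|) ^+ 3 <= T * g ^+ 2.
    rewrite exprMn /T -mulrA ler_wpM2l ?exprn_ge0 ?(ltW t0) //.
    by rewrite exprS real_normK ?num_real // ler_wpM2r // sqr_ge0.
  have k2 : (3 / 2 * b) ^+ 3 = 27 / 8 * b ^+ 3 by field.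
  rewrite k2; lra.
have Tg : 0 <= T * g ^+ 2 by rewrite mulr_ge0 // sqr_ge0.
rewrite -/T; rewrite /Q in h1; lra.
Qed.
End Elem.

(** * One step of the replacement argument *)
Section Step.
Context {R : realType}.
Notation RM := (measurableTypeR R).

Definition gpr D (A : set (D.-tuple RM)) : R := fine (gpow D A).

Lemma gprE D (A : set (D.-tuple RM)) : measurable A -> gpow D A = (gpr A)%:E.
Proof. by move=> mA; rewrite /gpr fineK // fin_num_measure. Qed.

Lemma gpr_ge0 D (A : set (D.-tuple RM)) : 0 <= gpr A.
Proof. exact: fine_ge0. Qed.

Lemma gpr_le1 D (A : set (D.-tuple RM)) : measurable A -> gpr A <= 1.
Proof. by move=> mA; rewrite -lee_fin -gprE //; exact: probability_le1. Qed.

Lemma gpr_mono D (A B : set (D.-tuple RM)) : measurable A -> measurable B ->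
  A `<=` B -> gpr A <= gpr B.
Proof. by move=> mA mB AB; rewrite -lee_fin -!gprE //; apply: le_measure => //; rewrite inE. Qed.

Lemma gpr_setU D (A B C : set (D.-tuple RM)) : measurable A -> measurable B -> measurable C ->
  C `<=` A `|` B -> gpr C <= gpr A + gpr B.
Proof.
move=> mA mB mC h; rewrite -lee_fin EFinD -!gprE //.
apply: (@le_trans _ _ (gpow D (A `|` B))).
  by apply: le_measure => //; rewrite inE //; exact: measurableU.
exact: measureU2.
Qed.

Context (I : finType) (q : I -> R) (xi : I -> nat -> R) (D : nat) (r : R).
Hypotheses (q0 : forall v, 0 <= q v) (q1 : \sum_v q v = 1) (r1 : r ^+ 2 < 1).
Notation E F := (\int[gpow D]_z F z).

Let M v (z : D.-tuple RM) : R := \prod_(i < D) mehler r (xi v i) (nth 0 z i).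

Definition kern v w : R := \prod_(i < D) ((Num.sqrt (1 - r ^+ 4))^-1 *
  expR (r ^+ 2 * (2 * (xi v i * xi w i) - r ^+ 2 * (xi v i ^+ 2 + xi w i ^+ 2)) / (2 * (1 - r ^+ 4)))).

Let mM v : measurable_fun setT (M v).
Proof. by apply: (@measurable_prod_nth _ D (fun i => mehler r (xi v i))) => i; exact: measurable_mehler. Qed.

Let M0 v z : 0 <= M v z.
Proof. by apply: prodr_ge0 => i _; rewrite ltW // mehler_gt0. Qed.

Let intM v : (\int[gpow D]_z (M v z)%:E = 1)%E.
Proof.
rewrite (@gpow_prod _ D (fun i => mehler r (xi v i)) (fun=> 1)).
- by rewrite big1.
- by move=> i; exact: measurable_mehler.
- by move=> i x; rewrite ltW // mehler_gt0.
- by move=> i; exact: mehler_int1.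
Qed.

Let intMM v w : (\int[gpow D]_z (M v z * M w z)%:E = (kern v w)%:E)%E.
Proof.
under eq_integral do rewrite -big_split.
rewrite (@gpow_prod _ D (fun i x => mehler r (xi v i) x * mehler r (xi w i) x)
  (fun i => (Num.sqrt (1 - r ^+ 4))^-1 *
  expR (r ^+ 2 * (2 * (xi v i * xi w i) - r ^+ 2 * (xi v i ^+ 2 + xi w i ^+ 2)) / (2 * (1 - r ^+ 4))))) //.
- by move=> i; apply: measurable_funM; exact: measurable_mehler.
- by move=> i x; rewrite mulr_ge0 // ltW // mehler_gt0.
- by move=> i; exact: mehler_int2.
Qed.

Let iM v : (gpow D).-integrable setT (EFin \o M v).
Proof.
apply/integrableP; split; first exact/measurable_EFinP.
by under eq_integral do rewrite /= ger0_norm //; rewrite intM ltry.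
Qed.

Let iMM v w : (gpow D).-integrable setT (EFin \o (fun z => M v z * M w z)).
Proof.
apply/integrableP; split; first by apply/measurable_EFinP; exact: measurable_funM.
by under eq_integral do rewrite /= ger0_norm ?mulr_ge0 //; rewrite intMM ltry.
Qed.

Let h z := \sum_v q v * M v z - 1.

Lemma integrable_rsum (J : finType) (F : J -> D.-tuple RM -> R) (c : J -> R) :
  (forall j, (gpow D).-integrable setT (EFin \o F j)) ->
  (gpow D).-integrable setT (EFin \o (fun z => \sum_j c j * F j z)).
Proof.
move=> iF; rewrite (_ : _ \o _ = (fun z => \sum_j (c j)%:E * (F j z)%:E)%E); last first.
  by apply/funext => z /=; rewrite sumEFin.
apply: integrable_sum => // j _; exact: (integrableZl measurableT (c j) (iF j)).
Qed.

Lemma Rintegral_rsum (J : finType) (F : J -> D.-tuple RM -> R) (c : J -> R) :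
  (forall j, (gpow D).-integrable setT (EFin \o F j)) ->
  E (fun z => \sum_j c j * F j z) = \sum_j c j * E (F j).
Proof.
move=> iF.
have gen (s : seq J) : (gpow D).-integrable setT (EFin \o (fun z => \sum_(j <- s) c j * F j z)) /\
    E (fun z => \sum_(j <- s) c j * F j z) = \sum_(j <- s) c j * E (F j).
  elim: s => [|j s [IH1 IH2]].
    have Z : (fun z => \sum_(j <- [::]) c j * F j z) = cst 0 by apply/funext => z; rewrite big_nil.
    rewrite Z big_nil; split; last by rewrite Rintegral_cst // mul0r.
    exact: integrable0.
  have Z : (fun z => \sum_(j0 <- j :: s) c j0 * F j0 z) = (fun z => c j * F j z + \sum_(j0 <- s) c j0 * F j0 z).
    by apply/funext => z; rewrite big_cons.
  have iZ := integrableZl measurableT (c j) (iF j).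
  rewrite Z big_cons; split; first exact: (integrableD measurableT iZ IH1).
  by rewrite RintegralD // RintegralZl // IH2.
exact: (gen _).2.
Qed.

Let i1 : (gpow D).-integrable setT (EFin \o (cst 1 : D.-tuple RM -> R)).
Proof. exact: finite_measure_integrable_cst. Qed.

Let EM v : E (M v) = 1. Proof. by rewrite /Rintegral intM. Qed.
Let EMM v w : E (fun z => M v z * M w z) = kern v w. Proof. by rewrite /Rintegral intMM. Qed.
Let E1 : E (cst 1 : D.-tuple RM -> R) = 1.
Proof. by rewrite Rintegral_cst // mul1r -[RHS]/(fine 1%E); congr fine; exact: probability_setT. Qed.

Let ih : (gpow D).-integrable setT (EFin \o h).
Proof. exact: (integrableB measurableT (integrable_rsum q iM) i1). Qed.

Let Eh : E h = 0.
Proof.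
rewrite /h RintegralB //; last exact: (integrable_rsum q iM).
rewrite (Rintegral_rsum q iM) E1.
by under eq_bigr do rewrite EM mulr1; rewrite q1 subrr.
Qed.

Let ih2_Eh2 : (gpow D).-integrable setT (EFin \o (fun z => h z ^+ 2)) /\
  E (fun z => h z ^+ 2) = \sum_v \sum_w q v * q w * kern v w - 1.
Proof.
pose F (p : I * I) z := M p.1 z * M p.2 z.
pose S z := \sum_p (q p.1 * q p.2) * F p z.
have iF p : (gpow D).-integrable setT (EFin \o F p) by exact: iMM.
have iS := integrable_rsum (fun p => q p.1 * q p.2) iF.
have iA := integrable_rsum q iM.
have Z : (fun z => h z ^+ 2) = (fun z => S z - (2 * (\sum_v q v * M v z) - 1)).
  apply/funext => z; rewrite /h /S /F sqrrB1 mulr2n.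
  rewrite (_ : \sum_(p : I * I) _ = (\sum_v q v * M v z) ^+ 2); first by ring.
  rewrite expr2 big_distrlr /= pair_big /=; apply: eq_bigr => p _; ring.
have i2A := integrableZl measurableT 2 iA.
have iB := integrableB measurableT i2A i1.
rewrite Z; split; first exact: (integrableB measurableT iS iB).
rewrite RintegralB // RintegralB // RintegralZl // (Rintegral_rsum q iM) E1.
rewrite (Rintegral_rsum (fun p => q p.1 * q p.2) iF).
under [X in 2 * X]eq_bigr do rewrite EM mulr1; rewrite q1.
rewrite (_ : \sum_(p : I * I) _ = \sum_v \sum_w q v * q w * kern v w); first by ring.
by rewrite pair_big /=; apply: eq_bigr => p _; rewrite EMM.
Qed.

Let g v i (y : R) : R := r * xi v i + Num.sqrt (1 - r ^+ 2) * y.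

Let mg v i : measurable_fun setT (g v i).
Proof. exact: measurable_affine. Qed.

Lemma gpr_tmap v (A : set (D.-tuple RM)) : measurable A ->
  gpr [set z | A (tmap (g v) z)] = E (fun z => \1_A z * M v z).
Proof.
move=> mA; rewrite /gpr /Rintegral; congr fine.
have mF : measurable_fun setT (fun z => (\1_A z)%:E : \bar R).
  by apply/measurable_EFinP; exact: measurable_indic.
have F0 z : (0 <= (\1_A z)%:E :> \bar R)%E by rewrite lee_fin.
have K := @gpow_density _ D (g v) (fun i => mehler r (xi v i)) (fun z => (\1_A z)%:E) (mg v)
  (fun i => measurable_mehler r (xi v i)) (fun i x => ltW (mehler_gt0 _ _ r1))
  (fun i f mf f0 => mehler_density (xi v i) r1 mf f0) mF F0.
transitivity (\int[gpow D]_z (\1_A (tmap (g v) z))%:E)%E; last first.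
  by rewrite K; apply: eq_integral => z _; rewrite EFinM.
have mA' : measurable [set z : D.-tuple RM | A (tmap (g v) z)].
  by rewrite -[X in measurable X]setTI; exact: (measurable_tmap (mg v)).
rewrite (eq_integral (fun z => (\1_[set z | A (tmap (g v) z)] z)%:E)) //.
by rewrite integral_indic ?setIT.
Qed.

(** Both laws integrate the same density defect [h], of mean zero, so that the
    indicator may be centred at any constant before Cauchy-Schwarz is applied. *)
Lemma step_bound (A : set (D.-tuple RM)) (c alpha a : R) : measurable A -> 0 < alpha -> 0 < a ->
  E (fun z => (\1_A z - c) ^+ 2) <= alpha ^+ 2 ->
  \sum_v \sum_w q v * q w * kern v w - 1 <= a ^+ 2 ->
  `|\sum_v q v * gpr [set z | A (tmap (g v) z)] - gpr A| <= alpha * a.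
Proof.
move=> mA al0 a0 hA ha.
have m1A : measurable_fun setT (\1_A : D.-tuple RM -> R) by exact: measurable_indic.
have mAc : measurable_fun setT (fun z => \1_A z - c : R) by exact: measurable_funB.
have bAc : [bounded (\1_A z - c : R) | z in [set: D.-tuple RM]].
  exists (1 + `|c|); split; first exact: num_real.
  move=> y hy z _; apply: le_trans (ltW hy); apply: le_trans (ler_normB _ _) _.
  by rewrite lerD2r indicE; case: (_ \in _); rewrite ?normr1 ?normr0.
have b1A : [bounded (\1_A z : R) | z in [set: D.-tuple RM]].
  exists 1; split; first exact: num_real.
  by move=> y hy z _; apply: le_trans (ltW hy); rewrite indicE; case: (_ \in _); rewrite ?normr1 ?normr0.
have iAM v : (gpow D).-integrable setT (EFin \o (fun z => \1_A z * M v z)).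
  exact: (integrableMr measurableT m1A b1A (iM v)).
have iAh : (gpow D).-integrable setT (EFin \o (fun z => \1_A z * h z)).
  exact: (integrableMr measurableT m1A b1A ih).
have iAch : (gpow D).-integrable setT (EFin \o (fun z => (\1_A z - c) * h z)).
  exact: (integrableMr measurableT mAc bAc ih).
have i1A : (gpow D).-integrable setT (EFin \o (\1_A : D.-tuple RM -> R)).
  by apply: measurable_bounded_integrable => //; rewrite [X in (X < _)%E]probability_setT ltry.
have iAc2 : (gpow D).-integrable setT (EFin \o (fun z => (\1_A z - c) ^+ 2)).
  apply: measurable_bounded_integrable => //.
  - by apply: le_lt_trans (probability_le1 _ _) (ltry _).
  - exact: measurable_funX.
  exists ((1 + `|c|) ^+ 2); split; first exact: num_real.
  move=> y hy z _; apply: le_trans (ltW hy); rewrite normrX ler_pXn2r ?nnegrE ?addr_ge0 //.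
  apply: le_trans (ler_normB _ _) _.
  by rewrite lerD2r indicE; case: (_ \in _); rewrite ?normr1 ?normr0.
have -> : \sum_v q v * gpr [set z | A (tmap (g v) z)] - gpr A = E (fun z => (\1_A z - c) * h z).
  under eq_bigr do rewrite gpr_tmap //.
  rewrite -(Rintegral_rsum q iAM).
  have -> : gpr A = E (\1_A : D.-tuple RM -> R).
    by rewrite /gpr /Rintegral integral_indic // setIT.
  rewrite -RintegralB //; last exact: (integrable_rsum q iAM).
  transitivity (E (fun z => \1_A z * h z)).
    apply: eq_Rintegral => z _; rewrite /h mulrBr mulr1 mulr_sumr; congr (_ - _).
    by apply: eq_bigr => v _; rewrite mulrCA.
  transitivity (E (fun z => \1_A z * h z) - c * E h); first by rewrite Eh mulr0 subr0.
  have ich := integrableZl measurableT c ih.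
  rewrite -RintegralZl // -RintegralB //.
  by apply: eq_Rintegral => z _; rewrite mulrBl.
have [ih2 Eh2] := ih2_Eh2.
apply: (le_trans (le_normr_Rintegral measurableT iAch)).
pose la := a / alpha.
have la0 : 0 < la by rewrite divr_gt0.
have j1 := integrableZl measurableT (la / 2) iAc2.
have j2 := integrableZl measurableT ((2 * la)^-1) ih2.
apply: (@le_trans _ _ (E (fun z => la / 2 * (\1_A z - c) ^+ 2 + (2 * la)^-1 * h z ^+ 2))).
  apply: le_Rintegral => //.
  - by apply: (integrable_norm).
  - exact: (integrableD measurableT j1 j2).
  move=> z _; rewrite normrM.
  rewrite -(real_normK (num_real (\1_A z - c))) -(real_normK (num_real (h z))).
  set x := `|_ - c|; set y := `|h z|.
  rewrite -subr_ge0 (_ : _ - _ = (2 * la)^-1 * (la * x - y) ^+ 2); last by field; rewrite gt_eqF.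
  by rewrite mulr_ge0 ?sqr_ge0 // invr_ge0 mulr_ge0 // ltW.
rewrite RintegralD // RintegralZl // RintegralZl // Eh2.
apply: (@le_trans _ _ (la / 2 * alpha ^+ 2 + (2 * la)^-1 * a ^+ 2)).
  apply: lerD; apply: ler_wpM2l => //; first by rewrite divr_ge0 // ltW.
  by rewrite invr_ge0 mulr_ge0 // ltW.
by rewrite /la le_eqVlt; apply/orP; left; apply/eqP; field; rewrite !gt_eqF.
Qed.

End Step.

(** * Polyhedral seminorms and finite product laws *)
Section Nrm.
Context {R : realType}.
Notation RM := (measurableTypeR R).
Implicit Types (a : nat -> nat -> R) (x y : nat -> R).

Definition Nrm a m D x : R := \big[Num.max/0]_(i < m) `|\sum_(j < D) a i j * x j|.

Lemma Nrm_ge0 a m D x : 0 <= Nrm a m D x.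
Proof.
rewrite /Nrm; elim/big_rec: _ => // i z _ z0.
by rewrite le_max normr_ge0.
Qed.

Lemma Nrm_leP a m D x (t : R) : 0 <= t ->
  reflect (forall i, (i < m)%N -> `|\sum_(j < D) a i j * x j| <= t) (Nrm a m D x <= t).
Proof.
move=> t0; apply: (iffP idP) => [h i im|h].
  apply: le_trans h; rewrite /Nrm (bigD1 (Ordinal im)) //=.
  by rewrite le_max lexx.
rewrite /Nrm; elim/big_rec: _ => // i z _ z0.
by rewrite ge_max z0 h.
Qed.

Lemma Nrm_coord a m D x i : (i < m)%N -> `|\sum_(j < D) a i j * x j| <= Nrm a m D x.
Proof. by move=> im; move/(Nrm_leP a m D x (Nrm_ge0 _ _ _ _)): (lexx (Nrm a m D x)); apply. Qed.

Lemma eq_Nrm a m D x y : (forall j, (j < D)%N -> x j = y j) -> Nrm a m D x = Nrm a m D y.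
Proof.
by move=> xy; rewrite /Nrm; apply: eq_bigr => i _; congr `|_|; apply: eq_bigr => j _; rewrite xy.
Qed.

Lemma NrmD a m D x y : Nrm a m D (fun j => x j + y j) <= Nrm a m D x + Nrm a m D y.
Proof.
apply/Nrm_leP => [|i im]; first by rewrite addr_ge0 ?Nrm_ge0.
under eq_bigr do rewrite mulrDr; rewrite big_split /=.
by apply: le_trans (ler_normD _ _) _; rewrite lerD // Nrm_coord.
Qed.

Lemma NrmZ a m D c x : Nrm a m D (fun j => c * x j) = `|c| * Nrm a m D x.
Proof.
apply/eqP; rewrite eq_le; apply/andP; split.
  apply/Nrm_leP => [|i im]; first by rewrite mulr_ge0 ?Nrm_ge0.
  under eq_bigr do rewrite mulrCA; rewrite -mulr_sumr normrM.
  by rewrite ler_wpM2l // Nrm_coord.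
have [->|c0] := eqVneq c 0; first by rewrite normr0 mul0r Nrm_ge0.
rewrite mulrC -ler_pdivlMr ?normr_gt0 //.
apply/Nrm_leP => [|i im]; first by rewrite divr_ge0 ?Nrm_ge0.
rewrite ler_pdivlMr ?normr_gt0 // -normrM mulr_suml.
under eq_bigr do rewrite -mulrA [_ * c]mulrC.
exact: Nrm_coord.
Qed.

Lemma NrmB a m D x y : Nrm a m D x <= Nrm a m D (fun j => x j + y j) + Nrm a m D y.
Proof.
have -> : Nrm a m D x = Nrm a m D (fun j => (x j + y j) + (-1) * y j).
  by apply: eq_Nrm => j _; ring.
by apply: le_trans (NrmD _ _ _ _ _) _; rewrite NrmZ normrN normr1 mul1r.
Qed.

Definition shz (x : nat -> R) (tau : R) (z : seq R) : nat -> R := fun i => x i + tau * nth 0 z i.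

Lemma measurable_Nrm d (T : measurableType d) a m D (f : T -> nat -> R) :
  (forall j, measurable_fun setT (fun w => f w j)) ->
  measurable_fun setT (fun w => Nrm a m D (f w)).
Proof.
move=> mf; rewrite /Nrm.
elim: m a => [|m IH] a.
  by under eq_fun do rewrite big_ord0; exact: measurable_cst.
under eq_fun do rewrite big_ord_recl /=.
apply: measurable_maxr; last exact: (IH (fun i => a i.+1)).
apply: measurableT_comp => //.
by apply: measurable_sum => j; apply: measurable_funM.
Qed.

Lemma measurable_Nrm_shz a m D x (tau t : R) :
  measurable [set z : D.-tuple RM | Nrm a m D (shz x tau (tval z)) <= t].
Proof.
apply: measurable_set_le; apply: measurable_Nrm => j.
by apply: measurable_funD => //; apply: measurable_funM => //; exact: measurable_nth.
Qed.
End Nrm.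

Section En.
Context {R : realType} {I : finType} (q : I -> R).
Hypotheses (q0 : forall v, 0 <= q v) (q1 : \sum_v q v = 1).

Fixpoint En n (F : seq I -> R) : R :=
  match n with 0 => F [::] | n.+1 => \sum_v q v * En n (fun s => F (v :: s)) end.

Lemma eq_En n F G : (forall s, size s = n -> F s = G s) -> En n F = En n G.
Proof.
elim: n F G => [|n IH] F G FG /=; first exact: FG.
by apply: eq_bigr => v _; congr (_ * _); apply: IH => s sn; apply: FG => /=; rewrite sn.
Qed.

Lemma En_cst n c : En n (fun=> c) = c.
Proof.
elim: n => //= n IH; under eq_bigr do rewrite IH.
by rewrite -mulr_suml q1 mul1r.
Qed.

Lemma EnZ n c F : En n (fun s => c * F s) = c * En n F.
Proof.
elim: n F => //= n IH F; rewrite mulr_sumr; apply: eq_bigr => v _.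
by rewrite IH mulrCA.
Qed.

Lemma EnD n F G : En n (fun s => F s + G s) = En n F + En n G.
Proof.
elim: n F G => //= n IH F G; rewrite -big_split /=; apply: eq_bigr => v _.
by rewrite IH mulrDr.
Qed.

Lemma EnB n F G : En n (fun s => F s - G s) = En n F - En n G.
Proof.
rewrite EnD; congr (_ + _); rewrite -mulN1r -EnZ.
by apply: eq_En => s _; rewrite mulN1r.
Qed.

Lemma En_sum n (J : Type) (r : seq J) (P : pred J) (F : J -> seq I -> R) :
  En n (fun s => \sum_(j <- r | P j) F j s) = \sum_(j <- r | P j) En n (F j).
Proof.
elim: r => [|j r IH].
  by rewrite big_nil; under [LHS]eq_En do rewrite big_nil; rewrite En_cst.
rewrite big_cons -IH; case: ifP => Pj.
  by rewrite -EnD; apply: eq_En => s _; rewrite big_cons Pj.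
by apply: eq_En => s _; rewrite big_cons Pj.
Qed.

Lemma En_le n F G : (forall s, size s = n -> F s <= G s) -> En n F <= En n G.
Proof.
elim: n F G => [|n IH] F G FG /=; first exact: FG.
by apply: ler_sum => v _; apply: ler_wpM2l => //; apply: IH => s sn; apply: FG => /=; rewrite sn.
Qed.


Lemma En_norm n F : `|En n F| <= En n (fun s => `|F s|).
Proof.
rewrite ler_norml; apply/andP; split.
  rewrite -[leLHS]mulN1r -EnZ; apply: En_le => s _.
  by rewrite mulN1r lerNl; have := ler_norm (- F s); rewrite normrN.
by apply: En_le => s _; exact: ler_norm.
Qed.

Lemma EnS n F : En n.+1 F = En n (fun s => \sum_v q v * F (v :: s)).
Proof. by rewrite En_sum /=; apply: eq_bigr => v _; rewrite EnZ. Qed.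

Lemma En_markov n (F : seq I -> R) (A : pred (seq I)) (c : R) : 0 < c ->
  (forall s, 0 <= F s) -> (forall s, A s -> c <= F s) ->
  En n (fun s => (A s)%:R) <= En n F / c.
Proof.
move=> c0 F0 AF; rewrite ler_pdivlMr // mulrC -EnZ; apply: En_le => s _.
by case: (boolP (A s)) => [/AF h|_]; rewrite ?mulr1 ?mulr0.
Qed.

Definition vsum (xi : I -> nat -> R) (s : seq I) : nat -> R := fun j => \sum_(v <- s) xi v j.

Lemma vsum_cons xi v s j : vsum xi (v :: s) j = xi v j + vsum xi s j.
Proof. by rewrite /vsum big_cons. Qed.

End En.

Fact split_gap (R : realType) (c A B : R) : c <= 4^-1 -> 1 - c <= A -> B <= c -> 1 <= 2 * (A - B).
Proof. by move=> *; lra. Qed.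

(** * A Berry-Esseen bound for balls of seminorms *)
Section CLT.
Context {R : realType} {I : finType} (q : I -> R) (xi : I -> nat -> R).
Notation RM := (measurableTypeR R).
Hypotheses (q0 : forall v, 0 <= q v) (q1 : \sum_v q v = 1).
Variables (a : nat -> nat -> R) (m D : nat).
Notation N := (Nrm a m D).

Definition gsm (x : nat -> R) (tau t : R) : R :=
  gpr [set z : D.-tuple RM | N (shz x tau (tval z)) <= t].

Variables (rad w : R).
Hypotheses (rad0 : 0 < rad) (w0 : 0 < w) (w1 : w <= 2^-1).
Hypothesis tailw : gpr [set z : D.-tuple RM | ~ (N (nth 0 (tval z)) <= rad)] <= w ^+ 2.

Let mtail : measurable [set z : D.-tuple RM | ~ (N (nth 0 (tval z)) <= rad)].
Proof.
apply: (@measurableC _ _ [set z : D.-tuple RM | N (nth 0 (tval z)) <= rad]).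
by apply: measurable_set_le; apply: measurable_Nrm => j; exact: measurable_nth.
Qed.

Let w2 : w ^+ 2 <= 4^-1.
Proof. by rewrite expr2; apply: le_trans (ler_pM (ltW w0) (ltW w0) w1 w1) _; lra. Qed.

Let w2w : w ^+ 2 <= w.
Proof.
have h : w <= 1 by apply: le_trans w1 _; rewrite invf_le1 // ler1n.
by rewrite expr2; apply: ler_piMr => //; exact: ltW.
Qed.

Let Ntau (tau : R) (z : seq R) : 0 < tau -> N (fun i => tau * nth 0 z i) = tau * N (nth 0 z).
Proof. by move=> t0; rewrite NrmZ gtr0_norm. Qed.

Lemma gsm_ge0 x (tau t : R) : 0 <= gsm x tau t. Proof. exact: gpr_ge0. Qed.
Lemma gsm_le1 x (tau t : R) : gsm x tau t <= 1. Proof. by apply: gpr_le1; exact: measurable_Nrm_shz. Qed.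
Lemma gsm_mono x (tau t u : R) : t <= u -> gsm x tau t <= gsm x tau u.
Proof.
move=> tu; apply: gpr_mono; try exact: measurable_Nrm_shz.
by move=> z /= h; exact: le_trans tu.
Qed.

Let gpr_split (A : set (D.-tuple RM)) : measurable A ->
  (forall z, A z \/ ~ (N (nth 0 (tval z)) <= rad)) -> 1 - w ^+ 2 <= gpr A.
Proof.
move=> mA h; rewrite lerBlDr; apply: (@le_trans _ _ (gpr A + gpr [set z : D.-tuple RM | ~ (N (nth 0 (tval z)) <= rad)])).
  apply: (@le_trans _ _ (gpr [set: D.-tuple RM])).
    by rewrite -lee_fin -gprE // [X in (_ <= X)%E]probability_setT.
  by apply: gpr_setU => // z _; exact: h.
by rewrite lerD2l.
Qed.

Lemma gsm_large x (tau t : R) : 0 < tau -> N x + tau * rad <= t -> 1 - w ^+ 2 <= gsm x tau t.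
Proof.
move=> tau0 h; apply: gpr_split; first exact: measurable_Nrm_shz.
move=> z /=; have [zR|zR] := leP (N (nth 0 (tval z))) rad; [left|right => //].
apply: le_trans h; apply: le_trans (NrmD _ _ _ _ _) _; rewrite lerD2l Ntau //.
by rewrite ler_pM2l.
Qed.

Lemma gsm_small x (tau t : R) : 0 < tau -> t < N x - tau * rad -> gsm x tau t <= w ^+ 2.
Proof.
move=> tau0 h; apply: le_trans tailw; apply: gpr_mono => //; first exact: measurable_Nrm_shz.
move=> z /= zt zR; move: h; apply/negP; rewrite -leNgt lerBlDr.
apply: le_trans (NrmB a m D x (fun i => tau * nth 0 (tval z) i)) _.
by rewrite lerD // Ntau // ler_pM2l.
Qed.

Lemma near_le_gsm x (tau t : R) : 0 < tau ->
  (`|N x - t| <= tau * rad)%R%:R <= 2 * (gsm x tau (t + 2 * (tau * rad)) - gsm x tau (t - 3 * (tau * rad))).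
Proof.
move=> tau0; have tr0 : 0 < tau * rad by rewrite mulr_gt0.
have [h|_] := boolP (`|N x - t| <= tau * rad); last by rewrite mulr_ge0 // subr_ge0; apply: gsm_mono; lra.
move: h; rewrite ler_norml => /andP[h1 h2].
have g1 : 1 - w ^+ 2 <= gsm x tau (t + 2 * (tau * rad)) by apply: gsm_large => //; lra.
have g2 : gsm x tau (t - 3 * (tau * rad)) <= w ^+ 2 by apply: gsm_small => //; lra.
exact: (split_gap w2 g1 g2).
Qed.

Lemma clt_step x (tau t e : R) : 1 < tau -> 0 < e ->
  \sum_v \sum_w q v * q w * kern xi D tau^-1 v w - 1 <= e ^+ 2 ->
  `|\sum_v q v * gsm (fun i => xi v i + x i) (Num.sqrt (tau ^+ 2 - 1)) t - gsm x tau t| <=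
  e * ((`|N x - t| <= tau * rad)%R%:R + w).
Proof.
move=> tau1 e0 he.
have tau0 : 0 < tau by apply: lt_trans tau1.
have r1 : tau^-1 ^+ 2 < 1 by rewrite exprVn invf_lt1 ?exprn_gt0 // exprn_egt1.
have mA := @measurable_Nrm_shz R a m D x tau t.
pose A : set (D.-tuple RM) := [set z | N (shz x tau (tval z)) <= t].
have E v : gsm (fun i => xi v i + x i) (Num.sqrt (tau ^+ 2 - 1)) t =
  gpr [set z | A (tmap (fun i y => tau^-1 * xi v i + Num.sqrt (1 - tau^-1 ^+ 2) * y) z)].
  rewrite /gsm /A; congr gpr; apply/funext => z /=; congr (is_true (_ <= _)).
  apply: eq_Nrm => i iD; rewrite /shz nth_mkseq // mulrDr mulrA mulfV ?gt_eqF // mul1r mulrA.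
  have -> : tau * Num.sqrt (1 - tau^-1 ^+ 2) = Num.sqrt (tau ^+ 2 - 1).
    rewrite -[X in X * _](gtr0_norm tau0) -sqrtr_sqr -sqrtrM ?sqr_ge0 //; congr Num.sqrt.
    by field; rewrite gt_eqF.
  by ring.
under eq_bigr do rewrite E.
have I01 (B : set (D.-tuple RM)) z : (\1_B z - 0 : R) ^+ 2 = \1_B z.
  by rewrite subr0 indicE; case: (_ \in _); rewrite ?expr1n ?expr0n.
have EI (B : set (D.-tuple RM)) : measurable B -> \int[gpow D]_z (\1_B z : R) = gpr B.
  by move=> mB; rewrite /gpr /Rintegral integral_indic // setIT.
have [near|far] := boolP (`|N x - t| <= tau * rad).
  apply: (@le_trans _ _ (1 * e)); last first.
    rewrite [1 * e]mulrC; apply: ler_wpM2l; first exact: ltW.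
    by rewrite lerDl; exact: ltW.
  apply: (step_bound q1 r1 (A := A) (c := 0)) => //.
  under eq_Rintegral do rewrite I01.
  by rewrite EI // expr1n; exact: gpr_le1.
rewrite /= add0r [e * w]mulrC.
rewrite -ltNge lter_normr in far.
case/orP: far => far.
  apply: (step_bound q1 r1 (A := A) (c := 0)) => //.
  under eq_Rintegral do rewrite I01.
  by rewrite EI //; apply: gsm_small => //; lra.
apply: (step_bound q1 r1 (A := A) (c := 1)) => //.
have I02 z : (\1_A z - 1 : R) ^+ 2 = \1_(~` A) z.
  by rewrite !indicE in_setC; case: (_ \in _); rewrite /= ?subrr ?expr0n // sub0r sqrrN expr1n.
under eq_Rintegral do rewrite I02.
rewrite EI; last exact: measurableC.
apply: le_trans tailw; apply: gpr_mono => //; first exact: measurableC.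
move=> z /= zA zR; apply: zA; rewrite /A /=.
apply: le_trans (NrmD _ _ _ _ _) _; rewrite Ntau //.
have : tau * N (nth 0 (tval z)) <= tau * rad by rewrite ler_pM2l.
lra.
Qed.

End CLT.

Section KernBound.
Context {R : realType} {I : finType} (q : I -> R) (xi : I -> nat -> R) (D : nat).
Hypotheses (q0 : forall v, 0 <= q v) (q1 : \sum_v q v = 1).
Variables (B mu rho : R).
Hypotheses (B1 : 1 <= B) (DB : D%:R <= B).
Hypothesis xiB : forall v, \sum_(i < D) xi v i ^+ 2 <= B.
Hypothesis xim : \sum_(i < D) (\sum_v q v * xi v i) ^+ 2 <= mu ^+ 2.
Hypothesis xic : \sum_(i < D) \sum_(j < D)
  (\sum_v q v * (xi v i * xi v j) - (i == j)%:R) ^+ 2 <= rho ^+ 2.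

Let g v w := \sum_(i < D) xi v i * xi w i.
Let x v := \sum_(i < D) xi v i ^+ 2.

Lemma kern_le (r : R) v w : r ^+ 4 <= 2^-1 ->
  kern xi D r v w <= expR (r ^+ 2 * (2 * g v w - r ^+ 2 * (x v + x w)) / (2 * (1 - (r ^+ 2) ^+ 2))
     + D%:R * ((r ^+ 2) ^+ 2 + 2 * (r ^+ 2) ^+ 4) / 2).
Proof.
move=> r2; set t := r ^+ 2.
have r4 : r ^+ 4 = t ^+ 2 by rewrite /t -exprM.
have t2 : t ^+ 2 <= 2^-1 by rewrite -r4.
have t20 : 0 <= t ^+ 2 by exact: sqr_ge0.
have t21 : 0 < 1 - t ^+ 2 by lra.
have s1 : (Num.sqrt (1 - t ^+ 2))^-1 <= expR ((t ^+ 2 + 2 * t ^+ 4) / 2).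
  rewrite -[leRHS]invrK -expRN lef_pV2 ?posrE ?expR_gt0 ?sqrtr_gt0 //.
  rewrite -[leLHS]ger0_norm ?expR_ge0 // -sqrtr_sqr ler_wsqrtr // -expRM_natl.
  rewrite (_ : 2 * - ((t ^+ 2 + 2 * t ^+ 4) / 2) = - (t ^+ 2 + 2 * t ^+ 4)); last by field.
  have t4 : t ^+ 4 = t ^+ 2 * t ^+ 2 by rewrite -exprD.
  have y0 : 0 < 1 + (t ^+ 2 + 2 * t ^+ 4) by rewrite t4; nra.
  rewrite expRN; apply: (@le_trans _ _ (1 + (t ^+ 2 + 2 * t ^+ 4))^-1).
    by rewrite lef_pV2 ?posrE ?expR_gt0 // expR_ge1Dx.
  by rewrite -[leLHS]mul1r ler_pdivrMr // t4; nra.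
rewrite /kern r4 -/t.
apply: (@le_trans _ _ (\prod_(i < D) expR ((t ^+ 2 + 2 * t ^+ 4) / 2 +
   t * (2 * (xi v i * xi w i) - t * (xi v i ^+ 2 + xi w i ^+ 2)) / (2 * (1 - t ^+ 2))))).
  apply: ler_prod => i _; rewrite mulr_ge0 ?invr_ge0 ?sqrtr_ge0 ?expR_ge0 //= expRD.
  by rewrite ler_wpM2r ?expR_ge0.
rewrite -expR_sum big_split /= sumr_const card_ord ler_expR addrC.
rewrite -[X in _ + X <= _]mulr_natl [X in _ + X <= _]mulrA lerD2r -mulr_suml -mulr_sumr.
rewrite le_eqVlt; apply/orP; left; apply/eqP; congr (_ * _ / _).
by rewrite sumrB -!mulr_sumr big_split.
Qed.

Lemma sum_qq_sqr (J : finType) (f : I -> J -> R) :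
  \sum_v \sum_w q v * q w * (\sum_j f v j * f w j) = \sum_j (\sum_v q v * f v j) ^+ 2.
Proof.
transitivity (\sum_v \sum_w \sum_j (q v * f v j) * (q w * f w j)).
  apply: eq_bigr => v _; apply: eq_bigr => w _; rewrite mulr_sumr.
  by apply: eq_bigr => j _; ring.
under eq_bigr do rewrite exchange_big /=.
rewrite exchange_big /=; apply: eq_bigr => j _.
by rewrite expr2 big_distrlr.
Qed.

Lemma kern_sum_bound (r : R) : 0 < r -> r ^+ 2 * B <= 4^-1 ->
  \sum_v \sum_w q v * q w * kern xi D r v w - 1 <=
  r ^+ 2 * mu ^+ 2 + (r ^+ 2) ^+ 2 * rho ^+ 2 / 2 + 20 * ((r ^+ 2) ^+ 3 * B * (1 + 2 * rho ^+ 2 + 2 * D%:R)).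
Proof.
move=> r0 rB; have [t tE] : exists t, t = r ^+ 2 by exists (r ^+ 2).
rewrite -tE in rB *; have t0 : 0 < t by rewrite tE exprn_gt0.
have t4 : t <= 4^-1 by apply: le_trans rB; rewrite ler_peMr // ltW.
have x0 v : 0 <= x v by apply: sumr_ge0 => i _; rewrite sqr_ge0.
have gB v w : `|g v w| <= B.
  have h : `|g v w| <= (x v + x w) / 2.
    apply: le_trans (ler_norm_sum _ _ _) _; rewrite /x -big_split /= mulr_suml.
    apply: ler_sum => i _; rewrite normrM.
    rewrite -(real_normK (num_real (xi v i))) -(real_normK (num_real (xi w i))).
    have := sqr_ge0 (`|xi v i| - `|xi w i|); rewrite sqrrB -mulr_natr; lra.
  apply: le_trans h _; rewrite ler_pdivrMr // mulr_natr mulr2n.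
  by apply: lerD; exact: xiB.
pose P v w := 1 + t * g v w - t ^+ 2 * (x v + x w) / 2 + D%:R * t ^+ 2 / 2 + t ^+ 2 * g v w ^+ 2 / 2 +
  20 * (t ^+ 3 * B * (1 + g v w ^+ 2)).
have kP v w : kern xi D r v w <= P v w.
  apply: le_trans (kern_le v w _) _.
    rewrite (_ : r ^+ 4 = t * t); last by rewrite tE -expr2 -exprM.
    by apply: le_trans (ler_pM (ltW t0) (ltW t0) t4 t4) _; lra.
  by rewrite -tE; apply: kernel_expansion => //; rewrite ?x0 ?xiB ?ler0n.
pose G := \sum_v \sum_w q v * q w * g v w.
pose G2 := \sum_v \sum_w q v * q w * g v w ^+ 2.
pose X := \sum_v q v * x v.
have S1 (c : R) : \sum_v \sum_w q v * q w * c = c.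
  under eq_bigr do rewrite -mulr_suml -mulr_sumr q1 mulr1.
  by rewrite -mulr_suml q1 mul1r.
have SX1 : \sum_v \sum_w q v * q w * x v = X.
  rewrite /X; apply: eq_bigr => v _; under eq_bigr do rewrite mulrAC.
  by rewrite -mulr_sumr q1 mulr1.
have SX2 : \sum_v \sum_w q v * q w * x w = X.
  rewrite exchange_big /= -SX1; apply: eq_bigr => v _; apply: eq_bigr => w _; ring.
have GE : G <= mu ^+ 2 by rewrite /G sum_qq_sqr.
pose Mx (i j : 'I_D) := \sum_v q v * (xi v i * xi v j).
have G2E : G2 = \sum_i \sum_j Mx i j ^+ 2.
  rewrite /G2 [RHS]pair_big /= /Mx.
  have /= <- := sum_qq_sqr (fun v (p : 'I_D * 'I_D) => xi v p.1 * xi v p.2).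
  apply: eq_bigr => v _; apply: eq_bigr => w _; congr (_ * _).
  rewrite expr2 /g big_distrlr /= pair_big /=; apply: eq_bigr => p _; ring.
have XE : X = \sum_i Mx i i.
  rewrite /X /x /Mx exchange_big /=; apply: eq_bigr => v _; rewrite mulr_sumr.
  by apply: eq_bigr => i _; rewrite expr2.
have HS : \sum_i \sum_j (Mx i j - (i == j)%:R) ^+ 2 = G2 - 2 * X + D%:R.
  rewrite G2E XE mulr_sumr -sumrB.
  rewrite (_ : D%:R = \sum_(i < D) 1 :> R); last by rewrite sumr_const card_ord.
  rewrite -big_split /=; apply: eq_bigr => i _.
  rewrite (bigD1 i) //= [in RHS](bigD1 i) //= eqxx.
  rewrite (eq_bigr (fun j => Mx i j ^+ 2)); last first.
    by move=> j ji; rewrite eq_sym (negbTE ji) subr0.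
  by rewrite sqrrB1 -mulr_natl; ring.
have HSr : G2 - 2 * X + D%:R <= rho ^+ 2.
  rewrite -HS; apply: le_trans xic; rewrite le_eqVlt; apply/orP; left; apply/eqP.
  by apply: eq_bigr => i _; apply: eq_bigr => j _.
have G2le : G2 <= 2 * rho ^+ 2 + 2 * D%:R.
  have : 2 * X <= G2 / 2 + 2 * D%:R.
    rewrite XE G2E mulr_sumr mulr_suml (_ : D%:R = \sum_(i < D) 1 :> R); last by rewrite sumr_const card_ord.
    rewrite mulr_sumr -big_split /=; apply: ler_sum => i _.
    apply: (@le_trans _ _ (Mx i i ^+ 2 / 2 + 2 * 1)).
      have := sqr_ge0 (Mx i i - 2); rewrite sqrrB -mulr_natr; lra.
    rewrite lerD2r ler_pM2r ?invr_gt0 // (bigD1 i) //= lerDl.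
    by apply: sumr_ge0 => j _; exact: sqr_ge0.
  lra.
have PE : \sum_v \sum_w q v * q w * P v w = 1 + t * G - t ^+ 2 * X + D%:R * t ^+ 2 / 2 +
  t ^+ 2 * G2 / 2 + 20 * (t ^+ 3 * B * (1 + G2)).
  pose c1 := 1 + D%:R * t ^+ 2 / 2 + 20 * (t ^+ 3 * B).
  transitivity (\sum_v \sum_w (q v * q w * c1 + t * (q v * q w * g v w) - t ^+ 2 / 2 * (q v * q w * x v)
     - t ^+ 2 / 2 * (q v * q w * x w) + (t ^+ 2 / 2 + 20 * (t ^+ 3 * B)) * (q v * q w * g v w ^+ 2))).
    by apply: eq_bigr => v _; apply: eq_bigr => w _; rewrite /P /c1; field.
  under eq_bigr do rewrite big_split /= sumrB sumrB big_split /= -!mulr_sumr.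
  rewrite big_split /= sumrB sumrB big_split /= -!mulr_sumr S1 SX1 SX2 -/G -/G2 /c1.
  by field.
apply: (@le_trans _ _ (\sum_v \sum_w q v * q w * P v w - 1)).
  rewrite lerD2r; apply: ler_sum => v _; apply: ler_sum => w _.
  by apply: ler_wpM2l; [exact: mulr_ge0|exact: kP].
rewrite PE.
have k1 : t * G <= t * mu ^+ 2 by rewrite ler_wpM2l // ltW.
have k2 : t ^+ 2 * (G2 - 2 * X + D%:R) <= t ^+ 2 * rho ^+ 2 by rewrite ler_wpM2l // sqr_ge0.
have k3 : t ^+ 3 * B * (1 + G2) <= t ^+ 3 * B * (1 + 2 * rho ^+ 2 + 2 * D%:R).
  apply: ler_wpM2l.
    by apply: mulr_ge0; [apply: exprn_ge0; exact: ltW|exact: le_trans B1].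
  lra.
lra.
Qed.
End KernBound.

Fact gap_bound (R : realType) (x1 x2 y1 y2 E c w : R) : `|x1 - y1| <= E -> `|x2 - y2| <= E ->
  y1 <= y2 + c + w -> x1 - x2 <= c + w + 2 * E.
Proof. by rewrite !ler_norml => /andP[? ?] /andP[? ?] ?; lra. Qed.

Fact step_arith (R : realType) (f p h E w e : R) : 0 <= e -> f <= p * (5 * h) + w + 2 * E ->
  e * (2 * f + w) <= E * (4 * e) + e * (10 * (p * h) + 3 * w).
Proof.
move=> e0 fE; rewrite [E * _]mulrA [E * 4]mulrC -mulrA [E * e]mulrC mulrCA -mulrDr.
by apply: ler_wpM2l => //; lra.
Qed.

Fact final_arith (R : realType) (E0 x1 x2 y y1 y2 H b w : R) : E0 <= x1 + w -> x2 - w <= E0 ->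
  `|x1 - y1| <= H -> `|x2 - y2| <= H -> y1 <= y + b + w -> y <= y2 + b + w ->
  `|E0 - y| <= H + b + 2 * w.
Proof. by rewrite !ler_norml => ? ? /andP[? ?] /andP[? ?] ? ?; apply/andP; split; lra. Qed.

Section Hybrid.
Context {R : realType} {I : finType} (q : I -> R) (xi : I -> nat -> R).
Notation RM := (measurableTypeR R).
Hypotheses (q0 : forall v, 0 <= q v) (q1 : \sum_v q v = 1).
Variables (a : nat -> nat -> R) (m D : nat).
Notation N := (Nrm a m D).
Variables (rad w : R).
Hypotheses (rad0 : 0 < rad) (w0 : 0 < w) (w1 : w <= 2^-1).
Hypothesis tailw : gpr [set z : D.-tuple RM | ~ (N (nth 0 (tval z)) <= rad)] <= w ^+ 2.
Variables (n : nat) (Lam p : R) (e : nat -> R).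
Hypotheses (Lam0 : 0 < Lam) (p0 : 0 <= p).
Definition hscale (L : R) (k j : nat) : R := Num.sqrt (L + (k - j)%:R).
Notation T := (hscale Lam n).
Notation F0 := (gsm a m D (fun=> 0) (T 0)).
Hypothesis anti : forall u h : R, 0 <= h -> F0 (u + h) <= F0 u + p * h + w.
Hypothesis e0 : forall j, (j < n)%N -> 0 < e j.
Hypothesis he : forall j, (j < n)%N ->
  \sum_v \sum_u q v * q u * kern xi D (T j)^-1 v u - 1 <= e j ^+ 2.

Notation Fh j t := (En q j (fun s => gsm a m D (vsum xi s) (T j) t)).

Fixpoint hyb_err j : R := match j with
  | 0 => 0
  | j.+1 => hyb_err j * (1 + 4 * e j) + e j * (10 * (p * rad * T j) + 3 * w) end.

Lemma hscale_gt0 j : 0 < T j.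
Proof. by rewrite sqrtr_gt0 ltr_wpDr. Qed.

Lemma hscale_sqr j : T j ^+ 2 = Lam + (n - j)%:R.
Proof. by rewrite sqr_sqrtr // addr_ge0 // ltW. Qed.

Lemma hscale_gt1 j : (j < n)%N -> 1 < T j.
Proof.
move=> jn; rewrite -[ltLHS]sqrtr1 ltr_sqrt; last by rewrite ltr_wpDr.
have h : 1 <= (n - j)%:R :> R by rewrite ler1n subn_gt0.
by apply: le_lt_trans h _; rewrite ltrDr.
Qed.

Lemma hscaleS j : (j < n)%N -> T j.+1 = Num.sqrt (T j ^+ 2 - 1).
Proof.
move=> jn; rewrite hscale_sqr /hscale; congr Num.sqrt.
by rewrite -addrA; congr (_ + _); rewrite -(subnSK jn) -natr1 addrK.
Qed.

(** Each replacement costs [e j] only on the samples whose partial sum lies near the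
    boundary; their proportion is controlled by the hybrid law itself. *)
Lemma hybrid_bound j (t : R) : (j <= n)%N -> `|Fh j t - F0 t| <= hyb_err j.
Proof.
elim: j t => [|j IH] t jn.
  rewrite /= (_ : vsum xi [::] = fun=> 0) ?subrr ?normr0 //.
  by apply/funext => i; rewrite /vsum big_nil.
have {}IH t' := IH t' (ltnW jn).
have T0 := hscale_gt0 j; have T1 := hscale_gt1 jn; have ej0 := e0 jn.
pose h := T j * rad.
have h0 : 0 < h by rewrite mulr_gt0.
have step : `|Fh j.+1 t - Fh j t| <= e j * (2 * (Fh j (t + 2 * h) - Fh j (t - 3 * h)) + w).
  rewrite (EnS q1) -EnB; apply: le_trans (En_norm q0 _ _) _.
  have -> : e j * (2 * (Fh j (t + 2 * h) - Fh j (t - 3 * h)) + w) =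
     En q j (fun s => e j * (2 * (gsm a m D (vsum xi s) (T j) (t + 2 * h) - gsm a m D (vsum xi s) (T j) (t - 3 * h)) + w)).
    by rewrite EnZ EnD EnZ EnB (En_cst q1).
  apply: En_le => // s _.
  apply: (@le_trans _ _ (e j * ((`|N (vsum xi s) - t| <= h)%R%:R + w))).
    have := clt_step q1 w0 tailw (vsum xi s) t T1 ej0 (he jn).
    rewrite -hscaleS //; apply: le_trans.
    rewrite le_eqVlt; apply/orP; left; apply/eqP; congr `|_ - _|.
    apply: eq_bigr => v _; congr (_ * gsm _ _ _ _ _ _).
    by apply/funext => i; rewrite vsum_cons.
  apply: ler_wpM2l; first exact: ltW.
  rewrite lerD2r; by apply: (near_le_gsm (w := w)).
have a5 : F0 (t + 2 * h) <= F0 (t - 3 * h) + p * (5 * h) + w.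
  have := @anti (t - 3 * h) (5 * h); rewrite (_ : t - 3 * h + 5 * h = t + 2 * h); last by ring.
  by apply; rewrite mulr_ge0 // ltW.
have IH2 := IH (t + 2 * h); have IH3 := IH (t - 3 * h).
have fin : Fh j (t + 2 * h) - Fh j (t - 3 * h) <= p * (5 * h) + w + 2 * hyb_err j.
  exact: gap_bound IH2 IH3 a5.
apply: (@le_trans _ _ (`|Fh j.+1 t - Fh j t| + `|Fh j t - F0 t|)).
  by rewrite -[X in `|X| <= _](subrKA (Fh j t)); exact: ler_normD.
have IH1 := IH t.
rewrite /= mulrDr mulr1 -addrA [leRHS]addrC lerD //.
apply: le_trans step _; rewrite -[p * rad * T j]mulrA [rad * T j]mulrC.
exact: step_arith (ltW ej0) fin.
Qed.

(** The boundary layer of width [sqrt Lam * rad] absorbs the final smoothing. *)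
Lemma hybrid_final (t : R) :
  `|En q n (fun s => (N (vsum xi s) <= t)%R%:R) - F0 t| <=
  hyb_err n + p * (Num.sqrt Lam * rad) + 2 * w.
Proof.
have Tn : T n = Num.sqrt Lam by rewrite /hscale subnn addr0.
have T0 := hscale_gt0 n; rewrite Tn in T0.
pose h := Num.sqrt Lam * rad; have h0 : 0 < h by rewrite mulr_gt0.
have w2w : w ^+ 2 <= w.
  rewrite expr2; apply: ler_piMr; first exact: ltW.
  by apply: le_trans w1 _; rewrite invf_le1 // ler1n.
have up : En q n (fun s => (N (vsum xi s) <= t)%R%:R) <= Fh n (t + h) + w.
  rewrite -[X in _ <= _ + X](En_cst q1 n) -EnD; apply: En_le => // s _; rewrite Tn.
  have [Nt|_] := boolP (N (vsum xi s) <= t); last by rewrite addr_ge0 ?gsm_ge0 // ltW.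
  have := gsm_large tailw (x := vsum xi s) (tau := Num.sqrt Lam) (t := t + h) T0.
  by move=> /(_ (lerD Nt (lexx _))); rewrite lerBlDr => /le_trans; apply; rewrite lerD2l.
have lo : Fh n (t - h) - w <= En q n (fun s => (N (vsum xi s) <= t)%R%:R).
  rewrite -[X in _ - X <= _](En_cst q1 n) -EnB; apply: En_le => // s _; rewrite Tn.
  have [Nt|Nt] := boolP (N (vsum xi s) <= t).
    by rewrite lerBlDr; apply: le_trans (gsm_le1 _ _ _ _ _ _) _; rewrite lerDl ltW.
  rewrite subr_le0; apply: le_trans w2w.
  by apply: (gsm_small tailw) => //; rewrite -/h ltrD2r ltNge.
have b1 := hybrid_bound (t + h) (leqnn n).
have b2 := hybrid_bound (t - h) (leqnn n).
have a1 := anti t (ltW h0).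
have a2 := anti (t - h) (ltW h0); rewrite subrK in a2.
exact: final_arith up lo b1 b2 a1 a2.
Qed.

Lemma hyb_err_bound j : (j <= n)%N ->
  hyb_err j <= expR (4 * \sum_(i < j) e i) * \sum_(i < j) e i * (10 * (p * rad * T i) + 3 * w).
Proof.
elim: j => [|j IH] jn; first by rewrite /= !big_ord0 mulr0.
have ej0 := e0 jn; have {}IH := IH (ltnW jn).
rewrite /= !big_ord_recr /= [4 * (_ + _)]mulrDr expRD [leRHS]mulrDr.
have b0 : 0 <= e j * (10 * (p * rad * T j) + 3 * w).
  apply: mulr_ge0; first exact: ltW.
  apply: addr_ge0; apply: mulr_ge0 => //; last exact: ltW.
  by apply: mulr_ge0; [apply: mulr_ge0 => //; exact: ltW|exact: ltW (hscale_gt0 j)].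
have s0 : 0 <= 4 * \sum_(i < j) e i.
  by apply: mulr_ge0 => //; apply: sumr_ge0 => i _; apply/ltW/e0; apply: ltn_trans jn.
apply: lerD.
  rewrite [leRHS]mulrAC; apply: ler_pM => //; last exact: expR_ge1Dx.
  - exact: le_trans (normr_ge0 _) (hybrid_bound 0 (ltnW jn)).
  - by apply: addr_ge0 => //; apply: mulr_ge0 => //; exact: ltW.
rewrite -expRD; apply: ler_peMl => //; apply: le_trans (expR_ge1Dx _); rewrite lerDl.
by apply: addr_ge0 => //; apply: mulr_ge0 => //; exact: ltW.
Qed.
End Hybrid.

Section Explicit.
Context {R : realType} {I : finType} (q : I -> R) (xi : I -> nat -> R).
Notation RM := (measurableTypeR R).
Hypotheses (q0 : forall v, 0 <= q v) (q1 : \sum_v q v = 1).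
Variables (a : nat -> nat -> R) (m D : nat).
Notation N := (Nrm a m D).

Fact expR4_le : expR 4 <= 160 :> R.
Proof.
have e1 : expR 1 <= 7 / 2 :> R.
  by have := @expR_le_cubic R 1; rewrite normr1 !expr1n => /(_ (lexx _)); lra.
have -> : expR 4 = expR 1 ^+ 4 :> R by rewrite -expRM_natl mulr1.
apply: (@le_trans _ _ ((7 / 2) ^+ 4)).
  by rewrite ler_pXn2r ?nnegrE ?expR_ge0 //; lra.
rewrite (_ : (7 / 2) ^+ 4 = 2401 / 16 :> R); [lra|by field].
Qed.

Lemma sum_rev_inv n (f : nat -> R) : \sum_(j < n) f (n - j)%N = \sum_(i < n) f i.+1.
Proof.
rewrite (reindex_inj rev_ord_inj) /=; apply: eq_bigr => i _; congr f.
by have := ltn_ord i; lia.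
Qed.

Theorem norm_clt (rad w B mu rho Lam P ell : R) (n : nat) :
  0 < rad -> 0 < w -> w <= 2^-1 ->
  gpr [set z : D.-tuple RM | ~ (N (nth 0 (tval z)) <= rad)] <= w ^+ 2 ->
  1 <= B -> D%:R <= B -> 0 <= mu -> 0 <= rho -> 0 <= P ->
  (forall v, \sum_(i < D) xi v i ^+ 2 <= B) ->
  \sum_(i < D) (\sum_v q v * xi v i) ^+ 2 <= mu ^+ 2 ->
  \sum_(i < D) \sum_(j < D) (\sum_v q v * (xi v i * xi v j) - (i == j)%:R) ^+ 2 <= rho ^+ 2 ->
  (0 < n)%N -> 4 * B <= Lam -> Lam <= n%:R ->
  (forall u h : R, 0 <= h -> gsm a m D (fun=> 0) (Num.sqrt (Lam + n%:R)) (u + h) <=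
     gsm a m D (fun=> 0) (Num.sqrt (Lam + n%:R)) u + P / Num.sqrt n%:R * h + w) ->
  \sum_(i < n) i.+1%:R^-1 <= ell ->
  let K := Num.sqrt (20 * (B * (1 + 2 * rho ^+ 2 + 2 * D%:R))) in
  ell * (Num.sqrt (2 * n%:R) * mu + rho + K / Num.sqrt Lam) <= 1 ->
  forall t, `|En q n (fun s => (N (vsum xi s) <= t)%R%:R)
     - gsm a m D (fun=> 0) (Num.sqrt (Lam + n%:R)) t| <=
  1600 * (rad * P * ell * (Num.sqrt n%:R * mu + 2 * rho + K / Num.sqrt n%:R) + w)
  + P * rad * (Num.sqrt Lam / Num.sqrt n%:R) + 2 * w.
Proof.
move=> rad0 w0 w1 tailw B1 DB mu0 rho0 P0 xiB xim xic n0 BL Ln anti hell K small t.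
have n0R : 0 < n%:R :> R by rewrite ltr0n.
have Lam0 : 0 < Lam by apply: lt_le_trans BL; rewrite mulr_gt0 // (lt_le_trans ltr01).
pose T := hscale Lam n.
have Tgt0 j : 0 < T j := hscale_gt0 n Lam0 j.
have Tsq j : T j ^+ 2 = Lam + (n - j)%:R := hscale_sqr n Lam0 j.
pose r j := (T j)^-1.
have r0 j : 0 < r j by rewrite invr_gt0.
have K2 : K ^+ 2 = 20 * (B * (1 + 2 * rho ^+ 2 + 2 * D%:R)).
  rewrite sqr_sqrtr // mulr_ge0 // mulr_ge0 ?(le_trans ler01 B1) //.
  by rewrite !addr_ge0 // mulr_ge0 // sqr_ge0.
have K0 : 0 < K.
  rewrite sqrtr_gt0 mulr_gt0 // mulr_gt0 ?(lt_le_trans ltr01 B1) //.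
  by rewrite -addrA ltr_pwDl // addr_ge0 // mulr_ge0 // sqr_ge0.
pose e j := r j * mu + r j ^+ 2 * rho + r j ^+ 3 * K.
have e0 j : 0 < e j.
  rewrite /e ltr_wpDl //; last by rewrite mulr_gt0 // exprn_gt0.
  by rewrite addr_ge0 // mulr_ge0 // ?exprn_ge0 // ltW.
have rB j : r j ^+ 2 * B <= 4^-1.
  rewrite exprVn Tsq mulrC ler_pdivrMr; last by rewrite ltr_wpDr.
  have : 0 <= (n - j)%:R :> R by [].
  lra.
have he j : \sum_v \sum_u q v * q u * kern xi D (T j)^-1 v u - 1 <= e j ^+ 2.
  have := kern_sum_bound q0 q1 B1 DB xiB xim xic (r0 j) (rB j).
  move/le_trans; apply.
  set x := r j * mu; set y := r j ^+ 2 * rho; set z := r j ^+ 3 * K.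
  have x0 : 0 <= x by rewrite mulr_ge0 // ltW.
  have y0 : 0 <= y by rewrite mulr_ge0 // exprn_ge0 // ltW.
  have z0 : 0 <= z by rewrite mulr_ge0 ?exprn_ge0 // ltW.
  apply: (@le_trans _ _ (x ^+ 2 + y ^+ 2 + z ^+ 2)).
    rewrite (_ : z ^+ 2 = r j ^+ 6 * (20 * (B * (1 + 2 * rho ^+ 2 + 2 * D%:R)))); last by rewrite -K2 /z; ring.
    rewrite (_ : 20 * ((r j ^+ 2) ^+ 3 * B * (1 + 2 * rho ^+ 2 + 2 * D%:R)) =
       r j ^+ 6 * (20 * (B * (1 + 2 * rho ^+ 2 + 2 * D%:R)))); last by ring.
    rewrite (_ : r j ^+ 2 * mu ^+ 2 = x ^+ 2); last by rewrite /x; ring.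
    rewrite (_ : (r j ^+ 2) ^+ 2 * rho ^+ 2 = y ^+ 2); last by rewrite /y; ring.
    rewrite lerD2r lerD2l.
    by apply: ler_piMr; [exact: sqr_ge0|rewrite invf_le1 // ler1n].
  rewrite /e -/x -/y -/z.
  have := mulr_ge0 x0 y0; have := mulr_ge0 x0 z0; have := mulr_ge0 y0 z0.
  rewrite (_ : (x + y + z) ^+ 2 = x ^+ 2 + y ^+ 2 + z ^+ 2 + 2 * (x * y) + 2 * (x * z) + 2 * (y * z)); last by ring.
  lra.
have sn0 : 0 < Num.sqrt n%:R :> R by rewrite sqrtr_gt0.
have p0 : 0 <= P / Num.sqrt n%:R by rewrite divr_ge0 // ltW.
have anti' : forall u h : R, 0 <= h -> gsm a m D (fun=> 0) (T 0) (u + h) <=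
   gsm a m D (fun=> 0) (T 0) u + P / Num.sqrt n%:R * h + w.
  by rewrite /T /hscale subn0.
have F1 := hybrid_final q0 q1 rad0 w0 w1 tailw Lam0 anti' (fun j _ => e0 j) (fun j _ => he j) t.
have F2 := hyb_err_bound q0 q1 rad0 w0 w1 tailw Lam0 p0 anti' (fun j _ => e0 j) (fun j _ => he j) (leqnn n).
pose c (j : nat) : R := (n - j)%:R^-1.
have cs : \sum_(j < n) c j <= ell.
  by apply: le_trans hell; rewrite (sum_rev_inv n (fun i => i%:R^-1)).
have ell1 : 1 <= ell.
  apply: le_trans hell; case: n n0 {Ln anti small t n0R T Tgt0 Tsq r r0 e e0 rB he sn0 p0 anti' F1 F2 c cs} => // n _.
  by rewrite big_ord_recl /= invr1 lerDl sumr_ge0.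
have c0 j : 0 <= c j by rewrite invr_ge0.
have r2c j : (j < n)%N -> r j ^+ 2 <= c j.
  move=> jn; rewrite exprVn Tsq /c lef_pV2 ?posrE ?ltr0n ?subn_gt0 //; last by rewrite ltr_wpDr.
  by rewrite lerDr ltW.
have T2n j : T j <= Num.sqrt (2 * n%:R).
  rewrite /T /hscale ler_wsqrtr // mulr_natl mulr2n; apply: lerD => //.
  by rewrite ler_nat leq_subr.
have rT j : r j * T j = 1 by rewrite /r mulVf // gt_eqF.
have r1 j : (j < n)%N -> r j <= c j * Num.sqrt (2 * n%:R).
  move=> jn; rewrite [leLHS](_ : _ = r j ^+ 2 * T j); last by rewrite expr2 -mulrA rT mulr1.
  by apply: ler_pM => //; [exact: sqr_ge0|exact: ltW|exact: r2c].
have rL j : r j <= (Num.sqrt Lam)^-1.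
  have sL : 0 < Num.sqrt Lam by rewrite sqrtr_gt0.
  rewrite lef_pV2 ?posrE // /T /hscale ler_wsqrtr // lerDl //.
have E1 : \sum_(j < n) e j <= 1.
  apply: le_trans small.
  apply: (@le_trans _ _ ((\sum_(j < n) c j) * (Num.sqrt (2 * n%:R) * mu + rho + K / Num.sqrt Lam))).
    rewrite mulr_suml; apply: ler_sum => j _; rewrite /e !mulrDr.
    apply: lerD; first apply: lerD.
    - by rewrite mulrA ler_wpM2r // r1.
    - by rewrite ler_wpM2r // r2c.
    - rewrite [K / _]mulrC mulrA ler_wpM2r ?(ltW K0) // exprSr.
      by apply: ler_pM => //; [exact: sqr_ge0|exact: ltW|exact: r2c].
  apply: ler_wpM2r => //; rewrite !addr_ge0 ?mulr_ge0 ?sqrtr_ge0 ?invr_ge0 ?(ltW K0) //.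
have E2 : \sum_(j < n) e j * T j <= n%:R * mu + ell * (Num.sqrt (2 * n%:R) * rho + K).
  apply: (@le_trans _ _ (\sum_(j < n) (mu + c j * (Num.sqrt (2 * n%:R) * rho + K)))).
    apply: ler_sum => j _.
    have -> : e j * T j = mu * (r j * T j) + r j * rho * (r j * T j) + r j ^+ 2 * K * (r j * T j) by rewrite /e; ring.
    rewrite rT !mulr1 -addrA lerD2l mulrDr; apply: lerD.
      by rewrite mulrA ler_wpM2r // r1.
    by rewrite ler_wpM2r ?(ltW K0) // r2c.
  rewrite big_split /= sumr_const card_ord -[mu *+ n]mulr_natl -mulr_suml; apply: lerD => //.
  by apply: ler_wpM2r => //; rewrite addr_ge0 ?mulr_ge0 ?sqrtr_ge0 ?(ltW K0).
rewrite {1}/hscale subn0 in F1; apply: (le_trans F1); rewrite -/T in F2 *.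
set X := \sum_(i < n) e i * _ in F2.
have XE : X = 10 * (P / Num.sqrt n%:R * rad) * \sum_(j < n) e j * T j + 3 * w * \sum_(j < n) e j.
  rewrite /X !mulr_sumr -big_split /=; apply: eq_bigr => j _; ring.
set W := Num.sqrt n%:R * mu + 2 * rho + K / Num.sqrt n%:R.
have s2 : Num.sqrt (2 * n%:R) <= 2 * Num.sqrt n%:R :> R.
  rewrite sqrtrM // ler_wpM2r ?sqrtr_ge0 //.
  by rewrite -[leRHS]ger0_norm // -sqrtr_sqr ler_wsqrtr // expr2; lra.
have nn : n%:R = Num.sqrt n%:R * Num.sqrt n%:R :> R by rewrite -expr2 sqr_sqrtr.
have E3 : \sum_(j < n) e j * T j <= Num.sqrt n%:R * (ell * W).
  apply: (le_trans E2); rewrite /W.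
  have -> : Num.sqrt n%:R * (ell * (Num.sqrt n%:R * mu + 2 * rho + K / Num.sqrt n%:R)) =
     ell * ((Num.sqrt n%:R * Num.sqrt n%:R) * mu) + ell * (2 * Num.sqrt n%:R * rho + K).
    by field; rewrite gt_eqF.
  rewrite -nn; apply: lerD.
    by apply: ler_peMl => //; rewrite mulr_ge0.
  apply: ler_wpM2l; first exact: le_trans ell1.
  by rewrite lerD2r ler_wpM2r.
have W0 : 0 <= W.
  by rewrite !addr_ge0 ?mulr_ge0 ?sqrtr_ge0 ?invr_ge0 ?sqrtr_ge0 ?(ltW K0).
have Xle : X <= 10 * (rad * P * ell * W) + 3 * w.
  rewrite XE; apply: lerD; last by rewrite -[leRHS]mulr1 ler_wpM2l // mulr_ge0 // ltW.
  apply: (@le_trans _ _ (10 * (P / Num.sqrt n%:R * rad) * (Num.sqrt n%:R * (ell * W)))).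
    by apply: ler_wpM2l => //; rewrite !mulr_ge0 // ?invr_ge0 ?sqrtr_ge0 // ltW.
  rewrite le_eqVlt; apply/orP; left; apply/eqP; by field; rewrite gt_eqF.
have X0 : 0 <= X.
  rewrite XE; have S0 : 0 <= \sum_(j < n) e j by apply: sumr_ge0 => j _; exact: ltW.
  have S1 : 0 <= \sum_(j < n) e j * T j by apply: sumr_ge0 => j _; apply: mulr_ge0; exact: ltW.
  apply: addr_ge0; apply: mulr_ge0 => //; last by rewrite mulr_ge0 // ltW.
  by rewrite mulr_ge0 // mulr_ge0 // ltW.
have F3 : hyb_err rad w n Lam (P / Num.sqrt n%:R) e n <= 160 * X.
  apply: (le_trans F2); apply: ler_wpM2r => //; apply: le_trans expR4_le.
  by rewrite ler_expR -[leRHS]mulr1 ler_wpM2l.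
rewrite -[leRHS]addrA -[leLHS]addrA; apply: lerD.
  apply: (le_trans F3); apply: (@le_trans _ _ (160 * (10 * (rad * P * ell * W) + 3 * w))).
    by rewrite ler_wpM2l.
  by move: w0; clear; move: (rad * P * ell * W) => y; lra.
rewrite lerD2r le_eqVlt; apply/orP; left; apply/eqP; ring.
Qed.
End Explicit.

(** * Anti-concentration of Gaussian seminorms *)
Fact modulus_arith (R : realType) (x y z w : R) : 0 <= z -> 0 <= w -> 0 <= x ->
  y <= 8 * z \/ y <= w -> y <= x + 84 * z + w.
Proof. by move=> ? ? ? [] ?; lra. Qed.

Section Anti.
Context {R : realType}.
Notation RM := (measurableTypeR R).
Variables (a : nat -> nat -> R) (m D m0 : nat).
Notation N := (Nrm a m D).

Let NrmZp (c : R) x : 0 <= c -> N (fun j => c * x j) = c * N x.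
Proof. by move=> c0; rewrite NrmZ ger0_norm. Qed.

Definition hscal (s : R) (z : nat -> R) : nat -> R := fun i => if (i < m0)%N then s * z i else z i.
Definition htail (z : nat -> R) : nat -> R := fun i => if (i < m0)%N then 0 else z i.

Lemma Nrm_hscal_grow (s s' : R) z : 0 < s -> s <= s' ->
  N (hscal s z) + (s' - s) / s * (N (hscal s z) - N (htail z)) <= N (hscal s' z).
Proof.
move=> s0 ss'; have s'0 : 0 < s' by exact: lt_le_trans ss'.
have r0 : 0 <= (s' - s) / s by rewrite divr_ge0 ?subr_ge0 // ltW.
have h1 : s' / s * N (hscal s z) <= N (hscal s' z) + (s' - s) / s * N (htail z).
  rewrite -NrmZp; last by rewrite divr_ge0 // ltW.
  rewrite -(NrmZp _ r0).
  rewrite (@eq_Nrm _ a m D (fun j => s' / s * hscal s z j) (fun j => hscal s' z j + (s' - s) / s * htail z j)).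
    exact: NrmD.
  move=> j _; rewrite /hscal /htail; case: ifP => _; first by rewrite mulr0 addr0; field; rewrite gt_eqF.
  by field; rewrite gt_eqF.
have -> : N (hscal s z) + (s' - s) / s * (N (hscal s z) - N (htail z)) =
   s' / s * N (hscal s z) - (s' - s) / s * N (htail z) by field; rewrite gt_eqF.
by rewrite lerBlDr.
Qed.

Lemma Nrm_hscal_le (s : R) z : 1 <= s -> N z <= N (hscal s z) + N (htail z).
Proof.
move=> s1; have s0 : 0 < s by exact: lt_le_trans ltr01 s1.
have i1 : s^-1 <= 1 by rewrite invf_le1.
have i0 : 0 <= s^-1 by rewrite invr_ge0 ltW.
have i2 : 0 <= 1 - s^-1 by rewrite subr_ge0.
have h : N z <= s^-1 * N (hscal s z) + (1 - s^-1) * N (htail z).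
  rewrite -(NrmZp _ i0) -(NrmZp _ i2).
  rewrite (@eq_Nrm _ a m D z (fun j => s^-1 * hscal s z j + (1 - s^-1) * htail z j)).
    exact: NrmD.
  move=> j _; rewrite /hscal /htail; case: ifP => _; first by rewrite mulr0 addr0; field; rewrite gt_eqF.
  by ring.
apply: (le_trans h); apply: lerD; rewrite -[leRHS]mul1r; apply: ler_wpM2r; rewrite ?Nrm_ge0 //.
by rewrite lerBlDr lerDl.
Qed.

Definition layer (u h k s : R) : set (D.-tuple RM) :=
  [set z | [/\ u < N (hscal s (nth 0 (tval z))), N (hscal s (nth 0 (tval z))) <= u + h &
            N (htail (nth 0 (tval z))) <= k]].

Let mN (f : nat -> R -> R) : (forall i, measurable_fun setT (f i)) ->
  measurable_fun [set: D.-tuple RM] (fun z : D.-tuple RM => N (fun i => f i (nth 0 (tval z) i))).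
Proof.
move=> mf; apply: measurable_Nrm => j.
by apply: (@measurableT_comp _ _ _ _ _ _ (f j)); [exact: mf|exact: measurable_nth].
Qed.

Lemma measurable_hs (s : R) : measurable_fun [set: D.-tuple RM] (fun z : D.-tuple RM => N (hscal s (nth 0 (tval z)))).
Proof.
apply: (mN (f := fun i y => if (i < m0)%N then s * y else y)) => i.
by case: (i < m0)%N => //; apply: measurable_funM.
Qed.

Lemma measurable_ht : measurable_fun [set: D.-tuple RM] (fun z : D.-tuple RM => N (htail (nth 0 (tval z)))).
Proof.
apply: (mN (f := fun i y => if (i < m0)%N then 0 else y)) => i.
by case: (i < m0)%N => //; exact: measurable_cst.
Qed.

Lemma measurable_layer u h k s : measurable (layer u h k s).
Proof.
rewrite (_ : layer u h k s = (~` [set z : D.-tuple RM | N (hscal s (nth 0 (tval z))) <= u]) `&`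
  ([set z : D.-tuple RM | N (hscal s (nth 0 (tval z))) <= u + h] `&`
   [set z : D.-tuple RM | N (htail (nth 0 (tval z))) <= k])).
  apply: measurableI; first by apply: measurableC; apply: measurable_set_le; exact: measurable_hs.
  apply: measurableI; apply: measurable_set_le; [exact: measurable_hs|exact: measurable_ht].
apply/seteqP; split => z /=; first by case=> h1 h2 h3; split => //; apply/negP; rewrite -ltNge.
by case=> /negP; rewrite -ltNge => ? [].
Qed.

Lemma layer_scale (u h k s : R) : 0 <= s ->
  gpr (layer u h k 1) <= (1 + s) ^+ m0 * gpr (layer u h k (1 + s)).
Proof.
move=> s0; have s1 : 0 < 1 + s by rewrite ltr_wpDr.
pose g i (y : R) := if (i < m0)%N then (1 + s) * y else y.
pose c i : R := if (i < m0)%N then 1 + s else 1.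
have mg i : measurable_fun setT (g i).
  by rewrite /g; case: (i < m0)%N => //; apply: measurable_funM.
have c0 i : 0 <= c i by rewrite /c; case: ifP => // _; exact: ltW.
have gc i (f : R -> \bar R) : measurable_fun setT f -> (forall x, 0 <= f x)%E ->
     (\int[@gam R]_x f x <= (c i)%:E * \int[@gam R]_x f (g i x))%E.
  move=> mf f0; rewrite /c /g; case: (i < m0)%N; first exact: gam_scale.
  by rewrite mul1e.
have ml := @measurable_layer u h k.
have mF : measurable_fun setT (fun z : D.-tuple RM => (\1_(layer u h k 1) z)%:E : \bar R).
  by apply/measurable_EFinP; exact: measurable_indic.
have F0 z : (0 <= (\1_(layer u h k 1) z)%:E :> \bar R)%E by rewrite lee_fin.
have K := gpow_dominate mg c0 gc mF F0.
have E (z : D.-tuple RM) : \1_(layer u h k 1) (tmap g z) = \1_(layer u h k (1 + s)) z :> R.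
  have e1 : N (hscal 1 (nth 0 (tval (tmap g z)))) = N (hscal (1 + s) (nth 0 (tval z))).
    by apply: eq_Nrm => j jD; rewrite /hscal nth_tmap // /g; case: (j < m0)%N; rewrite ?mul1r.
  have e2 : N (htail (nth 0 (tval (tmap g z)))) = N (htail (nth 0 (tval z))).
    by apply: eq_Nrm => j jD; rewrite /htail nth_tmap // /g; case: (j < m0)%N.
  rewrite !indicE; congr (_%:R); congr nat_of_bool.
  by apply/idP/idP => /set_mem z1; apply/mem_set; move: z1; rewrite /layer /= e1 e2.
have pc : \prod_(i < D) c i <= (1 + s) ^+ m0.
  have s1' : 1 <= 1 + s by rewrite lerDl.
  apply: (@le_trans _ _ ((1 + s) ^+ (minn D m0))); last by rewrite ler_weXn2l // geq_minr.
  rewrite le_eqVlt; apply/orP; left; apply/eqP.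
  elim: {K mF F0 mg gc c0 E ml} D => [|D' IH]; first by rewrite big_ord0 min0n expr0.
  rewrite big_ord_recr /= IH /c; case: ltnP => Dm.
    by rewrite (minn_idPl Dm) exprSr.
  by rewrite mulr1 (minn_idPr (leqW Dm)).
rewrite -lee_fin EFinM -!gprE //.
have i1 : (\int[gpow D]_z (\1_(layer u h k 1) z)%:E = gpow D (layer u h k 1))%E.
  by rewrite integral_indic ?setIT.
have i2 : (\int[gpow D]_z (\1_(layer u h k 1) (tmap g z))%:E = gpow D (layer u h k (1 + s)))%E.
  rewrite (eq_integral (fun z => (\1_(layer u h k (1 + s)) z)%:E)) ?integral_indic ?setIT //.
  by move=> z _; rewrite E.
by rewrite i1 i2 in K; apply: (le_trans K); apply: lee_wpmul2r.
Qed.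

Lemma gpr_disjoint_sum (J : nat) (A : nat -> set (D.-tuple RM)) (B : set (D.-tuple RM)) :
  (forall j, measurable (A j)) -> measurable B ->
  (forall j j' z, (j < j' < J)%N -> A j z -> ~ A j' z) ->
  (forall j, (j < J)%N -> A j `<=` B) -> \sum_(j < J) gpr (A j) <= gpr B.
Proof.
move=> mA; elim: J B => [|J IH] B mB dis sub; first by rewrite big_ord0 gpr_ge0.
rewrite big_ord_recr /=.
have mD : measurable (B `\` A J) by exact: measurableD.
have -> : gpr B = gpr (B `\` A J) + gpr (A J).
  apply: EFin_inj; rewrite EFinD -!gprE // -measureU //.
    by congr (gpow D _); rewrite setUC setDUK //; apply: sub.
  by rewrite setDE -setIA setICl setI0.
rewrite lerD2r; apply: IH => //.
  by move=> j j' z /andP[jj' j'J]; apply: dis; rewrite jj' ltnW.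
move=> j jJ z Ajz; split; first by apply: (sub j) => //; exact: ltnW.
by apply: (dis j J) => //; rewrite jJ /=.
Qed.

Notation Gam t := (gpr [set z : D.-tuple RM | N (nth 0 (tval z)) <= t]).

Let mGam (t : R) : measurable [set z : D.-tuple RM | N (nth 0 (tval z)) <= t].
Proof. by apply: measurable_set_le; apply: measurable_Nrm => j; exact: measurable_nth. Qed.

Let Gam_mono (t t' : R) : t <= t' -> Gam t <= Gam t'.
Proof. by move=> tt'; apply: gpr_mono => // z /= h; exact: le_trans tt'. Qed.

Variables (c1 k w : R).
Hypotheses (c10 : 0 < c1) (k0 : 0 <= k) (w0 : 0 <= w) (m00 : (0 < m0)%N).
Hypothesis small : forall t : R, 0 <= t -> Gam t <= c1 * t.
Hypothesis tiny : 0 < k -> Gam (4 * k) <= w.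
Hypothesis tailk : gpr [set z : D.-tuple RM | ~ (N (htail (nth 0 (tval z))) <= k)] <= w.

(** Scaling up the first [m0] coordinates by [1 + j * eta] pushes the layer outwards, so
    the rescaled layers are disjoint, while each keeps a fixed share of its probability. *)
Lemma layer_prob (u h : R) : 0 < h -> h <= u -> 2 * k <= u -> 4 * h * m0%:R <= u ->
  gpr (layer u h k 1) <= 84 * c1 * m0%:R * h.
Proof.
move=> h0 hu ku hm.
have u0 : 0 < u by exact: lt_le_trans hu.
have m1 : 1 <= m0%:R :> R by rewrite ler1n.
have mp : 0 < m0%:R :> R by rewrite ltr0n.
pose eta := 4 * h / u.
have eta0 : 0 < eta by rewrite divr_gt0 // mulr_gt0.
pose X := (eta * m0%:R)^-1.
have X1 : 1 <= X.
  rewrite /X invf_ge1; last exact: mulr_gt0.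
  by rewrite /eta -mulrA [_^-1 * _]mulrC mulrA ler_pdivrMr // mul1r.
have X0 : 0 <= X by exact: le_trans X1.
pose J := Num.truncn X.
have /andP[JX XJ] : J%:R <= X < J.+1%:R by exact: truncn_itv.
have J1 : (0 < J)%N by rewrite truncn_gt0.
have JX2 : X <= 2 * J%:R.
  by apply: (le_trans (ltW XJ)); rewrite -natrM ler_nat mul2n -addnn -addn1 leq_add2l.
pose s (j : nat) : R := j%:R * eta.
have s0 j : 0 <= s j by rewrite mulr_ge0 // ltW.
have sJ j : (j < J)%N -> s j <= m0%:R^-1.
  move=> jJ; rewrite /s; apply: (@le_trans _ _ (X * eta)).
    by rewrite ler_pM2r //; apply: le_trans JX; rewrite ler_nat ltnW.
  by rewrite /X invfM -mulrA [_^-1 * eta]mulrC mulrA mulVf ?mul1r // gt_eqF.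
have e72 : forall j, (j < J)%N -> (1 + s j) ^+ m0 <= 7 / 2.
  move=> j jJ; apply: (@le_trans _ _ (expR (s j) ^+ m0)).
    rewrite ler_pXn2r ?nnegrE ?expR_ge0 ?addr_ge0 //; exact: expR_ge1Dx.
  rewrite -expRM_natl; apply: (@le_trans _ _ (expR 1)).
    rewrite ler_expR; apply: (@le_trans _ _ (m0%:R * m0%:R^-1)); last by rewrite mulfV // gt_eqF.
    by rewrite ler_pM2l // sJ.
  by have := @expR_le_cubic R 1; rewrite normr1 !expr1n => /(_ (lexx _)); lra.
have B (j : nat) : layer u h k (1 + s j) `<=` [set z : D.-tuple RM | N (nth 0 (tval z)) <= 3 * u].
  move=> z /= [_ h2 h3]; have s1 : 1 <= 1 + s j by rewrite lerDl.
  by apply: (le_trans (Nrm_hscal_le (nth 0 (tval z)) s1)); lra.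
have dis (j j' : nat) z : (j < j' < J)%N -> layer u h k (1 + s j) z -> ~ layer u h k (1 + s j') z.
  move=> /andP[jj' j'J] [h1 h2 h3] [h4 h5 _]; move: h5; apply/negP; rewrite -ltNge.
  have s10 : 0 < 1 + s j by rewrite ltr_wpDr.
  have ss : 1 + s j <= 1 + s j' by rewrite lerD2l /s ler_pM2r // ler_nat ltnW.
  apply: lt_le_trans (Nrm_hscal_grow (nth 0 (tval z)) s10 ss).
  have g1 : eta / 2 <= (1 + s j' - (1 + s j)) / (1 + s j).
    rewrite ler_pdivlMr //; apply: (@le_trans _ _ eta).
      rewrite mulrAC -mulrA ler_piMr ?(ltW eta0) // ler_pdivrMr // mul1r.
      have := sJ j (ltn_trans jj' j'J).
      have : m0%:R^-1 <= 1 :> R by rewrite invf_le1.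
      lra.
    rewrite opprD addrACA subrr add0r /s -mulrBl ler_peMl ?(ltW eta0) //.
    by rewrite lerBrDr addrC natr1 ler_nat.
  have g2 : u / 2 < N (hscal (1 + s j) (nth 0 (tval z))) - N (htail (nth 0 (tval z))) by lra.
  have g3 : h = eta / 2 * (u / 2) by rewrite /eta; field; rewrite gt_eqF.
  rewrite {1}g3; apply: ltr_leD => //.
  have p1 : 0 <= eta / 2 by apply: divr_ge0 => //; exact: ltW.
  have p2 : 0 <= u / 2 by apply: divr_ge0 => //; exact: ltW.
  exact: (ler_pM p1 p2 g1 (ltW g2)).
have sum1 : \sum_(j < J) gpr (layer u h k (1 + s j)) <= 3 * c1 * u.
  apply: (@le_trans _ _ (Gam (3 * u))).
    apply: (@gpr_disjoint_sum J (fun j => layer u h k (1 + s j))) => //.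
    by move=> j; exact: measurable_layer.
  rewrite (_ : 3 * c1 * u = c1 * (3 * u)); last by ring.
  by apply: small; rewrite mulr_ge0 // ltW.
have sum2 : J%:R * gpr (layer u h k 1) <= 7 / 2 * (3 * c1 * u).
  apply: (@le_trans _ _ (\sum_(j < J) (7 / 2 * gpr (layer u h k (1 + s j))))).
    rewrite -[J in J%:R]card_ord -sumr_const mulr_suml; apply: ler_sum => j _; rewrite mul1r.
    apply: (le_trans (layer_scale u h k (s0 j))); apply: ler_wpM2r; first exact: gpr_ge0.
    exact: e72.
  by rewrite -mulr_sumr ler_pM2l.
have JX3 : u / (8 * h * m0%:R) <= J%:R.
  move: JX2; rewrite /X /eta (_ : (4 * h / u * m0%:R)^-1 = 2 * (u / (8 * h * m0%:R))).
    by rewrite ler_pM2l.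
  by field; rewrite !gt_eqF.
have L0 : 0 <= gpr (layer u h k 1) by exact: gpr_ge0.
have : u / (8 * h * m0%:R) * gpr (layer u h k 1) <= 7 / 2 * (3 * c1 * u).
  by apply: le_trans sum2; rewrite ler_wpM2r.
rewrite mulrAC ler_pdivrMr ?mulr_gt0 //.
rewrite (_ : 7 / 2 * (3 * c1 * u) * (8 * h * m0%:R) = u * (84 * c1 * m0%:R * h)); last by field.
by rewrite ler_pM2l.
Qed.

Theorem Gam_modulus (u h : R) : 0 <= h -> Gam (u + h) <= Gam u + 84 * c1 * m0%:R * h + w.
Proof.
rewrite le_eqVlt => /orP[/eqP <-|h0].
  by rewrite !addr0 mulr0 addr0 lerDl.
have m1 : 1 <= m0%:R :> R by rewrite ler1n.
have G0 t : 0 <= Gam t by exact: gpr_ge0.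
have ch : 0 <= c1 * h by rewrite mulr_ge0 // ltW.
have chm : c1 * h <= c1 * m0%:R * h by rewrite mulrAC ler_peMr.
have fin8 : Gam (u + h) <= 8 * (c1 * m0%:R * h) \/ Gam (u + h) <= w -> Gam (u + h) <= Gam u + 84 * c1 * m0%:R * h + w.
  have := G0 u; rewrite -[84 * c1 * _ * _]mulrA -[84 * c1 * _]mulrA [c1 * (_ * _)]mulrA.
  move=> gu; apply: modulus_arith => //; exact: le_trans ch chm.
have [uh|hu] := leP u h.
  apply: fin8; left; apply: (@le_trans _ _ (Gam (2 * h))); first by apply: Gam_mono; lra.
  apply: (le_trans (small _)); first by rewrite mulr_ge0 // ltW.
  by rewrite mulrCA; lra.
have u0 : 0 < u by exact: lt_trans hu.
have [uk|ku] := ltP u (2 * k).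
  have kp : 0 < k by lra.
  apply: fin8; right; apply: le_trans (tiny kp); apply: Gam_mono; lra.
have [hm|hm] := leP (4 * h * m0%:R) u; last first.
  apply: fin8; left; apply: (@le_trans _ _ (Gam (2 * u))); first by apply: Gam_mono; lra.
  apply: (le_trans (small _)); first by rewrite mulr_ge0 // ltW.
  rewrite (_ : 8 * (c1 * m0%:R * h) = c1 * (2 * (4 * h * m0%:R))); last by ring.
  by rewrite ler_pM2l // ler_pM2l // ltW.
have ml := @measurable_layer u h k 1.
have mt : measurable [set z : D.-tuple RM | ~ (N (htail (nth 0 (tval z))) <= k)].
  apply: (@measurableC _ _ [set z : D.-tuple RM | N (htail (nth 0 (tval z))) <= k]).
  by apply: measurable_set_le; exact: measurable_ht.
have L := layer_prob h0 (ltW hu) ku hm.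
apply: (@le_trans _ _ (Gam u + gpr (layer u h k 1) + gpr [set z : D.-tuple RM | ~ (N (htail (nth 0 (tval z))) <= k)])).
  apply: (@le_trans _ _ (Gam u + gpr (layer u h k 1 `|` [set z : D.-tuple RM | ~ (N (htail (nth 0 (tval z))) <= k)]))).
    apply: gpr_setU => //; first exact: measurableU.
    move=> z /= zuh; have e1 : N (hscal 1 (nth 0 (tval z))) = N (nth 0 (tval z)).
      by apply: eq_Nrm => j _; rewrite /hscal mul1r if_same.
    have [zu|zu] := leP (N (nth 0 (tval z))) u; [by left|right].
    have [zk|zk] := leP (N (htail (nth 0 (tval z)))) k; last first.
      by right.
    by left; split; rewrite ?e1.
  by rewrite -addrA lerD2l; apply: gpr_setU => //; exact: measurableU.
by apply: lerD => //; rewrite lerD2l.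
Qed.
End Anti.

(** * Orthonormalization in a finite probability space *)
Lemma sum_pick (R : realType) (D : nat) (f : nat -> R) j : (j < D)%N ->
  \sum_(i < D) (j == i)%:R * f i = f j.
Proof.
move=> jD; rewrite (bigD1 (Ordinal jD)) //= eqxx mul1r big1 ?addr0 // => i ij.
case: eqP => [e|]; last by rewrite mul0r.
by move: ij; rewrite -val_eqE /= e eqxx.
Qed.

Section GramSchmidt.
Context {R : realType} {I : finType} (q : I -> R) (y : nat -> I -> R).

Definition ip (f g : I -> R) : R := \sum_v q v * (f v * g v).

Lemma ipC f g : ip f g = ip g f.
Proof. by apply: eq_bigr => v _; rewrite [f v * _]mulrC. Qed.

Lemma ip_suml (n : nat) (c : nat -> R) (f : nat -> I -> R) g :
  ip (fun v => \sum_(i < n) c i * f i v) g = \sum_(i < n) c i * ip (f i) g.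
Proof.
rewrite /ip; under [RHS]eq_bigr do rewrite mulr_sumr.
rewrite exchange_big; apply: eq_bigr => v _; rewrite mulr_suml mulr_sumr.
by apply: eq_bigr => i _; ring.
Qed.

Lemma eq_ip f f' g g' : f =1 f' -> g =1 g' -> ip f g = ip f' g'.
Proof. by move=> ff gg; apply: eq_bigr => v _; rewrite ff gg. Qed.

Lemma ip_sumr (n : nat) (c : nat -> R) (f : nat -> I -> R) g :
  ip g (fun v => \sum_(i < n) c i * f i v) = \sum_(i < n) c i * ip g (f i).
Proof. by rewrite ipC ip_suml; apply: eq_bigr => i _; rewrite ipC. Qed.

Lemma ip_sum_orth (D : nat) (xi : nat -> I -> R) (c : nat -> R) j : (j < D)%N ->
  (forall i k, (i < D)%N -> (k < D)%N -> ip (xi i) (xi k) = (i == k)%:R) ->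
  \sum_(i < D) c i * ip (xi i) (xi j) = c j.
Proof.
move=> jD orth; rewrite -[RHS](sum_pick c jD); apply: eq_bigr => i _.
by rewrite orth // mulrC eq_sym.
Qed.

Variable c0 : R.
Hypothesis c00 : 0 < c0.

Lemma gram_schmidt (D : nat) :
  (forall c : nat -> R, c0 * \sum_(j < D) c j ^+ 2 <=
     ip (fun v => \sum_(j < D) c j * y j v) (fun v => \sum_(j < D) c j * y j v)) ->
  exists T : nat -> nat -> R, let xi i v := \sum_(j < D) T i j * y j v in
  [/\ forall i k, (i < D)%N -> (k < D)%N -> ip (xi i) (xi k) = (i == k)%:R,
      forall j v, (j < D)%N -> y j v = \sum_(i < D) ip (y j) (xi i) * xi i v,
      forall j i, (j < i < D)%N -> ip (y j) (xi i) = 0 &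
      forall j, (j < D)%N -> Num.sqrt c0 <= ip (y j) (xi j)].
Proof.
elim: D => [|D IH] pd; first by exists (fun _ _ => 0); split => //= j i; rewrite ltn0 andbF.
case: IH => [c|T /= [orth dec tri diag]].
  have := pd (fun j => if (j < D)%N then c j else 0).
  rewrite big_ord_recr /= ltnn expr0n /= addr0 => h.
  have e : c0 * \sum_(j < D) c j ^+ 2 = c0 * \sum_(i < D) (if (i < D)%N then c i else 0) ^+ 2.
    by congr (_ * _); apply: eq_bigr => i _; rewrite ltn_ord.
  rewrite e; apply: (le_trans h); rewrite le_eqVlt; apply/orP; left; apply/eqP.
  have e2 v : \sum_(j < D.+1) (if (j < D)%N then c j else 0) * y j v = \sum_(j < D) c j * y j v.
    rewrite big_ord_recr /= ltnn mul0r addr0; apply: eq_bigr => i _.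
    by rewrite ltn_ord.
  exact: eq_ip.
pose xi0 i v := \sum_(j < D) T i j * y j v.
rewrite -/xi0 in orth dec tri diag.
pose b i := ip (y D) (xi0 i).
pose r v := y D v - \sum_(i < D) b i * xi0 i v.
pose cc j := if (j < D)%N then - \sum_(i < D) b i * T i j else 1.
have rE v : r v = \sum_(j < D.+1) cc j * y j v.
  rewrite big_ord_recr /= /cc ltnn mul1r addrC /r; congr (_ + _).
  under [RHS]eq_bigr => j _ do rewrite ltn_ord mulNr mulr_suml.
  rewrite sumrN exchange_big /=; congr (- _); apply: eq_bigr => i _.
  by rewrite mulr_sumr; apply: eq_bigr => j _; rewrite mulrA.
have rr : c0 <= ip r r.
  have := pd cc; rewrite big_ord_recr /= {2}/cc ltnn expr1n => h.
  rewrite (eq_ip (f' := fun v => \sum_(j < D.+1) cc j * y j v) (g' := fun v => \sum_(j < D.+1) cc j * y j v)) //.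
  apply: le_trans h; rewrite mulrDr mulr1 lerDr mulr_ge0 ?(ltW c00) //.
  by apply: sumr_ge0 => i _; exact: sqr_ge0.
have r0 : 0 < ip r r by exact: lt_le_trans rr.
pose sr := Num.sqrt (ip r r).
have sr0 : 0 < sr by rewrite sqrtr_gt0.
have sr2 : sr * sr = ip r r by rewrite -expr2 sqr_sqrtr // ltW.
have ipB g : ip g r = ip g (y D) - \sum_(i < D) b i * ip g (xi0 i).
  rewrite -ip_sumr /ip -sumrB; apply: eq_bigr => v _; rewrite /r; ring.
have rxi j : (j < D)%N -> ip (xi0 j) r = 0.
  move=> jD; rewrite ipB ipC -/(b j); under eq_bigr do rewrite ipC.
  by rewrite (ip_sum_orth b jD orth) subrr.
have ry j : (j < D)%N -> ip (y j) r = 0.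
  move=> jD; rewrite (eq_ip (f' := fun v => \sum_(i < D) ip (y j) (xi0 i) * xi0 i v) (g' := r)) //; last by move=> v; exact: dec.
  rewrite (ip_suml D (fun i => ip (y j) (xi0 i)) xi0) big1 // => i _.
  by rewrite rxi // mulr0.
have ryD : ip (y D) r = ip r r.
  rewrite [RHS](ipB r) (ipC r); set S := \sum_(i < D) _.
  suff -> : S = 0 by rewrite subr0.
  by rewrite /S big1 // => i _; rewrite ipC rxi // mulr0.
pose T' i j := if (i < D)%N then (if (j < D)%N then T i j else 0) else cc j / sr.
exists T' => /=.
pose xi i v := \sum_(j < D.+1) T' i j * y j v.
have xiL i v : (i < D)%N -> xi i v = xi0 i v.
  move=> iD; rewrite /xi big_ord_recr /= /T' iD ltnn mul0r addr0; apply: eq_bigr => j _.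
  by rewrite ltn_ord.
have xiD v : xi D v = sr^-1 * r v.
  rewrite /xi rE mulr_sumr; apply: eq_bigr => j _; rewrite /T' ltnn; ring.
have ipZ g : ip g (xi D) = sr^-1 * ip g r.
  rewrite /ip mulr_sumr; apply: eq_bigr => v _; rewrite xiD; ring.
have ipL g i : (i < D)%N -> ip g (xi i) = ip g (xi0 i).
  by move=> iD; apply: eq_ip => // v; exact: xiL.
have DD : ip (xi D) (xi D) = 1.
  rewrite ipZ ipC ipZ -sr2 mulrA -invfM mulVf // mulf_neq0 // gt_eqF //.
have LD i : (i < D)%N -> ip (xi i) (xi D) = 0.
  by move=> iD; rewrite ipZ ipC ipL // ipC rxi // mulr0.
split.
- move=> i k; rewrite !ltnS [(i <= D)%N]leq_eqVlt [(k <= D)%N]leq_eqVlt => /orP[/eqP ->|iD] /orP[/eqP ->|kD].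
  + by rewrite eqxx.
  + by rewrite -/(xi D) -/(xi k) gtn_eqF // ipC LD.
  + by rewrite -/(xi i) -/(xi D) ltn_eqF // LD.
  + by rewrite -orth // -/(xi i) -/(xi k) ipL // ipC ipL // ipC.
- move=> j v; rewrite ltnS leq_eqVlt => jD.
  change (y j v = \sum_(i < D.+1) ip (y j) (xi i) * xi i v).
  move: jD => /orP[/eqP ->|jD]; rewrite big_ord_recr /= ipZ xiD.
    rewrite ryD -sr2 mulKf ?gt_eqF // mulrA mulfV ?gt_eqF // mul1r /r.
    have -> : \sum_(i < D) b i * xi0 i v = \sum_(i < D) ip (y D) (xi i) * xi i v.
      by apply: eq_bigr => i _; rewrite xiL // ipL.
    by rewrite addrC subrK.
  rewrite ry // mulr0 mul0r addr0 dec //; apply: eq_bigr => i _.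
  by rewrite xiL // ipL.
- move=> j i /andP[ji]; rewrite ltnS leq_eqVlt => /orP[/eqP e|iD].
    by rewrite e -/(xi D) ipZ ry ?mulr0 // -e.
  by rewrite -/(xi i) ipL // tri // ji.
- move=> j; rewrite ltnS leq_eqVlt => /orP[/eqP ->|jD].
    by rewrite -/(xi D) ipZ ryD -sr2 mulKf ?gt_eqF // ler_sqrt // ltW.
  by rewrite -/(xi j) ipL // diag.
Qed.
End GramSchmidt.

(** The whitening map of a nondegenerate covariance: [L] is its Cholesky factor and [T]
    the inverse of [L]. *)
Section Whitening.
Context {R : realType} {I : finType} (q : I -> R) (y : nat -> I -> R).
Variables (c0 : R) (D : nat) (C : nat -> nat -> R).

Definition whitening (L T : nat -> nat -> R) :=
  [/\ forall (x : nat -> R) j, (j < D)%N -> \sum_(i < D) L j i * (\sum_(k < D) T i k * x k) = x j,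
      (forall j i, (j < i < D)%N -> L j i = 0) /\
      (forall j, (j < D)%N -> Num.sqrt c0 <= L j j),
      forall j, (j < D)%N -> \sum_(i < D) L j i ^+ 2 = C j j,
      (forall x : nat -> R, \sum_(i < D) (\sum_(k < D) T i k * x k) ^+ 2 <= c0^-1 * \sum_(k < D) x k ^+ 2) &
      forall i k, (i < D)%N -> (k < D)%N ->
        \sum_(j < D) \sum_(l < D) T i j * C j l * T k l = (i == k)%:R].

Hypothesis c00 : 0 < c0.
Hypothesis pd : forall c : nat -> R, c0 * \sum_(j < D) c j ^+ 2 <=
     \sum_(i < D) \sum_(j < D) c i * c j * C i j.
Hypothesis CE : forall i j, (i < D)%N -> (j < D)%N -> C i j = ip q (y i) (y j).

Lemma whitening_exists : exists L T, whitening L T.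
Proof.
have ipS (c c' : nat -> R) : ip q (fun v => \sum_(j < D) c j * y j v) (fun v => \sum_(j < D) c' j * y j v) =
   \sum_(i < D) \sum_(j < D) c i * c' j * C i j.
  rewrite ip_suml; apply: eq_bigr => i _; rewrite ip_sumr mulr_sumr; apply: eq_bigr => j _.
  by rewrite CE // mulrA.
have pd' (c : nat -> R) : c0 * \sum_(j < D) c j ^+ 2 <=
     ip q (fun v => \sum_(j < D) c j * y j v) (fun v => \sum_(j < D) c j * y j v).
  by rewrite ipS.
have [T /= [orth dec tri diag]] := gram_schmidt c00 pd'.
pose xi i v := \sum_(j < D) T i j * y j v.
rewrite -/xi in orth dec tri diag.
pose L j i := ip q (y j) (xi i).
have TT (c : nat -> R) : c0 * \sum_(j < D) (\sum_(i < D) c i * T i j) ^+ 2 <= \sum_(i < D) c i ^+ 2.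
  apply: (le_trans (pd' (fun j => \sum_(i < D) c i * T i j))).
  have e v : \sum_(j < D) (\sum_(i < D) c i * T i j) * y j v = \sum_(i < D) c i * xi i v.
    under eq_bigr do rewrite mulr_suml.
    rewrite exchange_big /=; apply: eq_bigr => i _; rewrite mulr_sumr.
    by apply: eq_bigr => j _; rewrite mulrA.
  rewrite (eq_ip q e e) ip_suml le_eqVlt; apply/orP; left; apply/eqP; apply: eq_bigr => i _.
  rewrite ip_sumr expr2; congr (_ * _); under eq_bigr do rewrite ipC.
  exact: ip_sum_orth.
exists L, T; split => //.
- (* linear independence of the [y j] turns the expansion into [L T = 1] *)
  move=> x j jD.
  pose M k := \sum_(i < D) L j i * T i k - (j == k)%:R.
  have M0 v : \sum_(k < D) M k * y k v = 0.
    under eq_bigr do rewrite mulrBl mulr_suml.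
    rewrite sumrB exchange_big /= (sum_pick (fun k => y k v) jD).
    have -> : \sum_(i < D) \sum_(j0 < D) L j i * T i j0 * y j0 v = y j v.
      rewrite [RHS]dec //; apply: eq_bigr => i _; rewrite mulr_sumr.
      by apply: eq_bigr => k _; rewrite mulrA.
    by rewrite subrr.
  have : c0 * \sum_(k < D) M k ^+ 2 <= 0.
    apply: (le_trans (pd' M)); rewrite /ip big1 // => v _.
    by rewrite M0 !mul0r mulr0.
  rewrite pmulr_rle0 // => S0.
  have Mk (k : 'I_D) : M k = 0.
    have : \sum_(k < D) M k ^+ 2 = 0.
      by apply/eqP; rewrite eq_le S0 sumr_ge0 // => i _; exact: sqr_ge0.
    move/psumr_eq0P => /(_ (fun i _ => sqr_ge0 _)) /(_ k isT) /eqP.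
    by rewrite sqrf_eq0 => /eqP.
  under eq_bigr do rewrite mulr_sumr.
  rewrite exchange_big /= (eq_bigr (fun k : 'I_D => (j == k)%:R * x k)).
    exact: sum_pick.
  move=> k _; have /eqP := Mk k; rewrite subr_eq0 => /eqP <-.
  by rewrite mulr_suml; apply: eq_bigr => i _; rewrite mulrA.
- move=> j jD; rewrite CE //.
  rewrite [RHS](eq_ip q (f' := fun v => \sum_(i < D) L j i * xi i v) (g' := y j)) //; last by move=> v; exact: dec.
  by rewrite ip_suml; apply: eq_bigr => i _; rewrite expr2 ipC.
- move=> x; pose c i := \sum_(k < D) T i k * x k.
  have e : \sum_(i < D) c i ^+ 2 = \sum_(j < D) (\sum_(i < D) c i * T i j) * x j.
    under [RHS]eq_bigr do rewrite mulr_suml.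
    rewrite exchange_big /=; apply: eq_bigr => i _; rewrite expr2 {2}/c mulr_sumr.
    by apply: eq_bigr => k _; rewrite mulrA.
  have h := TT c.
  have h2 : 2 * \sum_(i < D) c i ^+ 2 <= c0 * \sum_(j < D) (\sum_(i < D) c i * T i j) ^+ 2 + c0^-1 * \sum_(k < D) x k ^+ 2.
    rewrite e !mulr_sumr -big_split /=; apply: ler_sum => j _.
    set z := \sum_(i < D) _; have := mulr_ge0 (ltW c00) (sqr_ge0 (z - c0^-1 * x j)).
    rewrite (_ : c0 * (z - c0^-1 * x j) ^+ 2 = c0 * z ^+ 2 + c0^-1 * x j ^+ 2 - 2 * (z * x j)).
      by rewrite subr_ge0.
    by field; rewrite gt_eqF.
  rewrite -/(c _) in h h2 *; move: h h2; rewrite mulr_natl mulr2n; move=> h h2.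
  have := le_trans h2 (lerD h (lexx _)); by rewrite lerD2l.
- move=> i k iD kD; rewrite -orth // /xi ipS; apply: eq_bigr => j _; apply: eq_bigr => l _.
  by rewrite [_ * T k l]mulrAC.
Qed.
End Whitening.

(** Whitening contracts both the mean and the covariance error of any other law, up to a
    power of the nondegeneracy constant. *)
Section WhitenLaw.
Context {R : realType} (c0 : R) (D : nat) (C L T : nat -> nat -> R).
Hypothesis c00 : 0 < c0.
Hypothesis wh : whitening c0 D C L T.
Context {I : finType} (q : I -> R) (y : I -> nat -> R).

Definition wht (x : nat -> R) : nat -> R := fun i => \sum_(k < D) T i k * x k.

Lemma wht_mean : \sum_(i < D) (\sum_v q v * wht (y v) i) ^+ 2 <=
  c0^-1 * \sum_(k < D) (\sum_v q v * y v k) ^+ 2.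
Proof.
have [_ _ _ contr _] := wh.
apply: le_trans (contr (fun k => \sum_v q v * y v k)).
rewrite le_eqVlt; apply/orP; left; apply/eqP; apply: eq_bigr => i _; congr (_ ^+ 2).
under eq_bigr do rewrite /wht mulr_sumr.
rewrite exchange_big /=; apply: eq_bigr => k _; rewrite mulr_sumr.
by apply: eq_bigr => v _; rewrite mulrCA.
Qed.

Lemma wht_cov (delta : R) : 0 <= delta ->
  (forall i j, (i < D)%N -> (j < D)%N -> `|\sum_v q v * (y v i * y v j) - C i j| <= delta) ->
  \sum_(i < D) \sum_(j < D) (\sum_v q v * (wht (y v) i * wht (y v) j) - (i == j)%:R) ^+ 2 <=
   (D%:R * delta / c0) ^+ 2.
Proof.
move=> d0 hd; have [_ _ _ contr norm] := wh.
pose S i j := \sum_v q v * (y v i * y v j).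
pose M i j := S i j - C i j.
have E (i j : 'I_D) : \sum_v q v * (wht (y v) i * wht (y v) j) - (i == j)%:R =
   \sum_(l < D) T j l * (\sum_(k < D) T i k * M k l).
  have e1 : \sum_v q v * (wht (y v) i * wht (y v) j) = \sum_(l < D) T j l * (\sum_(k < D) T i k * S k l).
    transitivity (\sum_v \sum_(l < D) \sum_(k < D) T j l * (T i k * (q v * (y v k * y v l)))).
      apply: eq_bigr => v _; rewrite /wht big_distrlr exchange_big /= mulr_sumr.
      apply: eq_bigr => l _; rewrite mulr_sumr; apply: eq_bigr => k _; ring.
    rewrite exchange_big /=; apply: eq_bigr => l _; rewrite exchange_big mulr_sumr.
    by apply: eq_bigr => k _; rewrite /S !mulr_sumr.
  have e2 : (i == j)%:R = \sum_(l < D) T j l * (\sum_(k < D) T i k * C k l).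
    rewrite -val_eqE /= -norm // exchange_big /=; apply: eq_bigr => l _; rewrite mulr_sumr.
    by apply: eq_bigr => k _; rewrite mulrC.
  rewrite e1 e2 -sumrB; apply: eq_bigr => l _; rewrite -mulrBr -sumrB; congr (_ * _).
  by apply: eq_bigr => k _; rewrite -mulrBr.
have ic0 : 0 <= c0^-1 by rewrite invr_ge0 ltW.
apply: (@le_trans _ _ (\sum_(i < D) c0^-1 * \sum_(l < D) (\sum_(k < D) T i k * M k l) ^+ 2)).
  apply: ler_sum => i _; under eq_bigr do rewrite E.
  exact: (contr (fun l => \sum_(k < D) T i k * M k l)).
rewrite -mulr_sumr exchange_big /=.
apply: (@le_trans _ _ (c0^-1 * \sum_(l < D) (c0^-1 * \sum_(k < D) M k l ^+ 2))).
  by apply: ler_wpM2l => //; apply: ler_sum => l _; exact: (contr (fun k => M k l)).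
apply: (@le_trans _ _ (c0^-1 * \sum_(l < D) (c0^-1 * (D%:R * delta ^+ 2)))).
  apply: ler_wpM2l => //; apply: ler_sum => l _; apply: ler_wpM2l => //.
  apply: (@le_trans _ _ (\sum_(k < D) delta ^+ 2)); last by rewrite sumr_const card_ord mulr_natl.
  apply: ler_sum => k _; rewrite -[M k l ^+ 2]ger0_norm ?sqr_ge0 // normrX.
  by rewrite ler_pXn2r ?nnegrE ?hd.
rewrite sumr_const card_ord -mulr_natl le_eqVlt; apply/orP; left; apply/eqP; field.
by rewrite gt_eqF.
Qed.
End WhitenLaw.

(** * Moment inequalities *)
Section Moments.
Context {R : realType}.

Lemma mixed_power_le (s y : R) (p i : nat) : (i <= 2 * p)%N ->
  `|s ^+ (2 * p - i) * y ^+ i.+2| <= s ^+ (2 * p) * y ^+ 2 + y ^+ (2 * p).+2.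
Proof.
move=> ip; have e k (z : R) : z ^+ (2 * k) = `|z| ^+ (2 * k) by rewrite -normrX ger0_norm // exprM exprn_ge0 ?sqr_ge0.
have e2 : y ^+ 2 = `|y| ^+ 2 by rewrite -normrX ger0_norm // sqr_ge0.
rewrite -[(2 * p).+2](_ : (2 * p.+1)%N = _); last by rewrite mulnS.
rewrite normrM !normrX (e p s) (e p.+1 y) e2.
have [ys|sy] := leP `|y| `|s|.
  apply: (@le_trans _ _ (`|s| ^+ (2 * p) * `|y| ^+ 2)); last by rewrite lerDl exprn_ge0.
  rewrite -[i.+2]addn2 exprD mulrA ler_wpM2r ?exprn_ge0 //.
  rewrite -[in leRHS](subnK ip) exprD ler_wpM2l ?exprn_ge0 //.
  by rewrite lerXn2r ?nnegrE.
apply: (@le_trans _ _ (`|y| ^+ (2 * p.+1))); last by rewrite lerDr mulr_ge0 ?exprn_ge0.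
rewrite (_ : (2 * p.+1 = (2 * p - i) + i.+2)%N); last by rewrite mulnS; lia.
rewrite exprD ler_wpM2r ?exprn_ge0 //.
by rewrite lerXn2r ?nnegrE // ltW.
Qed.

Lemma power_step (s y : R) (p : nat) :
  (s + y) ^+ (2 * p.+1) <= s ^+ (2 * p.+1) + (2 * p.+1)%:R * (s ^+ (2 * p).+1 * y) +
     4 ^+ p.+1 * (s ^+ (2 * p) * y ^+ 2 + y ^+ (2 * p.+1)).
Proof.
have E : (2 * p.+1 = (2 * p).+2)%N by rewrite mulnS.
rewrite E exprDn 2!big_ord_recl /= addrA; apply: lerD.
  by rewrite subn0 bin0 bin1 subn1 /= expr0 mulr1 expr1 mulr1n -[X in _ + X <= _]mulr_natl lexx.
set X := s ^+ (2 * p) * _ + _.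
have ev k (z : R) : 0 <= z ^+ (2 * k) by rewrite exprM exprn_ge0 ?sqr_ge0.
have X0 : 0 <= X by rewrite /X -E; apply: addr_ge0 => //; apply: mulr_ge0 => //; exact: sqr_ge0.
apply: (@le_trans _ _ (\sum_(i < (2 * p).+1) X *+ 'C((2 * p).+2, i.+2))).
  apply: ler_sum => i _; rewrite /bump /= !add1n subSS subSS.
  rewrite lerMn2r; apply/orP; right; apply: (le_trans (ler_norm _)).
  by apply: mixed_power_le; rewrite -ltnS.
rewrite sumrMnr -[X *+ _]mulr_natl; apply: ler_wpM2r => //.
have -> : 4 ^+ p.+1 = (2 ^ (2 * p).+2)%:R :> R.
  by rewrite -E expnM natrX.
rewrite ler_nat; have := Pascal 1 1 (2 * p).+2; rewrite -[(1 + 1)%N]/2%N => ->.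
rewrite 2!big_ord_recl /= addnA; apply: leq_trans (leq_addl _ _).
by apply: leq_sum => i _; rewrite /bump /= !add1n !exp1n !muln1.
Qed.

Lemma chebyshev_pow (I : finType) (w a : I -> R) (k : nat) :
  (forall v, 0 <= w v) -> (forall v, 0 <= a v) ->
  (\sum_v w v * a v) * (\sum_v w v * a v ^+ k) <= (\sum_v w v) * (\sum_v w v * a v ^+ k.+1).
Proof.
move=> w0 a0; rewrite -subr_ge0 -(pmulr_rge0 _ (ltr0n _ 2)).
suff -> : 2%:R * ((\sum_v w v) * (\sum_v w v * a v ^+ k.+1) - (\sum_v w v * a v) * (\sum_v w v * a v ^+ k)) =
   \sum_v \sum_u w v * w u * ((a v - a u) * (a v ^+ k - a u ^+ k)).
  apply: sumr_ge0 => v _; apply: sumr_ge0 => u _; apply: mulr_ge0; first exact: mulr_ge0.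
  have [h|h] := leP (a u) (a v).
    by rewrite mulr_ge0 ?subr_ge0 // lerXn2r ?nnegrE.
  by rewrite mulr_le0 ?subr_le0 ?(ltW h) // lerXn2r ?nnegrE // ltW.
have P (f g : I -> R) : (\sum_v f v) * (\sum_v g v) = \sum_v \sum_u f v * g u.
  by rewrite mulr_suml; apply: eq_bigr => v _; rewrite mulr_sumr.
rewrite mulr_natl mulr2n.
transitivity ((\sum_v \sum_u w v * (w u * a u ^+ k.+1)) - (\sum_v \sum_u w v * a v * (w u * a u ^+ k)) +
   ((\sum_u \sum_v w v * (w u * a u ^+ k.+1)) - (\sum_u \sum_v w v * a v * (w u * a u ^+ k)))).
  by rewrite [X in _ = _ + (X - _)]exchange_big [X in _ = _ + (_ - X)]exchange_big -!P.
rewrite -!sumrB -big_split /=; apply: eq_bigr => v _; rewrite -!sumrB -big_split /=.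
by apply: eq_bigr => u _; rewrite !exprS; ring.
Qed.

Lemma jensen_pow (I : finType) (w a : I -> R) (p : nat) :
  (forall v, 0 <= w v) -> (forall v, 0 <= a v) ->
  (\sum_v w v * a v) ^+ p.+1 <= (\sum_v w v) ^+ p * (\sum_v w v * a v ^+ p.+1).
Proof.
move=> w0 a0; have W0 : 0 <= \sum_v w v by exact: sumr_ge0.
have S0 k : 0 <= \sum_v w v * a v ^+ k by apply: sumr_ge0 => v _; rewrite mulr_ge0 ?exprn_ge0.
have S1 : 0 <= \sum_v w v * a v by have := S0 1%N.
elim: p => [|p IH]; first by rewrite expr0 mul1r expr1.
rewrite exprS; apply: (le_trans (ler_wpM2l S1 IH)).
rewrite mulrCA [in leRHS]exprSr -mulrA; apply: ler_wpM2l; first exact: exprn_ge0.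
exact: chebyshev_pow.
Qed.

Lemma addr_pow_even (x z : R) (p : nat) : (x + z) ^+ (2 * p) <= 4 ^+ p * (x ^+ (2 * p) + z ^+ (2 * p)).
Proof.
rewrite !exprM.
have h : (x + z) ^+ 2 <= 4 * Num.max (x ^+ 2) (z ^+ 2).
  have : 0 <= (x - z) ^+ 2 by exact: sqr_ge0.
  rewrite (_ : (x - z) ^+ 2 = 2 * x ^+ 2 + 2 * z ^+ 2 - (x + z) ^+ 2); last by ring.
  by case: (leP (x ^+ 2) (z ^+ 2)); lra.
apply: (@le_trans _ _ ((4 * Num.max (x ^+ 2) (z ^+ 2)) ^+ p)).
  by rewrite lerXn2r ?nnegrE ?sqr_ge0 // mulr_ge0 // le_max sqr_ge0.
rewrite exprMn ler_wpM2l ?exprn_ge0 //.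
by case: (leP (x ^+ 2) (z ^+ 2)) => _; rewrite ?lerDl ?lerDr exprn_ge0 ?sqr_ge0.
Qed.

Fixpoint rosc (p : nat) : R := if p is p'.+1 then 4 ^+ p * (rosc p' + 1) else 1.

Lemma rosc_ge0 p : 0 <= rosc p.
Proof. by elim: p => //= p IH; rewrite mulr_ge0 ?exprn_ge0 // addr_ge0. Qed.

(** Raising the exponent by one exchanges a factor [n] against a second moment, which is
    absorbed into the top moment by Chebyshev's association inequality. *)
Lemma En_moment (I : finType) (q : I -> R) (f : I -> R) (p n : nat) :
  (forall v, 0 <= q v) -> \sum_v q v = 1 -> \sum_v q v * f v = 0 ->
  En q n (fun s => (\sum_(v <- s) f v) ^+ (2 * p)) <= rosc p * n%:R ^+ p * \sum_v q v * f v ^+ (2 * p).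
Proof.
move=> q0 q1 f0; pose mom k := \sum_v q v * f v ^+ (2 * k).
have mom0 k : 0 <= mom k by apply: sumr_ge0 => v _; rewrite mulr_ge0 // exprM exprn_ge0 // sqr_ge0.
elim: p n => [|p IH] n.
  under eq_En do rewrite muln0 expr0; rewrite En_cst //= muln0; under eq_bigr do rewrite expr0 mulr1.
  by rewrite q1 !mulr1.
have cheb : mom 1%N * mom p <= mom p.+1.
  have := @chebyshev_pow I q (fun v => f v ^+ 2) p q0 (fun v => sqr_ge0 _).
  rewrite q1 mul1r; under [X in _ * X <= _]eq_bigr do rewrite -exprM.
  by under [X in _ <= X]eq_bigr do rewrite -exprM.
have := rosc_ge0 p => r0.
elim: n => [|n IHn].
  by rewrite /= big_nil expr0n muln_eq0 /= expr0n mulr0 mul0r.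
rewrite EnS //.
have step s : \sum_v q v * (\sum_(u <- v :: s) f u) ^+ (2 * p.+1) <=
   (\sum_(u <- s) f u) ^+ (2 * p.+1) + 4 ^+ p.+1 * (mom 1%N * (\sum_(u <- s) f u) ^+ (2 * p) + mom p.+1).
  set S := \sum_(u <- s) f u.
  apply: (@le_trans _ _ (\sum_v q v * (S ^+ (2 * p.+1) + (2 * p.+1)%:R * (S ^+ (2 * p).+1 * f v) +
     4 ^+ p.+1 * (S ^+ (2 * p) * f v ^+ 2 + f v ^+ (2 * p.+1))))).
    apply: ler_sum => v _; apply: ler_wpM2l => //; rewrite big_cons addrC.
    exact: power_step.
  have -> : \sum_v q v * (S ^+ (2 * p.+1) + (2 * p.+1)%:R * (S ^+ (2 * p).+1 * f v) +
     4 ^+ p.+1 * (S ^+ (2 * p) * f v ^+ 2 + f v ^+ (2 * p.+1))) =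
     (\sum_v q v) * S ^+ (2 * p.+1) + (2 * p.+1)%:R * S ^+ (2 * p).+1 * (\sum_v q v * f v) +
     4 ^+ p.+1 * (S ^+ (2 * p) * mom 1%N + mom p.+1).
    rewrite /mom [in RHS]mulrDr mulrA !mulr_sumr mulr_suml -!big_split /=; apply: eq_bigr => v _.
    rewrite -[(2 * 1)%N]/2%N; ring.
  by rewrite q1 f0 mul1r mulr0 addr0 [S ^+ (2 * p) * _]mulrC.
apply: (@le_trans _ _ (En q n (fun s => (\sum_(u <- s) f u) ^+ (2 * p.+1) +
     4 ^+ p.+1 * (mom 1%N * (\sum_(u <- s) f u) ^+ (2 * p) + mom p.+1)))).
  by apply: En_le => // s _; exact: step.
rewrite EnD // EnZ EnD // EnZ En_cst // -/(mom p.+1).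
have n1 : (n%:R : R) <= n.+1%:R by rewrite ler_nat.
have n1p k : (n%:R : R) ^+ k <= n.+1%:R ^+ k by rewrite lerXn2r ?nnegrE.
have one k : 1 <= (n.+1%:R : R) ^+ k by rewrite exprn_ege1 // ler1n.
apply: (@le_trans _ _ (rosc p.+1 * n%:R ^+ p.+1 * mom p.+1 + 4 ^+ p.+1 * ((rosc p + 1) * n.+1%:R ^+ p * mom p.+1))).
  apply: lerD => //; apply: ler_wpM2l; first exact: exprn_ge0.
  rewrite -mulrA mulrDl mul1r; apply: lerD; last by apply: ler_peMl.
  apply: (@le_trans _ _ (mom 1%N * (rosc p * n%:R ^+ p * mom p))).
    by apply: ler_wpM2l.
  rewrite (_ : mom 1%N * _ = rosc p * (n%:R ^+ p * (mom 1%N * mom p))); last by ring.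
  by apply: ler_wpM2l => //; apply: ler_pM => //; rewrite ?exprn_ge0 // mulr_ge0.
rewrite mulrA [4 ^+ _ * _]mulrA -/(rosc p.+1) -mulrDl; apply: ler_wpM2r => //.
rewrite -mulrDr; apply: ler_wpM2l; first exact: (rosc_ge0 p.+1).
rewrite !exprS (_ : n.+1%:R * _ = n%:R * n.+1%:R ^+ p + n.+1%:R ^+ p :> R).
  by rewrite lerD2r ler_wpM2l.
by rewrite -natr1; ring.
Qed.
End Moments.

(** * Whitened Gaussian seminorms *)
Section WhiteGauss.
Context {R : realType}.
Notation RM := (measurableTypeR R).
Variables (l : nat -> nat -> R) (m D : nat) (C L T : nat -> nat -> R) (c0 : R).
Hypothesis c00 : 0 < c0.
Hypothesis wh : whitening c0 D C L T.

Definition Lmap (x : nat -> R) : nat -> R := fun j => \sum_(k < D) L j k * x k.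
Definition whl : nat -> nat -> R := fun i k => \sum_(j < D) l i j * L j k.

Lemma Nrm_whl x : Nrm whl m D x = Nrm l m D (Lmap x).
Proof.
apply: eq_bigr => i _; congr `|_|; rewrite /whl /Lmap.
under eq_bigr do rewrite mulr_suml.
rewrite exchange_big /=; apply: eq_bigr => j _; rewrite mulr_sumr.
by apply: eq_bigr => k _; rewrite mulrA.
Qed.

Lemma Nrm_whl_wht x : Nrm whl m D (wht D T x) = Nrm l m D x.
Proof.
have [inv _ _ _ _] := wh.
by rewrite Nrm_whl; apply: eq_Nrm => j jD; rewrite /Lmap /wht inv.
Qed.

Variables (w : nat -> R) (C2 : R).
Hypothesis w0 : forall j, 0 <= w j.
Hypothesis Nw : forall x, Nrm l m D x ^+ 2 <= \sum_(j < D) w j * x j ^+ 2.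
Hypothesis C2P : forall j, (j < D)%N -> C j j <= C2.

Definition gmom (p : nat) : R := (2 * p)`!%:R * (2 * expR (2^-1 * C2)).

Lemma gmom_ge0 p : 0 <= gmom p.
Proof. by rewrite /gmom mulr_ge0 // mulr_ge0 // expR_ge0. Qed.

Lemma whl_tail (m0 p : nat) (k : R) : 0 < k ->
  gpr [set z : D.-tuple RM | ~ (Nrm whl m D (htail m0 (nth 0 (tval z))) <= k)] <=
  (\sum_(j < D) (if (j < m0)%N then 0 else w j)) ^+ p.+1 * gmom p.+1 / k ^+ (2 * p.+1).
Proof.
move=> k0; have [_ [tri _] rowC _ _] := wh.
pose wt j := if (j < m0)%N then 0 else w j.
have wt0 j : 0 <= wt j by rewrite /wt; case: ifP.
rewrite -[\sum_(j < D) _]/(\sum_(j < D) wt j); set W := \sum_(j < D) wt j.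
have W0 : 0 <= W by apply: sumr_ge0 => j _; exact: wt0.
pose V (z : D.-tuple RM) j := Lmap (htail m0 (nth 0 (tval z))) j.
have VE z j : V z j = \sum_(i < D) (if (i < m0)%N then 0 else L j i) * nth 0 (tval z) i.
  by apply: eq_bigr => i _; rewrite /htail; case: ifP; rewrite ?mulr0 ?mul0r.
have V0 z j : (j < D)%N -> (j < m0)%N -> V z j = 0.
  move=> jD jm; rewrite VE big1 // => i _; case: ltnP => mi; first by rewrite mul0r.
  by rewrite tri ?mul0r // (leq_trans jm mi) /=.
pose f (z : D.-tuple RM) := W ^+ p * \sum_(j < D) wt j * V z j ^+ (2 * p.+1).
have fE z : f z = \sum_(j < D) (W ^+ p * wt j) * V z j ^+ (2 * p.+1).
  by rewrite /f mulr_sumr; apply: eq_bigr => j _; rewrite mulrA.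
have ev (x : R) q : 0 <= x ^+ (2 * q) by rewrite exprM exprn_ge0 // sqr_ge0.
have Nf z : Nrm whl m D (htail m0 (nth 0 (tval z))) ^+ (2 * p.+1) <= f z.
  rewrite exprM Nrm_whl -/(V z).
  apply: (@le_trans _ _ ((\sum_(j < D) wt j * V z j ^+ 2) ^+ p.+1)).
    rewrite lerXn2r ?nnegrE ?sqr_ge0 //.
      by apply: sumr_ge0 => j _; rewrite mulr_ge0 // sqr_ge0.
    apply: (le_trans (Nw _)); apply: ler_sum => j _; rewrite /wt; case: ifP => // jm.
    by rewrite -/(V z j) V0 // expr0n mulr0 mul0r.
  apply: (le_trans (@jensen_pow R _ (fun j : 'I_D => wt j) (fun j => V z j ^+ 2) p _ _)) => //.
    by move=> j; exact: sqr_ge0.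
  rewrite /f le_eqVlt; apply/orP; left; apply/eqP; congr (_ * _); apply: eq_bigr => j _.
  by rewrite -exprM.
have mV j : measurable_fun setT (fun z => V z j).
  under eq_fun do rewrite VE.
  exact: (measurable_lin (fun i => if (i < m0)%N then 0 else L j i) D).
have mVp j : measurable_fun setT (fun z => V z j ^+ (2 * p.+1)).
  by apply: measurable_funX; exact: mV.
have Vint j : (j < D)%N -> (\int[gpow D]_z (V z j ^+ (2 * p.+1))%:E <= (gmom p.+1)%:E)%E.
  move=> jD; under eq_integral do rewrite VE.
  apply: (le_trans (gpow_moment D (fun i => if (i < m0)%N then 0 else L j i) p.+1)).
  rewrite lee_fin /gmom; apply: ler_wpM2l => //; apply: ler_wpM2l => //.
  rewrite ler_expR; apply: ler_wpM2l => //; apply: le_trans (C2P jD); rewrite -rowC //.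
  by apply: ler_sum => i _; case: ifP => // _; rewrite expr0n /= sqr_ge0.
have Ww0 j : 0 <= W ^+ p * wt j by rewrite mulr_ge0 // exprn_ge0.
have fint : (\int[gpow D]_z (f z)%:E <= (W ^+ p.+1 * gmom p.+1)%:E)%E.
  under eq_integral do rewrite fE -sumEFin.
  rewrite ge0_integral_sum //; last first.
  - by move=> j z _; rewrite lee_fin; apply: mulr_ge0.
  - move=> j; apply/measurable_EFinP; apply: measurable_funM => //; exact: mVp.
  apply: (@le_trans _ _ (\sum_(j < D) ((W ^+ p * wt j) * gmom p.+1)%:E)%E).
    apply: lee_sum => j _; under eq_integral do rewrite EFinM.
    rewrite ge0_integralZl //.
    - by rewrite [X in (_ <= X)%E]EFinM; apply: lee_wpmul2l; [rewrite lee_fin|exact: Vint].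
    - by apply/measurable_EFinP; exact: mVp.
    - by move=> z _; rewrite lee_fin.
    - by rewrite lee_fin.
  by rewrite sumEFin lee_fin -mulr_suml -mulr_sumr exprSr.
have mf : measurable_fun setT f.
  rewrite (funext fE); apply: measurable_sum => j; apply: measurable_funM => //; exact: mVp.
have mA : measurable [set z : D.-tuple RM | ~ (Nrm whl m D (htail m0 (nth 0 (tval z))) <= k)].
  apply: (@measurableC _ _ [set z : D.-tuple RM | Nrm whl m D (htail m0 (nth 0 (tval z))) <= k]).
  by apply: measurable_set_le; exact: measurable_ht.
rewrite ler_pdivlMr ?exprn_gt0 // -lee_fin; apply: le_trans fint.
set A := [set z | _].
have IE : ((gpr A)%:E = \int[gpow D]_z (\1_A z)%:E)%E by rewrite integral_indic // setIT -gprE.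
rewrite EFinM IE muleC -ge0_integralZl //; last 2 first.
- by apply/measurable_EFinP; exact: measurable_indic.
- by rewrite lee_fin exprn_ge0 // ltW.
apply: ge0_le_integral => //.
- by move=> z _; rewrite -EFinM lee_fin mulr_ge0 // exprn_ge0 // ltW.
- by apply/measurable_EFinP; apply: measurable_funM => //; exact: measurable_indic.
- by apply/measurable_EFinP.
move=> z _; rewrite -EFinM lee_fin indicE; case: (boolP (_ \in _)) => [/set_mem /= h|_]; last first.
  by rewrite mulr0 (le_trans (ev _ _) (Nf z)).
rewrite mulr1; apply: le_trans (Nf z); rewrite lerXn2r ?nnegrE ?Nrm_ge0 ?(ltW k0) //.
by apply/ltW; rewrite ltNge; apply/negP.
Qed.

Lemma whl_small (cN wr : R) (r : nat) (t : R) : (r <= D)%N -> 0 < cN -> 0 < wr -> 0 <= t ->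
  (forall x j, (j < r)%N -> wr * `|x j| <= cN * Nrm l m D x) ->
  gpr [set z : D.-tuple RM | Nrm whl m D (nth 0 (tval z)) <= t] <= (cN / (wr * Num.sqrt c0) * t) ^+ r.
Proof.
move=> rD cN0 wr0 t0 hN; have [_ [tri diag] _ _ _] := wh.
have sc0 : 0 < Num.sqrt c0 by rewrite sqrtr_gt0.
have t1 : 0 <= cN * t / wr by rewrite !mulr_ge0 ?invr_ge0 ?(ltW wr0) ?(ltW cN0).
have := gpow_small_box (fun=> 0) rD sc0 t1 (fun j jr => diag j (leq_trans jr rD)).
rewrite (_ : cN * t / wr / Num.sqrt c0 = cN / (wr * Num.sqrt c0) * t); last first.
  by field; rewrite !gt_eqF.
rewrite -lee_fin; apply: le_trans; rewrite -gprE; last first.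
  by apply: measurable_set_le; apply: measurable_Nrm => j; exact: measurable_nth.
apply: le_measure; rewrite ?inE.
- by apply: measurable_set_le; apply: measurable_Nrm => j; exact: measurable_nth.
- exact: measurable_small_box.
move=> z /=; rewrite Nrm_whl => h j jr; rewrite add0r.
have -> : tri_apply L j (tval z) = Lmap (nth 0 (tval z)) j.
  have jD := leq_trans jr rD.
  rewrite /Lmap /tri_apply (big_ord_widen_cond D (fun=> true) (fun i => L j i * nth 0 (tval z) i) jD).
  rewrite big_mkcond /=; apply: eq_bigr => i _; case: ltnP => // ji.
  by rewrite tri ?mul0r // ji /=.
rewrite ler_pdivlMr // mulrC; apply: (le_trans (hN _ _ jr)).
by rewrite ler_pM2l.
Qed.

End WhiteGauss.

Lemma gsm_center (R : realType) (a : nat -> nat -> R) (m D : nat) (tau t : R) : 0 < tau ->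
  gsm a m D (fun=> 0) tau t = gpr [set z : D.-tuple (measurableTypeR R) | Nrm a m D (nth 0 (tval z)) <= t / tau].
Proof.
move=> t0; congr gpr; apply/funext => z /=; apply/propext.
rewrite ler_pdivlMr // mulrC -[X in X * Nrm _ _ _ _](gtr0_norm t0) -NrmZ.
by rewrite (@eq_Nrm _ a m D (shz (fun=> 0) tau (tval z)) (fun j => tau * nth 0 (tval z) j)) // => j _; rewrite /shz add0r.
Qed.

(** * The head of the series under an arbitrary nearly matching law *)
Section HeadLaw.
Context {R : realType} {I : finType} (q : I -> R) (y : I -> nat -> R).
Notation RM := (measurableTypeR R).
Hypotheses (q0 : forall v, 0 <= q v) (q1 : \sum_v q v = 1).
Variables (l : nat -> nat -> R) (m D : nat) (C L T : nat -> nat -> R) (c0 : R).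
Hypothesis c00 : 0 < c0.
Hypothesis wh : whitening c0 D C L T.

Lemma eq_En_supp n (F G : seq I -> R) :
  (forall s, all (fun v => q v != 0) s -> F s = G s) -> En q n F = En q n G.
Proof.
elim: n F G => [|n IH] F G FG /=; first exact: FG.
apply: eq_bigr => v _; have [->|qv] := eqVneq (q v) 0; first by rewrite !mul0r.
by congr (_ * _); apply: IH => s sq; apply: FG => /=; rewrite qv.
Qed.

Lemma head_clt (bb d0 d1 B rad w mu rho Lam P ell : R) (n : nat) :
  0 <= d0 -> 0 <= d1 ->
  (forall v j, q v != 0 -> (j < D)%N -> `|y v j| <= bb) ->
  (forall j, (j < D)%N -> `|\sum_v q v * y v j| <= d0) ->
  (forall i j, (i < D)%N -> (j < D)%N -> `|\sum_v q v * (y v i * y v j) - C i j| <= d1) ->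
  1 <= B -> D%:R <= B -> c0^-1 * (D%:R * bb ^+ 2) <= B ->
  0 <= mu -> c0^-1 * (D%:R * d0 ^+ 2) <= mu ^+ 2 -> rho = D%:R * d1 / c0 ->
  0 < rad -> 0 < w -> w <= 2^-1 -> 0 <= P ->
  gpr [set z : D.-tuple RM | ~ (Nrm (whl l D L) m D (nth 0 (tval z)) <= rad)] <= w ^+ 2 ->
  (0 < n)%N -> 4 * B <= Lam -> Lam <= n%:R ->
  (forall u h : R, 0 <= h ->
    gpr [set z : D.-tuple RM | Nrm (whl l D L) m D (nth 0 (tval z)) <= u + h] <=
    gpr [set z : D.-tuple RM | Nrm (whl l D L) m D (nth 0 (tval z)) <= u] + P * h + w) ->
  \sum_(i < n) i.+1%:R^-1 <= ell ->
  let K := Num.sqrt (20 * (B * (1 + 2 * rho ^+ 2 + 2 * D%:R))) in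
  ell * (Num.sqrt (2 * n%:R) * mu + rho + K / Num.sqrt Lam) <= 1 ->
  forall t, `|En q n (fun s => (Nrm l m D (vsum y s) <= t)%R%:R)
     - gsm (whl l D L) m D (fun=> 0) (Num.sqrt (Lam + n%:R)) t| <=
  1600 * (rad * P * ell * (Num.sqrt n%:R * mu + 2 * rho + K / Num.sqrt n%:R) + w)
  + P * rad * (Num.sqrt Lam / Num.sqrt n%:R) + 2 * w.
Proof.
move=> d00 d10 yb ym yc B1 DB BB mu0 mud rhoE rad0 w0 w1 P0 tailw n0 BL Ln anti hell K small t.
pose xi v := if q v == 0 then (fun=> 0) else wht D T (y v).
have ic0 : 0 <= c0^-1 by rewrite invr_ge0 ltW.
have [_ _ _ contr _] := wh.
have qxi v j : q v * xi v j = q v * wht D T (y v) j.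
  by rewrite /xi; case: eqP => // ->; rewrite !mul0r.
have qxi2 v i j : q v * (xi v i * xi v j) = q v * (wht D T (y v) i * wht D T (y v) j).
  by rewrite /xi; case: eqP => // ->; rewrite !mul0r.
have rho0 : 0 <= rho by rewrite rhoE !mulr_ge0.
have -> : En q n (fun s => (Nrm l m D (vsum y s) <= t)%R%:R) =
   En q n (fun s => (Nrm (whl l D L) m D (vsum xi s) <= t)%R%:R).
  apply: eq_En_supp => s sq; congr ((_ <= t)%R%:R).
  rewrite -(Nrm_whl_wht l m wh); apply: eq_Nrm => i iD.
  rewrite /wht /vsum; under eq_bigr do rewrite mulr_sumr.
  rewrite exchange_big /=; apply: eq_big_seq => v vs.
  by rewrite /xi (negPf (allP sq _ vs)).
have sn0 : 0 < n%:R :> R by rewrite ltr0n.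
have Lam0 : 0 < Lam by apply: lt_le_trans BL; rewrite mulr_gt0 // (lt_le_trans ltr01).
have tau0 : 0 < Num.sqrt (Lam + n%:R) by rewrite sqrtr_gt0 addr_gt0.
apply: (@norm_clt R I q xi q0 q1 (whl l D L) m D rad w B mu rho Lam P ell n) => //.
- move=> v; rewrite /xi; case: eqP => [_|/eqP qv].
    by rewrite big1 ?(le_trans ler01) // => i _; rewrite expr0n.
  apply: (le_trans (contr _)); apply: le_trans BB; apply: ler_wpM2l => //.
  rewrite mulr_natl -[D in _ *+ D]card_ord -sumr_const; apply: ler_sum => j _.
  rewrite -[y v j ^+ 2]ger0_norm ?sqr_ge0 // normrX lerXn2r ?nnegrE ?yb //.
  by apply: le_trans (yb v j qv _).
- apply: le_trans mud; apply: (@le_trans _ _ (\sum_(i < D) (\sum_v q v * wht D T (y v) i) ^+ 2)).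
    by apply: ler_sum => i _; under eq_bigr do rewrite qxi.
  apply: (le_trans (wht_mean wh q y)); apply: ler_wpM2l => //.
  rewrite mulr_natl -[D in _ *+ D]card_ord -sumr_const; apply: ler_sum => j _.
  by rewrite -[leLHS]ger0_norm ?sqr_ge0 // normrX lerXn2r ?nnegrE ?ym.
- rewrite rhoE; apply: le_trans (wht_cov c00 wh d10 yc).
  apply: ler_sum => i _; apply: ler_sum => j _.
  by under eq_bigr do rewrite qxi2.
- move=> u h h0; rewrite !gsm_center // mulrDl.
  apply: (le_trans (anti (u / Num.sqrt (Lam + n%:R)) (h / Num.sqrt (Lam + n%:R)) _)).
    by rewrite divr_ge0 // ltW.
  rewrite lerD2r lerD2l [leRHS]mulrAC -mulrA; apply: ler_wpM2l => //; apply: ler_wpM2l => //.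
  rewrite lef_pV2 ?posrE //; last by rewrite sqrtr_gt0.
  by apply: ler_wsqrtr; rewrite lerDr ltW.
Qed.
End HeadLaw.

(** * Samples, empirical laws and tails of series *)
Section Samples.
Context {R : realType} {I : finType} (q : I -> R).
Hypotheses (q0 : forall v, 0 <= q v) (q1 : \sum_v q v = 1).

Lemma En_or n (A B : pred (seq I)) :
  En q n (fun s => (A s || B s)%:R) <= En q n (fun s => (A s)%:R) + En q n (fun s => (B s)%:R).
Proof.
by rewrite -EnD //; apply: En_le => // s _; case: (A s); case: (B s) => /=; rewrite ?addr0 ?add0r // lerDl.
Qed.

Lemma En_sub n (A B : pred (seq I)) : (forall s, size s = n -> A s -> B s) ->
  En q n (fun s => (A s)%:R) <= En q n (fun s => (B s)%:R).
Proof.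
move=> AB; apply: En_le => // s sn; case: (boolP (A s)) => [/(AB _ sn) ->|_] //.
Qed.

Lemma En_has n (a : pred I) : En q n (fun s => (has a s)%:R) <= n%:R * \sum_v q v * (a v)%:R.
Proof.
elim: n => [|n IH]; first by rewrite /= mul0r.
apply: (@le_trans _ _ (\sum_v q v * ((a v)%:R + En q n (fun s => (has a s)%:R)))).
  rewrite /=; apply: ler_sum => v _; apply: ler_wpM2l => //.
  rewrite -[X in _ <= X + _](En_cst q1 n) -EnD //; apply: En_le => // s _ /=.
  by case: (a v); case: (has a s) => /=; rewrite ?addr0 ?add0r // lerDl.
under eq_bigr do rewrite mulrDr; rewrite big_split /= -mulr_suml q1 mul1r.
by rewrite -natr1 mulrDl mul1r addrC lerD2r.
Qed.

Lemma En_sum_mean n (f : I -> R) : En q n (fun s => \sum_(v <- s) f v) = n%:R * \sum_v q v * f v.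
Proof.
elim: n => [|n IH]; first by rewrite /= big_nil mul0r.
rewrite EnS //; transitivity (En q n (fun s => \sum_v q v * f v + \sum_(u <- s) f u)).
  apply: eq_En => s _; under eq_bigr do rewrite big_cons mulrDr.
  by rewrite big_split /= -mulr_suml q1 mul1r.
by rewrite EnD // En_cst // IH -natr1 mulrDl mul1r addrC.
Qed.

Lemma En_deviation n p (f : I -> R) (x : R) : 0 < x -> \sum_v q v * f v = 0 ->
  En q n (fun s => (x < `|\sum_(v <- s) f v|)%R%:R) <=
  rosc p * n%:R ^+ p * (\sum_v q v * f v ^+ (2 * p)) / x ^+ (2 * p).
Proof.
move=> x0 f0; have xp : 0 < x ^+ (2 * p) by exact: exprn_gt0.
have ev (z : R) : 0 <= z ^+ (2 * p) by rewrite exprM exprn_ge0 // sqr_ge0.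
apply: (@le_trans _ _ (En q n (fun s => (\sum_(v <- s) f v) ^+ (2 * p)) / x ^+ (2 * p))).
  apply: (@En_markov R I q q0 n (fun s => (\sum_(v <- s) f v) ^+ (2 * p)) (fun s => x < `|\sum_(v <- s) f v|)) => // s xs.
  rewrite -[leRHS]ger0_norm // normrX lerXn2r ?nnegrE //; exact: ltW.
by rewrite ler_pM2r ?invr_gt0 //; exact: En_moment.
Qed.

Lemma En_weighted_moment n p M (wt : nat -> R) (y : I -> nat -> R) :
  (forall j, 0 <= wt j) -> (forall j, (j < M)%N -> \sum_v q v * y v j = 0) ->
  En q n (fun s => (\sum_(j < M) wt j * vsum y s j ^+ 2) ^+ p.+1) <=
  (\sum_(j < M) wt j) ^+ p * (rosc p.+1 * n%:R ^+ p.+1 * \sum_(j < M) wt j * \sum_v q v * y v j ^+ (2 * p.+1)).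
Proof.
move=> wt0 y0; set W := \sum_(j < M) wt j.
have W0 : 0 <= W by apply: sumr_ge0.
apply: (@le_trans _ _ (En q n (fun s => W ^+ p * \sum_(j < M) wt j * vsum y s j ^+ (2 * p.+1)))).
  apply: En_le => // s _.
  apply: (le_trans (@jensen_pow R _ (fun j : 'I_M => wt j) (fun j => vsum y s j ^+ 2) p _ _)) => //.
    by move=> j; exact: sqr_ge0.
  rewrite le_eqVlt; apply/orP; left; apply/eqP; congr (_ * _); apply: eq_bigr => j _.
  by rewrite -exprM.
rewrite EnZ // En_sum //; apply: ler_wpM2l; first exact: exprn_ge0.
rewrite mulr_sumr; apply: ler_sum => j _; rewrite EnZ // mulrCA; apply: ler_wpM2l => //.
by apply: (@En_moment R I q (fun v => y v j) p.+1 n) => //; exact: y0.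
Qed.

Definition emp (s : seq I) (v : I) : R := (count_mem v s)%:R / (size s)%:R.

Lemma emp_ge0 s v : 0 <= emp s v. Proof. by rewrite divr_ge0. Qed.

Lemma emp_mean s (f : I -> R) : \sum_v emp s v * f v = (size s)%:R^-1 * \sum_(u <- s) f u.
Proof.
rewrite /emp; under eq_bigr do rewrite mulrAC mulrC; rewrite -mulr_sumr; congr (_ * _).
elim: s => [|u s IH] /=; first by rewrite big_nil big1 // => v _; rewrite mul0r.
rewrite big_cons -IH; under eq_bigr do rewrite natrD mulrDl.
rewrite big_split /= (bigD1 u) //= eqxx mul1r [X in f u + X + _]big1 ?addr0 // => v vu.
by rewrite eq_sym (negPf vu) mul0r.
Qed.

Lemma emp_sum1 s : (0 < size s)%N -> \sum_v emp s v = 1.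
Proof.
move=> s0; under eq_bigr do rewrite -[emp _ _]mulr1.
by rewrite emp_mean big_const_seq count_predT iter_addr_0 mulVf // pnatr_eq0 -lt0n.
Qed.

Lemma emp_supp s v : emp s v != 0 -> v \in s.
Proof.
by apply: contraNT => vs; rewrite /emp (count_memPn vs) mul0r.
Qed.
End Samples.

(** * Splitting a seminorm into head and tail coordinates *)
Section Split.
Context {R : realType}.
Variables (l : nat -> nat -> R) (m D M : nat).
Hypothesis DM : (D <= M)%N.

Lemma Nrm_head x : Nrm l m M (fun j => if (j < D)%N then x j else 0) = Nrm l m D x.
Proof.
apply: eq_bigr => i _; congr `|_|.
rewrite (big_ord_widen_cond M (fun=> true) (fun j => l i j * x j) DM) [RHS]big_mkcond /=.
by apply: eq_bigr => j _; case: ifP; rewrite ?mulr0.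
Qed.

Lemma Nrm_split x : Nrm l m M x <= Nrm l m D x + Nrm l m M (htail D x).
Proof.
rewrite -[X in X + _]Nrm_head.
rewrite (@eq_Nrm _ l m M x (fun j => (if (j < D)%N then x j else 0) + htail D x j)).
  exact: NrmD.
by move=> j _; rewrite /htail; case: ifP; rewrite ?addr0 ?add0r.
Qed.

Lemma Nrm_split' x : Nrm l m D x <= Nrm l m M x + Nrm l m M (htail D x).
Proof.
rewrite -[X in X <= _]Nrm_head.
have -> : Nrm l m M (htail D x) = Nrm l m M (fun j => (-1) * htail D x j).
  by rewrite NrmZ normrN normr1 mul1r.
rewrite (@eq_Nrm _ l m M _ (fun j => x j + (-1) * htail D x j)); first exact: NrmD.
by move=> j _; rewrite /htail; case: ifP => _; ring.
Qed.

Context {I : finType} (q : I -> R).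
Hypotheses (q0 : forall v, 0 <= q v) (q1 : \sum_v q v = 1).
Variables (n : nat) (V : seq I -> nat -> R) (h eta : R).
Hypothesis tail : En q n (fun s => (h < Nrm l m M (htail D (V s)))%R%:R) <= eta.

Lemma En_split t : En q n (fun s => (Nrm l m M (V s) <= t)%R%:R) <=
  En q n (fun s => (Nrm l m D (V s) <= t + h)%R%:R) + eta.
Proof.
apply: (@le_trans _ _ (En q n (fun s => ((Nrm l m D (V s) <= t + h)%R || (h < Nrm l m M (htail D (V s)))%R)%:R))).
  apply: En_sub => // s _ st; have [//|hs] := ltP h (Nrm l m M (htail D (V s))); first by rewrite orbT.
  by rewrite orbF; apply: (le_trans (Nrm_split' (V s))); apply: lerD.
apply: le_trans (En_or q0 n (fun s => Nrm l m D (V s) <= t + h) (fun s => h < Nrm l m M (htail D (V s)))) _.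
by rewrite lerD2l.
Qed.

Lemma En_split' t : En q n (fun s => (Nrm l m D (V s) <= t)%R%:R) <=
  En q n (fun s => (Nrm l m M (V s) <= t + h)%R%:R) + eta.
Proof.
apply: (@le_trans _ _ (En q n (fun s => ((Nrm l m M (V s) <= t + h)%R || (h < Nrm l m M (htail D (V s)))%R)%:R))).
  apply: En_sub => // s _ st; have [//|hs] := ltP h (Nrm l m M (htail D (V s))); first by rewrite orbT.
  by rewrite orbF; apply: (le_trans (Nrm_split (V s))); apply: lerD.
apply: le_trans (En_or q0 n (fun s => Nrm l m M (V s) <= t + h) (fun s => h < Nrm l m M (htail D (V s)))) _.
by rewrite lerD2l.
Qed.
End Split.

(** * The sum and its bootstrap version compared with the same Gaussian law *)
Lemma sum_const_seq (R : realType) (I : Type) (s : seq I) (c : R) : \sum_(v <- s) c = (size s)%:R * c.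
Proof. by rewrite big_const_seq count_predT iter_addr_0 mulr_natl. Qed.

Lemma shift_moment (R : realType) (I : finType) (q f : I -> R) (p : nat) :
  (forall v, 0 <= q v) -> \sum_v q v = 1 ->
  \sum_v q v * (f v - \sum_u q u * f u) ^+ (2 * p) <= 2 * 4 ^+ p * \sum_v q v * f v ^+ (2 * p).
Proof.
move=> q0 q1; set mu := \sum_u q u * f u.
have ev (z : R) k : 0 <= z ^+ (2 * k) by rewrite exprM exprn_ge0 // sqr_ge0.
have mle : mu ^+ (2 * p) <= \sum_v q v * f v ^+ (2 * p).
  case: p => [|p]; first by rewrite muln0 expr0; under eq_bigr do rewrite expr0 mulr1; rewrite q1.
  have -> : (2 * p.+1 = (2 * p).+1.+1)%N by rewrite mulnS.
  have := @jensen_pow R I q (fun v => `|f v|) (2 * p).+1 q0 (fun v => normr_ge0 _).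
  rewrite q1 expr1n mul1r => h.
  have e z : z ^+ (2 * p).+2 = `|z| ^+ (2 * p).+2 :> R.
    by rewrite -normrX ger0_norm //; have := ev z p.+1; rewrite mulnS.
  rewrite e; under eq_bigr do rewrite e; apply: le_trans h.
  rewrite lerXn2r ?nnegrE //; first by apply: sumr_ge0 => v _; rewrite mulr_ge0.
  apply: (le_trans (ler_norm_sum _ _ _)); apply: ler_sum => v _.
  by rewrite normrM ger0_norm.
apply: (@le_trans _ _ (\sum_v q v * (4 ^+ p * (f v ^+ (2 * p) + mu ^+ (2 * p))))).
  apply: ler_sum => v _; apply: ler_wpM2l => //; apply: (le_trans (addr_pow_even _ _ _)).
  by rewrite [(- mu) ^+ _]exprM sqrrN -exprM.
under eq_bigr do rewrite mulrCA mulrDr; rewrite -mulr_sumr big_split /= -mulr_suml q1 mul1r.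
rewrite -mulrA mulrCA; apply: ler_wpM2l; first exact: exprn_ge0.
by rewrite mulr_natl mulr2n lerD2l.
Qed.

Section Compare.
Context {R : realType} {I : finType} (q : I -> R) (y : I -> nat -> R).
Local Notation empR := (@emp R I).
Hypotheses (q0 : forall v, 0 <= q v) (q1 : \sum_v q v = 1).
Variables (l : nat -> nat -> R) (m D M : nat) (w mom : nat -> R).
Hypothesis DM : (D <= M)%N.
Hypothesis w0 : forall j, 0 <= w j.
Hypothesis Nw : forall x : nat -> R, Nrm l m M x ^+ 2 <= \sum_(j < M) w j * x j ^+ 2.
Hypothesis y0 : forall j, (j < M)%N -> \sum_v q v * y v j = 0.
Hypothesis ymom : forall p j, (j < M)%N -> \sum_v q v * y v j ^+ (2 * p) <= mom p.

Definition cov i j := \sum_v q v * (y v i * y v j).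
Definition bad (bb : R) (v : I) : bool := [exists j : 'I_D, bb < `|y v j|].

Let ev (z : R) k : 0 <= z ^+ (2 * k).
Proof. by rewrite exprM exprn_ge0 // sqr_ge0. Qed.

Lemma prob_bad (bb : R) p : 0 < bb ->
  \sum_v q v * (bad bb v)%:R <= D%:R * mom p / bb ^+ (2 * p).
Proof.
move=> b0; rewrite ler_pdivlMr ?exprn_gt0 // mulr_suml.
apply: (@le_trans _ _ (\sum_v q v * \sum_(j < D) y v j ^+ (2 * p))).
  apply: ler_sum => v _; rewrite -mulrA; apply: ler_wpM2l => //.
  case: (boolP (bad bb v)) => [/existsP[j bj]|_]; last by rewrite mul0r sumr_ge0.
  rewrite mul1r (bigD1 j) //=; apply: (@le_trans _ _ (y v j ^+ (2 * p))); last by rewrite lerDl sumr_ge0.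
  rewrite -[leRHS]ger0_norm // normrX lerXn2r ?nnegrE ?(ltW b0) //; exact: ltW.
under eq_bigr do rewrite mulr_sumr.
rewrite exchange_big /= mulr_natl -[D in _ *+ D]card_ord -sumr_const; apply: ler_sum => j _.
by apply: ymom; apply: leq_trans DM.
Qed.

Lemma cauchy_bad (f : I -> R) (a : pred I) (e s pb : R) : 0 < e ->
  \sum_v q v * f v ^+ 2 <= s -> \sum_v q v * (a v)%:R <= pb ->
  `|\sum_v q v * (f v * (a v)%:R)| <= (e * s + pb / e) / 2.
Proof.
move=> e0 fs apb.
apply: (@le_trans _ _ (\sum_v q v * ((e * f v ^+ 2 + (a v)%:R / e) / 2))).
  apply: (le_trans (ler_norm_sum _ _ _)); apply: ler_sum => v _.
  rewrite normrM ger0_norm //; apply: ler_wpM2l => //.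
  rewrite normrM [`|(a v)%:R|]ger0_norm //; case: (a v) => /=; last first.
    by rewrite mulr0 mul0r addr0 divr_ge0 // mulr_ge0 ?sqr_ge0 // ltW.
  rewrite mulr1 ler_pdivlMr // -[f v ^+ 2]ger0_norm ?sqr_ge0 // normrX.
  have := mulr_ge0 (ltW e0) (sqr_ge0 (`|f v| - e^-1)).
  rewrite (_ : e * (`|f v| - e^-1) ^+ 2 = e * `|f v| ^+ 2 + 1 / e - `|f v| * 2).
    by rewrite subr_ge0.
  by field; rewrite gt_eqF.
have -> : \sum_v q v * ((e * f v ^+ 2 + (a v)%:R / e) / 2) =
   (e * (\sum_v q v * f v ^+ 2) + (\sum_v q v * (a v)%:R) / e) / 2.
  rewrite mulrDl !mulr_sumr !mulr_suml -big_split /=; apply: eq_bigr => v _.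
  by field; rewrite gt_eqF.
rewrite ler_pM2r ?invr_gt0 //; apply: lerD; first by rewrite ler_pM2l.
by rewrite ler_pM2r ?invr_gt0.
Qed.

Lemma prod_moment p i j : (i < M)%N -> (j < M)%N ->
  \sum_v q v * (y v i * y v j) ^+ (2 * p) <= mom (2 * p)%N.
Proof.
move=> iM jM; have h := lerD (ymom (2 * p) iM) (ymom (2 * p) jM).
rewrite -(ler_pM2l (ltr0n _ 2)) [leRHS]mulr_natl mulr2n; apply: le_trans h.
rewrite mulr_sumr -big_split /=; apply: ler_sum => v _.
rewrite mulrCA -mulrDr; apply: ler_wpM2l => //.
rewrite exprMn [(2 * (2 * p))%N]mulnC !exprM -![_ ^+ 2 ^+ p]exprM.
have := sqr_ge0 (y v i ^+ (2 * p) - y v j ^+ (2 * p)).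
set a := y v i ^+ _; set b := y v j ^+ _.
rewrite (_ : (a - b) ^+ 2 = a ^+ 2 + b ^+ 2 - 2 * (a * b)); last by ring.
by rewrite subr_ge0.
Qed.

Variables (n : nat) (bb d0 d1 e : R) (G : R -> R).
Hypothesis n0 : (0 < n)%N.
Hypothesis HC : forall (q' : I -> R) (y' : I -> nat -> R),
  (forall v, 0 <= q' v) -> \sum_v q' v = 1 ->
  (forall v j, q' v != 0 -> (j < D)%N -> `|y' v j| <= bb) ->
  (forall j, (j < D)%N -> `|\sum_v q' v * y' v j| <= d0) ->
  (forall i j, (i < D)%N -> (j < D)%N -> `|\sum_v q' v * (y' v i * y' v j) - cov i j| <= d1) ->
  forall t, `|En q' n (fun s => (Nrm l m D (vsum y' s) <= t)%R%:R) - G t| <= e.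

Lemma law_head (b eta pb : R) t : 0 < b -> b <= bb -> 0 < eta ->
  \sum_v q v * (bad b v)%:R <= pb ->
  (eta * mom 1%N + pb / eta) / 2 <= d0 -> (eta * mom 2%N + pb / eta) / 2 <= d1 ->
  `|En q n (fun s => (Nrm l m D (vsum y s) <= t)%R%:R) - G t| <= e + n%:R * pb.
Proof.
move=> b0 bbb eta0 hpb h0 h1.
pose y' v j := if bad b v then 0 else y v j.
have y'E v j : y' v j = y v j - y v j * (bad b v)%:R.
  by rewrite /y'; case: (bad b v); rewrite /= ?mulr1 ?mulr0 ?subrr ?subr0.
have y'E2 v i j : y' v i * y' v j = y v i * y v j - (y v i * y v j) * (bad b v)%:R.
  by rewrite /y'; case: (bad b v); rewrite /= ?mulr1 ?mulr0 ?mul0r ?subrr ?subr0.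
have H : `|En q n (fun s => (Nrm l m D (vsum y' s) <= t)%R%:R) - G t| <= e.
  apply: HC => //.
  - move=> v j _ jD; rewrite /y'; case: (boolP (bad b v)) => [_|]; first by rewrite normr0 (le_trans (ltW b0)).
    by rewrite negb_exists => /forallP /(_ (Ordinal jD)) /=; rewrite -leNgt => /le_trans; apply.
  - move=> j jD; have jM := leq_trans jD DM; under eq_bigr do rewrite y'E mulrBr.
    rewrite sumrB y0 // sub0r normrN; apply: le_trans h0; apply: cauchy_bad => //.
    exact: (ymom 1 jM).
  - move=> i j iD jD; have iM := leq_trans iD DM; have jM := leq_trans jD DM.
    under eq_bigr do rewrite y'E2 mulrBr.
    rewrite sumrB addrAC subrr sub0r normrN; apply: le_trans h1.
    apply: (cauchy_bad (f := fun v => y v i * y v j)) => //.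
    exact: (prod_moment 1 iM jM).
have B := En_has q0 q1 n (bad b).
have Bn : En q n (fun s => (has (bad b) s)%:R) <= n%:R * pb.
  by apply: (le_trans B); rewrite ler_wpM2l.
have yy s : ~~ has (bad b) s -> vsum y' s = vsum y s.
  move=> hs; apply/funext => j; apply: eq_big_seq => v vs; rewrite /y'.
  by move/hasPn: hs => /(_ _ vs) /negPf ->.
have X : `|En q n (fun s => (Nrm l m D (vsum y s) <= t)%R%:R) - En q n (fun s => (Nrm l m D (vsum y' s) <= t)%R%:R)| <= n%:R * pb.
  rewrite -EnB //; apply: (le_trans (En_norm q0 _ _)); apply: le_trans Bn.
  apply: En_le => // s _; case: (boolP (has _ s)) => [_|/yy ->]; last by rewrite subrr normr0.
  by case: (_ <= t)%R; case: (_ <= t)%R; rewrite /= ?subrr ?subr0 ?sub0r ?normrN ?normr0 ?normr1.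
rewrite -(subrK (En q n (fun s => (Nrm l m D (vsum y' s) <= t)%R%:R)) (En q n (fun s => (Nrm l m D (vsum y s) <= t)%R%:R))) -addrA.
by apply: (le_trans (ler_normD _ _)); rewrite [leRHS]addrC; apply: lerD.
Qed.

Definition smean s j := \sum_v empR s v * y v j.

Definition good_sample (b g : R) (s : seq I) : bool :=
  [&& ~~ has (bad b) s, [forall j : 'I_D, `|smean s j| <= g] &
   [forall i : 'I_D, [forall j : 'I_D, `|\sum_v empR s v * (y v i * y v j) - cov i j| <= g]]].

Lemma boot_head (b g : R) s t : size s = n -> 0 <= g -> b + g <= bb -> 0 <= d0 -> g + g ^+ 2 <= d1 ->
  good_sample b g s ->
  `|En (empR s) n (fun tau => (Nrm l m D (fun j => vsum y tau j - vsum y s j) <= t)%R%:R) - G t| <= e.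
Proof.
move=> sn g0 hb hd0 hd1 /and3P[/hasPn G1 /forallP G2 /forallP G3].
have es : \sum_v empR s v = 1 :> R by apply: emp_sum1; rewrite sn.
pose y' v j := y v j - smean s j.
have -> : En (empR s) n (fun tau => (Nrm l m D (fun j => vsum y tau j - vsum y s j) <= t)%R%:R) =
  En (empR s) n (fun tau => (Nrm l m D (vsum y' tau) <= t)%R%:R).
  apply: eq_En => tau taun; congr ((_ <= t)%R%:R); apply: eq_Nrm => j _.
  rewrite /vsum /y' sumrB; congr (_ - _).
  rewrite sum_const_seq taun /smean emp_mean sn mulrA mulfV ?mul1r //.
  by rewrite pnatr_eq0 -lt0n.
apply: HC => //.
- by move=> v; exact: emp_ge0.
- move=> v j /emp_supp vs jD; apply: le_trans hb; apply: (le_trans (ler_normB _ _)); apply: lerD.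
    have := G1 _ vs; rewrite negb_exists => /forallP /(_ (Ordinal jD)) /=.
    by rewrite -leNgt.
  exact: (G2 (Ordinal jD)).
- move=> j jD; under eq_bigr do rewrite mulrBr.
  by rewrite sumrB -mulr_suml es mul1r subrr normr0.
- move=> i j iD jD; have := G3 (Ordinal iD) => /forallP /(_ (Ordinal jD)) /= g3.
  have -> : \sum_v empR s v * (y' v i * y' v j) = \sum_v empR s v * (y v i * y v j) - smean s i * smean s j.
    have E v : empR s v * (y' v i * y' v j) = empR s v * (y v i * y v j) - (empR s v * y v i) * smean s j
       - (empR s v * y v j) * smean s i + empR s v * (smean s i * smean s j) by rewrite /y'; ring.
    have a1 k c : \sum_v empR s v * y v k * c = smean s k * c by rewrite /smean mulr_suml.
    have a2 (c : R) : \sum_v empR s v * c = c by rewrite -mulr_suml es mul1r.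
    by rewrite (eq_bigr _ (fun v _ => E v)) big_split /= !sumrB !a1 a2; ring.
  rewrite addrAC; apply: le_trans hd1; apply: (le_trans (ler_normB _ _)); apply: lerD => //.
  by rewrite normrM expr2; apply: ler_pM => //; [exact: (G2 (Ordinal iD))|exact: (G2 (Ordinal jD))].
Qed.

Lemma prob_not_good (b g pb : R) p : 0 < g -> \sum_v q v * (bad b v)%:R <= pb ->
  En q n (fun s => (~~ good_sample b g s)%:R) <=
   n%:R * pb + (D%:R * mom p + D%:R ^+ 2 * (2 * 4 ^+ p * mom (2 * p)%N)) * rosc p * n%:R ^+ p / (n%:R * g) ^+ (2 * p).
Proof.
move=> g0 hpb; have nR : 0 < n%:R :> R by rewrite ltr0n.
have ng : 0 < n%:R * g by rewrite mulr_gt0.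
have r0 : 0 <= rosc p :> R := rosc_ge0 p.
pose f i j v := y v i * y v j - cov i j.
pose A j (s : seq I) : bool := n%:R * g < `|\sum_(v <- s) y v j|.
pose B i j (s : seq I) : bool := n%:R * g < `|\sum_(v <- s) f i j v|.
have fx (u : R) : (u <= n%:R * g) = (n%:R^-1 * u <= g).
  by rewrite [_^-1 * u]mulrC ler_pdivrMr // mulrC.
apply: (@le_trans _ _ (En q n (fun s => (has (bad b) s)%:R + (\sum_(j < D) (A j s)%:R) + \sum_(i < D) \sum_(j < D) (B i j s)%:R))).
  apply: En_le => // s sn; rewrite /good_sample !negb_and negbK.
  have S1 : 0 <= \sum_(j < D) (A j s)%:R :> R by apply: sumr_ge0.
  have S2 : 0 <= \sum_(i < D) \sum_(j < D) (B i j s)%:R :> R by apply: sumr_ge0 => i _; apply: sumr_ge0.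
  case: (boolP (has _ s)) => [_|_] /=; first by rewrite -addrA lerDl addr_ge0.
  rewrite add0r; case: (boolP [forall j, _]) => [_|/forallPn[j hj]] /=; last first.
    have Aj : A j s.
      by rewrite /A ltNge fx; move: hj; rewrite /smean emp_mean sn normrM ger0_norm ?invr_ge0.
    apply: (@le_trans _ _ (\sum_(j < D) (A j s)%:R)); last by rewrite lerDl.
    by rewrite (bigD1 j) //= Aj lerDl sumr_ge0.
  case: (boolP [forall i, _]) => [_|/forallPn[i /forallPn[j hj]]] /=; first exact: addr_ge0.
  have Bij : B i j s.
    rewrite /B ltNge fx; move: hj; rewrite emp_mean sn /f sumrB.
    rewrite sum_const_seq sn.
    have -> : n%:R^-1 * \sum_(u <- s) y u i * y u j - cov i j =
       n%:R^-1 * (\sum_(u <- s) y u i * y u j - n%:R * cov i j) by field; rewrite gt_eqF.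
    by rewrite normrM ger0_norm ?invr_ge0.
  apply: (@le_trans _ _ (\sum_(i < D) \sum_(j < D) (B i j s)%:R)); last by rewrite lerDr.
  rewrite (bigD1 i) //= (bigD1 j) //= Bij -addrA lerDl; apply: addr_ge0; first exact: sumr_ge0.
  by apply: sumr_ge0 => k _; exact: sumr_ge0.
rewrite !EnD // !En_sum // -addrA; apply: lerD.
  by apply: (le_trans (En_has q0 q1 n (bad b))); rewrite ler_wpM2l.
pose Z : R := rosc p * (n%:R ^+ p / (n%:R * g) ^+ (2 * p)).
have Z0 : 0 <= Z by rewrite /Z !mulr_ge0 // ?invr_ge0 ?exprn_ge0 // ltW.
have dev (h : I -> R) (c : R) : \sum_v q v * h v = 0 -> \sum_v q v * h v ^+ (2 * p) <= c ->
    En q n (fun s => (n%:R * g < `|\sum_(v <- s) h v|)%R%:R) <= c * Z.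
  move=> h0 hc; apply: (le_trans (En_deviation q0 q1 n p ng h0)).
  rewrite [leLHS](_ : _ = (\sum_v q v * h v ^+ (2 * p)) * Z); first exact: ler_wpM2r.
  by rewrite /Z [in RHS]mulrC !mulrA [in RHS]mulrAC.
rewrite [leRHS](_ : _ = D%:R * (mom p * Z) + (D * D)%:R * ((2 * 4 ^+ p * mom (2 * p)%N) * Z)); last first.
  by rewrite /Z natrM; ring.
apply: lerD.
  rewrite mulr_natl -[D in _ *+ D]card_ord -sumr_const; apply: ler_sum => j _.
  have jM : (j < M)%N by apply: leq_trans DM.
  by apply: dev; [exact: y0|exact: ymom].
apply: (@le_trans _ _ (\sum_(i < D) \sum_(j < D) ((2 * 4 ^+ p * mom (2 * p)%N) * Z))); last first.
  by rewrite !sumr_const !card_ord -mulrnA [leRHS]mulr_natl.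
apply: ler_sum => i _; rewrite En_sum //; apply: ler_sum => j _.
have iM : (i < M)%N by apply: leq_trans DM.
have jM : (j < M)%N by apply: leq_trans DM.
have f0 : \sum_v q v * f i j v = 0.
  under eq_bigr do rewrite mulrBr; rewrite sumrB -mulr_suml q1 mul1r -/(cov i j).
  exact: subrr.
apply: dev => //; apply: (le_trans (shift_moment (fun v => y v i * y v j) p q0 q1)).
apply: ler_wpM2l; last exact: prod_moment.
by rewrite mulr_ge0 // exprn_ge0.
Qed.

Definition wtail j : R := if (j < D)%N then 0 else w j.

Let Nwtail (x : nat -> R) : Nrm l m M (htail D x) ^+ 2 <= \sum_(j < M) wtail j * x j ^+ 2.
Proof.
apply: (le_trans (Nw _)); apply: ler_sum => j _; rewrite /htail /wtail.
by case: ifP; rewrite ?expr0n /= ?mulr0 ?mul0r.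
Qed.

Let wtail0 j : 0 <= wtail j.
Proof. by rewrite /wtail; case: ifP. Qed.

Lemma tail_markov (q' : I -> R) (y' : I -> nat -> R) (h : R) p :
  (forall v, 0 <= q' v) -> \sum_v q' v = 1 ->
  (forall j, (j < M)%N -> \sum_v q' v * y' v j = 0) -> 0 < h ->
  En q' n (fun s => (h < Nrm l m M (htail D (vsum y' s)))%R%:R) <=
   (\sum_(j < M) wtail j) ^+ p * (rosc p.+1 * n%:R ^+ p.+1 *
     \sum_(j < M) wtail j * \sum_v q' v * y' v j ^+ (2 * p.+1)) / h ^+ (2 * p.+1).
Proof.
move=> q'0 q'1 y'0 h0.
have F0 s : 0 <= (\sum_(j < M) wtail j * vsum y' s j ^+ 2) ^+ p.+1.
  by apply: exprn_ge0; apply: sumr_ge0 => j _; rewrite mulr_ge0 // sqr_ge0.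
have F1 s : h < Nrm l m M (htail D (vsum y' s)) -> h ^+ (2 * p.+1) <= (\sum_(j < M) wtail j * vsum y' s j ^+ 2) ^+ p.+1.
  move=> hN; rewrite exprM lerXn2r ?nnegrE ?sqr_ge0 //.
    by apply: sumr_ge0 => j _; rewrite mulr_ge0 // sqr_ge0.
  by apply: le_trans (Nwtail _); rewrite lerXn2r ?nnegrE ?Nrm_ge0 // ltW.
apply: (le_trans (@En_markov R I q' q'0 n _ (fun s => h < Nrm l m M (htail D (vsum y' s))) _ (exprn_gt0 (2 * p.+1) h0) F0 F1)).
rewrite ler_pM2r ?invr_gt0 ?exprn_gt0 //.
exact: En_weighted_moment.
Qed.

Lemma law_tail (h : R) p : 0 < h ->
  En q n (fun s => (h < Nrm l m M (htail D (vsum y s)))%R%:R) <=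
   (\sum_(j < M) wtail j) ^+ p.+1 * (rosc p.+1 * n%:R ^+ p.+1 * mom p.+1) / h ^+ (2 * p.+1).
Proof.
move=> h0; apply: (le_trans (tail_markov p q0 q1 y0 h0)).
rewrite ler_pM2r ?invr_gt0 ?exprn_gt0 //; set W := \sum_(j < M) wtail j.
rewrite [leRHS](_ : _ = W ^+ p * (rosc p.+1 * n%:R ^+ p.+1 * (W * mom p.+1))); last by rewrite exprSr; ring.
apply: ler_wpM2l; first by apply: exprn_ge0; exact: sumr_ge0.
apply: ler_wpM2l; first by rewrite mulr_ge0 ?rosc_ge0 // exprn_ge0.
by rewrite mulr_suml; apply: ler_sum => j _; apply: ler_wpM2l => //; exact: ymom.
Qed.

Lemma boot_tail (h eta : R) p : 0 < h -> 0 < eta ->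
  En q n (fun s => (eta < En (empR s) n (fun tau =>
       (h < Nrm l m M (htail D (fun j => vsum y tau j - vsum y s j)))%R%:R))%R%:R) <=
   (\sum_(j < M) wtail j) ^+ p.+1 * (rosc p.+1 * n%:R ^+ p.+1 * (2 * 4 ^+ p.+1 * mom p.+1)) / h ^+ (2 * p.+1) / eta.
Proof.
move=> h0 eta0; set W := \sum_(j < M) wtail j.
have W0 : 0 <= W by exact: sumr_ge0.
have nR : 0 < n%:R :> R by rewrite ltr0n.
pose F s := W ^+ p * (rosc p.+1 * n%:R ^+ p.+1 *
  \sum_(j < M) wtail j * (2 * 4 ^+ p.+1 * (n%:R^-1 * \sum_(v <- s) y v j ^+ (2 * p.+1)))) / h ^+ (2 * p.+1).
have mk s : size s = n -> En (empR s) n (fun tau =>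
       (h < Nrm l m M (htail D (fun j => vsum y tau j - vsum y s j)))%R%:R) <= F s.
  move=> sn; pose y' v j := y v j - smean s j.
  have es : \sum_v empR s v = 1 :> R by apply: emp_sum1; rewrite sn.
  have -> : En (empR s) n (fun tau => (h < Nrm l m M (htail D (fun j => vsum y tau j - vsum y s j)))%R%:R) =
    En (empR s) n (fun tau => (h < Nrm l m M (htail D (vsum y' tau)))%R%:R).
    apply: eq_En => tau taun; congr ((h < _)%R%:R); apply: eq_Nrm => j _; rewrite /htail; case: ifP => // _.
    rewrite /vsum /y' sumrB; congr (_ - _).
    rewrite sum_const_seq taun /smean emp_mean sn mulrA mulfV ?mul1r //.
    by rewrite gt_eqF.
  have y'0 j : (j < M)%N -> \sum_v empR s v * y' v j = 0.
    by move=> _; under eq_bigr do rewrite mulrBr; rewrite sumrB -mulr_suml es mul1r subrr.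
  apply: (le_trans (tail_markov p (@emp_ge0 R I s) es y'0 h0)).
  rewrite /F ler_pM2r ?invr_gt0 ?exprn_gt0 //.
  apply: ler_wpM2l; first exact: exprn_ge0.
  apply: ler_wpM2l; first by rewrite mulr_ge0 ?rosc_ge0 // exprn_ge0.
  apply: ler_sum => j _; apply: ler_wpM2l => //.
  rewrite -sn -emp_mean; exact: (shift_moment (fun v => y v j) p.+1 (@emp_ge0 R I s) es).
have F0 s : 0 <= F s.
  rewrite /F divr_ge0 ?exprn_ge0 ?(ltW h0) // mulr_ge0 ?exprn_ge0 // mulr_ge0 //.
    by rewrite mulr_ge0 ?rosc_ge0 // exprn_ge0.
  apply: sumr_ge0 => j _; apply: mulr_ge0 => //; apply: mulr_ge0; first by rewrite mulr_ge0 // exprn_ge0.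
  by apply: mulr_ge0; [rewrite invr_ge0 ltW|apply: sumr_ge0].
apply: (@le_trans _ _ (En q n (fun s => (eta <= F s)%R%:R))).
  by apply: En_sub => // s sn /ltW /le_trans; apply; exact: mk.
apply: (le_trans (@En_markov R I q q0 n F (fun s => eta <= F s) eta eta0 F0 (fun s h => h))).
rewrite ler_pM2r ?invr_gt0 //.
have -> : En q n F = W ^+ p * (rosc p.+1 * n%:R ^+ p.+1 *
  \sum_(j < M) wtail j * (2 * 4 ^+ p.+1 * \sum_v q v * y v j ^+ (2 * p.+1))) / h ^+ (2 * p.+1).
  transitivity (En q n (fun s => (h ^- (2 * p.+1) * W ^+ p * (rosc p.+1 * n%:R ^+ p.+1)) *
     \sum_(j < M) (wtail j * (2 * 4 ^+ p.+1) * n%:R^-1) * \sum_(v <- s) y v j ^+ (2 * p.+1))).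
    apply: eq_En => s _; rewrite /F mulrC !mulrA; congr (_ * _); apply: eq_bigr => j _.
    by rewrite !mulrA.
  rewrite EnZ // En_sum // [in RHS]mulrC !mulrA; congr (_ * _); apply: eq_bigr => j _.
  by rewrite EnZ // En_sum_mean // !mulrA mulfVK ?gt_eqF.
rewrite ler_pM2r ?invr_gt0 ?exprn_gt0 //.
rewrite [leRHS](_ : _ = W ^+ p * (rosc p.+1 * n%:R ^+ p.+1 * (W * (2 * 4 ^+ p.+1 * mom p.+1)))); last by rewrite exprSr; ring.
apply: ler_wpM2l; first exact: exprn_ge0.
apply: ler_wpM2l; first by rewrite mulr_ge0 ?rosc_ge0 // exprn_ge0.
rewrite mulr_suml; apply: ler_sum => j _; apply: ler_wpM2l => //.
by apply: ler_wpM2l; [rewrite mulr_ge0 // exprn_ge0|exact: ymom].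
Qed.
End Compare.

(** * Anti-concentration of the whitened Gaussian seminorm *)
Lemma powRN_bound (R : realType) (b k alpha : R) (kappa : nat) : 1 <= b -> b ^+ kappa <= k ->
  4 <= kappa%:R * alpha -> 0 <= alpha -> k `^ (- alpha) <= b ^- 4.
Proof.
move=> b1 bk ka a0; have b0 : 0 < b by exact: lt_le_trans b1.
have bk0 : 0 < b ^+ kappa by exact: exprn_gt0.
have k0 : 0 < k by exact: lt_le_trans bk.
rewrite powRN lef_pV2 ?posrE ?powR_gt0 ?exprn_gt0 //.
apply: (@le_trans _ _ ((b ^+ kappa) `^ alpha)).
  rewrite -!powR_mulrn ?(ltW b0) // -powRrM; exact: ler_powR.
by apply: ge0_ler_powR => //; rewrite nnegrE ltW.
Qed.

Section WhiteModulus.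
Context {R : realType}.
Notation RM := (measurableTypeR R).
Variables (l : nat -> nat -> R) (m D : nat) (C L T : nat -> nat -> R) (c0 : R).
Hypothesis c00 : 0 < c0.
Hypothesis wh : whitening c0 D C L T.
Variables (w : nat -> R) (C2 : R).
Hypothesis w0 : forall j, 0 < w j.
Hypothesis Nw : forall x, Nrm l m D x ^+ 2 <= \sum_(j < D) w j * x j ^+ 2.
Hypothesis C2P : forall j, (j < D)%N -> C j j <= C2.
Variables (cN Cw alpha b wr : R) (S kappa : nat).
Hypotheses (cN0 : 0 < cN) (alpha0 : 0 <= alpha) (b1 : 1 <= b) (wr0 : 0 < wr) (Cw0 : 0 <= Cw).
Hypothesis hcN : forall x j, (j < D)%N -> Num.sqrt (w j) * `|x j| <= cN * Nrm l m D x.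
Hypothesis wrP : forall j, (j <= S)%N -> wr <= Num.sqrt (w j).
Hypothesis wtl : forall k, (0 < k)%N -> \sum_(j < D) (if (j < k)%N then 0 else w j) <= Cw * k%:R `^ (- alpha).
Hypothesis ka : 4 <= kappa%:R * alpha.
Hypothesis b2 : Cw ^+ S.+1 * gmom C2 S.+1 <= b.
Hypothesis b3 : (4 * (cN / (wr * Num.sqrt c0))) ^+ S.+1 <= b.
Hypothesis D0 : (0 < D)%N.

Let c1 := cN / (Num.sqrt (w 0%N) * Num.sqrt c0).
Notation Gam t := (gpr [set z : D.-tuple RM | Nrm (whl l D L) m D (nth 0 (tval z)) <= t]).

Lemma white_modulus (u h : R) : 0 <= h ->
  Gam (u + h) <= Gam u + 84 * c1 * (S.+2%:R * b ^+ kappa) * h + b ^- S.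
Proof.
move=> h0.
have b0 : 0 < b by exact: lt_le_trans b1.
have bS : 0 < b ^- S by rewrite invr_gt0 exprn_gt0.
have sw0 : 0 < Num.sqrt (w 0%N) by rewrite sqrtr_gt0.
have sc0 : 0 < Num.sqrt c0 by rewrite sqrtr_gt0.
have c10 : 0 < c1 by rewrite divr_gt0 // mulr_gt0.
have small t : 0 <= t -> Gam t <= c1 * t.
  move=> t0; rewrite -[leRHS]expr1; apply: (whl_small c00 wh D0 cN0 sw0 t0) => x j.
  by rewrite ltnS leqn0 => /eqP ->; exact: hcN.
pose m0 := ((Num.truncn (b ^+ kappa)).+1 + S)%N.
have bk1 : 1 <= b ^+ kappa by rewrite exprn_ege1.
have bk0 : 0 <= b ^+ kappa by exact: le_trans bk1.
have /andP[tr1 tr2] := truncn_itv bk0.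
have m0le : m0%:R <= S.+2%:R * b ^+ kappa.
  rewrite /m0 natrD -natr1 -[S.+2]addn2 natrD mulrDl [leRHS]addrC; apply: lerD.
    by rewrite mulr_natl mulr2n; apply: lerD.
  by apply: ler_peMr.
have m0ge : b ^+ kappa <= m0%:R.
  by apply: (le_trans (ltW tr2)); rewrite ler_nat /m0 leq_addr.
have fin (k : nat) : k%:R <= S.+2%:R * b ^+ kappa ->
   Gam (u + h) <= Gam u + 84 * c1 * k%:R * h + b ^- S -> Gam (u + h) <= Gam u + 84 * c1 * (S.+2%:R * b ^+ kappa) * h + b ^- S.
  move=> kk /le_trans; apply; rewrite lerD2r lerD2l; apply: ler_wpM2r => //.
  by apply: ler_wpM2l => //; rewrite mulr_ge0 // ltW.
have [Dm|mD] := leqP D m0.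
  apply: (fin D); first by apply: le_trans m0le; rewrite ler_nat.
  apply: (@Gam_modulus R (whl l D L) m D D c1 0 (b ^- S)) => //; first exact: ltW.
    by rewrite ltxx.
  rewrite (_ : [set z : D.-tuple RM | _] = set0); first by rewrite /gpr measure0 ltW.
  apply/seteqP; split => // z /= []; apply/Nrm_leP => // i im.
  by rewrite big1 ?normr0 // => j _; rewrite /htail ltn_ord mulr0.
have m00 : (0 < m0)%N by [].
have Sm : (S.+1 <= D)%N by apply: leq_trans (ltnW mD); rewrite /m0 addSn ltnS leq_addl.
apply: (fin m0) => //.
have bi0 : 0 < b^-1 by rewrite invr_gt0.
apply: (@Gam_modulus R (whl l D L) m D m0 c1 b^-1 (b ^- S)) => //; first exact: ltW.
  move=> _; have t0 : 0 <= 4 * b^-1 by rewrite mulr_ge0 // ltW.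
  apply: (le_trans (@whl_small R l m D C L T c0 c00 wh cN wr S.+1 _ Sm cN0 wr0 t0 _)).
    move=> x j jS; apply: le_trans (hcN x (leq_trans jS Sm)).
    by apply: ler_wpM2r => //; apply: wrP.
  rewrite (_ : _ * (4 * b^-1) = 4 * (cN / (wr * Num.sqrt c0)) * b^-1); last by ring.
  rewrite exprMn exprVn ler_pdivrMr ?exprn_gt0 // [b ^+ S.+1]exprSr [leRHS]mulrA mulVf ?mul1r //.
  by rewrite gt_eqF ?exprn_gt0.
apply: (le_trans (@whl_tail R l m D C L T c0 wh w C2 (fun j => ltW (w0 j)) Nw C2P m0 S _ bi0)).
have tl : \sum_(j < D) (if (j < m0)%N then 0 else w j) <= Cw * b ^- 4.
  apply: (le_trans (wtl m00)); apply: ler_wpM2l => //.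
  exact: (powRN_bound b1 m0ge ka alpha0).
have tl0 : 0 <= \sum_(j < D) (if (j < m0)%N then 0 else w j).
  by apply: sumr_ge0 => j _; case: ifP => // _; exact: ltW.
have g0 := gmom_ge0 C2 S.+1.
apply: (@le_trans _ _ ((Cw * b ^- 4) ^+ S.+1 * gmom C2 S.+1 / b^-1 ^+ (2 * S.+1))).
  apply: ler_wpM2r; first by rewrite invr_ge0 exprn_ge0 // ltW.
  apply: ler_wpM2r => //; rewrite lerXn2r ?nnegrE //.
  by rewrite mulr_ge0 // invr_ge0 exprn_ge0 // ltW.
have -> : (Cw * b ^- 4) ^+ S.+1 * gmom C2 S.+1 / b^-1 ^+ (2 * S.+1) =
   (Cw ^+ S.+1 * gmom C2 S.+1) * (b ^+ 2) ^- S.+1.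
  rewrite exprMn !exprVn invrK [b ^+ (2 * _)]exprM.
  rewrite (_ : b ^+ 4 = b ^+ 2 * b ^+ 2); last by ring.
  rewrite exprMn; set X := (b ^+ 2) ^+ S.+1.
  by field; rewrite gt_eqF // /X !exprn_gt0.
apply: (@le_trans _ _ (b * (b ^+ 2) ^- S.+1)).
  by apply: ler_wpM2r => //; rewrite invr_ge0 !exprn_ge0 // ltW.
rewrite ler_pdivrMr ?exprn_gt0 // mulrC ler_pdivlMr ?exprn_gt0 //.
by rewrite -exprS -exprM; apply: ler_weXn2l => //; rewrite leq_pmull.
Qed.
End WhiteModulus.

Lemma harmonic_le (R : realType) (b : R) (S n : nat) : 1 <= b -> n%:R = b ^+ S -> (0 < n)%N ->
  \sum_(i < n) i.+1%:R^-1 <= S.+1%:R * b.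
Proof.
move=> b1 nb n0; have b0 : 0 < b by exact: lt_le_trans b1.
have H k : \sum_(i < k.+1) i.+1%:R^-1 <= 1 + ln k.+1%:R :> R.
  elim: k => [|k IH]; first by rewrite big_ord1 invr1 ln1 addr0.
  rewrite big_ord_recr /=; apply: (le_trans (lerD IH (lexx _))); rewrite -addrA lerD2l.
  have e : ln (k.+2%:R : R) = ln k.+1%:R - ln (1 + - k.+2%:R^-1).
    have -> : 1 + - k.+2%:R^-1 = k.+1%:R / k.+2%:R :> R.
      by rewrite -[k.+1%:R](addrK 1) natr1 mulrBl mul1r mulfV // pnatr_eq0.
    by rewrite ln_div ?posrE // subKr.
  by rewrite e lerD2l lerNr; apply: le_ln1Dx; rewrite ltrN2 invf_lt1 ?ltr1n.
case: n nb n0 => // n nb _; apply: (le_trans (H n)).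
rewrite nb lnXn // -natr1 mulrDl mul1r addrC; apply: lerD => //.
rewrite -[ln b *+ S]mulr_natl; apply: ler_wpM2l => //.
exact: ltW (ln_sublinear b0).
Qed.

(** * Choice of the truncation and smoothing levels *)
Fact core_fact1 (R : realType) (r D : R) : r <= 1 -> 1 <= D -> 1 + 2 * r + 2 * D <= 5 * D.
Proof. by move=> *; lra. Qed.

Fact core_fact2 (R : realType) (u v z r k p : R) : r <= z -> u <= k * z -> v <= 2 * p * z ->
  1600 * (u + r) + v + 2 * r <= (1600 * (k + 1) + 2 * p + 2) * z.
Proof. by move=> *; lra. Qed.

Section CoreArith.
Context {R : realType}.
Variables (sn Dr yv b ci M1 s1 Pc : R) (kappa : nat).
Hypotheses (sn1 : 1 <= sn) (D1 : 1 <= Dr) (b1 : 2 <= b) (ci0 : 0 < ci) (M11 : 1 <= M1) (s11 : 1 <= s1) (Pc0 : 0 <= Pc).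
Hypotheses (Dy : Dr <= 2 * (yv * sn)) (ysn : 1 <= yv * sn) (yb : yv * b ^+ (kappa + 6) <= 1).

Let Kb := 4 * ci + 1.
Let ic := 1 + ci.
Hypotheses (h1 : 4 * Kb <= b) (h2 : s1 * (4 * (ic * M1) + 4 * ci + 10 * Kb) <= b)
  (h3 : 1600 * (Pc * s1 * (2 * (ic * M1) + 8 * ci + 20 * Kb) + 1) + 2 * Pc + 2 <= b).

Let n := sn ^+ 2.
Let d0 := M1 / n.
Let mu := ic * (Dr * d0).
Let d1 := 2 * b ^+ 2 / sn.
Let rho := Dr * d1 * ci.
Let B := Kb * (Dr * b ^+ 2).
Let Lam := Dr ^+ 2 * b ^+ 6.
Let ell := s1 * b.
Let P := Pc * b ^+ kappa.
Let K := Num.sqrt (20 * (B * (1 + 2 * rho ^+ 2 + 2 * Dr))).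

Let b0 : 0 < b. Proof. exact: lt_le_trans b1. Qed.
Let b11 : 1 <= b. Proof. by apply: le_trans b1; rewrite ler1n. Qed.
Let sn0 : 0 < sn. Proof. exact: lt_le_trans sn1. Qed.
Let D0 : 0 < Dr. Proof. exact: lt_le_trans D1. Qed.
Let y0 : 0 < yv. Proof. by have := lt_le_trans ltr01 ysn; rewrite pmulr_lgt0. Qed.
Let bk k : 1 <= b ^+ k. Proof. by rewrite exprn_ege1. Qed.
Let Kb1 : 1 <= Kb. Proof. by rewrite /Kb lerDr mulr_ge0 // ltW. Qed.
Let Kb0 : 0 < Kb. Proof. exact: lt_le_trans Kb1. Qed.
Let ic1 : 1 <= ic. Proof. by rewrite /ic lerDl ltW. Qed.
Let icci : ci <= ic. Proof. by rewrite /ic lerDr. Qed.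
Let ic0 : 0 < ic. Proof. exact: lt_le_trans ic1. Qed.
Let M10 : 0 < M1. Proof. exact: lt_le_trans M11. Qed.
Let s10 : 0 < s1. Proof. exact: lt_le_trans s11. Qed.
Let icM0 : 0 < ic * M1. Proof. exact: mulr_gt0. Qed.

Let ybk k : (k <= 6)%N -> yv * b ^+ k <= 1.
Proof. by move=> kk; apply: le_trans yb; rewrite ler_pM2l // ler_weXn2l // (leq_trans kk) // leq_addl. Qed.

Let Dsn : Dr / sn <= 2 * yv.
Proof. by rewrite ler_pdivrMr // -mulrA. Qed.

Lemma core_A1 : [/\ 1 <= B, Dr <= B & ci * (Dr * (2 * b) ^+ 2) <= B].
Proof.
have DB : Dr <= B.
  rewrite /B mulrCA; apply: ler_peMr; first exact: ltW.
  by rewrite -[1]mulr1; apply: ler_pM.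
split => //; first exact: le_trans DB.
rewrite /B (_ : ci * _ = (4 * ci) * (Dr * b ^+ 2)); last by ring.
by apply: ler_wpM2r; [rewrite mulr_ge0 ?exprn_ge0 // ltW|rewrite /Kb lerDl].
Qed.

Lemma core_A2 : [/\ 0 <= d0, 0 <= d1, 0 <= mu, 0 <= rho & ci * (Dr * d0 ^+ 2) <= mu ^+ 2].
Proof.
have d00 : 0 <= d0 by rewrite divr_ge0 ?exprn_ge0 // ltW.
have d10 : 0 <= d1 by rewrite divr_ge0 ?mulr_ge0 ?exprn_ge0 // ltW.
split => //.
- by apply: mulr_ge0; [exact: ltW|apply: mulr_ge0 => //; exact: ltW].
- by apply: mulr_ge0; [apply: mulr_ge0 => //|]; exact: ltW.
rewrite /mu (_ : (ic * _) ^+ 2 = ic ^+ 2 * (Dr ^+ 2 * d0 ^+ 2)); last by ring.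
apply: ler_pM; first exact: ltW.
- by apply: mulr_ge0; [exact: ltW|exact: sqr_ge0].
- by apply: (le_trans icci); rewrite expr2; apply: ler_peMr => //; exact: ltW.
by apply: ler_wpM2r; [exact: sqr_ge0|rewrite expr2; apply: ler_peMr => //; exact: ltW].
Qed.

Lemma core_A3 : 4 * B <= Lam /\ Lam <= n.
Proof.
split.
  rewrite /B /Lam (_ : 4 * _ = (4 * Kb) * (Dr * b ^+ 2)); last by ring.
  rewrite (_ : Dr ^+ 2 * b ^+ 6 = (Dr * b ^+ 4) * (Dr * b ^+ 2)); last by ring.
  apply: ler_wpM2r; first by rewrite mulr_ge0 ?exprn_ge0 // ltW.
  apply: (le_trans h1); rewrite -[leLHS]mul1r; apply: ler_pM => //; first exact: ltW.
  by rewrite -[leLHS]expr1; apply: ler_weXn2l.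
rewrite /Lam /n (_ : Dr ^+ 2 * b ^+ 6 = (Dr * b ^+ 3) ^+ 2); last by ring.
rewrite lerXn2r ?nnegrE ?(ltW sn0) ?mulr_ge0 ?exprn_ge0 ?(ltW D0) ?(ltW b0) //.
apply: (@le_trans _ _ (2 * (yv * sn) * b ^+ 3)).
  by apply: ler_wpM2r => //; rewrite exprn_ge0 // ltW.
rewrite (_ : 2 * (yv * sn) * b ^+ 3 = (2 * (yv * b ^+ 3)) * sn); last by ring.
rewrite -[leRHS]mul1r; apply: ler_wpM2r; first exact: ltW.
apply: (@le_trans _ _ (b * (yv * b ^+ 3))).
  by apply: ler_wpM2r => //; rewrite mulr_ge0 ?exprn_ge0 // ltW.
rewrite (_ : b * _ = yv * b ^+ 4); last by ring.
exact: ybk.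
Qed.

Let rhole : rho <= 4 * ci * (yv * b ^+ 2).
Proof.
rewrite /rho /d1 (_ : Dr * _ * ci = (2 * ci * b ^+ 2) * (Dr / sn)); last by field; rewrite gt_eqF.
rewrite (_ : 4 * ci * _ = (2 * ci * b ^+ 2) * (2 * yv)); last by ring.
by apply: ler_wpM2l => //; rewrite !mulr_ge0 ?exprn_ge0 // ltW.
Qed.

Let rho1 : rho <= 1.
Proof.
apply: (le_trans rhole); apply: (@le_trans _ _ (b * (yv * b ^+ 2))).
  apply: ler_wpM2r; first by rewrite mulr_ge0 ?exprn_ge0 // ltW.
  apply: le_trans h1; apply: ler_wpM2l => //; rewrite /Kb.
  by rewrite -[leLHS]addr0; apply: lerD => //; apply: ler_peMl; [exact: ltW|rewrite ler1n].
rewrite (_ : b * _ = yv * b ^+ 3); last by ring.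
exact: ybk.
Qed.

Let snmu : sn * mu <= 2 * (ic * M1) * yv.
Proof.
rewrite /mu /d0 /n (_ : sn * _ = (ic * M1) * (Dr / sn)); last by field; rewrite gt_eqF.
rewrite (_ : 2 * _ * yv = (ic * M1) * (2 * yv)); last by ring.
by apply: ler_wpM2l => //; exact: ltW.
Qed.

Let Kle : K <= 10 * Kb * Dr * b.
Proof.
have [_ _ _ rho0 _] := core_A2.
have X0 : 0 <= 10 * Kb * Dr * b by rewrite !mulr_ge0 // ltW.
rewrite -[leRHS]ger0_norm // -sqrtr_sqr; apply: ler_wsqrtr.
have r2 : rho ^+ 2 <= 1 by rewrite expr_le1.
have S3 : 1 + 2 * rho ^+ 2 + 2 * Dr <= 5 * Dr by exact: core_fact1.
apply: (@le_trans _ _ (20 * (B * (5 * Dr)))).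
  apply: ler_wpM2l => //; apply: ler_wpM2l => //.
  by have [B1 _ _] := core_A1; exact: le_trans B1.
rewrite /B (_ : 20 * _ = 100 * Kb * (Dr ^+ 2 * b ^+ 2)); last by ring.
rewrite (_ : (10 * _ * _ * _) ^+ 2 = 100 * Kb * (Dr ^+ 2 * b ^+ 2) * Kb); last by ring.
by apply: ler_peMr => //; rewrite !mulr_ge0 ?exprn_ge0 // ltW.
Qed.

Let sLam : Num.sqrt Lam = Dr * b ^+ 3.
Proof.
rewrite /Lam (_ : Dr ^+ 2 * b ^+ 6 = (Dr * b ^+ 3) ^+ 2); last by ring.
by rewrite sqrtr_sqr ger0_norm // mulr_ge0 ?exprn_ge0 // ltW.
Qed.

Lemma core_A4 : ell * (Num.sqrt (2 * n) * mu + rho + K / Num.sqrt Lam) <= 1.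
Proof.
have [_ _ mu0 _ _] := core_A2.
have s2 : Num.sqrt (2 * n) <= 2 * sn.
  rewrite -[leRHS]ger0_norm ?mulr_ge0 ?(ltW sn0) // -sqrtr_sqr; apply: ler_wsqrtr.
  rewrite exprMn /n; apply: ler_wpM2r; first exact: sqr_ge0.
  by rewrite expr2 -natrM ler_nat.
have t1 : Num.sqrt (2 * n) * mu <= 4 * (ic * M1) * yv.
  apply: (@le_trans _ _ (2 * (sn * mu))); first by rewrite mulrA ler_wpM2r.
  rewrite (_ : 4 * _ * yv = 2 * (2 * (ic * M1) * yv)); last by ring.
  by apply: ler_wpM2l.
have t3 : K / Num.sqrt Lam <= 10 * Kb / b ^+ 2.
  rewrite sLam ler_pdivrMr ?mulr_gt0 ?exprn_gt0 //; apply: (le_trans Kle).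
  by rewrite le_eqVlt; apply/orP; left; apply/eqP; field; rewrite gt_eqF.
apply: (@le_trans _ _ (ell * (4 * (ic * M1) * yv + 4 * ci * (yv * b ^+ 2) + 10 * Kb / b ^+ 2))).
  by apply: ler_wpM2l; [rewrite mulr_ge0 // ltW|apply: lerD => //; apply: lerD].
rewrite -(ler_pM2r b0) mul1r; apply: le_trans h2.
rewrite /ell (_ : s1 * b * _ * b = s1 * (4 * (ic * M1) * (yv * b ^+ 2) + 4 * ci * (yv * b ^+ 4) + 10 * Kb)); last by field; rewrite gt_eqF.
apply: ler_wpM2l; first exact: ltW.
have i0 : 0 <= 4 * (ic * M1) by apply: mulr_ge0 => //; exact: ltW.
have i1 : 0 <= 4 * ci by apply: mulr_ge0 => //; exact: ltW.
rewrite lerD2r; apply: lerD; apply: ler_piMr => //; exact: ybk.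
Qed.

Lemma core_A5 : 1600 * (b * P * ell * (sn * mu + 2 * rho + K / sn) + n^-1)
  + P * b * (Num.sqrt Lam / sn) + 2 * n^-1 <= yv * b ^+ (kappa + 5).
Proof.
have P0 : 0 <= P by apply: mulr_ge0 => //; exact: le_trans (bk _).
have ell0 : 0 <= ell by apply: mulr_ge0; exact: ltW.
have yb0 k : 0 <= yv * b ^+ k by rewrite mulr_ge0 ?exprn_ge0 // ltW.
have Ksn : K / sn <= 20 * Kb * (yv * b).
  apply: (@le_trans _ _ (10 * Kb * b * (Dr / sn))).
    rewrite (_ : 10 * Kb * b * _ = 10 * Kb * Dr * b / sn); last by ring.
    by rewrite ler_pM2r ?invr_gt0.
  rewrite (_ : 20 * Kb * (yv * b) = 10 * Kb * b * (2 * yv)); last by ring.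
  by apply: ler_wpM2l => //; rewrite !mulr_ge0 // ltW.
pose K2 := 2 * (ic * M1) + 8 * ci + 20 * Kb.
have y2 k : (k <= 2)%N -> yv * b ^+ k <= yv * b ^+ 2 by move=> k2; rewrite ler_pM2l // ler_weXn2l.
have W : sn * mu + 2 * rho + K / sn <= K2 * (yv * b ^+ 2).
  rewrite /K2 [leRHS]mulrDl [X in _ <= X + _]mulrDl; apply: lerD; first apply: lerD.
  - apply: (le_trans snmu); apply: ler_wpM2l; first by apply: mulr_ge0 => //; exact: ltW.
    by have := y2 0%N isT; rewrite expr0 mulr1.
  - by apply: (@le_trans _ _ (2 * (4 * ci * (yv * b ^+ 2)))); [apply: ler_wpM2l|rewrite !mulrA -natrM].
  - apply: (le_trans Ksn); apply: ler_wpM2l; first by apply: mulr_ge0 => //; exact: ltW.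
    by have := y2 1%N isT; rewrite expr1.
have ni : n^-1 <= yv * b ^+ (kappa + 4).
  apply: (@le_trans _ _ yv); last by apply: ler_peMr => //; exact: ltW.
  apply: (@le_trans _ _ sn^-1).
    by rewrite lef_pV2 ?posrE ?exprn_gt0 // /n expr2; apply: ler_peMr => //; exact: ltW.
  by rewrite -[leLHS]mul1r ler_pdivrMr.
have t1 : b * P * ell * (sn * mu + 2 * rho + K / sn) <= Pc * s1 * K2 * (yv * b ^+ (kappa + 4)).
  apply: (@le_trans _ _ (b * P * ell * (K2 * (yv * b ^+ 2)))).
    by apply: ler_wpM2l => //; apply: mulr_ge0 => //; apply: mulr_ge0 => //; exact: ltW.
  by rewrite le_eqVlt; apply/orP; left; apply/eqP; rewrite /P /ell exprD; ring.
have t2 : P * b * (Num.sqrt Lam / sn) <= 2 * Pc * (yv * b ^+ (kappa + 4)).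
  rewrite sLam (_ : P * b * _ = Pc * b ^+ (kappa + 4) * (Dr / sn)); last by rewrite /P exprD; ring.
  rewrite (_ : 2 * Pc * _ = Pc * b ^+ (kappa + 4) * (2 * yv)); last by ring.
  by apply: ler_wpM2l => //; apply: mulr_ge0 => //; exact: le_trans (bk _).
apply: (@le_trans _ _ ((1600 * (Pc * s1 * K2 + 1) + 2 * Pc + 2) * (yv * b ^+ (kappa + 4)))).
  exact: core_fact2.
rewrite (_ : yv * b ^+ (kappa + 5) = b * (yv * b ^+ (kappa + 4))); last by rewrite addnS exprS; ring.
exact: ler_wpM2r.
Qed.
End CoreArith.

(** * Bootstrap approximation for finite laws *)
Fact AT_arith (R : realType) (e i P Pc : R) : 0 <= e -> i <= e -> P <= Pc * e ->
  2 * (e + 2 * i) + 2 * P + i <= (2 * Pc + 10) * e.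
Proof. by move=> *; nra. Qed.

Section AT.
Context {R : realType}.
Notation RM := (measurableTypeR R).

Definition sumlaw (I : finType) (q : I -> R) (y : I -> nat -> R) l m M n (t : R) : R :=
  En q n (fun s => (Nrm l m M (vsum y s) <= Num.sqrt n%:R * t)%R%:R).

Definition bootlaw (I : finType) (y : I -> nat -> R) l m M (s : seq I) (t : R) : R :=
  En (@emp R I s) (size s) (fun tau =>
    (Nrm l m M (fun j => vsum y tau j - vsum y s j) <= Num.sqrt (size s)%:R * t)%R%:R).

Definition close (F Fh : R -> R) (Cn r : R) := forall t x, 0 <= x ->
  Fh (t + x) <= F t + Cn * x + r /\ F (t + x) <= Fh t + Cn * x + r.

Lemma close_of_common (A B G : R -> R) (sn h a p w r : R) : 0 < sn -> 0 <= h ->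
  (forall t, A t <= G (t + h) + a /\ G t <= A (t + h) + a) ->
  (forall t, B t <= G (t + h) + a /\ G t <= B (t + h) + a) ->
  (forall t u, 0 <= u -> G (t + u) <= G t + p / sn * u + w) ->
  2 * a + 2 * (p * (h / sn)) + w <= r ->
  close (fun t => A (sn * t)) (fun t => B (sn * t)) p r.
Proof.
move=> s0 h0 HA HB HG hr.
suff K (A' B' : R -> R) : (forall t, A' t <= G (t + h) + a /\ G t <= A' (t + h) + a) ->
  (forall t, B' t <= G (t + h) + a /\ G t <= B' (t + h) + a) -> forall t x, 0 <= x ->
  B' (sn * (t + x)) <= A' (sn * t) + p * x + r.
  by move=> t x x0; split; apply: K.
move=> HA' HB' t x x0; have [HB1 _] := HB' (sn * (t + x)).
have [_ HA2] := HA' (sn * t - h); rewrite subrK in HA2.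
have u0 : 0 <= sn * x + 2 * h by rewrite addr_ge0 // mulr_ge0 // ltW.
have := HG (sn * t - h) _ u0.
have -> : sn * t - h + (sn * x + 2 * h) = sn * (t + x) + h by ring.
have -> : p / sn * (sn * x + 2 * h) = p * x + 2 * (p * (h / sn)) by field; rewrite gt_eqF.
move: HB1 HA2 hr; move: (B' _) (G _) (G _) (A' _) (p * x) (p * _) => z1 z2 z3 z4 z5 z6 *.
lra.
Qed.

Variables (w mom : nat -> R) (c0 cN : R).

Definition admissible (I : finType) (q : I -> R) (y : I -> nat -> R) (l : nat -> nat -> R) m M :=
  [/\ (forall v, 0 <= q v) /\ \sum_v q v = 1,
      forall j, (j < M)%N -> \sum_v q v * y v j = 0,
      forall p j, (j < M)%N -> \sum_v q v * y v j ^+ (2 * p) <= mom p,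
      forall c : nat -> R, c0 * \sum_(j < M) c j ^+ 2 <=
        \sum_(i < M) \sum_(j < M) c i * c j * cov q y i j &
      (forall x : nat -> R, Nrm l m M x ^+ 2 <= \sum_(j < M) w j * x j ^+ 2) /\
      (forall (x : nat -> R) j, (j < M)%N -> Num.sqrt (w j) * `|x j| <= cN * Nrm l m M x)].

Lemma sum_head (D M : nat) (f : nat -> R) : (D <= M)%N ->
  \sum_(j < M) (if (j < D)%N then f j else 0) = \sum_(j < D) f j.
Proof.
by move=> DM; rewrite [RHS](big_ord_widen_cond M (fun=> true) f DM) [RHS]big_mkcond.
Qed.

Variables (alpha Cw Wt wr b yv : R) (S kappa n D M : nat).
Hypotheses (c00 : 0 < c0) (cN0 : 0 < cN) (w0 : forall j, 0 < w j) (mom0 : forall p, 0 <= mom p).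
Hypotheses (alpha0 : 0 <= alpha) (Cw0 : 0 <= Cw) (S0 : (0 < S)%N) (ka : 4 <= kappa%:R * alpha).
Hypothesis wtl : forall k, (0 < k)%N -> \sum_(j < M) (if (j < k)%N then 0 else w j) <= Cw * k%:R `^ (- alpha).
Hypothesis wtot : \sum_(j < M) w j <= Wt.
Hypotheses (wr0 : 0 < wr) (wrP : forall j, (j <= S)%N -> wr <= Num.sqrt (w j)).
Hypotheses (b2 : 2 <= b) (nb : n%:R = b ^+ S) (D0 : (0 < D)%N) (DM : (D <= M)%N).
Hypotheses (Dy : D%:R <= 2 * (yv * Num.sqrt n%:R)) (ysn : 1 <= yv * Num.sqrt n%:R)
  (yb : yv * b ^+ (kappa + 6) <= 1).
Hypothesis wD : \sum_(j < M) (if (j < D)%N then 0 else w j) <= Cw * yv ^+ 2.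

Let ci := c0^-1.
Let M1 := mom 1%N + mom 2%N + 1.
Let c1 := cN / (Num.sqrt (w 0%N) * Num.sqrt c0).
Let Pc := 84 * c1 * S.+2%:R.
Let Kb := 4 * ci + 1.
Let ic := 1 + ci.
Hypotheses (k1 : Wt ^+ S.+1 * gmom (mom 1%N) S.+1 <= b) (k2 : Cw ^+ S.+1 * gmom (mom 1%N) S.+1 <= b)
  (k3 : (4 * (cN / (wr * Num.sqrt c0))) ^+ S.+1 <= b)
  (k4 : 4 * Kb <= b) (k5 : S.+1%:R * (4 * (ic * M1) + 4 * ci + 10 * Kb) <= b)
  (k6 : 1600 * (Pc * S.+1%:R * (2 * (ic * M1) + 8 * ci + 20 * Kb) + 1) + 2 * Pc + 2 <= b)
  (k7 : 2 * mom (2 * S)%N <= b)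
  (k8 : Cw ^+ S.+1 * (rosc S.+1 * (2 * 4 ^+ S.+1 * mom S.+1)) <= b)
  (k9 : (2 * mom (2 * S)%N + 4 * (2 * 4 ^+ (2 * S) * mom (2 * (2 * S))%N)) * rosc (2 * S) <= b)
  (k10 : M1 <= b) (k11 : 2 * Pc + 10 <= b).

Let sn := Num.sqrt (n%:R : R).
Let b0 : 0 < b. Proof. exact: lt_le_trans b2. Qed.
Let b1 : 1 <= b. Proof. by apply: le_trans b2; rewrite ler1n. Qed.
Let bk k : 1 <= b ^+ k. Proof. by rewrite exprn_ege1. Qed.
Let bk0 k : 0 < b ^+ k. Proof. exact: exprn_gt0. Qed.
Let n0 : (0 < n)%N.
Proof. by rewrite -(ltr_nat R) nb. Qed.
Let nR : 0 < n%:R :> R. Proof. by rewrite nb. Qed.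
Let n2 : 2 <= n%:R :> R.
Proof. by rewrite nb; apply: (le_trans b2); rewrite -[leLHS]expr1; apply: ler_weXn2l. Qed.
Let nE : n%:R = sn ^+ 2. Proof. by rewrite sqr_sqrtr // ltW. Qed.
Let sn1 : 1 <= sn. Proof. by rewrite -sqrtr1; apply: ler_wsqrtr; rewrite nb. Qed.
Let sn0 : 0 < sn. Proof. exact: lt_le_trans sn1. Qed.
Let D1 : 1 <= D%:R :> R. Proof. by rewrite ler1n. Qed.
Let ci0 : 0 < ci. Proof. by rewrite invr_gt0. Qed.
Let M11 : 1 <= M1. Proof. by rewrite lerDr addr_ge0. Qed.
Let s11 : 1 <= S.+1%:R :> R. Proof. by rewrite ler1n. Qed.
Let c10 : 0 < c1. Proof. by rewrite divr_gt0 // mulr_gt0 // sqrtr_gt0. Qed.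
Let Pc0 : 0 <= Pc. Proof. by rewrite mulr_ge0 // mulr_ge0 // ltW. Qed.
Let yv0 : 0 < yv. Proof. by have := lt_le_trans ltr01 ysn; rewrite pmulr_lgt0. Qed.
Let ninv : n%:R^-1 <= yv.
Proof.
apply: (@le_trans _ _ sn^-1).
  by rewrite lef_pV2 ?posrE // nE expr2; apply: ler_peMr => //; exact: ltW.
by rewrite -[leLHS]mul1r ler_pdivrMr.
Qed.
Let D2n : D%:R <= 2 * n%:R :> R.
Proof.
apply: (le_trans Dy); apply: ler_wpM2l => //; rewrite [leRHS]nE expr2; apply: ler_wpM2r; first exact: ltW.
apply: (@le_trans _ _ 1) => //; apply: le_trans yb; apply: ler_peMr => //; exact: ltW.
Qed.

Context (I : finType) (q : I -> R) (y : I -> nat -> R) (l : nat -> nat -> R) (m : nat).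
Hypothesis adm : admissible q y l m M.

Let NwD (x : nat -> R) : Nrm l m D x ^+ 2 <= \sum_(j < D) w j * x j ^+ 2.
Proof.
have [_ _ _ _ [Nw _]] := adm.
rewrite -(Nrm_head l m DM) -(sum_head (fun j => w j * x j ^+ 2) DM); apply: (le_trans (Nw _)).
by apply: ler_sum => j _; case: ifP; rewrite ?expr0n /= ?mulr0.
Qed.

Let hcND (x : nat -> R) j : (j < D)%N -> Num.sqrt (w j) * `|x j| <= cN * Nrm l m D x.
Proof.
have [_ _ _ _ [_ hcN]] := adm.
move=> jD; rewrite -(Nrm_head l m DM).
by have := hcN (fun j => if (j < D)%N then x j else 0) j (leq_trans jD DM); rewrite jD.
Qed.

Let wtlD k : (0 < k)%N -> \sum_(j < D) (if (j < k)%N then 0 else w j) <= Cw * k%:R `^ (- alpha).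
Proof.
move=> k0; apply: le_trans (wtl k0); rewrite -(sum_head (fun j => if (j < k)%N then 0 else w j) DM).
by apply: ler_sum => j _; case: ifP => // _; case: ifP => // _; exact: ltW.
Qed.

Let wtotD : \sum_(j < D) (if (j < 0)%N then 0 else w j) <= Wt.
Proof.
apply: le_trans wtot; rewrite -(sum_head (fun j => if (j < 0)%N then 0 else w j) DM).
by apply: ler_sum => j _; case: ifP => //= _; exact: ltW.
Qed.

Let C2P j : (j < D)%N -> cov q y j j <= mom 1%N.
Proof.
have [_ _ ym _ _] := adm.
by move=> jD; apply: le_trans (ym 1%N j (leq_trans jD DM)); rewrite /cov; under eq_bigr do rewrite -expr2.
Qed.

Let whex : exists L T, whitening c0 D (cov q y) L T.
Proof.
have [_ _ _ pd _] := adm.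
apply: (@whitening_exists R I q (fun j v => y v j) c0 D (cov q y) c00) => // c.
rewrite -(sum_head (fun j => c j ^+ 2) DM).
have := pd (fun j => if (j < D)%N then c j else 0).
have -> : \sum_(j < M) (if (j < D)%N then c j else 0) ^+ 2 = \sum_(j < M) (if (j < D)%N then c j ^+ 2 else 0).
  by apply: eq_bigr => j _; case: ifP => //; rewrite expr0n.
move=> /le_trans; apply.
rewrite -(sum_head (fun i => \sum_(j < D) c i * c j * cov q y i j) DM).
apply: ler_sum => i _; case: ifP => _; last by rewrite big1 // => j _; rewrite !mul0r.
rewrite -(sum_head (fun j => c i * c j * cov q y i j) DM).
by apply: ler_sum => j _; case: ifP => // _; rewrite mulr0 mul0r.
Qed.

Let P := Pc * b ^+ kappa.
Let e := yv * b ^+ (kappa + 5).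
Let d0 := M1 / n%:R.
Let d1 := 2 * b ^+ 2 / sn.

Let gauss_head : exists G : R -> R,
  (forall t h, 0 <= h -> G (t + h) <= G t + P / sn * h + n%:R^-1) /\
  forall (q' : I -> R) (y' : I -> nat -> R),
  (forall v, 0 <= q' v) -> \sum_v q' v = 1 ->
  (forall v j, q' v != 0 -> (j < D)%N -> `|y' v j| <= 2 * b) ->
  (forall j, (j < D)%N -> `|\sum_v q' v * y' v j| <= d0) ->
  (forall i j, (i < D)%N -> (j < D)%N -> `|\sum_v q' v * (y' v i * y' v j) - cov q y i j| <= d1) ->
  forall t, `|En q' n (fun s => (Nrm l m D (vsum y' s) <= t)%R%:R) - G t| <= e.
Proof.
have [L [T wh]] := whex.
have [B1 B2 B3] := core_A1 D1 b2 ci0.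
have [A20 A21 A22 A23 A24] := core_A2 sn1 D1 b2 ci0 M11.
have [A30 A31] := core_A3 sn1 D1 b2 Dy ysn yb k4.
have A4 := core_A4 sn1 D1 b2 ci0 M11 s11 Dy ysn yb k4 k5.
have A5 := core_A5 sn1 D1 b2 ci0 M11 s11 Pc0 Dy ysn yb k4 k6.
have P0 : 0 <= P by apply: mulr_ge0 => //; exact: ltW.
have modul (u h : R) : 0 <= h ->
    gpr [set z : D.-tuple RM | Nrm (whl l D L) m D (nth 0 (tval z)) <= u + h] <=
    gpr [set z : D.-tuple RM | Nrm (whl l D L) m D (nth 0 (tval z)) <= u] + P * h + n%:R^-1.
  move=> h0; have := white_modulus c00 wh w0 NwD C2P cN0 alpha0 b1 wr0 Cw0 hcND wrP wtlD ka k2 k3 D0 u h0.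
  by rewrite nb /P /Pc /c1 !mulrA.
set Lam := D%:R ^+ 2 * b ^+ 6 in A30 A31 A4 A5.
have Lam0 : 0 < Lam by rewrite mulr_gt0 // exprn_gt0 // ltr0n.
have tau0 : 0 < Num.sqrt (Lam + n%:R) by rewrite sqrtr_gt0 addr_gt0.
exists (gsm (whl l D L) m D (fun=> 0) (Num.sqrt (Lam + n%:R))); split.
  move=> t h h0; rewrite !gsm_center // mulrDl.
  apply: (le_trans (modul _ _ (divr_ge0 h0 (ltW tau0)))); rewrite lerD2r lerD2l.
  rewrite [leRHS]mulrAC -[leRHS]mulrA; apply: ler_wpM2l => //; apply: ler_wpM2l => //.
  by rewrite lef_pV2 ?posrE //; apply: ler_wsqrtr; rewrite lerDr ltW.
move=> q' y' q'0 q'1 y'b y'm y'c t.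
apply: le_trans A5; rewrite -nE.
rewrite -nE in A4 A20 A22 A24 A31.
apply: (@head_clt R I q' y' q'0 q'1 l m D (cov q y) L T c0 c00 wh (2 * b) d0 d1 (Kb * (D%:R * b ^+ 2)) b n%:R^-1
   (ic * (D%:R * d0)) (D%:R * d1 * ci) Lam P (S.+1%:R * b) n) => //.
- by rewrite invr_gt0.
- by rewrite lef_pV2 ?posrE.
- have h := @whl_tail R l m D (cov q y) L T c0 wh w (mom 1%N) (fun j => ltW (w0 j)) NwD C2P 0 S b b0.
  rewrite (_ : [set z : D.-tuple RM | ~ (Nrm (whl l D L) m D (nth 0 (tval z)) <= b)] =
    [set z : D.-tuple RM | ~ (Nrm (whl l D L) m D (htail 0 (nth 0 (tval z))) <= b)]); last first.
    by apply/funext => z /=; rewrite (@eq_Nrm _ _ _ _ (htail 0 (nth 0 (tval z))) (nth 0 (tval z))).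
  apply: (le_trans h); rewrite nb ler_pdivrMr //.
  apply: (@le_trans _ _ (Wt ^+ S.+1 * gmom (mom 1%N) S.+1)).
    apply: ler_wpM2r; first exact: gmom_ge0.
    have sw0 : 0 <= \sum_(j < D) (if (j < 0)%N then 0 else w j).
      by apply: sumr_ge0 => j _; exact: ltW.
    by rewrite lerXn2r ?nnegrE //; exact: le_trans wtotD.
  apply: (le_trans k1); rewrite exprVn mulrC ler_pdivlMr ?exprn_gt0 // -exprM -exprS.
  by apply: ler_weXn2l => //; rewrite mulnC mulnS add2n.
- exact: harmonic_le.
Qed.

Let g := b / sn.
Let pb : R := (n%:R ^+ 2)^-1.

Let hpb : \sum_v q v * (bad y D b v)%:R <= pb.
Proof.
have [[q0 q1] y0 ym _ _] := adm.
apply: (le_trans (prob_bad (y := y) q0 DM ym (2 * S) b0)).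
rewrite ler_pdivrMr // /pb nb [leRHS]mulrC ler_pdivlMr ?exprn_gt0 //.
apply: (@le_trans _ _ (2 * b ^+ S * mom (2 * S)%N * (b ^+ S) ^+ 2)).
  by apply: ler_wpM2r; [exact: sqr_ge0|apply: ler_wpM2r => //; rewrite -nb].
rewrite (_ : 2 * _ * _ * _ = (2 * mom (2 * S)%N) * (b ^+ S) ^+ 3); last by ring.
apply: (@le_trans _ _ (b ^+ S * (b ^+ S) ^+ 3)).
  apply: ler_wpM2r; first exact/ltW/exprn_gt0.
  by apply: (le_trans k7); rewrite -[leLHS]expr1; apply: ler_weXn2l.
by rewrite -exprS -exprM [(S * 4)%N]mulnC mulnA.
Qed.

Theorem AT_core :
  En q n (fun s => (~~ `[< close (sumlaw q y l m M n) (bootlaw y l m M s) P (yv * b ^+ (kappa + 6)) >])%:R)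
   <= 3 / n%:R.
Proof.
have [[q0 q1] y0 ym _ [Nw _]] := adm.
have [G [Gmod HC]] := gauss_head.
have ni0 : 0 < n%:R^-1 :> R by rewrite invr_gt0.
have sb : sn <= n%:R by rewrite nE expr2; apply: ler_peMr => //; exact: ltW.
have d1b : b / sn <= d1.
  rewrite /d1 ler_pM2r ?invr_gt0 // expr2 mulrA; apply: ler_peMl; first exact: ltW.
  by apply: mulr_ege1 => //; rewrite ler1n.
have d0M x : 0 <= x -> x <= mom 1%N + mom 2%N -> (n%:R^-1 * x + pb / n%:R^-1) / 2 <= M1 / n%:R.
  move=> x0 xm; rewrite /pb invrK ler_pdivrMr // (_ : n%:R ^- 2 * n%:R = n%:R^-1).
    rewrite [leLHS](_ : _ = n%:R^-1 * (x + 1)); last by ring.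
    rewrite [leRHS](_ : _ = n%:R^-1 * (2 * M1)); last by ring.
    apply: ler_wpM2l; first exact: ltW.
    apply: (@le_trans _ _ M1); first by rewrite lerD2r.
    by apply: ler_peMl; [exact: le_trans M11|rewrite ler1n].
  by rewrite expr2 invfM -mulrA mulVf ?mulr1 // gt_eqF.
have hd0 : (n%:R^-1 * mom 1%N + pb / n%:R^-1) / 2 <= d0.
  by apply: d0M => //; rewrite lerDl.
have hd1 : (n%:R^-1 * mom 2%N + pb / n%:R^-1) / 2 <= d1.
  apply: (@le_trans _ _ (M1 / n%:R)); first by apply: d0M => //; rewrite lerDr.
  apply: le_trans d1b; apply: ler_pM; [exact: le_trans M11|exact: ltW|exact: k10|].
  by rewrite lef_pV2 ?posrE.
have hd00 : 0 <= d0 by apply: divr_ge0; [exact: le_trans M11|exact: ltW].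
have b2b : b <= 2 * b by apply: ler_peMl; [exact: ltW|rewrite ler1n].
have g0 : 0 < g by rewrite divr_gt0.
have gle : b + g <= 2 * b.
  by rewrite mulr_natl mulr2n lerD2l /g ler_pdivrMr //; apply: ler_peMr => //; exact: ltW.
have gg : g + g ^+ 2 <= d1.
  rewrite /d1 (_ : 2 * b ^+ 2 / sn = b ^+ 2 / sn + b ^+ 2 / sn); last by ring.
  apply: lerD; rewrite /g.
    by rewrite ler_pM2r ?invr_gt0 // -[leLHS]expr1; apply: ler_weXn2l.
  rewrite exprMn exprVn; apply: ler_wpM2l; first exact/ltW.
  by rewrite lef_pV2 ?posrE ?exprn_gt0 // expr2; apply: ler_peMr => //; exact: ltW.
pose h := sn * (yv * b).
have h0 : 0 < h by rewrite mulr_gt0 // mulr_gt0.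
have bn : b <= n%:R by rewrite nb -[leLHS]expr1; apply: ler_weXn2l.
have tl (X : R) : 0 <= X -> Cw ^+ S.+1 * (rosc S.+1 * X) <= b ->
    (\sum_(j < M) wtail D w j) ^+ S.+1 * (rosc S.+1 * n%:R ^+ S.+1 * X) / h ^+ (2 * S.+1) <= (n%:R ^+ 2)^-1.
  move=> X0 hX; set W := \sum_(j < M) wtail D w j.
  have W0 : 0 <= W by apply: sumr_ge0 => j _; rewrite /wtail; case: ifP => // _; exact: ltW.
  have r0 : 0 <= rosc S.+1 :> R := rosc_ge0 S.+1.
  have X1 : 0 <= rosc S.+1 * X by exact: mulr_ge0.
  apply: (@le_trans _ _ ((Cw * yv ^+ 2) ^+ S.+1 * (rosc S.+1 * n%:R ^+ S.+1 * X) / h ^+ (2 * S.+1))).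
    apply: ler_wpM2r; first by rewrite invr_ge0 exprn_ge0 // ltW.
    apply: ler_wpM2r; first by rewrite mulrAC mulr_ge0 // exprn_ge0 // ltW.
    by rewrite lerXn2r ?nnegrE // mulr_ge0 ?exprn_ge0 // ltW.
  rewrite [leLHS](_ : _ = Cw ^+ S.+1 * (rosc S.+1 * X) / (b ^+ 2) ^+ S.+1); last first.
    have hh : h ^+ (2 * S.+1) = n%:R ^+ S.+1 * ((yv ^+ 2) ^+ S.+1 * (b ^+ 2) ^+ S.+1).
      by rewrite exprM {1}/h [(sn * _) ^+ 2]exprMn -nE [(yv * b) ^+ 2]exprMn [LHS]exprMn [X in _ * X = _]exprMn.
    rewrite hh [(Cw * _) ^+ _]exprMn.
    have z1 : n%:R ^+ S.+1 != 0 :> R by rewrite expf_neq0 // gt_eqF.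
    have z2 : (yv ^+ 2) ^+ S.+1 != 0 by rewrite !expf_neq0 // gt_eqF.
    have z3 : (b ^+ 2) ^+ S.+1 != 0 by rewrite !expf_neq0 // gt_eqF.
    move: z1 z2 z3; move: (n%:R ^+ S.+1) ((yv ^+ 2) ^+ S.+1) ((b ^+ 2) ^+ S.+1) (Cw ^+ S.+1) (rosc S.+1) => u1 u2 u3 u4 u5 z1 z2 z3.
    by field; rewrite z1 z2 z3.
  rewrite ler_pdivrMr ?exprn_gt0 //; apply: (le_trans hX).
  rewrite nb mulrC ler_pdivlMr ?exprn_gt0 // -!exprM -exprS; apply: ler_weXn2l => //.
  by rewrite mulnC mulnS add2n.
have n21 : (n%:R ^+ 2)^-1 <= n%:R^-1 :> R.
  by rewrite lef_pV2 ?posrE ?exprn_gt0 // expr2; apply: ler_peMr; [exact: ltW|rewrite ler1n].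
have m0 := mom0 S.+1.
have e44 : 1 <= 2 * 4 ^+ S.+1 :> R by apply: mulr_ege1; rewrite ?ler1n // exprn_ege1 // ler1n.
have m4 : 0 <= 2 * 4 ^+ S.+1 * mom S.+1 by apply: mulr_ge0 => //; exact: le_trans e44.
have TL1 : En q n (fun s => (h < Nrm l m M (htail D (vsum y s)))%R%:R) <= n%:R^-1.
  have LT := law_tail q0 q1 D (fun j => ltW (w0 j)) Nw y0 ym n S h0.
  apply: (le_trans LT).
  apply: (le_trans (tl _ m0 _)) => //; apply: le_trans k8; apply: ler_wpM2l; first exact: exprn_ge0.
  by apply: ler_wpM2l; [exact: rosc_ge0|apply: ler_peMl].
pose tb s : bool := n%:R^-1 < En (@emp R I s) n (fun tau =>
       (h < Nrm l m M (htail D (fun j => vsum y tau j - vsum y s j)))%R%:R).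
have TL2 : En q n (fun s => (tb s)%:R) <= n%:R^-1.
  have BT := boot_tail q0 q1 D (fun j => ltW (w0 j)) Nw ym n0 S h0 ni0.
  apply: (le_trans BT).
  rewrite invrK; apply: (@le_trans _ _ ((n%:R ^+ 2)^-1 * n%:R)); first by rewrite ler_pM2r //; exact: tl.
  by rewrite expr2 invfM -mulrA mulVf ?mulr1 // gt_eqF.
have NG : En q n (fun s => (~~ good_sample q y D b g s)%:R) <= 2 / n%:R.
  apply: (le_trans (prob_not_good q0 q1 DM y0 ym n0 (2 * S) g0 hpb)).
  have n22 : 2 / n%:R = n%:R^-1 + n%:R^-1 :> R by rewrite mulr_natl mulr2n.
  rewrite n22; apply: lerD.
    by rewrite /pb expr2 invfM mulrA mulfV ?mul1r // gt_eqF.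
  set p := (2 * S)%N; set X := 2 * 4 ^+ p * mom (2 * p)%N.
  have X0 : 0 <= X by rewrite mulr_ge0 // mulr_ge0 // exprn_ge0.
  have r0 : 0 <= rosc p :> R := rosc_ge0 p.
  have -> : n%:R * g = sn * b by rewrite nE /g; field; rewrite gt_eqF.
  apply: (@le_trans _ _ (n%:R ^+ 2 * (2 * mom p + 4 * X) * rosc p * n%:R ^+ p / (sn * b) ^+ (2 * p))).
    apply: ler_wpM2r; first by rewrite invr_ge0 exprn_ge0 // mulr_ge0 // ltW.
    apply: ler_wpM2r; first by rewrite exprn_ge0 // ltW.
    apply: ler_wpM2r => //; rewrite mulrDr; apply: lerD.
      rewrite mulrA; apply: ler_wpM2r => //; apply: (le_trans D2n); rewrite mulrC; apply: ler_wpM2r => //.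
      by rewrite expr2; apply: ler_peMr; [exact: ltW|rewrite ler1n].
    rewrite mulrA; apply: ler_wpM2r => //.
    rewrite (_ : n%:R ^+ 2 * 4 = (2 * n%:R) ^+ 2); last by ring.
    by rewrite lerXn2r ?nnegrE // mulr_ge0 // ltW.
  rewrite [leLHS](_ : _ = (n%:R ^+ 2 / b ^+ (2 * p)) * ((2 * mom p + 4 * X) * rosc p)); last first.
    rewrite exprMn [sn ^+ (2 * p)]exprM -nE; field.
    by rewrite !expf_neq0 // gt_eqF.
  rewrite (_ : b ^+ (2 * p) = n%:R ^+ 4); last by rewrite nb -exprM /p mulnA [(S * 4)%N]mulnC.
  rewrite (_ : n%:R ^+ 2 / n%:R ^+ 4 = (n%:R ^+ 2)^-1); last by field; rewrite gt_eqF.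
  apply: (@le_trans _ _ ((n%:R ^+ 2)^-1 * n%:R)).
    by apply: ler_wpM2l; [rewrite invr_ge0 exprn_ge0 // ltW|apply: le_trans bn].
  by rewrite expr2 invfM -mulrA mulVf ?mulr1 // gt_eqF.
apply: (@le_trans _ _ (En q n (fun s => (~~ good_sample q y D b g s || tb s)%:R))); last first.
  apply: (le_trans (En_or q0 n (fun s => ~~ good_sample q y D b g s) tb)).
  rewrite (_ : 3 / n%:R = 2 / n%:R + n%:R^-1); first exact: lerD.
  by rewrite -[3]/(2 + 1)%:R natrD mulrDl mul1r.
apply: En_sub => // s szs; apply: contraR; rewrite negb_or negbK => /andP[gs]; rewrite -leNgt => ntb.
apply/asboolP.
have e0 : 0 <= e by rewrite mulr_ge0 ?exprn_ge0 // ltW.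
pose a := e + 2 / n%:R.
have a2 : e + n%:R^-1 + n%:R^-1 <= a by rewrite /a mulrDl mul1r addrA.
rewrite /sumlaw /bootlaw szs -/sn.
apply: (@close_of_common (fun T => En q n (fun s => (Nrm l m M (vsum y s) <= T)%R%:R))
  (fun T => En (@emp R I s) n (fun tau => (Nrm l m M (fun j => vsum y tau j - vsum y s j) <= T)%R%:R)) G sn h a P n%:R^-1) => //.
- exact: ltW.
- move=> T.
  have LH T' := law_head q0 q1 DM y0 ym HC T' b0 b2b ni0 hpb hd0 hd1.
  have npb : n%:R * pb = n%:R^-1 by rewrite /pb expr2 invfM mulrA mulfV ?mul1r // gt_eqF.
  rewrite npb in LH; split.
    apply: (le_trans (En_split DM q0 TL1 T)).
    have := LH (T + h); rewrite ler_norml => /andP[_]; rewrite lerBlDl => LH'.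
    apply: (le_trans (lerD LH' (lexx _))); rewrite -addrA lerD2l.
    exact: a2.
  have := LH T; rewrite distrC ler_norml => /andP[_]; rewrite lerBlDl => LH'.
  apply: (le_trans LH'); have := En_split' DM q0 TL1 T => ES.
  apply: (le_trans (lerD ES (lexx _))); rewrite -addrA lerD2l addrC.
  exact: a2.
- move=> T; have es0 := @emp_ge0 R I s.
  have BH T' := boot_head n0 HC T' szs (ltW g0) gle hd00 gg gs.
  have a1 : n%:R^-1 + e <= a by apply: le_trans a2; rewrite addrC lerDl ltW.
  split.
    apply: (le_trans (En_split DM es0 ntb T)).
    have := BH (T + h); rewrite ler_norml => /andP[_]; rewrite lerBlDl => LH'.
    apply: (le_trans (lerD LH' (lexx _))); rewrite -addrA lerD2l addrC.
    exact: a1.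
  have := BH T; rewrite distrC ler_norml => /andP[_]; rewrite lerBlDl => LH'.
  apply: (le_trans LH'); have := En_split' DM es0 ntb T => ES.
  apply: (le_trans (lerD ES (lexx _))); rewrite -addrA lerD2l.
  exact: a1.
have hs : h / sn = yv * b by rewrite /h mulrAC mulfV ?mul1r // gt_eqF.
rewrite hs (_ : yv * b ^+ (kappa + 6) = b * e); last by rewrite /e addnS exprS; ring.
have y1 : yv <= e by rewrite /e; apply: ler_peMr => //; exact: ltW.
have n1e : n%:R^-1 <= e by exact: le_trans y1.
have Pe : P * (yv * b) <= Pc * e.
  rewrite /P /e (_ : Pc * _ * (yv * b) = Pc * (yv * b ^+ (kappa + 1))); last by rewrite exprD; ring.
  apply: ler_wpM2l => //; apply: ler_wpM2l; first exact: ltW.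
  by apply: ler_weXn2l => //; rewrite leq_add2l.
apply: (@le_trans _ _ ((2 * Pc + 10) * e)); last exact: ler_wpM2r.
exact: (AT_arith e0 n1e Pe).
Qed.
End AT.

Lemma close_mono (R : realType) (F Fh : R -> R) (Cn r r' : R) : r <= r' -> close F Fh Cn r -> close F Fh Cn r'.
Proof.
move=> rr H t x x0; have [H1 H2] := H t x x0.
by split; [apply: (le_trans H1)|apply: (le_trans H2)]; rewrite lerD2l.
Qed.

Lemma min_pos (R : realType) (f : nat -> R) (S : nat) : (forall j, 0 < f j) ->
  exists2 e : R, 0 < e & forall j, (j <= S)%N -> e <= f j.
Proof.
move=> f0; elim: S => [|S [e e0 IH]].
  by exists (f 0%N) => // j; rewrite leqn0 => /eqP ->.
exists (Num.min e (f S.+1)); first by rewrite lt_min e0 f0.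
move=> j; rewrite leq_eqVlt => /orP[/eqP ->|]; first by rewrite ge_min lexx orbT.
by rewrite ltnS => /IH h; rewrite ge_min h.
Qed.

Lemma le_sum_norm (R : realType) (s : seq R) (k : R) : k \in s -> k <= 2 + \sum_(i <- s) `|i|.
Proof.
move=> ks; rewrite (big_rem _ ks) /= addrCA; apply: (le_trans (ler_norm k)).
by rewrite lerDl addr_ge0 // sumr_ge0.
Qed.

(** The exponent of the rate falls short of the balanced one, [alpha / (2 * alpha + 4)], and
    the difference pays for every loss that is a small power of [n]. *)
Theorem AT (R : realType) (w mom : nat -> R) (c0 cN alpha Cw Wt : R) :
  0 < c0 -> 0 < cN -> 0 < alpha -> 0 <= Cw -> (forall j, 0 < w j) -> (forall p, 0 <= mom p) ->
  (forall M k, (0 < k)%N -> \sum_(j < M) (if (j < k)%N then 0 else w j) <= Cw * k%:R `^ (- alpha)) ->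
  (forall M, \sum_(j < M) w j <= Wt) ->
  exists2 c : R, 0 < c & forall n, (0 < n)%N -> exists2 Cn : R, 0 <= Cn &
    forall (I : finType) (q : I -> R) y l m M, (0 < M)%N -> admissible w mom c0 cN q y l m M ->
    En q n (fun s => (~~ `[< close (sumlaw q y l m M n) (bootlaw y l m M s) Cn
       (c * n%:R `^ (- (alpha / (2 * alpha + 5)))) >])%:R) <= c / n%:R.
Proof.
move=> c00 cN0 al0 Cw0 w0 mom0 wtl wtot.
pose kappa := (Num.truncn (4 / alpha)).+1.
have ka : 4 <= kappa%:R * alpha.
  have q0 : 0 <= 4 / alpha by rewrite divr_ge0 // ltW.
  have /andP[_ h] := truncn_itv q0.
  by rewrite -ler_pdivrMr // ltW.
pose gap := alpha / (2 * alpha + 4) - alpha / (2 * alpha + 5).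
have p4 : 0 < 2 * alpha + 4 by rewrite addr_gt0 // mulr_gt0.
have p5 : 0 < 2 * alpha + 5 by rewrite addr_gt0 // mulr_gt0.
have gap0 : 0 < gap.
  rewrite subr_gt0 ltr_pM2l // ltf_pV2 ?posrE // ltrD2l ltr_nat //.
pose S := (Num.truncn ((kappa + 6)%:R / gap)).+1.
have Sgap : (kappa + 6)%:R / S%:R <= gap.
  have q0 : 0 <= (kappa + 6)%:R / gap by rewrite divr_ge0 // ltW.
  have /andP[_ h] := truncn_itv q0.
  by rewrite ler_pdivrMr ?ltr0n // mulrC -ler_pdivrMr // ltW.
have sw0 j : 0 < Num.sqrt (w j) by rewrite sqrtr_gt0.
have [wr wr0 wrP] := min_pos S sw0.
pose ci := c0^-1; pose M1 := mom 1%N + mom 2%N + 1.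
pose c1 := cN / (Num.sqrt (w 0%N) * Num.sqrt c0).
pose Pc := 84 * c1 * S.+2%:R; pose Kb := 4 * ci + 1; pose ic := 1 + ci.
pose ks := [:: Wt ^+ S.+1 * gmom (mom 1%N) S.+1; Cw ^+ S.+1 * gmom (mom 1%N) S.+1;
  (4 * (cN / (wr * Num.sqrt c0))) ^+ S.+1; 4 * Kb;
  S.+1%:R * (4 * (ic * M1) + 4 * ci + 10 * Kb);
  1600 * (Pc * S.+1%:R * (2 * (ic * M1) + 8 * ci + 20 * Kb) + 1) + 2 * Pc + 2;
  2 * mom (2 * S)%N; Cw ^+ S.+1 * (rosc S.+1 * (2 * 4 ^+ S.+1 * mom S.+1));
  (2 * mom (2 * S)%N + 4 * (2 * 4 ^+ (2 * S) * mom (2 * (2 * S))%N)) * rosc (2 * S); M1; 2 * Pc + 10].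
pose Cb := 2 + \sum_(i <- ks) `|i|.
have Cb2 : 2 <= Cb by rewrite lerDl sumr_ge0.
have Cb0 : 0 < Cb by apply: lt_le_trans Cb2.
have CbS : 0 < Cb ^+ S by exact: exprn_gt0.
exists (3 + Cb ^+ S); first by rewrite addr_gt0.
move=> n n0; have nR : 0 < n%:R :> R by rewrite ltr0n.
have n1 : 1 <= n%:R :> R by rewrite ler1n.
have [nC|Cn] := ltP n%:R (Cb ^+ S).
  exists 0 => // I q y l m M _ [[q0 q1] _ _ _ _].
  apply: (@le_trans _ _ 1).
    rewrite -[leRHS](En_cst q1 n 1); apply: En_le => // s _; by case: (~~ _).
  rewrite ler_pdivlMr // mul1r; apply: (le_trans (ltW nC)).
  by rewrite lerDr.
pose b := n%:R `^ S%:R^-1 : R.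
have nb : n%:R = b ^+ S.
  by rewrite -powR_mulrn ?powR_ge0 // -powRrM mulVf ?pnatr_eq0 // powRr1 // ltW.
have b0 : 0 <= b by exact: powR_ge0.
have Cbb : Cb <= b.
  by rewrite -(@ler_pXn2r _ S) ?nnegrE ?(ltW Cb0) // -nb.
have kb k : k \in ks -> k <= b by move=> kk; apply: le_trans Cbb; exact: le_sum_norm.
exists (Pc * b ^+ kappa).
  rewrite mulr_ge0 ?exprn_ge0 // /Pc mulr_ge0 // mulr_ge0 // divr_ge0 ?(ltW cN0) // mulr_ge0 // sqrtr_ge0.
move=> I q y l m M M0 adm.
pose D0 : R := n%:R `^ (2 + alpha)^-1.
have a20 : 0 < 2 + alpha by rewrite addr_gt0.
have nn0 : n%:R != 0 :> R by rewrite gt_eqF.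
have pD x z : n%:R `^ (x + z) = n%:R `^ x * n%:R `^ z :> R by rewrite powRD // nn0 implybT.
have D01 : 1 <= D0.
  by rewrite -(powRr0 n%:R); apply: ler_powR => //; rewrite invr_ge0 ltW.
pose yv : R := n%:R `^ (- (alpha / (2 * alpha + 4))).
have yv0 : 0 < yv by exact: powR_gt0.
have D0E : D0 = yv * Num.sqrt n%:R.
  rewrite -powR12_sqrt ?(ltW nR) // -pD /D0; congr (_ `^ _).
  by field; rewrite !gt_eqF //.
have yv2 : D0 `^ (- alpha) = yv ^+ 2.
  rewrite expr2 -pD /D0 -powRrM; congr (_ `^ _).
  by field; rewrite !gt_eqF //.
have bk : yv * b ^+ (kappa + 6) <= n%:R `^ (- (alpha / (2 * alpha + 5))).
  rewrite -powR_mulrn // -powRrM -pD; apply: ler_powR => //.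
  rewrite -lerBrDl opprK addrC mulrC; exact: Sgap.
have rate1 : n%:R `^ (- (alpha / (2 * alpha + 5))) <= 1 :> R.
  rewrite -[leRHS](powRr0 n%:R); apply: ler_powR => //.
  by rewrite oppr_le0 divr_ge0 // ltW.
pose D' := (Num.truncn D0).+1.
have D00 : 0 <= D0 by exact: le_trans D01.
have /andP[tr1 tr2] := truncn_itv D00.
have D'2 : D'%:R <= 2 * D0.
  by rewrite /D' -natr1 [leRHS]mulr_natl mulr2n; apply: lerD.
pose D := minn M D'.
have Dgt0 : (0 < D)%N by rewrite leq_min M0.
have DM : (D <= M)%N by exact: geq_minl.
have DD : D%:R <= 2 * (yv * Num.sqrt n%:R).
  by rewrite -D0E; apply: le_trans D'2; rewrite ler_nat geq_minr.
have wD : \sum_(j < M) (if (j < D)%N then 0 else w j) <= Cw * yv ^+ 2.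
  have [MD|DM'] := leqP M D'.
    rewrite big1; first by apply: mulr_ge0 => //; exact: sqr_ge0.
    move=> j _.
    by rewrite /D (minn_idPl MD) ltn_ord.
  apply: (le_trans (wtl M D Dgt0)); apply: ler_wpM2l => //.
  rewrite -yv2 !powRN lef_pV2 ?posrE ?powR_gt0 ?ltr0n // ?(lt_le_trans ltr01 D01) //.
  apply: ge0_ler_powR; rewrite ?nnegrE ?(ltW al0) //.
  by rewrite /D (minn_idPr (ltnW DM')) ltW.
have ysn : 1 <= yv * Num.sqrt n%:R by rewrite -D0E.
have yb : yv * b ^+ (kappa + 6) <= 1 by exact: le_trans rate1.
have S0 : (0 < S)%N by [].
have b2 : 2 <= b by exact: le_trans Cbb.
have K := @AT_core R w mom c0 cN alpha Cw Wt wr b yv S kappa n D M c00 cN0 w0 mom0 (ltW al0) Cw0 S0 ka (wtl M) (wtot M)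
  wr0 wrP b2 nb Dgt0 DM DD ysn yb wD.
apply: (@le_trans _ _ (3 / n%:R)); last first.
  by rewrite ler_pM2r ?invr_gt0 // lerDl ltW.
apply: le_trans (K _ _ _ _ _ _ _ _ _ _ _ I q y l m adm); try by apply: kb; rewrite !inE eqxx ?orbT.
have [[q0 _] _ _ _ _] := adm.
apply: En_sub => // s _; apply: contra => /asboolP H; apply/asboolP.
apply: close_mono H; apply: (le_trans bk); apply: ler_peMl; first exact: powR_ge0.
by apply: (@le_trans _ _ (3 + 0)); [rewrite addr0 ler1n|rewrite lerD2l ltW].
Qed.

(** * From cell counts to probabilities *)
Section RealProb.
Context {R : realType} {d : measure_display} {T : measurableType d} (P : probability T R).

Definition pr (A : set T) : R := fine (P A).

Lemma prE A : measurable A -> P A = (pr A)%:E.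
Proof. by move=> mA; rewrite fineK // fin_num_measure. Qed.

Lemma pr_ge0 A : 0 <= pr A. Proof. by rewrite fine_ge0. Qed.

Lemma pr_set0 : pr set0 = 0. Proof. by rewrite /pr measure0. Qed.

Lemma pr_setT : pr setT = 1. Proof. by rewrite /pr probability_setT. Qed.

Lemma pr_mono A B : measurable A -> measurable B -> A `<=` B -> pr A <= pr B.
Proof. by move=> mA mB AB; rewrite -lee_fin -!prE // le_measure ?inE. Qed.

Lemma pr_le1 A : measurable A -> pr A <= 1.
Proof. by move=> mA; rewrite -pr_setT; apply: pr_mono. Qed.

Lemma pr_disj A B : measurable A -> measurable B -> A `&` B = set0 -> pr (A `|` B) = pr A + pr B.
Proof.
move=> mA mB AB; apply: EFin_inj; rewrite EFinD -!prE //; first exact: measureU.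
exact: measurableU.
Qed.

Lemma pr_sub2 A B C : measurable A -> measurable B -> measurable C -> A `<=` B `|` C -> pr A <= pr B + pr C.
Proof.
move=> mA mB mC ABC; apply: (@le_trans _ _ (pr (B `|` (C `\` B)))).
  apply: pr_mono => //; first by apply: measurableU => //; exact: measurableD.
  by move=> w /ABC [Bw|Cw]; [left|have [?|?] := pselect (B w); [left|right]].
rewrite pr_disj //; last by rewrite setDE setICA setICr setI0.
  by rewrite lerD2l; apply: pr_mono => //; exact: measurableD.
exact: measurableD.
Qed.

Lemma pr_setC A : measurable A -> pr (~` A) = 1 - pr A.
Proof.
move=> mA; rewrite -pr_setT -(setvU A) pr_disj ?setICl ?addrK //; exact: measurableC.
Qed.

Lemma pr_bigcup_seq (J : eqType) (r : seq J) (A : J -> set T) B : measurable B ->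
  (forall j, measurable (A j)) -> (forall w, B w -> exists2 j, j \in r & A j w) ->
  pr B <= \sum_(j <- r) pr (A j).
Proof.
move=> mB mA; elim: r B mB => [|j r IH] B mB h.
  rewrite big_nil (_ : B = set0) ?pr_set0 //; apply/seteqP; split => // w /h[] //.
rewrite big_cons; apply: (@le_trans _ _ (pr (A j) + pr (B `\` A j))).
  apply: pr_sub2 => //; first exact: measurableD.
  by move=> w Bw; have [Aw|Aw] := pselect (A j w); [left|right].
rewrite lerD2l; apply: IH; first exact: measurableD.
move=> w [Bw nAw]; have [k] := h _ Bw; rewrite inE => /orP[/eqP -> //|kr Akw].
by exists k.
Qed.

Lemma pr_partition (J : finType) (f : T -> J) A : measurable A -> (forall j, measurable (f @^-1` [set j])) ->
  pr A = \sum_j pr (A `&` f @^-1` [set j]).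
Proof.
move=> mA mf.
have K (r : seq J) : uniq r -> measurable (A `&` [set w | f w \in r]) /\
    pr (A `&` [set w | f w \in r]) = \sum_(j <- r) pr (A `&` f @^-1` [set j]).
  elim: r => [_|j r IH /= /andP[jr ur]].
    rewrite big_nil (_ : _ `&` _ = set0) ?pr_set0 //; apply/seteqP; split => // w [].
    by rewrite /= in_nil.
  have [mr er] := IH ur.
  have e : A `&` [set w | f w \in j :: r] = (A `&` f @^-1` [set j]) `|` (A `&` [set w | f w \in r]).
    apply/seteqP; split => w /=.
      by case=> Aw; rewrite inE => /orP[/eqP|] h; [left|right].
    by case=> -[Aw h]; split => //; rewrite inE; [rewrite h eqxx|rewrite h orbT].
  have mj : measurable (A `&` f @^-1` [set j]) by exact: measurableI.
  rewrite e big_cons pr_disj //; first by split; [exact: measurableU|rewrite er].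
  apply/seteqP; split => // w [[_ /= fw] [_ /= h]].
  by move: jr; rewrite -fw h.
have [_] := K (index_enum J) (index_enum_uniq J).
rewrite (_ : A `&` _ = A) //; apply/seteqP; split => w; first by case.
by move=> Aw; split => //=; rewrite mem_index_enum.
Qed.

Context {I : finType}.

(** Revealing the coordinates one at a time turns a product formula on cells into an
    expectation over sequences. *)
Lemma cells_law (C : nat -> T -> I) (N : nat) (q : I -> R) (A : set T) (K : R) (F : pred (seq I)) :
  measurable A -> (forall i v, measurable (C i @^-1` [set v])) ->
  (forall s, size s = N -> pr (A `&` [set w | mkseq (C^~ w) N = s]) = K * \prod_(v <- s) q v) ->
  pr (A `&` [set w | F (mkseq (C^~ w) N)]) = K * En q N (fun s => (F s)%:R).
Proof.
move=> mA mC h.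
have mpre k (s : seq I) : measurable [set w | mkseq (C^~ w) k = s].
  elim: k s => [|k IH] s.
    case: s => [|v s]; first by rewrite (_ : [set _ | _] = setT) //; apply/seteqP; split.
    by rewrite (_ : [set _ | _] = set0) //; apply/seteqP; split.
  case/lastP: s => [|s v].
    by rewrite (_ : [set _ | _] = set0) //; apply/seteqP; split => // w /= /(congr1 size).
  rewrite (_ : [set _ | _] = [set w | mkseq (C^~ w) k = s] `&` C k @^-1` [set v]).
    by apply: measurableI.
  apply/seteqP; split => w /=; rewrite mkseqS; first by move/rcons_inj => [-> ->].
  by case=> -> ->.
have mF : measurable [set w | F (mkseq (C^~ w) N)].
  rewrite (_ : [set _ | _] = \bigcup_(t in [set t : N.-tuple I | F t]) [set w | mkseq (C^~ w) N = t]).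
    by apply: fin_bigcup_measurable => //; exact: finite_finset.
  apply/seteqP; split => w /=; last by case=> t /= Ft ->.
  move=> Fw; have sN : size (mkseq (C^~ w) N) == N by rewrite size_mkseq.
  by exists (Tuple sN).
pose base s := A `&` [set w | F (mkseq (C^~ w) N)] `&` [set w | mkseq (C^~ w) (size s) = s].
suff K1 k : forall s, (size s + k)%N = N -> pr (base s) = K * ((\prod_(v <- s) q v) * En q k (fun s' => (F (s ++ s'))%:R)).
  have := K1 N [::] (add0n N); rewrite big_nil mul1r /base /= => <-; congr pr.
  by apply/seteqP; split => w //= [].
elim: k => [|k IH] s sN.
  rewrite addn0 in sN; rewrite /= cats0 /base sN.
  have [Fs|nFs] := boolP (F s).
    rewrite mulr1 -h // -setIA; congr (pr (_ `&` _)); apply/seteqP; split => w /=; first by case.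
    by move=> e; rewrite e.
  rewrite mulr0 mulr0 (_ : _ `&` _ = set0) ?pr_set0 //; apply/seteqP; split => // w /= [[_ Fw] e].
  by move: nFs; rewrite -e Fw.
have mb : measurable (base s) by apply: measurableI => //; exact: measurableI.
rewrite (pr_partition (f := C (size s)) mb (mC (size s))).
rewrite /= !mulr_sumr; apply: eq_bigr => v _.
have -> : base s `&` C (size s) @^-1` [set v] = base (rcons s v).
  rewrite /base size_rcons -setIA; congr (_ `&` _); apply/seteqP; split => w /=; rewrite mkseqS.
    by case=> -> ->.
  by move/rcons_inj => [-> ->].
rewrite IH; last by rewrite size_rcons addSnnS.
rewrite -cats1 big_cat big_seq1 /= !mulrA; congr (_ * _).
by apply: eq_En => s' _; rewrite -catA.
Qed.
End RealProb.

(** * Triangular enumeration of unordered pairs *)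
Section Pairs.
Fixpoint tri (j : nat) : nat * nat :=
  if j is j'.+1 then let: (a, b) := tri j' in if (a < b)%N then (a.+1, b) else (0%N, b.+1) else (0%N, 0%N).

Definition tcode (a b : nat) : nat := ('C(b.+1, 2) + a)%N.

Lemma tri_spec j : let: (a, b) := tri j in (a <= b)%N /\ tcode a b = j.
Proof.
elim: j => [|j]; first by [].
move=> /=; case: (tri j) => a b [ab e]; case: ltnP => h.
  by split => //; rewrite /tcode addnS -/(tcode a b) e.
have {ab h} ab : a = b by apply/eqP; rewrite eqn_leq ab h.
split => //; rewrite /tcode binS bin1 addn0 -e /tcode ab addnS //.
Qed.

Lemma tcode_inj a b a' b' : (a <= b)%N -> (a' <= b')%N -> tcode a b = tcode a' b' -> a = a' /\ b = b'.
Proof.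
have W a0 b0 a1 b1 : (a0 <= b0)%N -> (b0 < b1)%N -> (tcode a0 b0 < tcode a1 b1)%N.
  move=> h0 h1; apply: (@leq_trans ('C(b0.+2, 2))).
    by rewrite binS bin1 /tcode -addnS leq_add2l ltnS.
  by apply: leq_trans (leq_addr _ _); exact: leq_bin2l.
move=> ab a'b' e; case: (ltngtP b b') => h.
- by have := W _ _ a' _ ab h; rewrite e ltnn.
- by have := W _ _ a _ a'b' h; rewrite e ltnn.
- by split => //; move: e; rewrite /tcode h => /addnI.
Qed.

Lemma tri_code a b : (a <= b)%N -> tri (tcode a b) = (a, b).
Proof.
move=> ab; have := tri_spec (tcode a b); case: (tri _) => a' b' [ab' e].
by have [-> ->] := tcode_inj ab' ab e.
Qed.

Lemma tri_lt j m : ((tri j).2 < m)%N = (j < 'C(m.+1, 2))%N.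
Proof.
have := tri_spec j; case: (tri j) => a b [ab <-] /=; apply/idP/idP => h.
  apply: (@leq_trans 'C(b.+2, 2)); last exact: leq_bin2l.
  by rewrite binS bin1 /tcode -addnS leq_add2l ltnS.
rewrite ltnNge; apply/negP => mb; move: h; apply/negP; rewrite -leqNgt.
by apply: leq_trans (leq_addr _ _); exact: leq_bin2l.
Qed.

Lemma sum_tri (V : nmodType) (m : nat) (F : nat -> nat -> V) :
  \sum_(j < 'C(m.+1, 2)) F (tri j).1 (tri j).2 = \sum_(b < m) \sum_(a < b.+1) F a b.
Proof.
elim: m => [|m IH]; first by rewrite !big_ord0.
rewrite big_ord_recr -IH /= binS bin1 big_split_ord /=; congr (_ + _).
apply: eq_bigr => a _; rewrite -/(tcode a m) tri_code //.
by rewrite -ltnS.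
Qed.
End Pairs.

(** * Polynomial weights *)
Section Weights.
Context {R : realType}.
Variable p : R.
Hypothesis p0 : 0 < p.

Lemma powR_step (x : R) : 1 <= x -> p / (1 + p) * (x + 1) `^ (- (p + 1)) <= x `^ (- p) - (x + 1) `^ (- p).
Proof.
move=> x1; have x0 : 0 < x by exact: lt_le_trans x1.
have x10 : 0 < x + 1 by rewrite addr_gt0.
have u0 : 0 < (x + 1)^-1 by rewrite invr_gt0.
have u1 : (x + 1)^-1 < 1 by rewrite invf_lt1 // ltrDr.
(* (x / (x+1)) ^ p = exp (p * ln (1 - 1/(x+1))) <= 1 / (1 + p / (x+1)) *)
have K : (x / (x + 1)) `^ p <= (1 + p * (x + 1)^-1)^-1.
  have xE : x / (x + 1) = 1 + - (x + 1)^-1 by field; rewrite gt_eqF.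
  have xp : 0 < x / (x + 1) by rewrite divr_gt0.
  rewrite /powR gt_eqF // xE.
  apply: (@le_trans _ _ (expR (- (p * (x + 1)^-1)))).
    rewrite ler_expR -mulrN; apply: ler_wpM2l; first exact: ltW.
    by apply: le_ln1Dx; rewrite ltrN2.
  rewrite expRN lef_pV2 ?posrE ?expR_gt0 ?addr_gt0 ?mulr_gt0 //.
  exact: expR_ge1Dx.
have E1 : x `^ (- p) = (x + 1) `^ (- p) * ((x / (x + 1)) `^ p)^-1.
  rewrite powRM ?(ltW x0) ?invr_ge0 ?(ltW x10) // !powRN invfM.
  have -> : (x + 1)^-1 `^ p = ((x + 1) `^ p)^-1.
    by rewrite -powR_inv1 ?(ltW x10) // powRAC powR_inv1 // powR_ge0.
  by rewrite invrK mulrCA mulVf ?mulr1 // gt_eqF // powR_gt0.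
have E2 : (x + 1) `^ (- (p + 1)) = (x + 1) `^ (- p) * (x + 1)^-1.
  rewrite opprD powRD; last by rewrite [x + 1 == 0]gt_eqF // implybT.
  by rewrite powR_inv1 // ltW.
have y0 : 0 < (x + 1) `^ (- p) by exact: powR_gt0.
have L0 : 0 < (x / (x + 1)) `^ p by rewrite powR_gt0 // divr_gt0.
have v0 : 0 < 1 + p * (x + 1)^-1 by rewrite addr_gt0 // mulr_gt0.
have K2 : 1 + p * (x + 1)^-1 <= ((x / (x + 1)) `^ p)^-1.
  by rewrite -[leLHS]invrK lef_pV2 ?posrE ?invr_gt0.
rewrite E1 E2 -[X in _ - X]mulr1 -mulrBr mulrCA ler_pM2l //.
apply: (@le_trans _ _ (p * (x + 1)^-1)); last by rewrite lerBrDl.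
apply: ler_wpM2r; first exact: ltW.
by rewrite ler_pdivrMr ?addr_gt0 // mulrDr mulr1 lerDl mulr_ge0 // ltW.
Qed.

Lemma powR_tail (B n : nat) :
  \sum_(b < n) (if (b < B)%N then 0 else b.+1%:R `^ (- (p + 1))) <= (1 + (1 + p) / p) * B.+1%:R `^ (- p).
Proof.
have c0 : 0 < (1 + p) / p by rewrite divr_gt0 // addr_gt0.
have y0 k : 0 < k.+1%:R `^ (- p) by rewrite powR_gt0.
have st k : k.+2%:R `^ (- (p + 1)) <= (1 + p) / p * (k.+1%:R `^ (- p) - k.+2%:R `^ (- p)).
  have := @powR_step k.+1%:R; rewrite ler1n natr1 => /(_ isT).
  by rewrite -(ler_pM2l c0) mulrA (_ : (1 + p) / p * (p / (1 + p)) = 1) ?mul1r //; field; rewrite !gt_eqF // addr_gt0.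
suff H k : \sum_(b < B + k.+1) (if (b < B)%N then 0 else b.+1%:R `^ (- (p + 1))) <=
   (1 + (1 + p) / p) * B.+1%:R `^ (- p) - (1 + p) / p * (B + k).+1%:R `^ (- p).
  have mono : \sum_(b < n) (if (b < B)%N then 0 else b.+1%:R `^ (- (p + 1))) <=
      \sum_(b < B + n.+1) (if (b < B)%N then 0 else b.+1%:R `^ (- (p + 1))) :> R.
    rewrite -!(big_mkord xpredT (fun b => if (b < B)%N then 0 else b.+1%:R `^ (- (p + 1)))).
    rewrite (@big_cat_nat _ _ _ n 0 (B + n.+1)) //=; last by rewrite addnS ltnW // ltnS leq_addl.
    rewrite lerDl; apply: sumr_ge0 => b _; case: ifP => // _; exact: powR_ge0.
  apply: (le_trans mono); apply: (le_trans (H n)).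
  by rewrite lerBlDr lerDl mulr_ge0 ?powR_ge0 // ltW.
elim: k => [|k IH].
  rewrite addn1 addn0 big_ord_recr /= ltnn big1 ?add0r; last by move=> b _; rewrite ltn_ord.
  rewrite mulrDl mul1r addrK; apply: ler_powR; first by rewrite ler1n.
  by rewrite lerN2 lerDl.
rewrite addnS big_ord_recr /= ltnNge leq_addr /=; apply: (le_trans (lerD IH (lexx _))).
have := st (B + k)%N; rewrite addnS.
set u := _ `^ _; set v := (B + k).+1%:R `^ _; set z := (B + k).+2%:R `^ _; set t := _ * B.+1%:R `^ _.
set c := (1 + p) / p; rewrite mulrBr => h.
apply: (le_trans (lerD (lexx _) h)).
by rewrite addrA subrK.
Qed.

Definition pw (j : nat) : R := (tri j).1.+1%:R `^ (- (p + 1)) * (tri j).2.+1%:R `^ (- (p + 1)).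

Lemma pw_gt0 j : 0 < pw j. Proof. by rewrite mulr_gt0 // powR_gt0. Qed.

Definition pwc : R := (1 + (1 + p) / p) ^+ 2.

(** The pairs enumerated from [k] on all have a larger index of order at least the square
    root of [k]. *)
Lemma pw_tail (M k : nat) : (0 < k)%N ->
  \sum_(j < M) (if (j < k)%N then 0 else pw j) <= pwc * k%:R `^ (- (p / 2)).
Proof.
move=> k0; pose B := (tri k).2.
have C0 : 0 < 1 + (1 + p) / p by rewrite addr_gt0 // divr_gt0 // addr_gt0.
have Bj j : (k <= j)%N -> (B <= (tri j).2)%N.
  move=> kj; rewrite leqNgt tri_lt -leqNgt; apply: leq_trans kj.
  by rewrite leqNgt -tri_lt ltnn.
have g0 a b : 0 <= a.+1%:R `^ (- (p + 1)) * b.+1%:R `^ (- (p + 1)) :> R by rewrite mulr_ge0 // powR_ge0.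
pose G a b : R := if (b < B)%N then 0 else a.+1%:R `^ (- (p + 1)) * b.+1%:R `^ (- (p + 1)).
have G0 a b : 0 <= G a b by rewrite /G; case: ifP.
pose m := (tri M).2.+1.
have Mm : (M <= 'C(m.+1, 2))%N by rewrite ltnW // -tri_lt.
apply: (@le_trans _ _ (\sum_(j < 'C(m.+1, 2)) G (tri j).1 (tri j).2)).
  apply: (@le_trans _ _ (\sum_(j < M) G (tri j).1 (tri j).2)).
    apply: ler_sum => j _; case: ltnP => [|kj]; first by move=> _; exact: G0.
    by rewrite /G ltnNge Bj.
  rewrite -!(big_mkord xpredT (fun j => G (tri j).1 (tri j).2)) (@big_cat_nat _ _ _ M 0 'C(m.+1, 2)) //=.
  by rewrite lerDl; apply: sumr_ge0.
rewrite (sum_tri m G).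
apply: (@le_trans _ _ (\sum_(b < m) (if (b < B)%N then 0 else b.+1%:R `^ (- (p + 1))) * (1 + (1 + p) / p))).
  apply: ler_sum => b _; rewrite /G; case: ifP => _; first by rewrite big1 ?mul0r.
  rewrite -mulr_suml mulrC; apply: ler_wpM2l; first exact: powR_ge0.
  have := powR_tail 0 b.+1; rewrite powR1 mulr1; exact: le_trans.
rewrite -mulr_suml mulrC /pwc expr2 -mulrA; apply: ler_wpM2l; first exact: ltW.
apply: (le_trans (powR_tail B m)); apply: ler_wpM2l; first exact: ltW.
rewrite !powRN lef_pV2 ?posrE ?powR_gt0 // ?ltr0n //.
have kB : (k <= B.+1 ^ 2)%N.
  have kk : (k < 'C(B.+2, 2))%N by rewrite -tri_lt.
  apply: leq_trans (ltnW kk) _; elim: {kk Bj G G0} B => [//|B' IH].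
  rewrite binS bin1 -[(B'.+2 ^ 2)%N]mulnn mulSn addnC; apply: leq_add => //.
  by apply: (leq_trans IH); rewrite -mulnn leq_mul.
rewrite mulrC powRrM; apply: ge0_ler_powR; rewrite ?nnegrE ?powR_ge0 ?(ltW p0) //.
rewrite powR12_sqrt // -[leRHS]ger0_norm // -sqrtr_sqr; apply: ler_wsqrtr.
by rewrite -natrX ler_nat.
Qed.
End Weights.

(** * Rayleigh quotients *)
Fact quad_contra (R : realType) (a b : R) : 0 < a -> (forall t, 0 <= 2 * t * a + t ^+ 2 * b) -> False.
Proof.
move=> a0 h; have b1 : 0 < `|b| + 1 by rewrite ltr_wpDl.
have := h (- (a / (`|b| + 1))).
have -> : 2 * - (a / (`|b| + 1)) * a + (- (a / (`|b| + 1))) ^+ 2 * b = (a / (`|b| + 1)) ^+ 2 * (b - 2 * (`|b| + 1)).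
  by field; rewrite gt_eqF.
rewrite pmulr_rge0 ?exprn_gt0 ?divr_gt0 // subr_ge0; apply/negP; rewrite -ltNge.
by have := ler_norm b; have := normr_ge0 b; lra.
Qed.

Section Rayleigh.
Context {R : realType} {V : vectType R} (f : V -> V -> R) (J : 'End(V)).
Hypotheses (fD : forall x y z, f (x + y) z = f x z + f y z) (fZ : forall a x y, f (a *: x) y = a * f x y)
  (fC : forall x y, f x y = f y x) (f0 : forall x, x != 0 -> 0 < f x x)
  (fJ : forall x y, f x (J y) = f (J x) y).

Let fDr x y z : f x (y + z) = f x y + f x z. Proof. by rewrite fC fD !(fC x). Qed.
Let fZr a x y : f x (a *: y) = a * f x y. Proof. by rewrite fC fZ fC. Qed.
Let f00 x : f 0 x = 0. Proof. by rewrite -(scale0r (0 : V)) fZ mul0r. Qed.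
Let f0r x : f x 0 = 0. Proof. by rewrite fC f00. Qed.

Let Q x := f x (J x).
Let Qs x t z : Q (x + t *: z) = Q x + 2 * t * f z (J x) + t ^+ 2 * Q z.
Proof.
rewrite /Q linearD linearZ !fDr !fD !fZr !fZ (fC x (J z)) -fJ; ring.
Qed.
Let fs x t z : f (x + t *: z) (x + t *: z) = f x x + 2 * t * f z x + t ^+ 2 * f z z.
Proof. rewrite !fDr !fD !fZr !fZ (fC x z); ring. Qed.

(** A minimizer of the quotient on the unit sphere is an eigenvector: the derivative in the
    direction of its own residual would otherwise be negative. *)
Lemma rayleigh (c : R) : (forall a, passmx.leigenvalue J a -> c <= a) -> forall x, c * f x x <= f x (J x).
Proof.
move=> hc x; have [->|x0] := eqVneq x 0; first by rewrite linear0 !f00 mulr0.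
pose n := \dim {: V}.
pose e := vbasis {: V}.
pose r (v : 'rV[R]_n) : V := \sum_(i < n) v 0 i *: e`_i.
have rD v w : r (v + w) = r v + r w.
  by rewrite /r -big_split; apply: eq_bigr => i _; rewrite mxE scalerDl.
have rZ a v : r (a *: v) = a *: r v.
  by rewrite /r scaler_sumr; apply: eq_bigr => i _; rewrite mxE scalerA.
have r0 v : r v = 0 -> v = 0.
  move=> rv; apply/rowP => i; rewrite mxE.
  have /freeP fr := basis_free (vbasisP {: V}).
  exact: (fr (fun i => v 0 i) rv i).
have rK z : r (\row_i coord e i z) = z.
  by rewrite [RHS](coord_vbasis (memvf z)); apply: eq_bigr => i _; rewrite mxE.
have csum (g : 'I_n -> 'rV[R]_n -> R) : (forall i, continuous (g i)) -> continuous (fun v => \sum_(i < n) g i v).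
  move=> cg; elim: (index_enum _) => [|i s IH].
    have -> : (fun v : 'rV[R]_n => \sum_(i <- [::]) g i v) = cst 0 by apply/funext => v; rewrite big_nil.
    exact: cst_continuous.
  have -> : (fun v : 'rV[R]_n => \sum_(j <- i :: s) g j v) = (fun v => g i v + \sum_(j <- s) g j v).
    by apply/funext => v; rewrite big_cons.
  by move=> v; exact: (cvgD (cg i v) (IH v)).
have fsum (g h : V -> V) v w : (forall x y, g (x + y) = g x + g y) -> (forall a x, g (a *: x) = a *: g x) ->
    (forall x y, h (x + y) = h x + h y) -> (forall a x, h (a *: x) = a *: h x) ->
    f (g (r v)) (h (r w)) = \sum_(i < n) \sum_(j < n) (v 0 i * w 0 j) * f (g e`_i) (h e`_j).
  move=> gD gZ hD hZ.
  have g0 : g 0 = 0 by have := gZ 0 0; rewrite !scale0r.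
  have h0 : h 0 = 0 by have := hZ 0 0; rewrite !scale0r.
  have S1 z : f (g (r v)) z = \sum_(i < n) v 0 i * f (g e`_i) z.
    rewrite /r; elim/big_ind2: _ => [|x1 y1 x2 y2 E1 E2|i _]; first by rewrite g0 f00.
      by rewrite gD fD E1 E2.
    by rewrite gZ fZ.
  have S2 z : f z (h (r w)) = \sum_(j < n) w 0 j * f z (h e`_j).
    rewrite /r; elim/big_ind2: _ => [|x1 y1 x2 y2 E1 E2|i _]; first by rewrite h0 f0r.
      by rewrite hD fDr E1 E2.
    by rewrite hZ fZr.
  rewrite S1; apply: eq_bigr => i _; rewrite S2 mulr_sumr; apply: eq_bigr => j _; rewrite mulrA; congr (_ * _).
have cquad (g : V -> V) : (forall x y, g (x + y) = g x + g y) -> (forall a x, g (a *: x) = a *: g x) ->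
    continuous (fun v : 'rV[R]_n => f (r v) (g (r v))).
  move=> gD gZ; rewrite (_ : (fun v => _) = (fun v : 'rV[R]_n => \sum_(i < n) \sum_(j < n) (v 0 i * v 0 j) * f e`_i (g e`_j))).
    apply: (csum) => i; apply: (csum) => j v.
    have c2 : continuous (fun _ : 'rV[R]_n => f e`_i (g e`_j)) by exact: cst_continuous.
    exact: (cvgM (cvgM (@coord_continuous R 1 n 0 i v) (@coord_continuous R 1 n 0 j v)) (c2 v)).
  apply/funext => v; exact: (fsum id g).
pose Sph : set 'rV[R]_n := [set v | `|v| = 1].
have cSph : compact Sph.
  apply: bounded_closed_compact.
    exists 1; split => // M M1 v /= ->; exact: ltW.
  rewrite (_ : Sph = (@Num.norm _ 'rV[R]_n) @^-1` [set 1]) //.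
  by apply: closed_comp => // v _; exact: norm_continuous.
have x'0 : (\row_i coord e i x : 'rV[R]_n) != 0.
  apply: contra_neq x0 => h; rewrite -(rK x) h; apply: big1 => i _.
  by rewrite mxE scale0r.
have nS z : z != 0 -> (`|z|^-1 *: z : 'rV[R]_n) \in Sph.
  move=> z0; apply/mem_set; rewrite /Sph /= normrZ ger0_norm ?invr_ge0 //.
  by rewrite mulVf // normr_eq0.
have S0 : Sph !=set0 by exists (`|\row_i coord e i x|^-1 *: \row_i coord e i x); apply/set_mem/nS.
pose g (v : 'rV[R]_n) := f (r v) (J (r v)) / f (r v) (r v).
have pos v : v != 0 -> 0 < f (r v) (r v) by move=> v0; apply: f0; apply: contra_neq v0; exact: r0.
have cg : {within Sph, continuous g}.
  apply: continuous_in_subspaceT => v /set_mem /= v1.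
  have v0 : v != 0 by rewrite -normr_eq0 v1 oner_eq0.
  have cn : continuous (fun v : 'rV[R]_n => f (r v) (J (r v))) by apply: (cquad) => *; rewrite ?linearD ?linearZ.
  have cd : continuous (fun v : 'rV[R]_n => f (r v) (r v)) by exact: (cquad id).
  by apply: (cvgM (cn v) (cvgV _ (cd v))); rewrite gt_eqF // pos.
have [u uS umin] := compact_EVT_min S0 cSph cg.
have u0 : u != 0 by move/set_mem: uS => /= u1; rewrite -normr_eq0 u1 oner_eq0.
pose U := r u; pose mu := g u.
have gscale a v : a != 0 -> g (a *: v) = g v.
  move=> a0; rewrite /g rZ linearZ /= !fZ !fZr.
  have [->|v0] := eqVneq v 0.
    have -> : r 0 = 0 by rewrite -(scale0r (0 : 'rV[R]_n)) rZ scale0r.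
    by rewrite !f00 !mulr0 !mul0r.
  have h1 := gt_eqF (pos v v0); by field; rewrite h1 a0.
have main z : mu * f z z <= Q z.
  have [->|z0] := eqVneq z 0; first by rewrite /Q linear0 !f00 mulr0.
  pose zz : 'rV[R]_n := \row_i coord e i z.
  have zz0 : zz != 0.
    apply: contra_neq z0 => h; rewrite -(rK z) -/zz h; apply: big1 => i _.
    by rewrite mxE scale0r.
  have := umin _ (nS zz zz0); rewrite gscale ?invr_eq0 ?normr_eq0 // /g -/mu.
  by rewrite -/(mu) ler_pdivlMr ?pos // rK.
have muE : Q U = mu * f U U by rewrite /mu /g mulfVK // gt_eqF // pos.
suff JU : J U = mu *: U.
  apply: (le_trans _ (main x)); apply: ler_wpM2r; first exact/ltW/f0.
  apply: hc; rewrite /passmx.leigenvalue /passmx.leigenspace; apply/eqP => h.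
  have : U \in lker (J - mu *: \1%VF) by rewrite memv_ker add_lfunE opp_lfunE scale_lfunE id_lfunE JU subrr.
  rewrite h memv0 => /eqP /r0 e0; by move: u0; rewrite e0 eqxx.
apply/eqP; rewrite -subr_eq0; apply/negPn/negP => z0.
set z := J U - mu *: U in z0.
have a0 := f0 z0; set a := f z z in a0.
have aE : f z (J U) - mu * f z U = a.
  have -> : a = f z (J U + (-1) *: (mu *: U)) by rewrite scaleN1r.
  by rewrite fDr !fZr mulN1r.
have step t : 0 <= 2 * t * a + t ^+ 2 * (Q z - mu * f z z).
  have := main (U + t *: z); rewrite Qs fs muE -aE -subr_ge0.
  move=> h; apply: (le_trans h); rewrite le_eqVlt; apply/orP; left; apply/eqP; ring.
exact: (quad_contra a0 step).
Qed.
End Rayleigh.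

(** * From finite laws to the Hilbert-valued sample *)
Section Transfer.
Context {R : realType} {H : hilbertType R} {d : measure_display} {T : measurableType d} (P : probability T R).
Variables (n : nat) (X Xs : 'I_n.+1 -> T -> H).
Notation N := n.+1.
Notation pr := (pr P).
Hypotheses (rX : forall i, random_element (X i)) (rXs : forall i, random_element (Xs i)).
Hypotheses (ind : independent P X) (idd : identically_distributed P X) (swr : sampled_with_replacement P X Xs).

Let G0 : set (set T) := [set B | exists i A, borel H A /\ B = X i @^-1` A].
Let G : set (set T) := sigma_generated X.
Let GI A B : G A -> G B -> G (A `&` B).
Proof. exact: (@measurableI _ (g_sigma_algebraType G0)). Qed.
Let Gsub A : G A -> measurable A.
Proof.
apply: smallest_sub; first exact: sigma_algebra_measurable.
by move=> B [i [A' [bA ->]]]; exact: rX.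
Qed.

Lemma meas_fin (J : finType) (f : T -> J) (A : J -> set T) :
  (forall j, measurable (f @^-1` [set j])) -> (forall j, measurable (A j)) ->
  measurable [set w | A (f w) w].
Proof.
move=> mf mA; rewrite (_ : [set _ | _] = \bigcup_(j in [set: J]) (f @^-1` [set j] `&` A j)).
  by apply: fin_bigcup_measurable => [|j _]; [exact: finite_finset|exact: measurableI].
apply/seteqP; split => w /=; first by exists (f w).
by case=> j _ [/= <-].
Qed.

Section Cells.
Context {I : finType} (cell : H -> I).
Definition bcell := forall v, borel H (cell @^-1` [set v]).
Hypothesis bc : bcell.

Definition smp (Y : 'I_N -> T -> H) (w : T) : N.-tuple I := [tuple cell (Y i w) | i < N].

Lemma smp_mkseq Y w : tval (smp Y w) = mkseq (fun i => cell (Y (inord i) w)) N.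
Proof.
apply: (@eq_from_nth _ (cell (Y ord0 w))); first by rewrite size_tuple size_mkseq.
move=> i; rewrite size_tuple => iN; rewrite nth_mkseq // -[i]/(nat_of_ord (Ordinal iN)) -tnth_nth tnth_mktuple.
by congr (cell (Y _ w)); apply: val_inj; rewrite /= inordK.
Qed.

Lemma smp_eq Y (t : N.-tuple I) : smp Y @^-1` [set t] = \bigcap_i (Y i @^-1` (cell @^-1` [set tnth t i])).
Proof.
apply/seteqP; split => w /=; first by move=> <- i _ /=; rewrite tnth_mktuple.
by move=> h; apply: eq_from_tnth => i; rewrite tnth_mktuple; exact: (h i).
Qed.

Lemma smp_meas Y t : (forall i, random_element (Y i)) -> measurable (smp Y @^-1` [set t]).
Proof.
move=> rY; rewrite smp_eq; apply: fin_bigcap_measurable => [|i _]; first exact: finite_finset.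
by apply: rY; exact: bc.
Qed.

Let Gsmp t : G (smp X @^-1` [set t]).
Proof.
rewrite smp_eq; apply: (@fin_bigcap_measurable _ (g_sigma_algebraType G0)) => [|i _]; first exact: finite_finset.
by apply: sub_sigma_algebra; exists i, (cell @^-1` [set tnth t i]); split; [exact: bc|].
Qed.

Definition qcell (v : I) : R := pr (X ord0 @^-1` (cell @^-1` [set v])).

Let msk Y t : [set w | mkseq (fun i => cell (Y (inord i) w)) N = t] = smp Y @^-1` [set u : N.-tuple I | tval u = t].
Proof. by apply/funext => w /=; rewrite -smp_mkseq. Qed.

Let mskT Y (t : N.-tuple I) : [set w | mkseq (fun i => cell (Y (inord i) w)) N = t] = smp Y @^-1` [set t].
Proof.
rewrite msk; apply/funext => w /=; apply/propext; split => [h|h]; first exact: val_inj.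
by rewrite -h.
Qed.

Let mC (Y : 'I_N -> T -> H) : (forall i, random_element (Y i)) ->
  forall i v, measurable ((fun w => cell (Y (inord i) w)) @^-1` [set v]).
Proof. by move=> rY i v; exact: (rY (inord i) _ (bc v)). Qed.

Lemma law_smp (F : pred (seq I)) : pr [set w | F (smp X w)] = En qcell N (fun s => (F s)%:R).
Proof.
have := @cells_law R d T P I (fun i w => cell (X (inord i) w)) N qcell setT 1 F measurableT (mC rX).
rewrite setTI mul1r => <-; first by congr pr; apply/funext => w /=; rewrite smp_mkseq.
move=> s sN; rewrite setTI mul1r; have sN' : size s == N by exact/eqP.
have -> : s = Tuple sN' by [].
rewrite mskT smp_eq /pr ind; last by move=> i; exact: bc.
rewrite big_tuple; set t := Tuple sN'.
have -> : (\prod_(i < N) P (X i @^-1` (cell @^-1` [set tnth t i])) = \prod_(i < N) (qcell (tnth t i))%:E)%E.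
  by apply: eq_bigr => i _; rewrite (idd i ord0 (bc _)) prE //; exact: (rX _ (bc _)).
by rewrite prodEFin.
Qed.

Lemma card_cells (t : N.-tuple I) w v : smp X w = t ->
  #|[pred j | X j w \in cell @^-1` [set v]]| = count_mem v t.
Proof.
move=> <-; rewrite /smp -map_tnth_enum count_map enumT cardE /enum_mem size_filter.
apply: eq_count => j; rewrite /= tnth_mktuple; apply/idP/eqP => [/set_mem //|h].
exact/mem_set.
Qed.

Lemma boot_smp A (t : N.-tuple I) (F : pred (seq I)) : G A -> A `<=` smp X @^-1` [set t] ->
  pr (A `&` [set w | F (smp Xs w)]) = pr A * En (@emp R I t) N (fun s => (F s)%:R).
Proof.
move=> GA At; have mA := Gsub GA.
have := @cells_law R d T P I (fun i w => cell (Xs (inord i) w)) N (@emp R I t) A (pr A) F mA (mC rXs).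
move=> <-; first by congr pr; congr (_ `&` _); apply/funext => w /=; rewrite smp_mkseq.
move=> s sN; have sN' : size s == N by exact/eqP.
have -> : s = Tuple sN' by [].
rewrite mskT smp_eq; set u := Tuple sN'.
have [_ _ /(_ A GA) K] := swr (fun i => bc (tnth u i)).
rewrite /pr -K.
rewrite (eq_integral (fun=> (\prod_(v <- u) @emp R I t v)%:E)).
  have -> : (\int[P]_(_ in A) (\prod_(v <- u) @emp R I t v)%:E = (\prod_(v <- u) @emp R I t v)%:E * P A)%E.
    exact: integral_cst.
  by rewrite prE // -EFinM /= mulrC.
move=> w /set_mem Aw; congr (_%:E); rewrite big_tuple; apply: eq_bigr => i _.
by rewrite (card_cells _ (At w Aw)) /emp size_tuple.
Qed.
End Cells.

Variables (stat stats : T -> R) (kappa : T -> probability (measurableTypeR R) R).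
Hypotheses (mst : measurable_fun setT stat) (msts : measurable_fun setT stats).
Hypothesis rc : regular_cond_distribution P G stats kappa.

Definition kap (t : R) (w : T) : R := fine (kappa w `]-oo, t]%classic).

Let mle (f : T -> R) t : measurable_fun setT f -> measurable [set w | f w <= t].
Proof. by move=> mf; exact: measurable_set_le. Qed.

Let statsE t : stats @^-1` `]-oo, t]%classic = [set w | stats w <= t].
Proof. by apply/funext => w /=; rewrite in_itv. Qed.

Section OneSided.
Context {I : finType} (cell : H -> I) (Psi : seq I -> seq I -> R).
Hypothesis bc : bcell cell.
Variables (eps eta del t : R).
Hypothesis eta0 : 0 < eta.
Let S w := smp cell X w.
Let Ss w := smp cell Xs w.
Definition bad_boot := [set w | eps < `|stats w - Psi (smp cell X w) (smp cell Xs w)|].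

Lemma bad_boot_meas : measurable bad_boot.
Proof.
apply: (@meas_fin _ S (fun s => [set w | eps < `|stats w - Psi s (Ss w)|])) => s.
  exact: smp_meas.
apply: (@meas_fin _ Ss (fun u => [set w | eps < `|stats w - Psi s u|])) => u.
  exact: smp_meas.
rewrite (_ : [set _ | _] = ~` [set w | `|stats w - Psi s u| <= eps]).
  apply: measurableC; apply: mle; apply: measurableT_comp => //.
  by apply: measurable_funB.
by apply/funext => w /=; apply/propext; rewrite ltNge; split => /negP.
Qed.
Hypothesis hbad : pr bad_boot <= del.

Definition bootF (s : seq I) (u : R) : R := En (@emp R I s) N (fun tau => (Psi s tau <= u)%R%:R).

Let A_up s := S @^-1` [set s] `&` kap t @^-1` `]bootF s (t + eps) + eta, +oo[%classic.
Let A_dn s := S @^-1` [set s] `&` kap t @^-1` `]-oo, bootF s (t - eps) - eta[%classic.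

Let Gkap (B : set R) : measurable B -> G (kap t @^-1` B).
Proof. by move=> mB; have [h _ _] := rc (measurable_itv `]-oo, t]); exact: h. Qed.

Let Gset s B : measurable B -> G (S @^-1` [set s] `&` kap t @^-1` B).
Proof.
move=> mB; apply: GI; last exact: Gkap.
rewrite smp_eq; apply: (@fin_bigcap_measurable _ (g_sigma_algebraType G0)) => [|i _]; first exact: finite_finset.
by apply: sub_sigma_algebra; exists i, (cell @^-1` [set tnth s i]); split; [exact: bc|].
Qed.

Let kapE A : G A -> (\int[P]_(w in A) (kap t w)%:E)%E = (pr (A `&` [set w | (stats w <= t)%R]))%:E.
Proof.
move=> GA; have [_ _ /(_ A GA) ->] := rc (measurable_itv `]-oo, t]).
by rewrite statsE prE //; apply: measurableI; [exact: Gsub|exact: mle].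
Qed.

Let kap_int A : measurable A -> P.-integrable A (EFin \o kap t).
Proof. 
by move=> mA; have [_ h _] := rc (measurable_itv `]-oo, t]); exact: (integrableS measurableT).
Qed.

Let cst_int A (c : R) : measurable A -> P.-integrable A (EFin \o cst c).
Proof.
by move=> mA; apply: (integrableS measurableT) => //; exact: finite_measure_integrable_cst.
Qed.

Lemma kap_up : pr [set w | bootF (S w) (t + eps) + eta < kap t w] <= del / eta.
Proof.
rewrite ler_pdivlMr // mulrC; apply: le_trans hbad.
have mS s : measurable (S @^-1` [set s]) by exact: smp_meas.
have mD : measurable [set w | bootF (S w) (t + eps) + eta < kap t w].
  apply: (@meas_fin _ S (fun s => [set w | bootF s (t + eps) + eta < kap t w])) => // s.
  rewrite (_ : [set _ | _] = kap t @^-1` `]bootF s (t + eps) + eta, +oo[%classic).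
    by apply: Gsub; apply: Gkap; exact: measurable_itv.
  by apply/funext => w /=; rewrite in_itv /= andbT.
rewrite (pr_partition P mD mS) (pr_partition P bad_boot_meas mS) mulr_sumr; apply: ler_sum => s _.
have -> : [set w | bootF (S w) (t + eps) + eta < kap t w] `&` S @^-1` [set s] = A_up s.
  rewrite /A_up; apply/seteqP; split => w /=; rewrite in_itv /= andbT; first by case=> h <-.
  by case=> <- h.
have GA : G (A_up s) by apply: Gset; exact: measurable_itv.
have mA := Gsub GA.
have As : A_up s `<=` S @^-1` [set s] by move=> w [].
have mstl : measurable [set w | (stats w <= t)%R] by exact: mle.
have mPs : measurable [set w | (Psi s (Ss w) <= t + eps)%R].
  apply: (@meas_fin _ Ss (fun u => [set w | (Psi s u <= t + eps)%R])) => u; first exact: smp_meas.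
  by case: (Psi s u <= t + eps)%R; [rewrite (_ : [set _ | _] = setT)|rewrite (_ : [set _ | _] = set0)] => //; apply/seteqP; split.
have L1 : (bootF s (t + eps) + eta) * pr (A_up s) <= pr (A_up s `&` [set w | (stats w <= t)%R]).
  rewrite -lee_fin -kapE // EFinM -prE // -(integral_cst P mA); apply: le_integral => //.
  - exact: cst_int.
  - exact: kap_int.
  by move=> w /set_mem [_ /=]; rewrite in_itv /= andbT lee_fin => /ltW.
have L2 : pr (A_up s `&` [set w | (stats w <= t)%R]) <= pr (A_up s) * bootF s (t + eps) + pr (bad_boot `&` S @^-1` [set s]).
  rewrite -(boot_smp bc (fun tau => Psi s tau <= t + eps)%R GA As); apply: pr_sub2; try exact: measurableI.
    by apply: measurableI => //; exact: bad_boot_meas.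
  move=> w /= [Aw st]; have [h|h] := leP (Psi s (Ss w)) (t + eps); [by left|right].
  have [sw _] := Aw; split => //; change (eps < `|stats w - Psi (S w) (Ss w)|); rewrite sw.
  by rewrite distrC; apply: lt_le_trans (ler_norm _); rewrite ltrBrDr; apply: le_lt_trans h; rewrite addrC lerD2r.
move: L1 L2; set x := pr (A_up s); set y := pr _; set z := pr _; set b := bootF _ _ => L1 L2.
by have := le_trans L1 L2; rewrite mulrDl [b * x]mulrC lerD2l.
Qed.

Lemma kap_down : pr [set w | kap t w < bootF (S w) (t - eps) - eta] <= del / eta.
Proof.
rewrite ler_pdivlMr // mulrC; apply: le_trans hbad.
have mS s : measurable (S @^-1` [set s]) by exact: smp_meas.
have mD : measurable [set w | kap t w < bootF (S w) (t - eps) - eta].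
  apply: (@meas_fin _ S (fun s => [set w | kap t w < bootF s (t - eps) - eta])) => // s.
  rewrite (_ : [set _ | _] = kap t @^-1` `]-oo, bootF s (t - eps) - eta[%classic).
    by apply: Gsub; apply: Gkap; exact: measurable_itv.
  by apply/funext => w /=; rewrite in_itv.
rewrite (pr_partition P mD mS) (pr_partition P bad_boot_meas mS) mulr_sumr; apply: ler_sum => s _.
have -> : [set w | kap t w < bootF (S w) (t - eps) - eta] `&` S @^-1` [set s] = A_dn s.
  rewrite /A_dn; apply/seteqP; split => w /=; rewrite in_itv /=; first by case=> h <-.
  by case=> <- h.
have GA : G (A_dn s) by apply: Gset; exact: measurable_itv.
have mA := Gsub GA.
have As : A_dn s `<=` S @^-1` [set s] by move=> w [].
have mstl : measurable [set w | (stats w <= t)%R] by exact: mle.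
have mPs : measurable [set w | (Psi s (Ss w) <= t - eps)%R].
  apply: (@meas_fin _ Ss (fun u => [set w | (Psi s u <= t - eps)%R])) => u; first exact: smp_meas.
  by case: (Psi s u <= t - eps)%R; [rewrite (_ : [set _ | _] = setT)|rewrite (_ : [set _ | _] = set0)] => //; apply/seteqP; split.
have L1 : pr (A_dn s `&` [set w | (stats w <= t)%R]) <= (bootF s (t - eps) - eta) * pr (A_dn s).
  rewrite -lee_fin -kapE // EFinM -prE // -(integral_cst P mA); apply: le_integral => //.
  - exact: kap_int.
  - exact: cst_int.
  by move=> w /set_mem [_ /=]; rewrite in_itv /= lee_fin => /ltW.
have L2 : pr (A_dn s) * bootF s (t - eps) <= pr (A_dn s `&` [set w | (stats w <= t)%R]) + pr (bad_boot `&` S @^-1` [set s]).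
  rewrite -(boot_smp bc (fun tau => Psi s tau <= t - eps)%R GA As); apply: pr_sub2; try exact: measurableI.
    by apply: measurableI => //; exact: bad_boot_meas.
  move=> w /= [Aw st]; have [h|h] := leP (stats w) t; [by left|right].
  have [sw _] := Aw; split => //; change (eps < `|stats w - Psi (S w) (Ss w)|); rewrite sw.
  apply: lt_le_trans (ler_norm _); rewrite ltrBrDr; apply: le_lt_trans h.
  by rewrite -lerBrDl.
move: L1 L2; set x := pr (A_dn s); set y := pr _; set z := pr _; set b := bootF _ _ => L1 L2.
have := le_trans L2 (lerD L1 (lexx _)); rewrite mulrBl [b * x]mulrC -addrA lerDl addrC subr_ge0.
by [].
Qed.
End OneSided.
End Transfer.

Fact mulr_swap (R : realType) (a b c : R) : a * (b * c) = b * a * c.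
Proof. by rewrite mulrCA mulrA. Qed.

Fact compl_arith (R : realType) (p c th : R) : 1 - p <= c + th -> 1 - c <= p + th.
Proof. by move=> h; lra. Qed.

Fact good_arith (R : realType) (kp b1 b2 f1 f2 st del eps r C : R) :
  kp <= b1 + r -> b2 - r <= kp -> b1 <= f2 + C * (2 * eps) + r -> f1 <= b2 + C * (2 * eps) + r ->
  st <= f1 + del -> f2 <= st + del -> del <= r -> C * (2 * eps) <= r -> `|st - kp| <= 4 * r.
Proof. by move=> *; rewrite ler_norml; apply/andP; split; lra. Qed.

Fact rat_arith (R : realType) (f k fq kq th r : R) : fq <= f + th / 2 -> kq <= k + th / 2 ->
  f <= fq -> k <= kq -> `|fq - kq| <= r -> `|f - k| <= r + th.
Proof. by move=> ? ? ? ?; rewrite !ler_norml => /andP[? ?]; apply/andP; split; lra. Qed.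

Fact unit_dist (R : realType) (x y : R) : x <= 1 -> y <= 1 -> 0 <= x -> 0 <= y -> `|x - y| <= 1.
Proof. by move=> *; rewrite ler_norml; apply/andP; split; lra. Qed.

Section TransferEnd.
Context {R : realType} {H : hilbertType R} {d : measure_display} {T : measurableType d} (P : probability T R).
Variables (n : nat) (X Xs : 'I_n.+1 -> T -> H).
Notation N := n.+1.
Notation pr := (pr P).
Hypotheses (rX : forall i, random_element (X i)) (rXs : forall i, random_element (Xs i)).
Hypotheses (ind : independent P X) (idd : identically_distributed P X) (swr : sampled_with_replacement P X Xs).
Variables (stat stats : T -> R) (kappa : T -> probability (measurableTypeR R) R).
Hypotheses (mst : measurable_fun setT stat) (msts : measurable_fun setT stats).
Hypothesis rc : regular_cond_distribution P (sigma_generated X) stats kappa.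

Definition bad_stat (I : finType) (cell : H -> I) (Phi : seq I -> R) (eps : R) :=
  [set w | eps < `|stat w - Phi (smp cell X w)|].

Lemma bad_stat_meas (I : finType) (cell : H -> I) Phi eps : bcell cell -> measurable (bad_stat cell Phi eps).
Proof.
move=> bc; apply: (@meas_fin _ T _ (smp cell X) (fun s => [set w | eps < `|stat w - Phi s|])) => s.
  exact: smp_meas.
rewrite (_ : [set _ | _] = ~` [set w | `|stat w - Phi s| <= eps]).
  apply: measurableC; apply: measurable_set_le; apply: measurableT_comp => //.
  by apply: measurable_funB.
by apply/funext => w /=; apply/propext; rewrite ltNge; split => /negP.
Qed.

Definition statF t := pr [set w | (stat w <= t)%R].

Lemma statF_cell (I : finType) (cell : H -> I) (Phi : seq I -> R) (eps del t : R) : bcell cell ->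
  pr (bad_stat cell Phi eps) <= del ->
  let F u := En (qcell P X cell) N (fun s => (Phi s <= u)%R%:R) in
  statF t <= F (t + eps) + del /\ F (t - eps) <= statF t + del.
Proof.
move=> bc hb F; have mb := bad_stat_meas Phi eps bc.
have mF u : measurable [set w | (Phi (smp cell X w) <= u)%R].
  apply: (@meas_fin _ T _ (smp cell X) (fun s => [set w | (Phi s <= u)%R])) => s; first exact: smp_meas.
  by case: (Phi s <= u)%R; [rewrite (_ : [set _ | _] = setT)|rewrite (_ : [set _ | _] = set0)] => //; apply/seteqP; split.
have FE u : F u = pr [set w | (Phi (smp cell X w) <= u)%R].
  by rewrite (law_smp rX ind idd bc (fun s => Phi s <= u)%R).
have ms : measurable [set w | (stat w <= t)%R] by exact: measurable_set_le.
have fin x y : x <= y + pr (bad_stat cell Phi eps) -> x <= y + del by move=> /le_trans; apply; rewrite lerD2l.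
rewrite !FE; split; apply: fin; apply: pr_sub2 => // w /= h.
  have [h'|h'] := leP (Phi (smp cell X w)) (t + eps); [by left|right].
  change (eps < `|stat w - Phi (smp cell X w)|).
  by rewrite distrC; apply: lt_le_trans (ler_norm _); rewrite ltrBrDr; apply: le_lt_trans h'; rewrite addrC lerD2r.
have [h'|h'] := leP (stat w) t; [by left|right].
change (eps < `|stat w - Phi (smp cell X w)|).
by apply: lt_le_trans (ler_norm _); rewrite ltrBrDr; apply: le_lt_trans h'; rewrite -lerBrDl.
Qed.

Variables (Cn r c : R).
Hypotheses (Cn0 : 0 <= Cn) (r0 : 0 < r).

(** Data of arbitrarily fine finite descriptions of the sample and of its bootstrap. *)
Hypothesis approx : forall eps del : R, 0 < eps -> 0 < del ->
  exists (I : finType) (cell : H -> I) (Phi : seq I -> R) (Psi : seq I -> seq I -> R),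
  [/\ bcell cell, pr (bad_stat cell Phi eps) <= del, pr (bad_boot X Xs stats cell Psi eps) <= del &
   En (qcell P X cell) N (fun s => (~~ `[< close (fun u => En (qcell P X cell) N (fun s => (Phi s <= u)%R%:R))
      (bootF n Psi s) Cn r >])%:R) <= c / N%:R].

Definition good_at (t : R) := [set w | (`|statF t - kap kappa t w| <= 4 * r)%R].

Let mkap t : measurable_fun setT (kap kappa t).
Proof.
have [h _ _] := rc (measurable_itv `]-oo, t]).
move=> _ B mB; rewrite setTI.
apply: (@smallest_sub _ (sigma_algebra setT) [set B | exists i A, borel H A /\ B = X i @^-1` A]).
- exact: sigma_algebra_measurable.
- by move=> A [i [A' [bA ->]]]; exact: rX.
- exact: h.
Qed.

Lemma good_at_meas t : measurable (good_at t).
Proof.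
apply: measurable_set_le; apply: measurableT_comp => //.
by apply: measurable_funB => //; exact: mkap.
Qed.

(** At each level the two distribution functions are sandwiched between those of the finite
    descriptions at neighbouring levels; the Lipschitz term of [close] absorbs the shift of the
    level, because the shift can be taken small after [Cn] is known. *)
Lemma good_finite (ts : seq R) (th : R) : 0 < th ->
  pr (~` [set w | forall t, t \in ts -> good_at t w]) <= c / N%:R + th.
Proof.
move=> th0; pose k : R := (size ts)%:R + 1.
have k0 : 0 < k by rewrite ltr_wpDl.
pose eps := r / (2 * (Cn + 1)).
have Cn1 : 0 < Cn + 1 by rewrite ltr_wpDl.
have eps0 : 0 < eps by rewrite divr_gt0 // mulr_gt0.
have epsC : Cn * (2 * eps) <= r.
  rewrite /eps (_ : Cn * _ = Cn / (Cn + 1) * r); last by field; rewrite gt_eqF.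
  by apply: ler_piMl; [exact: ltW|rewrite ler_pdivrMr // mul1r lerDl].
pose del := Num.min r (th * r / (2 * k)).
have del0 : 0 < del by rewrite lt_min r0 divr_gt0 // mulr_gt0.
have delr : del <= r by rewrite ge_min lexx.
have delk : 2 * k * (del / r) <= th.
  have h : del <= th * r / (2 * k) by rewrite ge_min lexx orbT.
  rewrite -ler_pdivlMl ?mulr_gt0 // ler_pdivrMr // (le_trans h) //.
  by rewrite le_eqVlt; apply/orP; left; apply/eqP; field; rewrite gt_eqF.
have [I [cell [Phi [Psi [bc h1 h2 h3]]]]] := approx eps0 del0.
pose S w := smp cell X w.
pose F u := En (qcell P X cell) N (fun s => (Phi s <= u)%R%:R).
pose nc (s : seq I) := ~~ `[< close F (bootF n Psi s) Cn r >].
pose B0 := [set w | nc (S w)].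
pose U t := [set w | bootF n Psi (S w) (t + eps) + r < kap kappa t w].
pose V t := [set w | kap kappa t w < bootF n Psi (S w) (t - eps) - r].
have mS s : measurable (S @^-1` [set s]) by exact: smp_meas.
have mB0 : measurable B0.
  apply: (@meas_fin _ T _ S (fun s => [set w | nc s])) => // s.
  by case: (nc s); [rewrite (_ : [set _ | _] = setT)|rewrite (_ : [set _ | _] = set0)] => //; apply/seteqP; split.
have mU t : measurable (U t).
  apply: (@meas_fin _ T _ S (fun s => [set w | bootF n Psi s (t + eps) + r < kap kappa t w])) => // s.
  rewrite (_ : [set _ | _] = ~` [set w | kap kappa t w <= bootF n Psi s (t + eps) + r]).
    by apply: measurableC; apply: measurable_set_le; exact: mkap.
  by apply/funext => w /=; apply/propext; rewrite ltNge; split => /negP.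
have mV t : measurable (V t).
  apply: (@meas_fin _ T _ S (fun s => [set w | kap kappa t w < bootF n Psi s (t - eps) - r])) => // s.
  rewrite (_ : [set _ | _] = ~` [set w | bootF n Psi s (t - eps) - r <= kap kappa t w]).
    apply: measurableC; rewrite (_ : [set _ | _] = [set w | - kap kappa t w <= - (bootF n Psi s (t - eps) - r)]).
      by apply: measurable_set_le; apply: measurable_funN; exact: mkap.
    by apply/funext => w /=; rewrite lerN2.
  by apply/funext => w /=; apply/propext; rewrite ltNge; split => /negP.
have mG : measurable [set w | forall t, t \in ts -> good_at t w].
  rewrite (_ : [set _ | _] = \bigcap_(t in [set t | t \in ts]) good_at t) //.
  by apply: fin_bigcap_measurable => [|t _]; [exact: finite_seq|exact: good_at_meas].
have pU t : pr (U t) <= del / r by exact: (kap_up rX rXs swr msts rc bc t r0 h2).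
have pV t : pr (V t) <= del / r by exact: (kap_down rX rXs swr msts rc bc t r0 h2).
have pB0 : pr B0 <= c / N%:R by rewrite (law_smp rX ind idd bc nc).
have main t w : ~ B0 w -> ~ U t w -> ~ V t w -> good_at t w.
  move=> /negP; rewrite negbK => /asboolP cl /negP; rewrite -leNgt => u1 /negP; rewrite -leNgt => v1.
  have e20 : 0 <= 2 * eps by rewrite mulr_ge0 // ltW.
  have [c1 c2] := cl (t - eps) _ e20.
  have te : t - eps + 2 * eps = t + eps by ring.
  rewrite te in c1 c2.
  have [s1 s2] := statF_cell t bc h1; rewrite -/F in s1 s2.
  exact: (good_arith u1 v1 c1 c2 s1 s2 delr epsC).
apply: (@le_trans _ _ (pr B0 + \sum_(t <- ts) (pr (U t) + pr (V t)))).
  apply: (@le_trans _ _ (pr B0 + pr (~` [set w | forall t, t \in ts -> good_at t w] `\` B0))).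
    apply: pr_sub2 => //; [exact: measurableC|apply: measurableD => //; exact: measurableC|].
    by move=> w nw; have [?|?] := pselect (B0 w); [left|right].
  rewrite lerD2l; apply: (@le_trans _ _ (\sum_(t <- ts) pr (U t `|` V t))).
    apply: pr_bigcup_seq; [by apply: measurableD => //; exact: measurableC|by move=> t; exact: measurableU|].
    move=> w [ng nb]; apply: contrapT => nex; apply: ng => t tts.
    by apply: main => // h; apply: nex; exists t => //; [left|right].
  by apply: ler_sum => t _; apply: pr_sub2 => //; exact: measurableU.
apply: lerD => //; apply: (@le_trans _ _ (\sum_(t <- ts) (2 * (del / r)))).
  by apply: ler_sum => t _; rewrite mulr_natl mulr2n; apply: lerD.
have h0 : 0 <= 2 * (del / r) by rewrite mulr_ge0 // divr_ge0 // ltW.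
have E : \sum_(t <- ts) (2 * (del / r)) = (size ts)%:R * (2 * (del / r)).
  exact: sum_const_seq.
rewrite E; apply: (@le_trans _ _ (k * (2 * (del / r)))).
  by apply: ler_wpM2r => //; rewrite lerDl.
by rewrite (mulr_swap k 2).
Qed.

(** Right continuity of a distribution function, in the form that moves a bound from rational
    levels to all levels. *)
Lemma rcont (d' : measure_display) (T' : measurableType d') (Q : probability T' R) (f : T' -> R) (t th : R) :
  measurable_fun setT f -> 0 < th -> exists2 s, t < s & forall u, t <= u <= s ->
    fine (Q [set w | (f w <= u)%R]) <= fine (Q [set w | (f w <= t)%R]) + th.
Proof.
move=> mf th0; have ml u : measurable [set w | (f w <= u)%R] by exact: measurable_set_le.
pose F k := [set w | (f w <= t + k.+1%:R^-1)%R].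
have capF : \bigcap_k F k = [set w | (f w <= t)%R].
  apply/seteqP; split => w /=; last by move=> h k _; rewrite /F /= (le_trans h) // lerDl invr_ge0.
  move=> h; apply/ler_addgt0Pr => e e0.
  have [k _ hk] := near_infty_natSinv_lt (PosNum e0).
  have := h k I; rewrite /F /= => /le_trans; apply; rewrite lerD2l ltW //.
  exact: (hk k (leqnn k)).
have cv := @nonincreasing_cvg_mu _ _ R Q F.
have F0 : (Q (F 0%N) < +oo)%E by rewrite (le_lt_trans (probability_le1 Q _)) ?ltry //; exact: ml.
have mF k : measurable (F k) by exact: ml.
have mcap : measurable (\bigcap_k F k) by rewrite capF; exact: ml.
have noninc : {homo F : k m / (k <= m)%N >-> (m <= k)%O}.
  move=> k m km; apply/subsetPset => w; rewrite /F /= => /le_trans; apply; rewrite lerD2l.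
  by rewrite lef_pV2 ?posrE // ler_nat ltnS.
have {}cv := cv F0 mF mcap noninc.
rewrite capF in cv.
have fcv : (fun k => fine (Q (F k))) @ \oo --> fine (Q [set w | (f w <= t)%R]).
  by apply: fine_cvg; rewrite fineK ?fin_num_measure.
have /cvgrPdist_lt /(_ _ th0) [k _ hk] := fcv.
exists (t + k.+1%:R^-1); first by rewrite ltrDl.
move=> u /andP[tu us]; have := hk k (leqnn k); rewrite /= distrC => /ltW /(le_trans (ler_norm _)).
rewrite lerBlDl => hh; apply: le_trans hh; apply: fine_le; rewrite ?fin_num_measure //.
by apply: le_measure; rewrite ?inE // => w /= /le_trans; apply.
Qed.

(** It is enough to treat finitely many levels at a time: both distribution functions are
    monotone and right continuous, so rational levels suffice. *)
Theorem transfer_of_good : (forall (ts : seq R) (th : R), 0 < th ->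
    pr (~` [set w | forall t, t \in ts -> good_at t w]) <= c / N%:R + th) ->
  ((1 - c / N%:R)%:E <= P [set w | (sup [set `|fine (P [set w' | (stat w' <= t)%R]) -
      fine (kappa w `]-oo, t]%classic)| | t in [set: R]] <= 4 * r)%R])%E.
Proof.
move=> hgood; pose rt k : R := if unpickle k is Some q then ratr q else 0.
pose E k := [set w | forall t, t \in [seq rt i | i <- iota 0 k] -> good_at t w].
have mE k : measurable (E k).
  rewrite (_ : E k = \bigcap_(t in [set t | t \in [seq rt i | i <- iota 0 k]]) good_at t) //.
  by apply: fin_bigcap_measurable => [|t _]; [exact: finite_seq|exact: good_at_meas].
have pE k : 1 - c / N%:R <= pr (E k).
  apply/ler_addgt0Pr => th th0; have := hgood [seq rt i | i <- iota 0 k] th th0.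
  rewrite (_ : [set _ | _] = E k) // (pr_setC P (mE k)); exact: compl_arith.
have mcap : measurable (\bigcap_k E k) by exact: bigcapT_measurable.
have capE : \bigcap_k E k = [set w | (sup [set `|fine (P [set w' | (stat w' <= t)%R]) -
      fine (kappa w `]-oo, t]%classic)| | t in [set: R]] <= 4 * r)%R].
  apply/seteqP; split => w /= hw.
    apply: ge_sup; first by exists (`|fine (P [set w' | (stat w' <= 0)%R]) - fine (kappa w `]-oo, 0]%classic)|), 0.
    move=> _ [t _ <-]; apply/ler_addgt0Pr => th th0.
    have th20 : 0 < th / 2 by rewrite divr_gt0.
    have [s1 ts1 H1] := rcont P t mst th20.
    have [s2 ts2 H2] := rcont (kappa w) (f := idfun) t (@measurable_id _ _ _) th20.
    have tm : t < Num.min s1 s2 by rewrite lt_min ts1.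
    have [q qt] := rat_in_itvoo tm.
    move: qt; rewrite in_itv /= => /andP[tq]; rewrite lt_min => /andP[q1 q2].
    have gq : good_at (ratr q) w.
      apply: (hw (pickle q).+1 I); apply/mapP; exists (pickle q); last by rewrite /rt pickleK.
      by rewrite mem_iota /= add0n ltnS.
    have K1 : fine (P [set w | (stat w <= ratr q)%R]) <= fine (P [set w | (stat w <= t)%R]) + th / 2.
      by apply: H1; rewrite !ltW.
    have K2 : kap kappa (ratr q) w <= kap kappa t w + th / 2.
      have E2 u : [set x : R | (idfun x <= u)%R] = `]-oo, u]%classic by apply/funext => x /=; rewrite in_itv.
      by have := H2 (ratr q); rewrite !E2; apply; rewrite !ltW.
    have K3 : fine (P [set w | (stat w <= t)%R]) <= fine (P [set w | (stat w <= ratr q)%R]).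
      apply: (pr_mono P); [exact: measurable_set_le|exact: measurable_set_le|].
      by move=> x /= /le_trans; apply; exact: ltW.
    have K4 : kap kappa t w <= kap kappa (ratr q) w.
      apply: (pr_mono (kappa w)) => // x /=; rewrite !in_itv /= => /le_trans; apply; exact: ltW.
    exact: (rat_arith K1 K2 K3 K4 gq).
  move=> k _ t _; rewrite /good_at /=.
  apply: le_trans hw; apply: ub_le_sup; last by exists t.
  exists 1 => _ [u _ <-].
  have a1 : fine (P [set w | (stat w <= u)%R]) <= 1 by apply: (pr_le1 P); exact: measurable_set_le.
  have a2 : fine (kappa w `]-oo, u]%classic) <= 1 by exact: (pr_le1 (kappa w)).
  have a3 : 0 <= fine (P [set w | (stat w <= u)%R]) by exact: (pr_ge0 P).
  have a4 : 0 <= fine (kappa w `]-oo, u]%classic) by exact: (pr_ge0 (kappa w)).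
  exact: unit_dist.
rewrite -capE.
have noninc : {homo E : k m / (k <= m)%N >-> (m <= k)%O}.
  move=> k m km; apply/subsetPset => w hw t /mapP[i]; rewrite mem_iota /= add0n => ik ->.
  by apply: hw; apply/mapP; exists i => //; rewrite mem_iota /= add0n (leq_trans ik).
have F0 : (P (E 0%N) < +oo)%E by rewrite (le_lt_trans (probability_le1 P _)) ?ltry //; exact: mE.
have cv := @nonincreasing_cvg_mu _ _ R P E F0 mE mcap noninc.
rewrite -(cvg_lim _ cv) //; apply: lime_ge; first by apply/cvg_ex; eexists; exact: cv.
by apply: nearW => k; rewrite /= (prE P (mE k)) lee_fin; exact: pE.
Qed.

Theorem transfer :
  ((1 - c / N%:R)%:E <= P [set w | (sup [set `|fine (P [set w' | (stat w' <= t)%R]) -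
      fine (kappa w `]-oo, t]%classic)| | t in [set: R]] <= 4 * r)%R])%E.
Proof. exact: transfer_of_good good_finite. Qed.
End TransferEnd.

(** * Inner products, operator norms and expectations *)
Fact cs_arith (R : realType) (a b c : R) : 0 < b -> 0 <= a - 2 * (c / b) * c + (c / b) ^+ 2 * b -> c ^+ 2 <= a * b.
Proof.
move=> b0; rewrite (_ : a - _ + _ = (a * b - c ^+ 2) / b); last by field; rewrite gt_eqF.
by rewrite pmulr_lge0 ?invr_gt0 // subr_ge0.
Qed.

Section HilbertFacts.
Context {R : realType} {H : hilbertType R}.
Implicit Types x y z : H.

Lemma hipC x y : '<<x, y>> = '<<y, x>>. Proof. by rewrite hermC /= expr0 mul1r. Qed.
Lemma ipDr x y z : '<<x, y + z>> = '<<x, y>> + '<<x, z>>. Proof. by rewrite linearDr. Qed.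
Lemma ipBr x y z : '<<x, y - z>> = '<<x, y>> - '<<x, z>>. Proof. by rewrite linearBr. Qed.
Lemma ipZr a x y : '<<x, a *: y>> = a * '<<x, y>>. Proof. by rewrite linearZr_LR. Qed.
Lemma ip0r x : '<<x, 0>> = 0. Proof. by rewrite linear0r. Qed.
Lemma ipBl x y z : '<<x - y, z>> = '<<x, z>> - '<<y, z>>. Proof. by rewrite hipC ipBr !(hipC z). Qed.
Lemma ipZl a x y : '<<a *: x, y>> = a * '<<x, y>>. Proof. by rewrite hipC ipZr hipC. Qed.
Lemma hip_sumr x (I : Type) (r : seq I) (P : pred I) (F : I -> H) :
  '<<x, \sum_(i <- r | P i) F i>> = \sum_(i <- r | P i) '<<x, F i>>.
Proof. by apply: (big_morph (fun y => '<<x, y>>) (ipDr x) (ip0r x)). Qed.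

Lemma ip_sub2 a x y : `|x - a *: y| ^+ 2 = `|x| ^+ 2 - 2 * a * '<<x, y>> + a ^+ 2 * `|y| ^+ 2.
Proof. by rewrite -!inner_normE ipBl !ipBr !ipZl !ipZr (hipC y x); ring. Qed.

Lemma ip_cs x y : `|'<<x, y>>| <= `|x| * `|y|.
Proof.
have h : '<<x, y>> ^+ 2 <= `|x| ^+ 2 * `|y| ^+ 2.
  have [->|y0] := eqVneq y 0; first by rewrite ip0r normr0 expr0n mulr0.
  have b0 : 0 < `|y| ^+ 2 by rewrite exprn_gt0 // normr_gt0.
  by apply: (cs_arith b0); rewrite -ip_sub2 exprn_ge0.
have h0 : 0 <= `|x| * `|y| by rewrite mulr_ge0.
rewrite -(ler_pXn2r (ltn0Sn 1)) ?nnegrE ?normr_ge0 //.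
by rewrite exprMn real_normK ?num_real.
Qed.

Lemma ip_cts x : continuous (fun y : H => '<<x, y>>).
Proof.
move=> y; apply/cvgrPdist_lt => e e0.
have k0 : 0 < `|x| + 1 by rewrite ltr_wpDl.
have cid : z @[z --> y] --> y by exact: cvg_id.
have /cvgrPdist_lt /(_ _ (divr_gt0 e0 k0)) := cid.
apply: filterS => z /= h; rewrite -ipBr; apply: (le_lt_trans (ip_cs x (y - z))).
rewrite ltr_pdivlMr // in h; apply: le_lt_trans h; rewrite mulrC.
by apply: ler_wpM2l => //; rewrite lerDl.
Qed.

Section OpNorm.
Variables (A : H -> H) (K : R).
Hypotheses (AB : forall x y, A x - A y = A (x - y)) (AK : forall x, `|A x| <= K * `|x|).

Let K0 x : `|x| <= 1 -> `|A x| <= `|K|.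
Proof. by move=> x1; apply: (le_trans (AK x)); apply: le_trans (ler_norm _) _; rewrite normrM normr_id; exact: ler_piMr. Qed.

Lemma opnorm_ge x : `|x| <= 1 -> `|A x| <= opnorm A.
Proof. by move=> x1; apply: ub_le_sup; [exists `|K| => _ [y /= y1 <-]; exact: K0|exists x]. Qed.

Lemma opnorm_form u v : `|u| <= 1 -> `|v| <= 1 -> `|'<<u, A v>>| <= opnorm A.
Proof.
move=> u1 v1; apply: (le_trans (ip_cs _ _)); apply: le_trans (opnorm_ge v1).
exact: ler_piMl.
Qed.

(** The operator norm is a countable supremum of forms: a nearly maximal [x] is replaced by a
    member of the dense family, and the norm of its image is then read off along the direction of
    that image. *)
Lemma opnorm_attained (d : nat -> H) th : (forall x, `|x| <= 1 -> forall del : R, 0 < del -> exists i, `|x - d i| <= del) ->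
  0 < th -> exists i j, opnorm A - th <= `|'<<d i, A (d j)>>|.
Proof.
move=> dd th0; have hs : has_sup [set `|A x| | x in [set x | `|x| <= 1]].
  split; first by exists `|A 0|, 0 => //=; rewrite normr0.
  by exists `|K| => _ [y /= y1 <-]; exact: K0.
have th4 : 0 < th / 2 by rewrite divr_gt0.
have [_ [x x1 <-] hx] := sup_adherent th4 hs.
have k0 : 0 < `|K| + 1 by rewrite ltr_wpDl.
have [j hj] := dd x x1 (th / 4 / (`|K| + 1)) (divr_gt0 (divr_gt0 th0 (ltr0n _ 4)) k0).
pose y := A (d j); pose y' := `|y|^-1 *: y.
have y'1 : `|y'| <= 1.
  rewrite normrZ normfV normr_id; have [->|y0] := eqVneq y 0; first by rewrite normr0 mulr0.
  by rewrite mulVf // normr_eq0.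
have y'y : '<<y', y>> = `|y|.
  rewrite ipZl inner_normE; have [->|y0] := eqVneq y 0; first by rewrite normr0 expr0n mulr0.
  by rewrite expr2 mulrA mulVf ?mul1r // normr_eq0.
have ky : 0 < `|y| + 1 by rewrite ltr_wpDl.
have [i hi] := dd y' y'1 (th / 4 / (`|y| + 1)) (divr_gt0 (divr_gt0 th0 (ltr0n _ 4)) ky).
exists i, j; rewrite -/y.
have e1 : `|A x| - `|y| <= th / 4.
  apply: (le_trans (lerB_dist _ _)); rewrite AB; apply: (le_trans (AK _)).
  apply: (@le_trans _ _ ((`|K| + 1) * `|x - d j|)).
    by apply: ler_wpM2r => //; rewrite (le_trans (ler_norm _)) // lerDl.
  by rewrite mulrC -ler_pdivlMr.
have e2 : `|y| - '<<d i, y>> <= th / 4.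
  rewrite -y'y -ipBl; apply: (le_trans (ler_norm _)); apply: (le_trans (ip_cs _ _)).
  apply: (@le_trans _ _ (th / 4 / (`|y| + 1) * (`|y| + 1))); last by rewrite divfK // gt_eqF.
  by apply: ler_pM => //; rewrite lerDl.
apply: le_trans (ler_norm _); move: hx e1 e2; rewrite -/(opnorm A); clear; move: (opnorm A) => o ? ? ?; lra.
Qed.
End OpNorm.

(** Radial truncation moves a countable dense set into the unit ball at a cost controlled by the
    distance to the approximated point. *)
Lemma dense_ball : separable_space H -> exists d : nat -> H, (forall i, `|d i| <= 1) /\
  forall x, `|x| <= 1 -> forall del : R, 0 < del -> exists i, `|x - d i| <= del.
Proof.
move=> [D /countable_injP [f fi] dD].
pose d0 k := xget 0 [set x | D x /\ f x = k].
have d0f x : D x -> d0 (f x) = x.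
  move=> Dx; rewrite /d0; case: xgetP => [y _ [Dy fy]|/(_ x)]; last by case.
  by apply: fi => //; exact: mem_set.
exists (fun k => (Num.max 1 `|d0 k|)^-1 *: d0 k); split=> [i|x x1 del del0].
  have m0 : 0 < Num.max 1 `|d0 i| by rewrite lt_max ltr01.
  by rewrite normrZ ger0_norm ?invr_ge0 ?(ltW m0) // ler_pdivrMl // mulr1 le_max lexx orbT.
have del2 : 0 < del / 2 by rewrite divr_gt0.
have [|y [hy Dy]] := dD (ball x (del / 2)) _ (ball_open x (del / 2)); first by exists x; exact: ballxx.
exists (f y); rewrite d0f //; move: hy; rewrite -ball_normE /= => hy.
set c := Num.max 1 `|y|.
have c1 : 1 <= c by rewrite le_max lexx.
have e : `|y - c^-1 *: y| <= del / 2.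
  rewrite -{1}[y]scale1r -scalerBl normrZ ger0_norm ?subr_ge0 ?invf_le1 ?(lt_le_trans ltr01) //.
  have yb : `|y| <= 1 + del / 2.
    rewrite (_ : y = x - (x - y)); last by rewrite subKr.
    by apply: (le_trans (ler_normB _ _)); apply: lerD => //; exact: ltW.
  have c0 : 0 < c by rewrite (lt_le_trans ltr01).
  have cb : c <= 1 + del / 2 by rewrite ge_max yb lerDl ltW.
  have yc : `|y| <= c by rewrite le_max lexx orbT.
  apply: (@le_trans _ _ ((1 - c^-1) * c)).
    by apply: ler_wpM2l => //; rewrite subr_ge0 invf_le1.
  by rewrite mulrBl mulVf ?gt_eqF // mul1r lerBlDl.
have -> : x - c^-1 *: y = (x - y) + (y - c^-1 *: y) by rewrite addrA subrK.
apply: (le_trans (ler_normD _ _)); move: hy e; clear; move: `|_ - _| `|_ - _| => a b ? ?; lra.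
Qed.

Notation HB := (g_sigma_algebraType [set U : set H | open U]).

Lemma borel_cts (f : H -> R) : continuous f -> measurable_fun [set: HB] (f : HB -> R).
Proof.
move=> cf; apply: (measurability (@RGenOpens.G R)).
  exact: RGenOpens.measurableE.
move=> _ [_ [a [b ->]] <-]; rewrite setTI; apply: sub_sigma_algebra.
move/continuousP : cf; apply; exact: interval_open.
Qed.
End HilbertFacts.

Section Expect.
Context {R : realType} {d : measure_display} {T : measurableType d} (P : probability T R).
Notation pr := (pr P).
Implicit Types f g : T -> R.
Definition itg f := P.-integrable setT (EFin \o f).
Definition Ex f := fine (\int[P]_w (f w)%:E).

Lemma itg_meas f : itg f -> measurable_fun setT f.
Proof. by move/integrableP => [/measurable_EFinP]. Qed.

Lemma itg_le f g : measurable_fun setT f -> (forall w, `|f w| <= g w) -> itg g -> itg f.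
Proof.
move=> mf fg; apply: le_integrable => //; first exact/measurable_EFinP.
by move=> w _ /=; rewrite lee_fin (le_trans (fg w)) // ler_norm.
Qed.

Lemma itg_cst c : itg (fun=> c).
Proof. exact: (finite_measure_integrable_cst P c). Qed.
Lemma itgD f g : itg f -> itg g -> itg (fun w => f w + g w).
Proof. by move=> hf hg; exact: (integrableD measurableT hf hg). Qed.
Lemma itgZ c f : itg f -> itg (fun w => c * f w).
Proof. by move=> hf; exact: (integrableZl measurableT c hf). Qed.
Lemma itgB f g : itg f -> itg g -> itg (fun w => f w - g w).
Proof. by move=> hf hg; exact: (integrableB measurableT hf hg). Qed.
Lemma itg_abs f : itg f -> itg (fun w => `|f w|).
Proof. by move=> hf; exact: (integrable_abse hf). Qed.
Lemma itg_sum (I : Type) (r : seq I) (F : I -> T -> R) : (forall i, itg (F i)) -> itg (fun w => \sum_(i <- r) F i w).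
Proof.
move=> h; elim: r => [|i r IH].
  by rewrite (_ : (fun w => _) = fun=> 0); [exact: itg_cst|apply/funext => w; rewrite big_nil].
by rewrite (_ : (fun w => _) = fun w => F i w + \sum_(i <- r) F i w); [exact: itgD|apply/funext => w; rewrite big_cons].
Qed.

Lemma Ex_cst c : Ex (fun=> c) = c.
Proof. by rewrite /Ex integral_cst //= probability_setT mule1. Qed.
Lemma ExD f g : itg f -> itg g -> Ex (fun w => f w + g w) = Ex f + Ex g.
Proof. by move=> hf hg; exact: (RintegralD measurableT hf hg). Qed.
Lemma ExB f g : itg f -> itg g -> Ex (fun w => f w - g w) = Ex f - Ex g.
Proof. by move=> hf hg; exact: (RintegralB measurableT hf hg). Qed.
Lemma ExZ c f : itg f -> Ex (fun w => c * f w) = c * Ex f.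
Proof. by move=> hf; exact: (RintegralZl c measurableT hf). Qed.
Lemma Ex_le f g : itg f -> itg g -> (forall w, f w <= g w) -> Ex f <= Ex g.
Proof. by move=> hf hg h; apply: (le_Rintegral measurableT hf hg) => w _; exact: h. Qed.
Lemma Ex_abs f : itg f -> `|Ex f| <= Ex (fun w => `|f w|).
Proof. by move=> hf; exact: (le_normr_Rintegral measurableT hf). Qed.
Lemma Ex_sum (I : Type) (r : seq I) (F : I -> T -> R) : (forall i, itg (F i)) ->
  Ex (fun w => \sum_(i <- r) F i w) = \sum_(i <- r) Ex (F i).
Proof.
move=> h; elim: r => [|i r IH].
  by rewrite big_nil -[RHS](Ex_cst 0); congr Ex; apply/funext => w; rewrite big_nil.
rewrite big_cons -IH -ExD //; last exact: itg_sum.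
by congr Ex; apply/funext => w; rewrite big_cons.
Qed.

Lemma Ex_bool (b : pred T) : measurable [set w | b w] -> itg (fun w => (b w)%:R) /\ Ex (fun w => (b w)%:R) = pr [set w | b w].
Proof.
move=> mb; have E : (fun w => (b w)%:R) = \1_[set w | b w] :> (T -> R).
  by apply/funext => w; rewrite indicE; congr (_%:R); congr nat_of_bool; apply/idP/idP => [h|/set_mem //]; exact: mem_set.
rewrite E; split; first exact: integrable_indic.
by rewrite /Ex /pr integral_indic // setIT.
Qed.

Lemma pr_markov f th : itg f -> 0 < th -> pr [set w | th < `|f w|] <= Ex (fun w => `|f w|) / th.
Proof.
move=> hf th0; have ha := itg_abs hf.
have mb : measurable [set w | th < `|f w|].
  rewrite (_ : [set _ | _] = ~` [set w | `|f w| <= th]).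
    by apply: measurableC; apply: measurable_set_le => //; exact: itg_meas.
  by apply/funext => w /=; apply/propext; rewrite ltNge; split => /negP.
have [h1 <-] := @Ex_bool (fun w => th < `|f w|) mb.
rewrite ler_pdivlMr // mulrC -ExZ //; apply: Ex_le => //; first exact: itgZ.
by move=> w; case: ltP => h; rewrite ?mulr0 ?mulr1 // ltW.
Qed.

Section CellFun.
Context {I : finType} (c : T -> I).
Hypothesis mc : forall v, measurable (c @^-1` [set v]).

Lemma cellfun_meas (F : I -> R) : measurable_fun setT (fun w => F (c w)).
Proof.
move=> _ B mB; rewrite setTI; apply: (@meas_fin _ T _ c (fun v => [set w | B (F v)])) => // v.
have [h|h] := pselect (B (F v)); [rewrite (_ : [set _ | _] = setT)|rewrite (_ : [set _ | _] = set0)] => //; by apply/seteqP; split.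
Qed.

Lemma cellfun_itg (F : I -> R) : itg (fun w => F (c w)).
Proof.
apply: (@itg_le _ (fun=> \sum_v `|F v|)); [exact: cellfun_meas| |exact: itg_cst].
by move=> w; rewrite (bigD1 (c w)) //= lerDl sumr_ge0.
Qed.

Lemma Ex_cell (F : I -> R) : Ex (fun w => F (c w)) = \sum_v pr (c @^-1` [set v]) * F v.
Proof.
have E v : [set w | c w == v] = c @^-1` [set v] by apply/funext => w /=; apply/propext; split => /eqP.
have h v : itg (fun w => (c w == v)%:R) /\ Ex (fun w => (c w == v)%:R) = pr [set w | c w == v].
  by apply: Ex_bool; rewrite E.
rewrite (_ : (fun w => _) = fun w => \sum_v F v * (c w == v)%:R).
  rewrite Ex_sum => [|v]; last by apply: itgZ; exact: (h v).1.
  by apply: eq_bigr => v _; rewrite ExZ ?(h v).2 ?E 1?mulrC //; exact: (h v).1.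
apply/funext => w; rewrite (bigD1 (c w)) //= eqxx mulr1 big1 ?addr0 // => v /negPf.
by rewrite eq_sym => ->; rewrite mulr0.
Qed.
End CellFun.

(** A countable supremum is reached up to [eps] by finitely many of its terms, outside an event
    of small probability. *)
Lemma sup_approx (F : nat -> T -> R) (S : T -> R) : (forall k, measurable_fun setT (F k)) ->
  (forall w k, `|F k w| <= S w) -> (forall w (th : R), 0 < th -> exists k, S w - th <= `|F k w|) ->
  measurable_fun setT S /\
  forall eps del : R, 0 < eps -> 0 < del -> exists K, measurable [set w | forall k, (k < K)%N -> `|F k w| < S w - eps] /\
    pr [set w | forall k, (k < K)%N -> `|F k w| < S w - eps] <= del.
Proof.
move=> mF h1 h2; have mS : measurable_fun setT S.
  apply: (measurability (@RGenOInfty.G R)); first exact: RGenOInfty.measurableE.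
  move=> _ [_ [t ->] <-]; rewrite setTI.
  rewrite (_ : _ @^-1` _ = ~` \bigcap_k [set w | `|F k w| <= t]).
    apply: measurableC; apply: bigcapT_measurable => k; apply: measurable_set_le => //.
    exact: measurableT_comp.
  apply/seteqP; split => w /=; rewrite in_itv /= andbT.
    move=> tS hall; have e0 : 0 < (S w - t) / 2 by rewrite divr_gt0 // subr_gt0.
    have [k hk] := h2 w _ e0; have := hall k I => /= hk'.
    move: tS hk hk'; clear; move: (S w) `|_| => s f ? ? ?; lra.
  move=> hn; rewrite ltNge; apply/negP => St; apply: hn => k _ /=; exact: le_trans (h1 w k) _.
split=> // eps del eps0 del0.
pose E K := [set w | forall k, (k < K)%N -> `|F k w| < S w - eps].
have mE K : measurable (E K).
  rewrite (_ : E K = \bigcap_(k in [set k | (k < K)%N]) (~` [set w | S w - eps <= `|F k w|])).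
    apply: bigcap_measurableType => k _.
    apply: measurableC; rewrite (_ : [set _ | _] = [set w | S w - `|F k w| <= eps]).
      by apply: measurable_set_le; apply: measurable_funB => //; exact: measurableT_comp.
    by apply/funext => w /=; rewrite !lerBlDr addrC.
  by apply/seteqP; split => w /= h k /h; rewrite ltNge => /negP.
have capE : \bigcap_K E K = set0.
  rewrite -subset0 => w h; have [k hk] := h2 w eps eps0.
  by have := h k.+1 I k (ltnSn k); rewrite ltNge hk.
have noninc : {homo E : k m / (k <= m)%N >-> (m <= k)%O}.
  by move=> k m km; apply/subsetPset => w h i ik; apply: h; exact: leq_trans ik km.
have F0 : (P (E 0%N) < +oo)%E by rewrite (le_lt_trans (probability_le1 P _)) ?ltry //; exact: mE.
have mcap : measurable (\bigcap_K E K) by rewrite capE.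
have := @nonincreasing_cvg_mu _ _ R P E F0 mE mcap noninc.
rewrite capE measure0 => cv.
have fcv : (fun k => fine (P (E k))) @ \oo --> (0 : R) by exact: (fine_cvg cv).
have /cvgrPdist_lt /(_ _ del0) [K _ hK] := fcv.
exists K; split; first exact: mE.
by have := hK K (leqnn K); rewrite /= sub0r normrN => /ltW /(le_trans (ler_norm _)).
Qed.
End Expect.

(** * Rounding the scores *)
Section FiniteCS.
Context {R : realType}.

(** Cauchy-Schwarz, with weights that make the rows of the seminorm square summable. *)
Lemma wcs M (w l x : nat -> R) : (forall j, 0 < w j) ->
  (\sum_(j < M) l j * x j) ^+ 2 <= (\sum_(j < M) w j * x j ^+ 2) * (\sum_(j < M) l j ^+ 2 / w j).
Proof.
move=> w0; set B := \sum_(j < M) w j * _; set A := \sum_(j < M) _ / _; set C := \sum_(j < M) _.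
have t0 j : 0 <= l j ^+ 2 / w j by rewrite divr_ge0 ?sqr_ge0 // ltW.
have A0 : 0 <= A by rewrite sumr_ge0.
have [A1|A1] := eqVneq A 0.
  have C0 : C = 0.
    apply: big1 => j _; move/eqP: A1; rewrite psumr_eq0 // => /allP /(_ j); rewrite mem_index_enum => /(_ isT).
    by rewrite mulf_eq0 sqrf_eq0 invr_eq0 (gt_eqF (w0 _)) orbF => /eqP ->; rewrite mul0r.
  by rewrite C0 A1 mulr0 expr0n.
apply: cs_arith; first by rewrite lt_def A1.
rewrite /B /A /C mulr_sumr mulr_sumr -sumrB -big_split /=; apply: sumr_ge0 => j _.
rewrite -/C -/A (_ : _ + _ = w j * (x j - C / A * (l j / w j)) ^+ 2).
  by rewrite mulr_ge0 ?sqr_ge0 // ltW.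
by field; rewrite A1 gt_eqF.
Qed.

Lemma fcs M (l x : nat -> R) : (\sum_(j < M) l j * x j) ^+ 2 <= (\sum_(j < M) l j ^+ 2) * (\sum_(j < M) x j ^+ 2).
Proof.
have e1 : \sum_(j < M) l j ^+ 2 / 1 = \sum_(j < M) l j ^+ 2 by apply: eq_bigr => j _; rewrite divr1.
have e2 : \sum_(j < M) 1 * x j ^+ 2 = \sum_(j < M) x j ^+ 2 by apply: eq_bigr => j _; rewrite mul1r.
by have := @wcs M (fun=> 1) l x (fun=> ltr01); rewrite e1 e2 mulrC.
Qed.

(** A double sum, grouped by unordered pairs of indices. *)
Lemma sum_sym_tri m (F : nat -> nat -> R) :
  \sum_(j < 'C(m.+1, 2)) (if (tri j).1 == (tri j).2 then F (tri j).1 (tri j).1 else F (tri j).1 (tri j).2 + F (tri j).2 (tri j).1)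
  = \sum_(a < m) \sum_(b < m) F a b.
Proof.
rewrite (sum_tri m (fun a b => if a == b then F a a else F a b + F b a)).
elim: m => [|m IH]; first by rewrite !big_ord0.
rewrite big_ord_recr IH /= big_ord_recr /= eqxx.
have e1 : \sum_(i < m) (if (i : nat) == m then F i i else F i m + F m i) = \sum_(i < m) (F i m + F m i).
  by apply: eq_bigr => a _; rewrite ltn_eqF.
rewrite e1.
rewrite [RHS]big_ord_recr /= [X in _ = _ + X]big_ord_recr /= big_split /=.
have e2 : \sum_(i < m) \sum_(b < m.+1) F i b = \sum_(a < m) (\sum_(b < m) F a b + F a m).
  by apply: eq_bigr => a _; rewrite big_ord_recr.
rewrite e2.
by rewrite big_split /= !addrA.
Qed.
End FiniteCS.

Fact steps_arith (R : realType) (S t k b : R) : (b = 1 /\ k + 1 <= t) \/ (b = 0 /\ t < k + 1) ->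
  0 <= S -> S <= t -> S <= k -> t - 1 <= S \/ k <= S ->
  [/\ 0 <= S + b, S + b <= t, S + b <= k + 1 & t - 1 <= S + b \/ k + 1 <= S + b].
Proof.
move=> hb h0 h1 h2 h3; case: hb => -[-> h]; (split; [lra|lra|lra|]).
  by case: h3 => ?; [left|right]; lra.
by left; case: h3 => ?; lra.
Qed.

Section Rounding.
Context {R : realType}.
Implicit Types x t : R.

Definition steps K t : R := \sum_(k < K) (k.+1%:R <= t)%R%:R.

Lemma steps_neg K t : t <= 0 -> steps K t = 0.
Proof. by move=> t0; apply: big1 => k _; rewrite leNgt (le_lt_trans t0). Qed.

Lemma stepsP K t : 0 <= t -> [/\ 0 <= steps K t, steps K t <= t, steps K t <= K%:R & t - 1 <= steps K t \/ K%:R <= steps K t].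
Proof.
move=> t0; elim: K => [|K [h0 h1 h2 h3]].
  by rewrite /steps big_ord0; split=> //; right.
rewrite /steps big_ord_recr -/(steps K t) /= -[K.+1]addn1 natrD.
by apply: steps_arith => //; case: leP => h; [left|right].
Qed.

(** The code of a real number is the pair of threshold vectors of its positive and negative
    parts, so that sets of equal code are intersections of half lines and their complements. *)
Definition rcode_type L := ({ffun 'I_(L ^ 2) -> bool} * {ffun 'I_(L ^ 2) -> bool})%type.
Definition rcode L x : rcode_type L :=
  ([ffun k : 'I_(L ^ 2) => k.+1%:R <= L%:R * x], [ffun k : 'I_(L ^ 2) => k.+1%:R <= - (L%:R * x)]).
Definition rval L (c : rcode_type L) : R := L%:R^-1 * (\sum_k (c.1 k)%:R - \sum_k (c.2 k)%:R).
Definition rnd L x := rval (rcode L x).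

Lemma rndE L x : rnd L x = L%:R^-1 * (steps (L ^ 2) (L%:R * x) - steps (L ^ 2) (- (L%:R * x))).
Proof. by rewrite /rnd /rval /=; congr (_ * (_ - _)); apply: eq_bigr => k _; rewrite ffunE. Qed.

Lemma rndN L x : rnd L (- x) = - rnd L x.
Proof. by rewrite !rndE mulrN opprK -[RHS]mulrN opprB. Qed.

Lemma rnd_pos L x : (0 < L)%N -> 0 <= x -> 0 <= rnd L x <= x /\ x - rnd L x <= L%:R^-1 * (1 + x ^+ 2).
Proof.
move=> L0 x0; have l0 : 0 < L%:R :> R by rewrite ltr0n.
have t0 : 0 <= L%:R * x by rewrite mulr_ge0 // ltW.
have [h0 h1 h2 h3] := stepsP (L ^ 2) t0.
rewrite rndE (@steps_neg _ (- _)) ?oppr_le0 // subr0.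
rewrite mulr_ge0 ?invr_ge0 ?(ltW l0) //= !ler_pdivrMl // h1; split=> //.
rewrite -(ler_pM2l l0) mulrBr !mulrA divff ?gt_eqF // !mul1r.
have x2 : 0 <= x ^+ 2 by exact: sqr_ge0.
case: h3 => h3.
  by rewrite lerBlDr; apply: (@le_trans _ _ (1 + steps (L ^ 2) (L%:R * x))); rewrite ?lerD2r ?lerDl // -lerBlDl.
have Lx : L%:R <= x.
  by rewrite -(ler_pM2l l0); apply: le_trans h1; apply: le_trans h3; rewrite natrX expr2.
rewrite lerBlDr; apply: (@le_trans _ _ (x ^+ 2)).
  by rewrite expr2; apply: ler_wpM2r.
by rewrite -[x in x <= _]add0r -addrA addrCA [X in _ <= X](_ : _ = x ^+ 2 + (1 + steps (L ^ 2) (L%:R * x))) ?add0r ?lerDl ?addr_ge0 // addrCA addrA.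
Qed.

Lemma rnd_le L x : (0 < L)%N -> `|rnd L x| <= `|x|.
Proof.
move=> L0; have [x0|x0] := leP 0 x; first by have [/andP[h0 h1] _] := rnd_pos L0 x0; rewrite !ger0_norm.
have x0' : 0 <= - x by rewrite oppr_ge0 ltW.
have [/andP[h0 h1] _] := rnd_pos L0 x0'.
by rewrite -[`|x|]normrN -[`|rnd L x|]normrN -rndN !ger0_norm.
Qed.

(** The relative form of the error, with one more power of [x], covers both the grid and the
    range beyond the last threshold, where the rounded value saturates. *)
Lemma rnd_err L x : (0 < L)%N -> `|x - rnd L x| <= L%:R^-1 * (1 + x ^+ 2).
Proof.
move=> L0; have [x0|x0] := leP 0 x.
  by have [/andP[h0 h1] h] := rnd_pos L0 x0; rewrite ger0_norm ?subr_ge0.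
have x0' : 0 <= - x by rewrite oppr_ge0 ltW.
have [/andP[h0 h1] h] := rnd_pos L0 x0'.
rewrite (_ : x - rnd L x = - (- x - rnd L (- x))); last by rewrite rndN opprB opprK addrC.
by rewrite normrN ger0_norm ?subr_ge0 // -[x ^+ 2]sqrrN.
Qed.

Fact prod_err_arith (a b p q : R) (l : R) : `|p| <= `|a| -> `|q| <= `|b| -> 0 <= l ->
  `|a - p| <= l * (1 + a ^+ 2) -> `|b - q| <= l * (1 + b ^+ 2) ->
  (a * b - p * q) ^+ 2 <= l ^+ 2 * (16 + 16 * (a ^+ 8 + b ^+ 8)).
Proof.
move=> pa qb l0 ea eb.
have h : `|a * b - p * q| <= l * (`|a| * (1 + b ^+ 2) + `|b| * (1 + a ^+ 2)).
  rewrite (_ : a * b - p * q = a * (b - q) + q * (a - p)); last by ring.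
  apply: (le_trans (ler_normD _ _)); rewrite !normrM mulrDr; apply: lerD.
    by rewrite mulrCA; exact: ler_wpM2l.
  by rewrite mulrCA; apply: ler_pM.
have u0 : 0 <= `|a * b - p * q| by [].
rewrite -[(a * b - p * q) ^+ 2]real_normK ?num_real //.
apply: (@le_trans _ _ ((l * (`|a| * (1 + b ^+ 2) + `|b| * (1 + a ^+ 2))) ^+ 2)).
  by apply: lerXn2r; rewrite ?nnegrE // (le_trans u0).
rewrite exprMn; apply: ler_wpM2l; first exact: sqr_ge0.
rewrite -[a ^+ 2]real_normK ?num_real // -[b ^+ 2]real_normK ?num_real //.
rewrite (_ : a ^+ 8 = `|a| ^+ 8); last by rewrite -normrX ger0_norm // (exprM a 2 4) exprn_even_ge0.
rewrite (_ : b ^+ 8 = `|b| ^+ 8); last by rewrite -normrX ger0_norm // (exprM b 2 4) exprn_even_ge0.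
move: (normr_ge0 a) (normr_ge0 b); move: `|a| `|b| => {a b p q pa qb ea eb h u0} s t s0 t0.
(* with M the larger of the two, the left side is at most (2 M + 2 M^3)^2 and M^2, M^4, M^6 <= 1 + M^8 *)
have K (x y : R) : 0 <= x -> x <= y -> (x * (1 + y ^+ 2) + y * (1 + x ^+ 2)) ^+ 2 <= 16 + 16 * y ^+ 8.
  move=> x0 xy; have y0 : 0 <= y by exact: le_trans xy.
  apply: (@le_trans _ _ ((y * (1 + y ^+ 2) + y * (1 + y ^+ 2)) ^+ 2)).
    apply: lerXn2r; rewrite ?nnegrE; [| |apply: lerD].
    - by rewrite addr_ge0 // mulr_ge0 // addr_ge0 // sqr_ge0.
    - by rewrite addr_ge0 // mulr_ge0 // addr_ge0 // sqr_ge0.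
    - by apply: ler_wpM2r => //; rewrite addr_ge0 // sqr_ge0.
    - by apply: ler_wpM2l => //; rewrite lerD2l; apply: lerXn2r.
  have E : 16 + 16 * y ^+ 8 - (y * (1 + y ^+ 2) + y * (1 + y ^+ 2)) ^+ 2 =
    2 * (y ^+ 4 - y ^+ 2) ^+ 2 + 14 * (y ^+ 4 - 2^-1) ^+ 2 + (2 * y ^+ 2 - 1) ^+ 2 + 23 / 2 by field.
  rewrite -subr_ge0 E; apply: addr_ge0; last by rewrite divr_ge0.
  by apply: addr_ge0; [apply: addr_ge0|]; rewrite ?sqr_ge0 // mulr_ge0 // sqr_ge0.
have [st|ts] := leP s t.
  by apply: (le_trans (K _ _ s0 st)); rewrite lerD2l ler_pM2l // lerDr exprn_ge0.
rewrite addrC; apply: (le_trans (K _ _ t0 (ltW ts))).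
by rewrite lerD2l ler_pM2l // lerDl exprn_ge0.
Qed.

Lemma rnd_prod_err L x t : (0 < L)%N ->
  (x * t - rnd L x * rnd L t) ^+ 2 <= (L%:R^-1) ^+ 2 * (16 + 16 * (x ^+ 8 + t ^+ 8)).
Proof.
by move=> L0; apply: prod_err_arith; rewrite ?invr_ge0 ?ler0n ?rnd_le ?rnd_err.
Qed.
End Rounding.

Fact bessel_arith (R : realType) (x y : R) : 0 <= y - 2 * 1 * x + 1 ^+ 2 * x -> x <= y.
Proof. by rewrite expr1n; lra. Qed.

Fact sq_add4 (R : realType) (u v : R) : (u + v) ^+ 2 <= 4 * (u ^+ 2 + v ^+ 2).
Proof.
rewrite -subr_ge0 (_ : _ - _ = 2 * u ^+ 2 + 2 * v ^+ 2 + (u - v) ^+ 2); last by ring.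
by apply: addr_ge0; [apply: addr_ge0|]; rewrite ?sqr_ge0 // mulr_ge0 // sqr_ge0.
Qed.

(** * The rounded model is admissible *)
Fact even_prod_le (R : realType) (a b p q : R) k : `|p| <= `|a| -> `|q| <= `|b| ->
  (p * q) ^+ (2 * k) <= 2^-1 * (a ^+ (2 * (2 * k)) + b ^+ (2 * (2 * k))).
Proof.
move=> pa qb; have ev (x : R) : x ^+ (2 * k) = `|x| ^+ (2 * k) by rewrite !exprM real_normK ?num_real.
rewrite ev normrM exprMn ![(2 * (2 * k))%N]mulnC !(exprM _ (2 * k) 2) !(ev a) !(ev b).
apply: (@le_trans _ _ (`|a| ^+ (2 * k) * `|b| ^+ (2 * k))).
  by apply: ler_pM; rewrite ?exprn_ge0 //; apply: lerXn2r.
move: (`|a| ^+ _) (`|b| ^+ _) => A B; have := sqr_ge0 (A - B); rewrite sqrrB; clear; move: (A ^+ 2) (B ^+ 2) (A * B) => x y z; rewrite -mulr_natr; lra.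
Qed.

Fact cov_arith (R : realType) (c1 S V G eta : R) : 0 <= S -> c1 * S <= 2 * V + 2 * (S * G) -> G <= eta -> eta <= c1 / 4 -> c1 / 4 * S <= V.
Proof.
move=> S0 h Ge ec; have h2 : S * G <= S * (c1 / 4) by apply: ler_wpM2l => //; exact: le_trans ec.
rewrite (_ : S * (c1 / 4) = c1 * S / 4) in h2; last by ring.
rewrite (_ : c1 / 4 * S = c1 * S / 4); last by ring.
by move: h h2; move: (S * G) (c1 * S) => {S0 Ge ec} g u; lra.
Qed.

Fact sq_split (R : realType) (a b k : R) : (a - k) ^+ 2 <= 2 * (b - k) ^+ 2 + 2 * (a - b) ^+ 2.
Proof.
rewrite -subr_ge0 (_ : _ - _ = ((b - k) - (a - b)) ^+ 2); first exact: sqr_ge0.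
by ring.
Qed.

Section Model.
Context {R : realType} {H : hilbertType R} {d : measure_display} {T : measurableType d} (P : probability T R).
Notation HB := (g_sigma_algebraType [set U : set H | open U]).
Variables (Y : T -> H) (e : nat -> H) (s : nat -> R) (m' L : nat).
Notation m := m'.+1.
Notation M := 'C(m.+1, 2).
Notation Ex := (Ex P).
Notation itg := (itg P).
Notation pr := (pr P).
Hypotheses (rY : random_element Y) (L0 : (0 < L)%N).
Notation I := {ffun 'I_m -> rcode_type L}.

Definition cellm (h : H) : I := [ffun a : 'I_m => rcode L ('<<h, e a>> / s a)].
Definition zv (v : I) (a : nat) : R := rval (v (inord a)).
Definition zs (a : nat) (w : T) : R := '<<Y w, e a>> / s a.

Lemma zv_cell h a : (a < m)%N -> zv (cellm h) a = rnd L ('<<h, e a>> / s a).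
Proof. by move=> am; rewrite /zv ffunE inordK. Qed.

Lemma ip_borel u (c : R) : measurable_fun [set: HB] ((fun h : H => '<<h, u>> / c) : HB -> R).
Proof.
apply: (@measurable_funM _ HB R setT (fun h : H => '<<h, u>>) (fun=> c^-1)); last exact: measurable_cst.
rewrite (_ : (fun h : H => '<<h, u>>) = fun h => '<<u, h>>); last by apply/funext => h; rewrite hipC.
apply (@borel_cts R H (fun h => '<<u, h>>) (@ip_cts R H u)).
Qed.

Lemma borel_rcode (f : H -> R) (c : rcode_type L) : measurable_fun [set: HB] (f : HB -> R) ->
  borel H [set h | rcode L (f h) = c].
Proof.
move=> mf; have bit (g : H -> R) t (b : bool) : measurable_fun [set: HB] (g : HB -> R) ->
    measurable ([set h | (t <= g h)%R = b] : set HB).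
  move=> mg; have m0 : measurable ([set h | - g h <= - t] : set HB).
    by apply: measurable_set_le; exact: measurable_funN.
  case: b; first by rewrite (_ : [set _ | _] = [set h | - g h <= - t]) //; apply/funext => h /=; rewrite lerN2.
  rewrite (_ : [set _ | _] = ~` [set h | - g h <= - t]); first exact: measurableC.
  by apply/funext => h /=; rewrite lerN2; apply/propext; split=> [->//|/negP/negbTE].
have mLf : measurable_fun [set: HB] ((fun h => L%:R * f h) : HB -> R) by apply: measurable_funM => //; exact: measurable_cst.
rewrite (_ : [set _ | _] = \bigcap_(k in [set: 'I_(L ^ 2)]) ([set h | (k.+1%:R <= L%:R * f h)%R = c.1 k] `&`
    [set h | (k.+1%:R <= - (L%:R * f h))%R = c.2 k])).
  apply: (@fin_bigcap_measurable _ HB) => [|k _]; first exact: finite_finset.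
  by apply: (@measurableI _ HB); apply: bit => //; exact: measurable_funN.
case: c => c1 c2; apply/seteqP; split => h /=; first by case=> <- <- k _; rewrite !ffunE.
by move=> hk; congr pair; apply/ffunP => k; rewrite ffunE; have [] := hk k Logic.I.
Qed.

Lemma bcell_cellm : bcell cellm.
Proof.
move=> v; rewrite (_ : _ @^-1` _ = \bigcap_(a in [set: 'I_m]) [set h | rcode L ('<<h, e a>> / s a) = v a]).
  apply: (@fin_bigcap_measurable _ HB) => [|a _]; first exact: finite_finset.
  by apply: borel_rcode; exact: ip_borel.
apply/seteqP; split => h /=; first by move=> <- a _; rewrite ffunE.
by move=> hk; apply/ffunP => a; rewrite ffunE; exact: hk.
Qed.

Lemma random_borel (f : H -> R) : measurable_fun [set: HB] (f : HB -> R) -> measurable_fun setT (fun w => f (Y w)).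
Proof.
by move=> mf _ B mB; rewrite setTI; apply: (rY (A := f @^-1` B)); rewrite -[_ @^-1` _]setTI; exact: mf.
Qed.

Lemma zs_meas a : measurable_fun setT (zs a).
Proof. by apply: (@random_borel (fun h => '<<h, e a>> / s a)); exact: ip_borel. Qed.

Definition qm (v : I) : R := pr (Y @^-1` (cellm @^-1` [set v])).
Definition ymean j := \sum_v qm v * (zv v (tri j).1 * zv v (tri j).2).
Definition yv v j := zv v (tri j).1 * zv v (tri j).2 - ymean j.

Lemma mcell v : measurable ((fun w => cellm (Y w)) @^-1` [set v]).
Proof. exact: (rY (bcell_cellm v)). Qed.

Lemma ExqE (F : I -> R) : Ex (fun w => F (cellm (Y w))) = \sum_v qm v * F v.
Proof. exact: (Ex_cell P mcell F). Qed.

Lemma qm_ge0 v : 0 <= qm v. Proof. exact: pr_ge0. Qed.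
Lemma qm_sum : \sum_v qm v = 1.
Proof. by rewrite -[RHS](Ex_cst P 1) (ExqE (fun=> 1)); apply: eq_bigr => v _; rewrite mulr1. Qed.

Lemma yv_mean j : \sum_v qm v * yv v j = 0.
Proof.
rewrite (eq_bigr (fun v => qm v * (zv v (tri j).1 * zv v (tri j).2) - qm v * ymean j)); last by move=> v _; rewrite mulrBr.
by rewrite sumrB -mulr_suml qm_sum mul1r subrr.
Qed.

Variable mo : nat -> R.
Hypothesis HM : forall a, (a < m)%N -> forall k, itg (fun w => zs a w ^+ (2 * k)) /\ Ex (fun w => zs a w ^+ (2 * k)) <= mo k.

Lemma tri_ltm j : (j < M)%N -> ((tri j).1 < m)%N /\ ((tri j).2 < m)%N.
Proof.
rewrite -tri_lt => h; split=> //; have := tri_spec j; case: (tri j) h => a b /= bm [ab _].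
exact: leq_ltn_trans ab bm.
Qed.

Lemma yv_moment p j : (j < M)%N -> \sum_v qm v * yv v j ^+ (2 * p) <= 2 * 4 ^+ p * mo (2 * p)%N.
Proof.
move=> /tri_ltm [am bm]; apply: (le_trans (shift_moment _ _ qm_ge0 qm_sum)).
apply: ler_wpM2l; first by rewrite mulr_ge0 // exprn_ge0.
rewrite -(ExqE (fun v => (zv v (tri j).1 * zv v (tri j).2) ^+ (2 * p))).
have [ia ea] := HM am (2 * p); have [ib eb] := HM bm (2 * p).
apply: (@le_trans _ _ (Ex (fun w => 2^-1 * (zs (tri j).1 w ^+ (2 * (2 * p)) + zs (tri j).2 w ^+ (2 * (2 * p)))))).
  apply: Ex_le; [exact: (cellfun_itg P mcell (fun v => (zv v (tri j).1 * zv v (tri j).2) ^+ (2 * p)))|by apply: itgZ; exact: itgD|].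
  by move=> w; rewrite !zv_cell //; apply: even_prod_le; exact: rnd_le.
rewrite ExZ ?ExD //; last exact: itgD.
by rewrite ler_pdivrMl // mulr_natl mulr2n; exact: lerD.
Qed.

Variable c1 : R.
Hypothesis HJ : forall (c : nat -> R) k, c1 * \sum_(j < M) c j ^+ 2 <=
  Ex (fun w => (\sum_(j < M) c j * (zs (tri j).1 w * zs (tri j).2 w) - k) ^+ 2).
Hypothesis HL : (L%:R^-1) ^+ 2 * (M%:R * (16 + 16 * (mo 4 + mo 4))) <= c1 / 4.

Lemma cov_quad (c : nat -> R) : \sum_(i < M) \sum_(j < M) c i * c j * cov qm yv i j = \sum_v qm v * (\sum_(j < M) c j * yv v j) ^+ 2.
Proof.
transitivity (\sum_v \sum_(i < M) \sum_(j < M) qm v * (c i * yv v i * (c j * yv v j))).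
  rewrite [RHS]exchange_big /=; apply: eq_bigr => i _; rewrite [RHS]exchange_big /=; apply: eq_bigr => j _.
  by rewrite /cov mulr_sumr; apply: eq_bigr => v _; ring.
apply: eq_bigr => v _; rewrite expr2 big_distrlr /= mulr_sumr; apply: eq_bigr => i _.
by rewrite mulr_sumr.
Qed.

(** Rounding costs only a factor in the lower bound on the covariance: the variance of a linear
    form of the true products is at most twice that of the rounded ones plus twice the mean square
    of the difference. *)
Lemma cov_lower (c : nat -> R) : c1 / 4 * \sum_(j < M) c j ^+ 2 <= \sum_(i < M) \sum_(j < M) c i * c j * cov qm yv i j.
Proof.
rewrite cov_quad -(ExqE (fun v => (\sum_(j < M) c j * yv v j) ^+ 2)).
pose k := \sum_(j < M) c j * ymean j.
pose z j w := zs (tri j).1 w * zs (tri j).2 w.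
pose r j w := zv (cellm (Y w)) (tri j).1 * zv (cellm (Y w)) (tri j).2.
pose Z w := \sum_(j < M) c j * z j w; pose Zl w := \sum_(j < M) c j * r j w.
pose S := \sum_(j < M) c j ^+ 2.
pose g j w := (L%:R^-1) ^+ 2 * (16 + 16 * (zs (tri j).1 w ^+ 8 + zs (tri j).2 w ^+ 8)).
pose G w := \sum_(j < M) g j w.
have yE w : \sum_(j < M) c j * yv (cellm (Y w)) j = Zl w - k.
  by rewrite /Zl /k -sumrB; apply: eq_bigr => j _; rewrite /yv mulrBr.
rewrite (_ : (fun w => _) = fun w => (Zl w - k) ^+ 2); last by apply/funext => w; rewrite yE.
have S0 : 0 <= S by rewrite sumr_ge0 // => j _; exact: sqr_ge0.
have ig (j : 'I_M) : itg (g j) /\ Ex (g j) <= (L%:R^-1) ^+ 2 * (16 + 16 * (mo 4 + mo 4)).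
  have [am bm] := tri_ltm (ltn_ord j); have [ia ea] := HM am 4; have [ib eb] := HM bm 4.
  have i1 := itgD ia ib; have i2 := itgZ 16 i1; have i3 := itgD (itg_cst P 16) i2.
  split; first exact: (itgZ (L%:R^-1 ^+ 2) i3).
  rewrite /g (ExZ (L%:R^-1 ^+ 2) i3); apply: ler_wpM2l; first exact: sqr_ge0.
  rewrite (ExD (itg_cst P 16) i2) Ex_cst lerD2l (ExZ 16 i1); apply: ler_wpM2l => //.
  by rewrite (ExD ia ib); exact: lerD.
have iG : itg G by apply: itg_sum => j; exact: (ig j).1.
have EG : Ex G <= (L%:R^-1) ^+ 2 * (M%:R * (16 + 16 * (mo 4 + mo 4))).
  rewrite /G Ex_sum => [|j]; last exact: (ig j).1.
  apply: (@le_trans _ _ (\sum_(j < M) (L%:R^-1) ^+ 2 * (16 + 16 * (mo 4 + mo 4)))).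
    by apply: ler_sum => j _; exact: (ig j).2.
  by rewrite sumr_const card_ord -[leLHS]mulr_natl mulrCA.
have dZ w : (Z w - Zl w) ^+ 2 <= S * G w.
  rewrite /Z /Zl -sumrB (eq_bigr (fun j : 'I_M => c j * (z j w - r j w))); last by move=> j _; rewrite mulrBr.
  apply: (le_trans (fcs M c (fun j => z j w - r j w))); apply: ler_wpM2l => //.
  apply: ler_sum => j _; have [am bm] := tri_ltm (ltn_ord j).
  by rewrite /z /r !zv_cell //; exact: rnd_prod_err.
have iZl : itg (fun w => (Zl w - k) ^+ 2).
  exact: (cellfun_itg P mcell (fun v => (\sum_(j < M) c j * (zv v (tri j).1 * zv v (tri j).2) - k) ^+ 2)).
have iB : itg (fun w => 2 * (Zl w - k) ^+ 2 + 2 * (S * G w)) by apply: itgD; apply: itgZ => //; exact: itgZ.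
have pt w : (Z w - k) ^+ 2 <= 2 * (Zl w - k) ^+ 2 + 2 * (S * G w).
  by apply: (le_trans (sq_split _ (Zl w) _)); rewrite lerD2l; apply: ler_wpM2l.
have iZ : itg (fun w => (Z w - k) ^+ 2).
  apply: itg_le iB => [|w]; last by rewrite ger0_norm ?sqr_ge0.
  apply: measurable_funX; apply: measurable_funB => //.
  apply: measurable_sum => j; apply: measurable_funM => //; apply: measurable_funM; exact: zs_meas.
have hb : Ex (fun w => (Z w - k) ^+ 2) <= 2 * Ex (fun w => (Zl w - k) ^+ 2) + 2 * (S * Ex G).
  apply: (le_trans (Ex_le iZ iB pt)).
  by rewrite ExD ?ExZ //; try exact: itgZ; apply: itgZ; exact: itgZ.
exact: (cov_arith S0 (le_trans (HJ c k) hb) EG HL).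
Qed.

Variable rows : seq (H * H).
Variables (p b B : R).
Hypotheses (b0 : 0 < b) (B0 : 0 < B).
Hypothesis s0 : forall a, (a < m)%N -> 0 < s a.
Hypothesis orth : forall a a', (a < m)%N -> (a' < m)%N -> '<<e a, e a'>> = (a == a')%:R.
Hypothesis slo : forall a, (a < m)%N -> b * a.+1%:R `^ (- (p + 1)) <= s a ^+ 2.
Hypothesis shi : forall a, (a < m)%N -> s a ^+ 2 <= B * a.+1%:R `^ (- (p + 1)).
Hypothesis rows1 : forall i, (i < size rows)%N -> `|(nth (0, 0) rows i).1| <= 1 /\ `|(nth (0, 0) rows i).2| <= 1.
Hypothesis rowse : forall a a', (a < m)%N -> (a' < m)%N -> exists2 i, (i < size rows)%N & nth (0, 0) rows i = (e a, e a').

Definition rl i a := '<<(nth (0, 0) rows i).1, e a>>.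
Definition rr i a := '<<(nth (0, 0) rows i).2, e a>>.
(** The coefficient of the coordinate of the pair [(a, a')] in the form [<<u, . v>>] of a symmetric
    operator with entries [s a * s a' * x]. *)
Definition lrow i j : R := let a := (tri j).1 in let a' := (tri j).2 in
  s a * s a' * (if a == a' then rl i a * rr i a else rl i a * rr i a' + rl i a' * rr i a).
Definition wj j : R := 4 * B ^+ 2 * pw p j.

Lemma bessel u : \sum_(a < m) '<<u, e a>> ^+ 2 <= `|u| ^+ 2.
Proof.
pose v := \sum_(a < m) '<<u, e a>> *: e a.
have uv : '<<u, v>> = \sum_(a < m) '<<u, e a>> ^+ 2.
  by rewrite hip_sumr; apply: eq_bigr => a _; rewrite ipZr expr2.
have vv : '<<v, v>> = \sum_(a < m) '<<u, e a>> ^+ 2.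
  rewrite {2}/v hip_sumr; apply: eq_bigr => a _; rewrite ipZr expr2; congr (_ * _).
  rewrite hipC hip_sumr (bigD1 a) //= ipZr orth // eqxx mulr1 big1 ?addr0 // => a' ne.
  by rewrite ipZr orth // eq_sym; move: ne; rewrite -val_eqE /= => /negPf ->; rewrite mulr0.
have := exprn_ge0 2 (normr_ge0 (u - 1 *: v)).
by rewrite ip_sub2 -(inner_normE v) vv uv; exact: bessel_arith.
Qed.

Lemma row_form i (x : nat -> R) : \sum_(j < M) lrow i j * (x (tri j).1 * x (tri j).2) =
  (\sum_(a < m) rl i a * s a * x a) * (\sum_(a < m) rr i a * s a * x a).
Proof.
rewrite big_distrlr /= -(sum_sym_tri m (fun a a' => rl i a * s a * x a * (rr i a' * s a' * x a'))).
by apply: eq_bigr => j _; rewrite /lrow; case: eqP => [->|_]; ring.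
Qed.

Lemma wj_gt0 j : 0 < wj j.
Proof. by rewrite !mulr_gt0 ?exprn_gt0 // pw_gt0. Qed.

(** Bessel's inequality for the two unit vectors of a row bounds the row in the weighted norm. *)
Lemma norm_upper x : Nrm lrow (size rows) M x ^+ 2 <= \sum_(j < M) wj j * x j ^+ 2.
Proof.
set S := \sum_(j < M) _; have S0 : 0 <= S by rewrite sumr_ge0 // => j _; rewrite mulr_ge0 ?sqr_ge0 // ltW // wj_gt0.
have h : Nrm lrow (size rows) M x <= Num.sqrt S.
  apply/Nrm_leP => [|i im]; first exact: sqrtr_ge0.
  rewrite -sqrtr_sqr; apply: ler_wsqrtr; apply: (le_trans (wcs M (lrow i) x wj_gt0)).
  rewrite -/S; apply: ler_piMr => //.
  apply: (@le_trans _ _ (\sum_(a < m) \sum_(a' < m) rl i a ^+ 2 * rr i a' ^+ 2)).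
    rewrite -(sum_sym_tri m (fun a a' => rl i a ^+ 2 * rr i a' ^+ 2)); apply: ler_sum => j _.
    have [am bm] := tri_ltm (ltn_ord j).
    rewrite ler_pdivrMr ?wj_gt0 // /lrow exprMn.
    set a := (tri j).1 in am *; set a' := (tri j).2 in bm *.
    set V := (if _ then _ else _) ^+ 2; set W := (if _ then _ else _).
    have VW : V <= 4 * W.
      rewrite /V /W; case: eqP => _.
        by rewrite -exprMn ler_peMl ?sqr_ge0 // ler1n.
      by rewrite -!exprMn; exact: sq_add4.
    have ss : (s a * s a') ^+ 2 <= B ^+ 2 * pw p j.
      rewrite exprMn; apply: (le_trans (ler_pM (sqr_ge0 _) (sqr_ge0 _) (shi am) (shi bm))).
      by rewrite /pw mulrACA -expr2.
    apply: (@le_trans _ _ (B ^+ 2 * pw p j * (4 * W))).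
      by apply: ler_pM => //; exact: sqr_ge0.
    by rewrite /wj (_ : B ^+ 2 * pw p j * (4 * W) = W * (4 * B ^+ 2 * pw p j)) //; ring.
  rewrite -big_distrlr /=; have [u1 v1] := rows1 im.
  have K u : `|u| <= 1 -> \sum_(a < m) '<<u, e a>> ^+ 2 <= 1.
    by move=> hu; apply: (le_trans (bessel u)); rewrite expr_le1.
  apply: mulr_ile1; rewrite ?sumr_ge0 //; by [move=> a _; exact: sqr_ge0|exact: K].
rewrite -(sqr_sqrtr S0); apply: lerXn2r => //; rewrite nnegrE; [exact: Nrm_ge0|exact: sqrtr_ge0].
Qed.

(** The row of the pair of eigenvectors [(e a, e a')] reads off a single coordinate. *)
Lemma norm_lower x j : (j < M)%N -> Num.sqrt (wj j) * `|x j| <= 2 * B / b * Nrm lrow (size rows) M x.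
Proof.
move=> jM; have [am bm] := tri_ltm jM; have [i im ie] := rowse am bm.
have tj := tri_spec j; set a := (tri j).1 in am bm ie *; set a' := (tri j).2 in bm ie *.
have [ab ec] : (a <= a')%N /\ tcode a a' = j by move: tj; rewrite /a /a'; case: (tri j).
have key : \sum_(k < M) lrow i k * x k = s a * s a' * x j.
  rewrite (bigD1 (Ordinal jM)) //= [X in _ + X]big1 ?addr0.
    rewrite /lrow /rl /rr -/a -/a' ie /=; case: eqP => [<-|/eqP ne].
      by rewrite !orth // eqxx mulr1 mulr1.
    have z0 : '<<e a, e a'>> = 0 by rewrite orth // (negPf ne).
    by rewrite z0 mul0r addr0 !orth // !eqxx !mulr1.
  move=> k /eqP kj; rewrite /lrow /rl /rr ie /=; have [km km'] := tri_ltm (ltn_ord k).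
  have := tri_spec k; have kjn : k <> j :> nat by move=> kk; apply: kj; exact: val_inj.
  case: (tri k) km km' => c c' /= cm cm' [cc ek].
  have ne : ~ (a = c /\ a' = c') by case=> ac ac'; apply: kjn; rewrite -ek -ec ac ac'.
  rewrite !orth //; case: eqP => [cc'|/eqP cne].
    case: eqP => [ac|_]; last by rewrite !mul0r mulr0 mul0r.
    by case: eqP => [ac'|_]; [case: ne; rewrite -cc'|rewrite !mulr0 mul0r].
  have lt : (c < c')%N by rewrite ltn_neqAle cne.
  have e1 : ((a == c)%:R * (a' == c')%:R : R) = 0.
    by case: eqP => [ac|_]; [case: eqP => [ac'|_]; [case: ne|rewrite mulr0]|rewrite mul0r].
  have e2 : ((a == c')%:R * (a' == c)%:R : R) = 0.
    case: eqP => [ac|_]; last by rewrite mul0r.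
    by case: eqP => [ac'|_]; [move: lt; rewrite -ac -ac' ltnNge ab|rewrite mulr0].
  by rewrite e1 e2 addr0 mulr0 mul0r.
have ss0 : 0 < s a * s a' by rewrite mulr_gt0 ?s0.
have h := Nrm_coord lrow M x im; rewrite key normrM (gtr0_norm ss0) in h.
have c0 : 0 < 2 * B / b by rewrite divr_gt0 // mulr_gt0.
have sq : Num.sqrt (wj j) <= 2 * B / b * (s a * s a').
  rewrite -[leRHS]ger0_norm; last by rewrite mulr_ge0 // ltW.
  rewrite -sqrtr_sqr; apply: ler_wsqrtr.
  have low : b ^+ 2 * pw p j <= (s a * s a') ^+ 2.
    rewrite exprMn expr2 /pw mulrACA; apply: ler_pM (slo am) (slo bm); by rewrite mulr_ge0 ?powR_ge0 // ltW.
  rewrite [leRHS]exprMn; apply: le_trans (ler_wpM2l (sqr_ge0 _) low).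
  by rewrite le_eqVlt; apply/orP; left; apply/eqP; rewrite /wj; field; rewrite gt_eqF.
apply: (le_trans (ler_wpM2r (normr_ge0 _) sq)); rewrite -[leLHS]mulrA; apply: ler_wpM2l => //; exact: ltW.
Qed.

Theorem rounded_admissible : admissible wj (fun p => 2 * 4 ^+ p * mo (2 * p)%N) (c1 / 4) (2 * B / b) qm yv lrow (size rows) M.
Proof.
split.
- by split; [exact: qm_ge0|exact: qm_sum].
- by move=> j _; exact: yv_mean.
- by move=> k j; exact: yv_moment.
- exact: cov_lower.
- by split; [exact: norm_upper|exact: norm_lower].
Qed.
End Model.

Fact err_arith (R : realType) (eta K i ru : R) : eta / 2 * (K + K) + (i / 2 + 2^-1) * (ru + ru) = eta * K + (i + 1) * ru.
Proof. by field. Qed.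

(** * Accuracy of the rounded model *)
Fact prod_diff_arith (R : realType) (f1 f2 g1 g2 eta : R) : 0 < eta ->
  `|f1 * f2 - g1 * g2| <= eta / 2 * (f1 ^+ 2 + f2 ^+ 2) + (eta^-1 / 2 + 2^-1) * ((f1 - g1) ^+ 2 + (f2 - g2) ^+ 2).
Proof.
move=> e0; have amgm (x y : R) : `|x * y| <= eta / 2 * x ^+ 2 + eta^-1 / 2 * y ^+ 2.
  have K (z : R) : z = 1 \/ z = -1 -> z * (x * y) <= eta / 2 * x ^+ 2 + eta^-1 / 2 * y ^+ 2.
    move=> hz; have z2 : z ^+ 2 = 1 by case: hz => ->; rewrite ?sqrrN expr1n.
    rewrite -subr_ge0 (_ : _ - _ = eta^-1 / 2 * (eta * x - z * y) ^+ 2 + eta^-1 / 2 * (1 - z ^+ 2) * y ^+ 2).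
      by rewrite z2 subrr mulr0 mul0r addr0 mulr_ge0 ?sqr_ge0 // divr_ge0 // invr_ge0 ltW.
    by field; rewrite gt_eqF.
  rewrite ler_norml; apply/andP; split; last by have := K 1 (or_introl erefl); rewrite mul1r.
  by rewrite lerNl -mulN1r; exact: K (or_intror erefl).
have amg1 (x y : R) : `|x * y| <= 2^-1 * (x ^+ 2 + y ^+ 2).
  rewrite ler_norml; have := sqr_ge0 (x - y); have := sqr_ge0 (x + y); rewrite sqrrB sqrrD -mulr_natr.
  by move: (x ^+ 2) (y ^+ 2) (x * y); clear => ? ? ? ? ?; apply/andP; split; lra.
set a := f1 - g1; set b := f2 - g2.
rewrite (_ : f1 * f2 - g1 * g2 = f1 * b + f2 * a - a * b); last by rewrite /a /b; ring.
apply: (le_trans (ler_normB _ _)); apply: (le_trans (lerD (ler_normD _ _) (lexx _))).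
apply: (le_trans (lerD (lerD (amgm f1 b) (amgm f2 a)) (amg1 a b))).
by rewrite le_eqVlt; apply/orP; left; apply/eqP; ring.
Qed.

Fact rnd_sq_err (R : realType) L (x : R) : (0 < L)%N -> (x - rnd L x) ^+ 2 <= (L%:R^-1) ^+ 2 * (2 + 2 * x ^+ 4).
Proof.
move=> L0; rewrite -[X in X <= _]real_normK ?num_real //.
have l0 : 0 <= L%:R^-1 * (1 + x ^+ 2) by rewrite mulr_ge0 ?invr_ge0 // addr_ge0 // sqr_ge0.
apply: (@le_trans _ _ ((L%:R^-1 * (1 + x ^+ 2)) ^+ 2)).
  by apply: lerXn2r; rewrite ?nnegrE //; exact: rnd_err.
rewrite exprMn; apply: ler_wpM2l; first exact: sqr_ge0.
rewrite -subr_ge0 (_ : _ - _ = (1 - x ^+ 2) ^+ 2); [exact: sqr_ge0|by ring].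
Qed.

Section Errors.
Context {R : realType} {H : hilbertType R} {d : measure_display} {T : measurableType d} (P : probability T R).
Notation HB := (g_sigma_algebraType [set U : set H | open U]).
Variables (Y : T -> H) (e : nat -> H) (s : nat -> R) (m' L : nat) (Sig : {linear H -> H}) (K B : R) (mo : nat -> R).
Notation m := m'.+1.
Notation Ex := (Ex P).
Notation itg := (itg P).
Notation pr := (pr P).
Hypotheses (rY : random_element Y) (L0 : (0 < L)%N) (K0 : 0 <= K) (B0 : 0 < B).
Hypothesis SK : forall x, `|Sig x| <= K * `|x|.
Hypothesis HS : forall x y, itg (fun w => '<<x, Y w>> * '<<y, Y w>>) /\ Ex (fun w => '<<x, Y w>> * '<<y, Y w>>) = '<<x, Sig y>>.
Hypothesis HM : forall a, (a < m)%N -> forall k, itg (fun w => zs Y e s a w ^+ (2 * k)) /\ Ex (fun w => zs Y e s a w ^+ (2 * k)) <= mo k.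
Hypothesis s0 : forall a, (a < m)%N -> 0 < s a.
Hypothesis orth : forall a a', (a < m)%N -> (a' < m)%N -> '<<e a, e a'>> = (a == a')%:R.
Hypothesis sB : forall a, (a < m)%N -> s a ^+ 2 <= B.
Hypothesis Seig : forall a, (a < m)%N -> Sig (e a) = s a ^+ 2 *: e a.

Definition gu (u : H) (v : {ffun 'I_m -> rcode_type L}) : R := \sum_(a < m) '<<u, e a>> * s a * zv v a.
Definition psi (u : H) : H := u - \sum_(a < m) '<<u, e a>> *: e a.
Definition eu u w := '<<u, Y w>> - gu u (cellm e s m' L (Y w)).
Notation mc := (@mcell R H d T Y e s m' L rY).

Lemma ip_meas u : measurable_fun setT (fun w => '<<u, Y w>>).
Proof. by apply: (@random_borel _ _ _ _ _ rY (fun h => '<<u, h>>)); exact: borel_cts (@ip_cts R H u). Qed.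

Lemma eu_meas u : measurable_fun setT (eu u).
Proof. by apply: measurable_funB; [exact: ip_meas|exact: (itg_meas (cellfun_itg P mc (gu u)))]. Qed.

Lemma ex_ip2 u : itg (fun w => '<<u, Y w>> ^+ 2) /\ Ex (fun w => '<<u, Y w>> ^+ 2) = '<<u, Sig u>>.
Proof. exact: (HS u u). Qed.

Definition rerr : R := 2 * (B * ((L%:R^-1) ^+ 2 * (m%:R * (2 + 2 * mo 2)))).

(** The error splits into the part of [u] outside the span of the first eigenvectors and the
    rounding of the first scores. *)
Lemma ex_eu u : `|u| <= 1 -> itg (fun w => eu u w ^+ 2) /\ Ex (fun w => eu u w ^+ 2) <= 2 * '<<psi u, Sig (psi u)>> + rerr.
Proof.
move=> u1; pose z a w := zs Y e s a w; pose r a w := rnd L (zs Y e s a w).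
have euE w : eu u w = '<<psi u, Y w>> + \sum_(a < m) '<<u, e a>> * s a * (z a w - r a w).
  rewrite /psi ipBl [X in _ = _ - X + _]hipC hip_sumr.
  rewrite (eq_bigr (fun a : 'I_m => '<<u, e a>> * s a * z a w)); last first.
    move=> a _; rewrite ipZr /z /zs -[RHS]mulrA; congr (_ * _).
    by rewrite mulrCA divff ?mulr1 // gt_eqF // s0.
  rewrite (eq_bigr (F1 := fun a : 'I_m => '<<u, e a>> * s a * (z a w - r a w))
     (fun a : 'I_m => '<<u, e a>> * s a * z a w - '<<u, e a>> * s a * r a w)); last by move=> a _; rewrite mulrBr.
  rewrite sumrB addrA subrK /eu /gu; congr (_ - _); apply: eq_bigr => a _.
  by rewrite zv_cell.
pose q a w := (L%:R^-1) ^+ 2 * (2 + 2 * zs Y e s a w ^+ 4) : R.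
have iq (a : 'I_m) : itg (q a) /\ Ex (q a) <= (L%:R^-1) ^+ 2 * (2 + 2 * mo 2).
  have [ia ea] := HM (ltn_ord a) 2; have i2 := itgZ 2 ia; have i3 := itgD (itg_cst P 2) i2.
  split; first exact: (itgZ (L%:R^-1 ^+ 2) i3).
  rewrite /q (ExZ (L%:R^-1 ^+ 2) i3); apply: ler_wpM2l; first exact: sqr_ge0.
  by rewrite (ExD (itg_cst P 2) i2) Ex_cst lerD2l (ExZ 2 ia); apply: ler_wpM2l.
pose G w := \sum_(a < m) q a w.
have iG : itg G by apply: itg_sum => a; exact: (iq a).1.
have EG : Ex G <= (L%:R^-1) ^+ 2 * (m%:R * (2 + 2 * mo 2)).
  rewrite /G Ex_sum => [|a]; last exact: (iq a).1.
  apply: (@le_trans _ _ (\sum_(a < m) (L%:R^-1) ^+ 2 * (2 + 2 * mo 2))).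
    by apply: ler_sum => a _; exact: (iq a).2.
  by rewrite sumr_const card_ord -[leLHS]mulr_natl mulrCA.
have cB : \sum_(a < m) ('<<u, e a>> * s a) ^+ 2 <= B.
  apply: (@le_trans _ _ (\sum_(a < m) '<<u, e a>> ^+ 2 * B)).
    by apply: ler_sum => a _; rewrite exprMn; apply: ler_wpM2l; [exact: sqr_ge0|exact: sB].
  rewrite -mulr_suml; apply: ler_piMl; first exact: ltW.
  by apply: (le_trans (bessel orth u)); rewrite expr_le1.
have sq2 (x y : R) : (x + y) ^+ 2 <= 2 * x ^+ 2 + 2 * y ^+ 2.
  by rewrite -subr_ge0 (_ : _ - _ = (x - y) ^+ 2); [exact: sqr_ge0|ring].
have G0 w : 0 <= G w.
  by apply: sumr_ge0 => a _; rewrite mulr_ge0 ?sqr_ge0 // addr_ge0 // mulr_ge0 // (exprM _ 2 2) sqr_ge0.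
have pt w : eu u w ^+ 2 <= 2 * '<<psi u, Y w>> ^+ 2 + 2 * (B * G w).
  rewrite euE; apply: (le_trans (sq2 _ _)); rewrite lerD2l; apply: ler_wpM2l => //.
  apply: (le_trans (fcs m (fun a => '<<u, e a>> * s a) (fun a => z a w - r a w))).
  apply: (ler_pM _ _ cB); try by apply: sumr_ge0 => a _; exact: sqr_ge0.
  by apply: ler_sum => a _; exact: rnd_sq_err.
have [ip eip] := ex_ip2 (psi u).
have i1 := itgZ 2 ip; have i2 := itgZ 2 (itgZ B iG); have i3 := itgD i1 i2.
have ie : itg (fun w => eu u w ^+ 2).
  apply: itg_le i3 => [|w]; last by rewrite ger0_norm ?sqr_ge0.
  by apply: measurable_funX; exact: eu_meas.
split=> //; apply: (le_trans (Ex_le ie i3 pt)).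
rewrite (ExD i1 i2) (ExZ 2 ip) eip lerD2l (ExZ 2 (itgZ B iG)) (ExZ B iG) /rerr.
by apply: ler_wpM2l => //; apply: ler_wpM2l => //; exact: ltW.
Qed.

Lemma ex_ip2_le u : `|u| <= 1 -> Ex (fun w => '<<u, Y w>> ^+ 2) <= K.
Proof.
move=> u1; rewrite (ex_ip2 u).2; apply: le_trans (ler_norm _) _; apply: (le_trans (ip_cs _ _)).
apply: (@le_trans _ _ (1 * (K * 1))); last by rewrite mul1r mulr1.
by apply: ler_pM => //; apply: (le_trans (SK u)); exact: ler_wpM2l.
Qed.

Definition herr u v w := '<<u, Y w>> * '<<v, Y w>> - gu u (cellm e s m' L (Y w)) * gu v (cellm e s m' L (Y w)).

(** The arithmetic-geometric inequality with a free parameter [eta] lets a small mean square error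
    of each factor control the mean error of the product. *)
Lemma ex_herr u v (eta ru : R) : `|u| <= 1 -> `|v| <= 1 -> 0 < eta ->
  Ex (fun w => eu u w ^+ 2) <= ru -> Ex (fun w => eu v w ^+ 2) <= ru ->
  itg (herr u v) /\ Ex (fun w => `|herr u v w|) <= eta * K + (eta^-1 + 1) * ru.
Proof.
move=> u1 v1 e0 hu hv.
have [iu _] := ex_ip2 u; have [iv _] := ex_ip2 v; have [jx _] := ex_eu u1; have [jy _] := ex_eu v1.
have i1 := itgZ (eta / 2) (itgD iu iv); have i2 := itgZ (eta^-1 / 2 + 2^-1) (itgD jx jy).
have i3 := itgD i1 i2.
have pt w : `|herr u v w| <= eta / 2 * ('<<u, Y w>> ^+ 2 + '<<v, Y w>> ^+ 2) + (eta^-1 / 2 + 2^-1) * (eu u w ^+ 2 + eu v w ^+ 2).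
  exact: prod_diff_arith.
have ih : itg (herr u v).
  apply: itg_le pt i3; apply: measurable_funB; first by apply: measurable_funM; exact: ip_meas.
  exact: (itg_meas (cellfun_itg P mc (fun c => gu u c * gu v c))).
split=> //; apply: (le_trans (Ex_le (itg_abs ih) i3 pt)).
rewrite (ExD i1 i2) (ExZ _ (itgD iu iv)) (ExZ _ (itgD jx jy)) (ExD iu iv) (ExD jx jy).
have c0 : 0 <= eta / 2 by rewrite divr_ge0 // ltW.
have c1 : 0 <= eta^-1 / 2 + 2^-1 by rewrite addr_ge0 // divr_ge0 // invr_ge0 ltW.
have h1 := ler_wpM2l c0 (lerD (ex_ip2_le u1) (ex_ip2_le v1)).
have h2 := ler_wpM2l c1 (lerD hu hv).
by apply: (le_trans (lerD h1 h2)); rewrite err_arith.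
Qed.

(** The form of [Sig] at the part of [u] that the first scores miss is controlled by a tail of
    the spectral series at [u]. *)
Lemma psi_form u : `|u| <= 1 ->
  '<<psi u, Sig (psi u)>> <= 2 * `|Sig u - \sum_(a < m) (s a ^+ 2 * '<<u, e a>>) *: e a|.
Proof.
move=> u1; have b1 : `|psi u| <= 2.
  have pu : `|\sum_(a < m) '<<u, e a>> *: e a| ^+ 2 <= 1.
    pose v := \sum_(a < m) '<<u, e a>> *: e a; rewrite -/v -inner_normE.
    have -> : '<<v, v>> = \sum_(a < m) '<<u, e a>> ^+ 2.
      rewrite {2}/v hip_sumr; apply: eq_bigr => a _; rewrite ipZr expr2; congr (_ * _).
      rewrite hipC hip_sumr (bigD1 a) //= ipZr orth // eqxx mulr1 big1 ?addr0 // => a' ne.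
      by rewrite ipZr orth // eq_sym; move: ne; rewrite -val_eqE /= => /negPf ->; rewrite mulr0.
    by apply: (le_trans (bessel orth u)); rewrite expr_le1.
  apply: (le_trans (ler_normB _ _)); rewrite -[2]/(1 + 1); apply: lerD => //.
  by rewrite -(@expr_le1 _ 2).
have -> : Sig (psi u) = Sig u - \sum_(a < m) (s a ^+ 2 * '<<u, e a>>) *: e a.
  rewrite linearB linear_sum; congr (_ - _); apply: eq_bigr => a _.
  by rewrite linearZ /= Seig // scalerA mulrC.
apply: le_trans (ler_norm _) _; apply: (le_trans (ip_cs _ _)); exact: ler_wpM2r.
Qed.
End Errors.

(** * Finite descriptions of the sample and of its bootstrap *)
(** Deterministic comparison of the scaled operator norm with the finite seminorm, from the
    comparison of each of the forms that define the latter. *)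
Lemma norm_close (R : realType) (N mm M : nat) (o th tau : R) (F : nat -> R) (l : nat -> nat -> R) (x : nat -> R) : (0 < N)%N ->
  (forall i, (i < mm)%N -> `|F i| <= o) -> (exists2 i, (i < mm)%N & o - tau <= `|F i|) ->
  (forall i, (i < mm)%N -> `|N%:R * F i - \sum_(j < M) l i j * x j| <= N%:R * (2 * th)) -> 0 <= th -> 0 <= tau ->
  `|Num.sqrt N%:R * o - Nrm l mm M x / Num.sqrt N%:R| <= Num.sqrt N%:R * (2 * th + tau).
Proof.
move=> N0 Fo [i0 i0m Fi0] hF th0 tau0; set q := Num.sqrt N%:R.
have n0 : 0 < N%:R :> R by rewrite ltr0n.
have q0 : 0 < q by rewrite sqrtr_gt0.
have qq : q * q = N%:R by rewrite -expr2 sqr_sqrtr // ltW.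
have o0 : 0 <= o by apply: le_trans (Fo _ i0m).
have up : Nrm l mm M x <= N%:R * (o + 2 * th).
  apply/Nrm_leP => [|i im]; first by rewrite mulr_ge0 // ?addr_ge0 // ?mulr_ge0 // ltW.
  rewrite -[\sum_(j < M) _](subKr (N%:R * F i)); apply: (le_trans (ler_normB _ _)).
  rewrite mulrDr; apply: lerD (hF i im); rewrite normrM gtr0_norm //.
  by apply: ler_wpM2l; [exact: ltW|exact: Fo].
have lo : N%:R * (o - tau - 2 * th) <= Nrm l mm M x.
  apply: le_trans (Nrm_coord l M x i0m); rewrite mulrBr lerBlDr.
  apply: (@le_trans _ _ `|N%:R * F i0|); first by rewrite normrM gtr0_norm //; apply: ler_wpM2l => //; exact: ltW.
  rewrite -[N%:R * F i0](subrK (\sum_(j < M) l i0 j * x j)) addrC; apply: (le_trans (ler_normD _ _)).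
  by rewrite lerD2l; exact: hF.
have e1 : q * o - Nrm l mm M x / q = (N%:R * o - Nrm l mm M x) / q by rewrite -qq; field; rewrite gt_eqF.
rewrite e1 normrM (gtr0_norm (_ : 0 < q^-1)) ?invr_gt0 // ler_pdivrMr // mulrAC qq.
have tn : 0 <= N%:R * tau by rewrite mulr_ge0 // ltW.
move: up lo tn; rewrite ler_norml !mulrDr !mulrN; clear.
by move: (N%:R * o) (N%:R * tau) (N%:R * (2 * th)) (Nrm _ _ _ _) => a b c e ? ? ?; apply/andP; split; lra.
Qed.

Fact rho_exists (R : realType) (K kp : R) : 0 <= K -> 0 < kp -> exists eta rho : R, [/\ 0 < eta, 0 < rho & eta * K + (eta^-1 + 1) * rho <= kp].
Proof.
move=> K0 k0; have K1 : 0 < K + 1 by rewrite ltr_wpDl.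
pose eta := kp / 2 / (K + 1); have e0 : 0 < eta by rewrite !divr_gt0.
have i0 : 0 < eta^-1 + 1 by rewrite addr_gt0 // invr_gt0.
exists eta, (kp / 2 / (eta^-1 + 1)); split=> //; first by rewrite !divr_gt0.
rewrite [(eta^-1 + 1) * _]mulrC divfK ?gt_eqF //.
have h : eta * K <= kp / 2.
  by rewrite /eta mulrAC -mulrA; apply: ler_piMr; rewrite ?divr_ge0 ?(ltW k0) // ler_pdivrMr // mul1r lerDl.
by move: h; move: (eta * K) => z; clear => ?; lra.
Qed.

Fact level_exists (R : realType) (C t : R) : 0 <= C -> 0 < t -> exists2 L : nat, (0 < L)%N & (L%:R^-1) ^+ 2 * C <= t.
Proof.
move=> C0 t0; have [k _ hk] := near_infty_natSinv_lt (PosNum (divr_gt0 t0 (ltr_wpDl C0 ltr01))).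
have := hk k (leqnn k); rewrite /= => /ltW h; exists k.+1 => //.
have C1 : 0 < C + 1 by rewrite ltr_wpDl.
rewrite ler_pdivlMr // in h; apply: le_trans h.
have i1 : (k.+1%:R^-1 : R) <= 1 by rewrite invf_le1 // ler1n.
have i0 : 0 <= (k.+1%:R^-1 : R) by rewrite invr_ge0.
apply: ler_pM; rewrite ?exprn_ge0 ?lerDl // expr2; exact: ler_piMl.
Qed.

Fact family_bound (Q : nat -> nat -> Prop) : (forall k a b, (a <= b)%N -> Q k a -> Q k b) ->
  (forall k, exists a, Q k a) -> forall K, exists a, forall k, (k < K)%N -> Q k a.
Proof.
move=> mono ex; elim=> [|K [a ha]]; first by exists 0%N.
have [b hb] := ex K; exists (maxn a b) => k; rewrite ltnS leq_eqVlt => /orP[/eqP ->|kK].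
  by apply: mono hb; exact: leq_maxr.
by apply: mono (ha k kK); exact: leq_maxl.
Qed.

Fact largest_below (V : nat -> Prop) : V 0%N -> forall N0, exists2 m, V m & forall a, V a -> (a < N0)%N -> (a <= m)%N.
Proof.
move=> V0; elim=> [|N0 [m Vm hm]]; first by exists 0%N.
have [VN|nV] := pselect (V N0); first by exists N0 => // a _; rewrite ltnS.
exists m => // a Va; rewrite ltnS leq_eqVlt => /orP[/eqP aN|]; first by case: nV; rewrite -aN.
exact: hm.
Qed.

Fact a34_arith (R : realType) (x : R) : 0 < x -> 3 / 4 * x <= x. Proof. by move=> ?; lra. Qed.

Fact quarter_arith (R : realType) (x : R) : 0 < x -> x / 4 <= x / 2. Proof. by move=> ?; lra. Qed.

Fact psi_arith (R : realType) (a x rd : R) : a <= 2 * x -> x <= rd / 8 -> 2 * a <= rd / 2. Proof. by move=> ? ?; lra. Qed.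

Fact rerr_arith (R : realType) (l B m u : R) : 2 * (B * (l * (m * u))) = l * (2 * (B * (m * u))). Proof. by ring. Qed.

Fact dbl (R : realType) (x y : R) : x * (2 * y) = x * y + x * y.
Proof. by ring. Qed.

Fact sub_sub (V : zmodType) (x y z t : V) : (x - y) - (z - t) = (x - z) - (y - t).
Proof. by rewrite !opprD !opprK addrACA. Qed.

Section EmpCov.
Context {R : realType} {H : hilbertType R} (n : nat).
Implicit Types (x : 'I_n.+1 -> H) (u v z : H).

Lemma emp_form x u v : '<<u, empirical_cov x v>> = n.+1%:R^-1 * \sum_i '<<u, x i>> * '<<v, x i>>.
Proof.
rewrite /empirical_cov ipZr hip_sumr; congr (_ * _); apply: eq_bigr => i _.
by rewrite /tensor ipZr mulrC (hipC (x i)).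
Qed.

Lemma emp_sub x u v : empirical_cov x u - empirical_cov x v = empirical_cov x (u - v).
Proof.
rewrite /empirical_cov -scalerBr -sumrB; congr (_ *: _); apply: eq_bigr => i _.
by rewrite /tensor -scalerBl -ipBr.
Qed.

Lemma emp_bound x z : `|empirical_cov x z| <= (n.+1%:R^-1 * \sum_i `|x i| * `|x i|) * `|z|.
Proof.
rewrite /empirical_cov normrZ ger0_norm ?invr_ge0 // -mulrA; apply: ler_wpM2l; first by rewrite invr_ge0.
rewrite mulr_suml; apply: (le_trans (ler_norm_sum _ _ _)); apply: ler_sum => i _.
by rewrite /tensor normrZ mulrAC; apply: ler_wpM2r => //; exact: ip_cs.
Qed.
End EmpCov.

Section Approx.
Context {R : realType} {H : hilbertType R} {d : measure_display} {T : measurableType d} (P : probability T R).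
Variables (n : nat) (X Xs : 'I_n.+1 -> T -> H).
Notation N := n.+1.
Notation HB := (g_sigma_algebraType [set U : set H | open U]).
Notation Ex := (Ex P).
Notation itg := (itg P).
Notation pr := (pr P).
Hypotheses (rX : forall i, random_element (X i)) (rXs : forall i, random_element (Xs i)).
Hypotheses (ind : independent P X) (idd : identically_distributed P X) (swr : sampled_with_replacement P X Xs).
Hypothesis sep : separable_space H.
Variables (Sig : {linear H -> H}) (K : R).
Hypotheses (K0 : 0 <= K) (SK : forall x, `|Sig x| <= K * `|x|).
Notation Y := (X ord0).
Hypothesis HS : forall x y, itg (fun w => '<<x, Y w>> * '<<y, Y w>>) /\ Ex (fun w => '<<x, Y w>> * '<<y, Y w>>) = '<<x, Sig y>>.

Definition samp w := fun i => X i w.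
Definition boots w := fun i => Xs i w.
Definition Adev w z := empirical_cov (samp w) z - Sig z.
Definition Bdev w z := empirical_cov (boots w) z - empirical_cov (samp w) z.

Lemma Adev_form w u v : '<<u, Adev w v>> = N%:R^-1 * (\sum_i '<<u, X i w>> * '<<v, X i w>>) - '<<u, Sig v>>.
Proof. by rewrite /Adev ipBr emp_form. Qed.
Lemma Bdev_form w u v : '<<u, Bdev w v>> = N%:R^-1 * (\sum_i '<<u, Xs i w>> * '<<v, Xs i w>>) - N%:R^-1 * (\sum_i '<<u, X i w>> * '<<v, X i w>>).
Proof. by rewrite /Bdev ipBr !emp_form. Qed.
Lemma Adev_sub w u v : Adev w u - Adev w v = Adev w (u - v).
Proof. by rewrite /Adev sub_sub emp_sub -linearB. Qed.
Lemma Bdev_sub w u v : Bdev w u - Bdev w v = Bdev w (u - v).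
Proof. by rewrite /Bdev sub_sub !emp_sub. Qed.
Lemma Adev_bound w : exists k, forall z, `|Adev w z| <= k * `|z|.
Proof. by eexists => z; apply: (le_trans (ler_normB _ _)); apply: (le_trans (lerD (emp_bound _ _) (SK _))); rewrite -mulrDl. Qed.
Lemma Bdev_bound w : exists k, forall z, `|Bdev w z| <= k * `|z|.
Proof. by eexists => z; apply: (le_trans (ler_normB _ _)); apply: (le_trans (lerD (emp_bound _ _) (emp_bound _ _))); rewrite -mulrDl. Qed.

Let mip (Z : T -> H) u : random_element Z -> measurable_fun setT (fun w => '<<u, Z w>>).
Proof. by move=> rZ; exact: ip_meas. Qed.

Let msum (Z : 'I_N -> T -> H) u v : (forall i, random_element (Z i)) ->
  measurable_fun setT (fun w => N%:R^-1 * (\sum_i '<<u, Z i w>> * '<<v, Z i w>>)).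
Proof.
by move=> rZ; apply: measurable_funM => //; apply: measurable_sum => i; apply: measurable_funM; exact: mip.
Qed.

Lemma Adev_meas u v : measurable_fun setT (fun w => '<<u, Adev w v>>).
Proof.
rewrite (_ : (fun w => _) = fun w => N%:R^-1 * (\sum_i '<<u, X i w>> * '<<v, X i w>>) - '<<u, Sig v>>).
  by apply: measurable_funB => //; exact: msum.
by apply/funext => w; rewrite Adev_form.
Qed.

Lemma Bdev_meas u v : measurable_fun setT (fun w => '<<u, Bdev w v>>).
Proof.
rewrite (_ : (fun w => _) = fun w => N%:R^-1 * (\sum_i '<<u, Xs i w>> * '<<v, Xs i w>>) - N%:R^-1 * (\sum_i '<<u, X i w>> * '<<v, X i w>>)).
  by apply: measurable_funB; exact: msum.
by apply/funext => w; rewrite Bdev_form.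
Qed.

(** A countable family of pairs of unit vectors that computes every operator norm. *)
Lemma norming_pairs : exists pair : nat -> H * H, (forall k, `|(pair k).1| <= 1 /\ `|(pair k).2| <= 1) /\
  forall (A : H -> H) k th, (forall x y, A x - A y = A (x - y)) -> (forall x, `|A x| <= k * `|x|) -> 0 < th ->
  exists i, opnorm A - th <= `|'<<(pair i).1, A (pair i).2>>|.
Proof.
have [f [f1 fd]] := dense_ball sep.
exists (fun k => let ij := odflt (0%N, 0%N) (unpickle k) in (f ij.1, f ij.2)); split; first by move=> k /=.
move=> A k th AB AK th0; have [i [j ij]] := opnorm_attained AB AK fd th0.
by exists (pickle (i, j)); rewrite pickleK.
Qed.

(** Given the sample, a resampled point is uniform on the sample; averaging over the sample gives
    back the common law. *)
Lemma boot_marginal i A : borel H A -> pr (Xs i @^-1` A) = pr (Y @^-1` A).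
Proof.
move=> bA; pose A' j := if j == i then A else setT.
have bA' j : borel H (A' j) by rewrite /A'; case: (j == i) => //; exact: (@measurableT _ HB).
have [_ _ /(_ setT)] := swr bA'.
have -> : \bigcap_j (Xs j @^-1` A' j) = Xs i @^-1` A.
  apply/seteqP; split => w /=; first by move=> h; have := h i Logic.I; rewrite /A' eqxx.
  by move=> h j _; rewrite /A' /=; case: eqP => [->|].
rewrite setTI => h; rewrite /pr -h; last exact: (@measurableT _ (g_sigma_algebraType [set B | exists i A, borel H A /\ B = X i @^-1` A])).
have E w : \prod_j (#|[pred k | X k w \in A' j]|%:R / N%:R : R) = N%:R^-1 * \sum_(k < N) (`[< A (X k w) >])%:R.
  rewrite (bigD1 i) //= [X in _ * X]big1 ?mulr1.
    rewrite mulrC; congr (_ * _); rewrite -sum1_card natr_sum big_mkcond /=; apply: eq_bigr => k _.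
    rewrite /A' eqxx inE; case: asboolP => h'; first by rewrite mem_set.
    by rewrite memNset.
  move=> j ji; rewrite /A' (negPf ji) (eq_card (B := 'I_N)) ?card_ord ?divff //.
  by move=> k; rewrite [RHS]inE; exact: (mem_set (A := setT) Logic.I).
under eq_integral do rewrite E.
rewrite -/(Ex (fun w => N%:R^-1 * \sum_(k < N) (`[< A (X k w) >])%:R)).
have hk (k : 'I_N) : itg (fun w => (`[< A (X k w) >])%:R) /\ Ex (fun w => (`[< A (X k w) >])%:R) = pr (Y @^-1` A).
  have sE : [set w | `[< A (X k w) >]] = X k @^-1` A by apply/funext => w /=; apply/propext; split => /asboolP.
  have mk : measurable [set w | `[< A (X k w) >]] by rewrite sE; exact: rX.
  have [h1 h2] := @Ex_bool _ _ _ P (fun w => `[< A (X k w) >]) mk.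
  by split=> //; rewrite h2 sE /pr (idd k ord0 bA).
rewrite ExZ; last by apply: itg_sum => k; exact: (hk k).1.
rewrite Ex_sum => [|k]; last exact: (hk k).1.
rewrite (eq_bigr (fun=> pr (Y @^-1` A))); last by move=> k _; exact: (hk k).2.
by rewrite sumr_const card_ord -[X in _ * X]mulr_natl mulKf // pnatr_eq0.
Qed.

Variables (V : nat -> Prop) (e : nat -> H) (s : nat -> R) (mo : nat -> R) (p b B c1 : R).
Hypotheses (V0 : V 0%N) (Vdown : forall a a', (a <= a')%N -> V a' -> V a).
Hypotheses (b0 : 0 < b) (B0 : 0 < B) (c10 : 0 < c1) (mo0 : forall k, 0 <= mo k).
Hypothesis VM : forall a, V a -> forall k, itg (fun w => zs Y e s a w ^+ (2 * k)) /\ Ex (fun w => zs Y e s a w ^+ (2 * k)) <= mo k.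
Hypothesis Vs : forall a, V a -> 0 < s a.
Hypothesis Vorth : forall a a', V a -> V a' -> '<<e a, e a'>> = (a == a')%:R.
Hypothesis Vlo : forall a, V a -> b * a.+1%:R `^ (- (p + 1)) <= s a ^+ 2.
Hypothesis Vhi : forall a, V a -> s a ^+ 2 <= B * a.+1%:R `^ (- (p + 1)).
Hypothesis VB : forall a, V a -> s a ^+ 2 <= B.
Hypothesis Veig : forall a, V a -> Sig (e a) = s a ^+ 2 *: e a.
Hypothesis VJ : forall m', V m' -> forall (c : nat -> R) k, c1 * \sum_(j < 'C(m'.+2, 2)) c j ^+ 2 <=
  Ex (fun w => (\sum_(j < 'C(m'.+2, 2)) c j * (zs Y e s (tri j).1 w * zs Y e s (tri j).2 w) - k) ^+ 2).
Hypothesis spec : forall u (del : R), 0 < del -> exists N0, forall m', V m' -> (forall a, V a -> (a < N0)%N -> (a <= m')%N) ->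
  `|Sig u - \sum_(a < m'.+1) (s a ^+ 2 * '<<u, e a>>) *: e a| <= del.

Section Rows.
Variables (m' L : nat) (rows : seq (H * H)) (th : R).
Notation m := m'.+1.
Notation M := 'C(m.+1, 2).
Hypotheses (Vm : V m') (L0 : (0 < L)%N) (th0 : 0 < th).
Let cell := cellm e s m' L.
Let bV a : (a < m)%N -> V a. Proof. by rewrite ltnS => am; exact: Vdown am Vm. Qed.
Let ru i := (nth (0, 0) rows i).1.
Let rv i := (nth (0, 0) rows i).2.
Definition Grow i (v : {ffun 'I_m -> rcode_type L}) : R := gu e s (ru i) v * gu e s (rv i) v.
Definition frow i (h : H) : R := '<<ru i, h>> * '<<rv i, h>>.
Definition badset := [set h | exists2 i, (i < size rows)%N & th < `|frow i h - Grow i (cell h)|].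

Lemma badset_borel : borel H badset.
Proof.
rewrite (_ : badset = \bigcup_(i in [set i | (i < size rows)%N]) [set h | th < `|frow i h - Grow i (cell h)|]); last first.
  by apply/seteqP; split => h /=; case=> i im hi; exists i.
apply: (@bigcup_measurable _ HB) => i _.
apply: (@meas_fin _ HB _ (cell : HB -> _) (fun v => [set h | th < `|frow i h - Grow i v|])) => [v|v]; first exact: (bcell_cellm e s (L := L) v).
have mf : measurable_fun [set: HB] ((frow i) : HB -> R).
  by apply: (@measurable_funM _ HB); exact: borel_cts (@ip_cts R H _).
rewrite (_ : [set _ | _] = ~` ([set h | `|frow i h - Grow i v| <= th] : set HB)).
  apply: measurableC; apply: (@measurable_set_le _ _ HB); apply: measurableT_comp => //.
  by apply: measurable_funB.
by apply/funext => h /=; apply/propext; rewrite ltNge; split => /negP.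
Qed.

Variable kp : nat -> R.
Hypothesis hrow : forall i, itg (herr Y e s m' L (ru i) (rv i)) /\ ((i < size rows)%N -> Ex (fun w => `|herr Y e s m' L (ru i) (rv i) w|) <= kp i).
Hypothesis kth : forall i, kp i <= th.

Lemma badset_pr : pr (Y @^-1` badset) <= (\sum_(i <- iota 0 (size rows)) kp i) / th.
Proof.
rewrite mulr_suml big_seq.
have mA i : measurable [set w | th < `|herr Y e s m' L (ru i) (rv i) w|].
  rewrite (_ : [set _ | _] = ~` [set w | `|herr Y e s m' L (ru i) (rv i) w| <= th]).
    by apply: measurableC; apply: measurable_set_le; apply: measurableT_comp => //; exact: itg_meas (hrow i).1.
  by apply/funext => h /=; apply/propext; rewrite ltNge; split => /negP.
apply: (@le_trans _ _ (\sum_(i <- iota 0 (size rows)) pr [set w | th < `|herr Y e s m' L (ru i) (rv i) w|])).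
  apply: pr_bigcup_seq => //; first exact: (rX ord0 badset_borel).
  by move=> w [i im hi]; exists i => //; rewrite mem_iota.
rewrite big_seq; apply: ler_sum => i; rewrite mem_iota add0n => /andP[_ im].
apply: (le_trans (pr_markov (hrow i).1 th0)); apply: ler_wpM2r; first by rewrite invr_ge0 ltW.
exact: (hrow i).2.
Qed.

Lemma row_sum i v : \sum_(j < M) lrow e s rows i j * yv P Y e s (L := L) v j = Grow i v - \sum_v' qm P Y e s (L := L) v' * Grow i v'.
Proof.
have G v' : \sum_(j < M) lrow e s rows i j * (zv v' (tri j).1 * zv v' (tri j).2) = Grow i v' by exact: row_form.
rewrite -G (eq_bigr (fun v' => \sum_(j < M) qm P Y e s (L := L) v' * (lrow e s rows i j * (zv v' (tri j).1 * zv v' (tri j).2)))); last first.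
  by move=> v' _; rewrite -G mulr_sumr.
rewrite exchange_big -sumrB /=; apply: eq_bigr => j _; rewrite /yv mulrBr; congr (_ - _).
by rewrite /ymean mulr_sumr; apply: eq_bigr => v' _; rewrite mulrCA.
Qed.

Lemma mean_err i : (i < size rows)%N -> `|'<<ru i, Sig (rv i)>> - \sum_v' qm P Y e s (L := L) v' * Grow i v'| <= th.
Proof.
move=> im; have [ih eh] := hrow i; have [i1 <-] := HS (ru i) (rv i).
rewrite -(ExqE P e s (rX ord0) (Grow i)) -ExB //; last exact: (cellfun_itg P (mcell e s (rX ord0)) (Grow i)).
by apply: (le_trans (Ex_abs ih)); apply: (le_trans (eh im)); exact: kth.
Qed.

Let vs (Z : 'I_N -> T -> H) w i : \sum_(j < M) lrow e s rows i j * vsum (yv P Y e s (L := L)) (smp cell Z w) j =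
  \sum_(k < N) (Grow i (cell (Z k w)) - \sum_v' qm P Y e s (L := L) v' * Grow i v').
Proof.
rewrite (eq_bigr (fun j : 'I_M => \sum_(k < N) lrow e s rows i j * yv P Y e s (L := L) (cell (Z k w)) j)).
  by rewrite exchange_big; apply: eq_bigr => k _; exact: row_sum.
move=> j _; rewrite /vsum big_tuple mulr_sumr; apply: eq_bigr => k _.
by rewrite tnth_mktuple.
Qed.

Let devs (Z : 'I_N -> T -> H) w i : (i < size rows)%N -> (forall k, ~ badset (Z k w)) ->
  `|\sum_(k < N) (frow i (Z k w) - Grow i (cell (Z k w)))| <= N%:R * th.
Proof.
move=> im nb; apply: (le_trans (ler_norm_sum _ _ _)).
apply: (@le_trans _ _ (\sum_(k < N) th)); last by rewrite sumr_const card_ord mulr_natl.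
by apply: ler_sum => k _; rewrite leNgt; apply/negP => h; apply: (nb k); exists i.
Qed.

Lemma A_row w i : (i < size rows)%N -> (forall k, ~ badset (X k w)) ->
  `|N%:R * '<<ru i, Adev w (rv i)>> - \sum_(j < M) lrow e s rows i j * vsum (yv P Y e s (L := L)) (smp cell X w) j| <= N%:R * (2 * th).
Proof.
move=> im nb; have N0 : N%:R != 0 :> R by rewrite pnatr_eq0.
rewrite vs Adev_form mulrBr mulVKf // sumrB sumr_const card_ord -[X in _ - (_ - X)]mulr_natl sub_sub -sumrB -mulrBr.
apply: (le_trans (ler_normB _ _)); rewrite dbl; apply: lerD; first exact: (devs im nb).
by rewrite normrM normr_nat; apply: ler_wpM2l => //; exact: mean_err.
Qed.

Lemma B_row w i : (i < size rows)%N -> (forall k, ~ badset (X k w)) -> (forall k, ~ badset (Xs k w)) ->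
  `|N%:R * '<<ru i, Bdev w (rv i)>> - \sum_(j < M) lrow e s rows i j *
     (vsum (yv P Y e s (L := L)) (smp cell Xs w) j - vsum (yv P Y e s (L := L)) (smp cell X w) j)| <= N%:R * (2 * th).
Proof.
move=> im nb nbs; have N0 : N%:R != 0 :> R by rewrite pnatr_eq0.
rewrite (eq_bigr (fun j : 'I_M => lrow e s rows i j * vsum (yv P Y e s (L := L)) (smp cell Xs w) j -
  lrow e s rows i j * vsum (yv P Y e s (L := L)) (smp cell X w) j)); last by move=> j _; rewrite mulrBr.
rewrite sumrB !vs Bdev_form mulrBr !mulVKf // !sumrB [X in _ - X]sub_sub subrr subr0 sub_sub -sumrB -[X in _ - X]sumrB.
apply: (le_trans (ler_normB _ _)); rewrite dbl.
by apply: lerD; exact: devs.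
Qed.
End Rows.

Definition dstat w := Num.sqrt N%:R * opnorm (Adev w).
Definition dstats w := Num.sqrt N%:R * opnorm (Bdev w).

Lemma A_sup pair : (forall k : nat, `|(pair k).1| <= 1 /\ `|(pair k).2| <= 1) ->
  (forall (A : H -> H) k th, (forall x y, A x - A y = A (x - y)) -> (forall x, `|A x| <= k * `|x|) -> 0 < th ->
  exists i, opnorm A - th <= `|'<<(pair i).1, A (pair i).2>>|) ->
  measurable_fun setT (fun w => opnorm (Adev w)) /\
  forall eps del : R, 0 < eps -> 0 < del -> exists K, measurable [set w | forall k, (k < K)%N -> `|'<<(pair k).1, Adev w (pair k).2>>| < opnorm (Adev w) - eps] /\
    pr [set w | forall k, (k < K)%N -> `|'<<(pair k).1, Adev w (pair k).2>>| < opnorm (Adev w) - eps] <= del.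
Proof.
move=> p1 pN; apply: (@sup_approx _ _ _ P (fun k w => '<<(pair k).1, Adev w (pair k).2>>)) => [k|w k|w th th0].
- exact: Adev_meas.
- by have [kk hk] := Adev_bound w; exact: (opnorm_form hk (p1 k).1 (p1 k).2).
- by have [kk hk] := Adev_bound w; exact: (pN _ _ _ (Adev_sub w) hk th0).
Qed.

Lemma B_sup pair : (forall k : nat, `|(pair k).1| <= 1 /\ `|(pair k).2| <= 1) ->
  (forall (A : H -> H) k th, (forall x y, A x - A y = A (x - y)) -> (forall x, `|A x| <= k * `|x|) -> 0 < th ->
  exists i, opnorm A - th <= `|'<<(pair i).1, A (pair i).2>>|) ->
  measurable_fun setT (fun w => opnorm (Bdev w)) /\
  forall eps del : R, 0 < eps -> 0 < del -> exists K, measurable [set w | forall k, (k < K)%N -> `|'<<(pair k).1, Bdev w (pair k).2>>| < opnorm (Bdev w) - eps] /\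
    pr [set w | forall k, (k < K)%N -> `|'<<(pair k).1, Bdev w (pair k).2>>| < opnorm (Bdev w) - eps] <= del.
Proof.
move=> p1 pN; apply: (@sup_approx _ _ _ P (fun k w => '<<(pair k).1, Bdev w (pair k).2>>)) => [k|w k|w th th0].
- exact: Bdev_meas.
- by have [kk hk] := Bdev_bound w; exact: (opnorm_form hk (p1 k).1 (p1 k).2).
- by have [kk hk] := Bdev_bound w; exact: (pN _ _ _ (Bdev_sub w) hk th0).
Qed.

Lemma dstat_meas : measurable_fun setT dstat.
Proof. by have [pair [p1 pN]] := norming_pairs; apply: measurable_funM => //; exact: (A_sup p1 pN).1. Qed.

Lemma dstats_meas : measurable_fun setT dstats.
Proof. by have [pair [p1 pN]] := norming_pairs; apply: measurable_funM => //; exact: (B_sup p1 pN).1. Qed.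

Lemma psi_e m' a : V m' -> (a < m'.+1)%N -> psi e m' (e a) = 0.
Proof.
move=> Vm am; have bV k : (k < m'.+1)%N -> V k by rewrite ltnS => km; exact: Vdown km Vm.
have E : \sum_(k < m'.+1) '<<e a, e k>> *: e k = e a.
  rewrite (bigD1 (Ordinal am)) //= Vorth; [|exact: bV|exact: bV].
  rewrite eqxx scale1r big1; first by rewrite addr0.
  move=> k ka; have ne : (a == k) = false by apply/eqP => ak; move/eqP: ka; apply; exact: val_inj.
  by rewrite Vorth; [rewrite ne scale0r|exact: bV|exact: bV].
by rewrite /psi E subrr.
Qed.

Lemma union_pr (Z : 'I_N -> T -> H) A : borel H A -> (forall i, random_element (Z i)) ->
  (forall i, pr (Z i @^-1` A) = pr (Y @^-1` A)) ->
  measurable [set w | exists k, A (Z k w)] /\ pr [set w | exists k, A (Z k w)] <= N%:R * pr (Y @^-1` A).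
Proof.
move=> bA rZ hZ; have mZ k : measurable (Z k @^-1` A) by exact: (rZ k _ bA).
have mU : measurable [set w | exists k, A (Z k w)].
  rewrite (_ : [set _ | _] = \bigcup_(k in [set: 'I_N]) (Z k @^-1` A)).
    by apply: fin_bigcup_measurable => //; exact: finite_finset.
  by apply/seteqP; split => w /=; [case=> k hk; exists k|case=> k _ hk; exists k].
split=> //; apply: (@le_trans _ _ (\sum_(k <- enum 'I_N) pr (Z k @^-1` A))).
  by apply: pr_bigcup_seq => // w [k hk]; exists k => //; rewrite mem_enum.
by rewrite (eq_bigr (fun=> pr (Y @^-1` A))) // sum_const_seq size_enum_ord.
Qed.

Variables (Cn r c : R).
Hypothesis ATn : forall (I : finType) (q : I -> R) y l mm M, (0 < M)%N ->
  admissible (wj p B) (fun k => 2 * 4 ^+ k * mo (2 * k)%N) (c1 / 4) (2 * B / b) q y l mm M ->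
  En q N (fun s => (~~ `[< close (sumlaw q y l mm M N) (bootlaw y l mm M s) Cn r >])%:R) <= c / N%:R.

(** The choices are made in this order to avoid circularity: first finitely many pairs that nearly
    attain both operator norms, then the number of scores, which adds the rows of eigenvector
    pairs, and last the rounding level. The added rows have no truncation error, so that their
    number does not affect the choice of the number of scores. *)
Theorem finite_description (eps del : R) : 0 < eps -> 0 < del ->
  exists (I : finType) (cell : H -> I) (Phi : seq I -> R) (Psi : seq I -> seq I -> R),
  [/\ bcell cell, pr (bad_stat X dstat cell Phi eps) <= del, pr (bad_boot X Xs dstats cell Psi eps) <= del &
   En (qcell P X cell) N (fun s => (~~ `[< close (fun u => En (qcell P X cell) N (fun s => (Phi s <= u)%R%:R))
      (bootF n Psi s) Cn r >])%:R) <= c / N%:R].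
Proof.
move=> eps0 del0; pose q : R := Num.sqrt N%:R.
have n0 : 0 < N%:R :> R by rewrite ltr0n.
have q0 : 0 < q by rewrite sqrtr_gt0.
pose th := eps / (4 * q); have th0 : 0 < th by rewrite divr_gt0 // mulr_gt0.
have thq : q * (2 * th + th) <= eps.
  rewrite /th (_ : q * _ = 3 / 4 * eps); last by field; rewrite gt_eqF.
  exact: a34_arith.
have [pair [pair1 pairN]] := norming_pairs.
have del2 : 0 < del / 2 by rewrite divr_gt0.
have [K1 [mE1 pE1]] := (A_sup pair1 pairN).2 th (del / 2) th0 del2.
have [K2 [mE2 pE2]] := (B_sup pair1 pairN).2 th (del / 2) th0 del2.
pose K3 := maxn K1 K2.
have share (j : nat) : exists2 kp : R, 0 < kp & kp <= th /\ j%:R * kp / th <= del / (8 * N%:R).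
  have j1 : 0 < j%:R + 1 :> R by rewrite ltr_wpDl.
  have d8 : 0 < del / (8 * N%:R) by rewrite divr_gt0 // mulr_gt0.
  exists (Num.min th (th * (del / (8 * N%:R)) / (j%:R + 1))).
    by rewrite lt_min th0 divr_gt0 // mulr_gt0.
  split; first by rewrite ge_min lexx.
  rewrite ler_pdivrMr //; apply: (@le_trans _ _ (j%:R * (th * (del / (8 * N%:R)) / (j%:R + 1)))).
    by apply: ler_wpM2l => //; rewrite ge_min lexx orbT.
  rewrite mulrA mulrAC [X in _ <= X]mulrC; apply: ler_piMl; first by rewrite mulr_ge0 // ltW.
  by rewrite ler_pdivrMr // mul1r lerDl.
have [kd kd0 [kdth kds]] := share K3.
have [etad [rd [etad0 rd0 hd]]] := rho_exists K0 kd0.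
pose Q k N0 := forall m', V m' -> (forall a, V a -> (a < N0)%N -> (a <= m')%N) ->
  2 * '<<psi e m' (pair k).1, Sig (psi e m' (pair k).1)>> <= rd / 2 /\
  2 * '<<psi e m' (pair k).2, Sig (psi e m' (pair k).2)>> <= rd / 2.
have Qmono k a a' : (a <= a')%N -> Q k a -> Q k a'.
  by move=> aa hQ m' Vm cov; apply: hQ => // x Vx xa; apply: cov => //; exact: leq_trans xa aa.
have bVm m' (Vm : V m') a : (a < m'.+1)%N -> V a by rewrite ltnS => am; exact: Vdown am Vm.
have Qex k : exists a, Q k a.
  have rd8 : 0 < rd / 8 by rewrite divr_gt0.
  have [a1 h1] := spec (pair k).1 rd8; have [a2 h2] := spec (pair k).2 rd8.
  exists (maxn a1 a2) => m' Vm cov.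
  have one u : `|u| <= 1 -> `|Sig u - \sum_(a < m'.+1) (s a ^+ 2 * '<<u, e a>>) *: e a| <= rd / 8 ->
      2 * '<<psi e m' u, Sig (psi e m' u)>> <= rd / 2.
    move=> u1 hu; have o (a a' : nat) : (a < m'.+1)%N -> (a' < m'.+1)%N -> '<<e a, e a'>> = (a == a')%:R.
      by move=> ? ?; apply: Vorth; exact: (bVm m' Vm).
    exact: (psi_arith (psi_form o (fun a am => Veig (bVm m' Vm a am)) u1) hu).
  split; apply: one; rewrite ?(pair1 k).1 ?(pair1 k).2 //; [apply: h1|apply: h2] => // x Vx xa; apply: cov => //.
    by apply: leq_trans xa _; exact: leq_maxl.
  by apply: leq_trans xa _; exact: leq_maxr.
have [N0 hN0] := family_bound Qmono Qex K3.
have [m' Vm cov] := largest_below V0 N0.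
pose m := m'.+1; have bV a : (a < m)%N -> V a by exact: bVm.
have [ke ke0 [keth kes]] := share (m * m)%N.
have [etae [re [etae0 re0 he]]] := rho_exists K0 ke0.
pose C1 : R := 'C(m.+1, 2)%:R * (16 + 16 * (mo 4 + mo 4)).
pose C2 : R := 2 * (B * (m%:R * (2 + 2 * mo 2))).
have C10 : 0 <= C1 by rewrite mulr_ge0 // addr_ge0 // mulr_ge0 // addr_ge0.
have C20 : 0 <= C2 by rewrite !mulr_ge0 ?(ltW B0) // addr_ge0 // mulr_ge0.
have t0 : 0 < Num.min (c1 / 4) (Num.min (rd / 2) re) by rewrite !lt_min re0 !divr_gt0.
have [L L0 hL] := level_exists (addr_ge0 C10 C20) t0.
have l2 : 0 <= (L%:R^-1 : R) ^+ 2 by exact: sqr_ge0.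
have HL : (L%:R^-1) ^+ 2 * C1 <= c1 / 4.
  apply: le_trans (le_trans (ler_wpM2l l2 _) hL) _; first by rewrite lerDl.
  by rewrite ge_min lexx.
have rerrE : rerr m' L B mo = (L%:R^-1) ^+ 2 * C2 by rewrite /rerr /C2; exact: rerr_arith.
have HR : rerr m' L B mo <= Num.min (rd / 2) re.
  rewrite rerrE; apply: le_trans (le_trans (ler_wpM2l l2 _) hL) _; first by rewrite lerDr.
  by rewrite ge_min lexx orbT.
have HRd : rerr m' L B mo <= rd / 2 by apply: le_trans HR _; rewrite ge_min lexx.
have HRe : rerr m' L B mo <= re by apply: le_trans HR _; rewrite ge_min lexx orbT.
pose es := [seq (e a, e a') | a <- iota 0 m, a' <- iota 0 m].
pose rows := [seq pair k | k <- iota 0 K3] ++ es.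
have ses : size es = (m * m)%N by rewrite size_allpairs size_iota.
have srows : size rows = (K3 + m * m)%N by rewrite size_cat size_map size_iota ses.
have rowd k : (k < K3)%N -> nth (0, 0) rows k = pair k.
  by move=> kK; rewrite nth_cat size_map size_iota kK (nth_map 0%N) ?size_iota // nth_iota.
have rowe i : (K3 <= i)%N -> (i < size rows)%N -> exists a a', [/\ (a < m)%N, (a' < m)%N & nth (0, 0) rows i = (e a, e a')].
  move=> Ki im; rewrite nth_cat size_map size_iota ltnNge Ki /=.
  have : nth (0, 0) es (i - K3) \in es by apply: mem_nth; rewrite ses ltn_subLR // -srows.
  case/allpairsP => -[a a'] [am am' ->]; exists a, a'.
  by move: am am'; rewrite !mem_iota !add0n => /andP[_ am] /andP[_ am']; split.
have en a : (a < m)%N -> `|e a| <= 1.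
  move=> am; have := Vorth (bV a am) (bV a am); rewrite eqxx inner_normE => h.
  by rewrite -(@expr_le1 _ 2) // h.
have rows1 i : `|(nth (0, 0) rows i).1| <= 1 /\ `|(nth (0, 0) rows i).2| <= 1.
  have [im|im] := ltnP i (size rows); last by rewrite nth_default //= normr0.
  have [iK|Ki] := ltnP i K3; first by rewrite rowd //; exact: pair1.
  by have [a [a' [am am' ->]]] := rowe i Ki im; split; exact: en.
pose kp i : R := if (i < K3)%N then kd else ke.
have kpth i : kp i <= th by rewrite /kp; case: ifP.
have oV (a a' : nat) : (a < m)%N -> (a' < m)%N -> '<<e a, e a'>> = (a == a')%:R by move=> ? ?; apply: Vorth; exact: bV.
have HMm a : (a < m)%N -> forall k, itg (fun w => zs Y e s a w ^+ (2 * k)) /\ Ex (fun w => zs Y e s a w ^+ (2 * k)) <= mo k.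
  by move=> am; exact: VM (bV a am).
have s0m a : (a < m)%N -> 0 < s a by move=> am; exact: Vs (bV a am).
have sBm a : (a < m)%N -> s a ^+ 2 <= B by move=> am; exact: VB (bV a am).
have eue u := ex_eu (rX ord0) L0 B0 HS HMm s0m oV sBm (u := u).
have hrow i : itg (herr Y e s m' L (nth (0, 0) rows i).1 (nth (0, 0) rows i).2) /\ ((i < size rows)%N ->
    Ex (fun w => `|herr Y e s m' L (nth (0, 0) rows i).1 (nth (0, 0) rows i).2 w|) <= kp i).
  have [u1 v1] := rows1 i.
  have gen eta ru := @ex_herr R H d T P Y e s m' L Sig K B mo (rX ord0) L0 K0 B0 SK HS HMm s0m oV sBm _ _ eta ru u1 v1.
  pose mx := Num.max (Ex (fun w => eu Y e s m' L (nth (0, 0) rows i).1 w ^+ 2)) (Ex (fun w => eu Y e s m' L (nth (0, 0) rows i).2 w ^+ 2)).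
  have e1 : Ex (fun w => eu Y e s m' L (nth (0, 0) rows i).1 w ^+ 2) <= mx by rewrite le_max lexx.
  have e2 : Ex (fun w => eu Y e s m' L (nth (0, 0) rows i).2 w ^+ 2) <= mx by rewrite le_max lexx orbT.
  split; first exact: (gen 1 mx ltr01 e1 e2).1.
  move=> im; rewrite /kp; case: ltnP => Ki.
    apply: le_trans hd; apply: (gen etad rd etad0 _ _).2.
      apply: (le_trans (eue _ u1).2); rewrite rowd // (splitr rd).
      by apply: lerD => //; exact: (hN0 i Ki m' Vm cov).1.
    apply: (le_trans (eue _ v1).2); rewrite rowd // (splitr rd).
    by apply: lerD => //; exact: (hN0 i Ki m' Vm cov).2.
  have [a [a' [am am' E]]] := rowe i Ki im.
  apply: le_trans he; apply: (gen etae re etae0 _ _).2.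
    by apply: (le_trans (eue _ u1).2); rewrite E /= psi_e // linear0 ip0r mulr0 add0r.
  by apply: (le_trans (eue _ v1).2); rewrite E /= psi_e // linear0 ip0r mulr0 add0r.
pose cell := cellm e s m' L; pose bad := badset m' L rows th.
have bbad : borel H bad by exact: badset_borel.
have pbad : N%:R * pr (Y @^-1` bad) <= del / 4.
  have h1 : pr (Y @^-1` bad) <= (\sum_(i <- iota 0 (size rows)) kp i) / th by apply: badset_pr.
  have Eg m2 : \sum_(i <- iota 0 (K3 + m2)) kp i = K3%:R * kd + m2%:R * ke.
    rewrite iotaD big_cat /=; congr (_ + _).
      rewrite big_seq (eq_bigr (fun=> kd)) => [|i]; last by rewrite mem_iota add0n /kp => /andP[_ ->].
      by rewrite -big_seq sum_const_seq size_iota.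
    rewrite big_seq (eq_bigr (fun=> ke)) => [|i]; last by rewrite mem_iota add0n => /andP[hi _]; rewrite /kp ltnNge hi.
    by rewrite -big_seq sum_const_seq size_iota.
  have E : \sum_(i <- iota 0 (size rows)) kp i = K3%:R * kd + (m * m)%:R * ke by rewrite srows Eg.
  rewrite E mulrDl in h1.
  have h2 : pr (Y @^-1` bad) <= del / (8 * N%:R) + del / (8 * N%:R) by apply: (le_trans h1); exact: lerD.
  apply: (le_trans (ler_wpM2l (ltW n0) h2)); rewrite le_eqVlt; apply/orP; left; apply/eqP; field.
  by rewrite gt_eqF.
have [mBX pBX] := @union_pr X bad bbad rX (fun i => congr1 fine (idd i ord0 bbad)).
have [mBS pBS] := @union_pr Xs bad bbad rXs (fun i => boot_marginal i bbad).
pose qv := qm P Y e s (m' := m') (L := L); pose y := yv P Y e s (m' := m') (L := L).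
pose l := lrow e s rows; pose mm := size rows; pose M := 'C(m.+1, 2).
exists {ffun 'I_m -> rcode_type L}, cell, (fun S => Nrm l mm M (vsum y S) / q),
  (fun S U => Nrm l mm M (fun j => vsum y U j - vsum y S j) / q).
have mmK k : (k < K3)%N -> (k < mm)%N by move=> kK; rewrite /mm srows; apply: leq_trans kK (leq_addr _ _).
have M0 : (0 < M)%N by rewrite bin_gt0.
have adm : admissible (wj p B) (fun k => 2 * 4 ^+ k * mo (2 * k)%N) (c1 / 4) (2 * B / b) qv y l mm M.
  apply: (rounded_admissible (rX ord0) L0 HMm (VJ Vm) HL b0 B0 s0m oV) => //.
  - by move=> a am; exact: Vlo (bV a am).
  - by move=> a am; exact: Vhi (bV a am).
  - move=> a a' am am'; have : (e a, e a') \in es by apply/allpairsP; exists (a, a'); rewrite !mem_iota.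
    move=> hin; exists (K3 + index (e a, e a') es)%N.
      by rewrite srows ltn_add2l -ses index_mem.
    by rewrite nth_cat size_map size_iota ltnNge leq_addr /= addKn nth_index.
split.
- exact: bcell_cellm.
- have mb : measurable (bad_stat X dstat cell (fun S => Nrm l mm M (vsum y S) / q) eps).
    by apply: bad_stat_meas => //; (exact: dstat_meas || exact: bcell_cellm).
  apply: (@le_trans _ _ (del / 2 + del / 2)); last by rewrite -splitr.
  apply: (@le_trans _ _ (pr [set w | forall k, (k < K1)%N -> `|'<<(pair k).1, Adev w (pair k).2>>| < opnorm (Adev w) - th] + pr [set w | exists k, bad (X k w)])).
    apply: pr_sub2 => // w hw; have [h1|h1] := pselect (exists k, bad (X k w)); [by right|left => k kK].
    have nb k' : ~ bad (X k' w) by move=> h; apply: h1; exists k'.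
    rewrite ltNge; apply/negP => hk.
    have [kk hkk] := Adev_bound w.
    have k3 : (k < K3)%N by apply: leq_trans kK (leq_maxl _ _).
    have hk' : opnorm (Adev w) - th <= `|'<<(nth (0, 0) rows k).1, Adev w (nth (0, 0) rows k).2>>| by rewrite rowd.
    have hA i (im : (i < mm)%N) : `|N%:R * '<<(nth (0, 0) rows i).1, Adev w (nth (0, 0) rows i).2>> -
        \sum_(j < M) l i j * vsum y (smp cell X w) j| <= N%:R * (2 * th) by exact: (A_row hrow kpth im nb).
    have hc := @norm_close R N mm M (opnorm (Adev w)) th th (fun i => '<<(nth (0, 0) rows i).1, Adev w (nth (0, 0) rows i).2>>) l
      (vsum y (smp cell X w)) (ltn0Sn n) (fun i _ => opnorm_form hkk (rows1 i).1 (rows1 i).2) (ex_intro2 _ _ k (mmK k k3) hk') hA (ltW th0) (ltW th0).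
    have hw' : eps < `|dstat w - Nrm l mm M (vsum y (smp cell X w)) / q| := hw.
    by move: hw'; rewrite ltNge => /negP; apply; exact: le_trans hc thq.
  by apply: lerD => //; apply: (le_trans pBX); apply: (le_trans pbad); exact: quarter_arith.
- have mb : measurable (bad_boot X Xs dstats cell (fun S U => Nrm l mm M (fun j => vsum y U j - vsum y S j) / q) eps).
    by apply: bad_boot_meas => //; (exact: dstats_meas || exact: bcell_cellm).
  apply: (@le_trans _ _ (del / 2 + (del / 4 + del / 4))); last by rewrite (_ : _ + _ = del) //; field.
  pose BB := [set w | exists k, bad (X k w)] `|` [set w | exists k, bad (Xs k w)].
  have mBB : measurable BB by exact: measurableU.
  have pBB : pr BB <= del / 4 + del / 4.
    apply: (@le_trans _ _ (pr [set w | exists k, bad (X k w)] + pr [set w | exists k, bad (Xs k w)])); first by apply: pr_sub2.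
    by apply: lerD; [apply: (le_trans pBX)|apply: (le_trans pBS)].
  apply: (@le_trans _ _ (pr [set w | forall k, (k < K2)%N -> `|'<<(pair k).1, Bdev w (pair k).2>>| < opnorm (Bdev w) - th] + pr BB)); last by apply: lerD.
    apply: pr_sub2 => // w hw; have [h1|h1] := pselect (BB w); [by right|left => k kK].
    have nb k' : ~ bad (X k' w) by move=> h; apply: h1; left; exists k'.
    have nbs k' : ~ bad (Xs k' w) by move=> h; apply: h1; right; exists k'.
    rewrite ltNge; apply/negP => hk.
    have [kk hkk] := Bdev_bound w.
    have k3 : (k < K3)%N by apply: leq_trans kK (leq_maxr _ _).
    have hk' : opnorm (Bdev w) - th <= `|'<<(nth (0, 0) rows k).1, Bdev w (nth (0, 0) rows k).2>>| by rewrite rowd.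
    have hB i (im : (i < mm)%N) : `|N%:R * '<<(nth (0, 0) rows i).1, Bdev w (nth (0, 0) rows i).2>> -
        \sum_(j < M) l i j * (vsum y (smp cell Xs w) j - vsum y (smp cell X w) j)| <= N%:R * (2 * th) by apply: B_row.
    have hc := @norm_close R N mm M (opnorm (Bdev w)) th th (fun i => '<<(nth (0, 0) rows i).1, Bdev w (nth (0, 0) rows i).2>>) l
      (fun j => vsum y (smp cell Xs w) j - vsum y (smp cell X w) j) (ltn0Sn n) (fun i _ => opnorm_form hkk (rows1 i).1 (rows1 i).2)
      (ex_intro2 _ _ k (mmK k k3) hk') hB (ltW th0) (ltW th0).
    have hw' : eps < `|dstats w - Nrm l mm M (fun j => vsum y (smp cell Xs w) j - vsum y (smp cell X w) j) / q| := hw.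
    by move: hw'; rewrite ltNge => /negP; apply; exact: le_trans hc thq.
- apply: le_trans (ATn M0 adm).
  rewrite (_ : qcell P X cell = qv) //; apply: En_le => [v|S SN]; first exact: qm_ge0.
  have E1 : (fun u => En qv N (fun s0 => (Nrm l mm M (vsum y s0) / q <= u)%R%:R)) = sumlaw qv y l mm M N.
    apply/funext => u; rewrite /sumlaw; congr (En qv N); apply/funext => s0.
    by rewrite ler_pdivrMr // mulrC.
  have E2 : bootF n (fun S U => Nrm l mm M (fun j => vsum y U j - vsum y S j) / q) S = bootlaw y l mm M S.
    apply/funext => u; rewrite /bootF /bootlaw SN; congr (En _ N); apply/funext => s0.
    by rewrite ler_pdivrMr // mulrC.
  by rewrite E1 E2.
Qed.
End Approx.

(** * Consequences of the hypotheses on moments and covariances *)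
Section Bounds.
Context {R : realType}.

Lemma inf_bound (k : R) (S : set (\bar R)) y : 0 < k -> (1 <= k%:E * ereal_inf S)%E -> S y -> (1 <= k%:E * y)%E.
Proof.
move=> k0 h Sy; apply: (le_trans h); apply: lee_wpmul2l; first by rewrite lee_fin ltW.
exact: ereal_inf_lbound.
Qed.

Lemma sup_bound (k : R) (S : set (\bar R)) y : (ereal_sup S <= k%:E * 1)%E -> S y -> (y <= k%:E)%E.
Proof. by rewrite mule1 => h Sy; apply: le_trans h; exact: ereal_sup_ubound. Qed.

Context {d : measure_display} {T : measurableType d} (P : probability T R).

Lemma Lnorm_moment (f : T -> R) (k : nat) (C : R) : measurable_fun setT f -> (0 < k)%N -> 0 <= C ->
  ('N[P]_((2 * k)%:R)%:E[EFin \o f] <= C%:E)%E ->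
  itg P (fun w => f w ^+ (2 * k)) /\ Ex P (fun w => f w ^+ (2 * k)) <= C ^+ (2 * k).
Proof.
move=> mf k0 C0 h.
have q0 : (2 * k)%:R != 0 :> R by rewrite pnatr_eq0 -lt0n muln_gt0 k0.
have ev w : 0 <= f w ^+ (2 * k) by rewrite exprM exprn_ge0 ?sqr_ge0.
have E : (\int[P]_x `|(EFin \o f) x| `^ (2 * k)%:R = \int[P]_x (f x ^+ (2 * k))%:E)%E.
  apply: eq_integral => x _; rewrite /= powR_mulrn // -normrX ger0_norm //.
have I1 : (\int[P]_x (f x ^+ (2 * k))%:E <= (C ^+ (2 * k))%:E)%E.
  rewrite -E -(poweR_Lnorm P (EFin \o f) q0) -powR_mulrn // -poweR_EFin.
  by apply: gt0_ler_poweR => //; rewrite in_itv /= ?leey ?Lnorm_ge0 ?lee_fin ?C0.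
have I0 : (0 <= \int[P]_x (f x ^+ (2 * k))%:E)%E by apply: integral_ge0 => x _; rewrite lee_fin.
split.
  apply/integrableP; split; first by apply/measurable_EFinP; exact: measurable_funX.
  rewrite (eq_integral (fun x => (f x ^+ (2 * k))%:E)); first by apply: le_lt_trans I1 _; exact: ltry.
  by move=> x _; rewrite /= ger0_norm.
by rewrite -lee_fin /Ex fineK // ge0_fin_numE //; apply: le_lt_trans I1 _; exact: ltry.
Qed.
End Bounds.

Fact var_arith (R : realType) (z k0 k : R) : (z - k) ^+ 2 = (z - k0) ^+ 2 + (2 * (k0 - k) * (z - k0) + (k0 - k) ^+ 2).
Proof. by ring. Qed.

Fact prod_amgm (R : realType) (x y : R) : (x * y) ^+ 2 <= 2^-1 * (x ^+ 4 + y ^+ 4).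
Proof.
rewrite -subr_ge0 (_ : _ - _ = 2^-1 * (x ^+ 2 - y ^+ 2) ^+ 2); last by field.
by rewrite mulr_ge0 ?sqr_ge0.
Qed.

Section CovForm.
Context {R : realType} {d : measure_display} {T : measurableType d} (P : probability T R) (k : nat).
Notation Ex := (Ex P).
Notation itg := (itg P).

Lemma mxinnerE (A B : symmx R k) : mxinner A B = \sum_i \sum_j vsval A i j * vsval B j i.
Proof. by rewrite /mxinner /mxtrace; apply: eq_bigr => i _; rewrite mxE. Qed.

Lemma symmx_sym (A : symmx R k) i j : vsval A i j = vsval A j i.
Proof. by have /symvP h := subvsP A; rewrite -{1}h mxE. Qed.

Lemma mxinnerC (A B : symmx R k) : mxinner A B = mxinner B A.
Proof. by rewrite /mxinner mxtrace_mulC. Qed.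

Lemma mxinner_self (A : symmx R k) : mxinner A A = \sum_i \sum_j vsval A i j ^+ 2.
Proof. by rewrite mxinnerE; apply: eq_bigr => i _; apply: eq_bigr => j _; rewrite (symmx_sym A j) expr2. Qed.

Lemma mxinner_gt0 (A : symmx R k) : A != 0 -> 0 < mxinner A A.
Proof.
move=> A0; rewrite mxinner_self lt_def.
have n0 i : 0 <= \sum_j vsval A i j ^+ 2 by apply: sumr_ge0 => j _; exact: sqr_ge0.
rewrite sumr_ge0 // andbT; apply: contra A0; rewrite psumr_eq0 // => /allP h.
apply/eqP; apply: val_inj; apply/matrixP => i j; rewrite [RHS]mxE.
have := h i (mem_index_enum _); rewrite psumr_eq0 => [/allP h'|j' _]; last exact: sqr_ge0.
by have := h' j (mem_index_enum _); rewrite sqrf_eq0 => /eqP.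
Qed.

Variables (z : nat -> T -> R) (J : 'End(symmx R k)) (cc : R).
Hypothesis mz : forall a, (a < k)%N -> measurable_fun setT (z a).
Hypothesis z4 : forall a, (a < k)%N -> itg (fun w => z a w ^+ 4).
Hypothesis HJ : covariance_operator P (fun w => outer (\col_(i < k) z i w)) J.
Hypothesis eig : forall a, passmx.leigenvalue J a -> cc <= a.
Hypothesis cc0 : 0 <= cc.
Notation M := 'C(k.+1, 2).

Let tri_ltk j : (j < M)%N -> ((tri j).1 < k)%N /\ ((tri j).2 < k)%N.
Proof.
rewrite -tri_lt => h; split=> //; have := tri_spec j; case: (tri j) h => a b /= bm [ab _].
exact: leq_ltn_trans ab bm.
Qed.

Let coef (c : nat -> R) (a b : nat) : R := let j := tcode (minn a b) (maxn a b) in if a == b then c j else c j / 2.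

Let coefC c a b : coef c a b = coef c b a.
Proof. by rewrite /coef minnC maxnC eq_sym. Qed.

Let coef_tri c j : coef c (tri j).1 (tri j).2 = if (tri j).1 == (tri j).2 then c j else c j / 2.
Proof.
rewrite /coef; have := tri_spec j; case: (tri j) => a b /= [ab e].
by rewrite (minn_idPl ab) (maxn_idPr ab) e.
Qed.

Let Asym c : (\matrix_(i < k, j < k) coef c i j) \in symv R k.
Proof. by apply/symvP/matrixP => i j; rewrite !mxE coefC. Qed.

Let A c : symmx R k := Subvs (Asym c).

Let A_outer c w : mxinner (A c) (outer (\col_(i < k) z i w)) = \sum_(j < M) c j * (z (tri j).1 w * z (tri j).2 w).
Proof.
rewrite mxinnerE (eq_bigr (fun i : 'I_k => \sum_(j < k) coef c i j * (z j w * z i w))); last first.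
  by move=> i _; apply: eq_bigr => j _; rewrite /= !mxE big_ord1 !mxE.
rewrite -(sum_sym_tri k (fun i j => coef c i j * (z j w * z i w))); apply: eq_bigr => j _.
have e2 := coef_tri c j; have e3 := coefC c (tri j).2 (tri j).1.
case: eqP e2 => [e|_] e2; first by move: e e2 => {e3}; move: (tri j).1 (tri j).2 => a a' <- ->.
by rewrite e3 e2; field.
Qed.

Let A_norm (c : nat -> R) : 2^-1 * \sum_(j < M) c j ^+ 2 <= mxinner (A c) (A c).
Proof.
rewrite mxinner_self (eq_bigr (fun i : 'I_k => \sum_(j < k) coef c i j ^+ 2)); last first.
  by move=> i _; apply: eq_bigr => j _; rewrite /= mxE.
rewrite -(sum_sym_tri k (fun i j => coef c i j ^+ 2)) mulr_sumr; apply: ler_sum => j _.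
have e2 := coef_tri c j; have e3 := coefC c (tri j).2 (tri j).1.
case: eqP e2 => [e|_] e2.
  rewrite (_ : coef c (tri j).1 (tri j).1 = c j); last by rewrite -e2 -e.
  by apply: ler_piMl; [exact: sqr_ge0|rewrite invf_le1 // ler1n].
by rewrite e3 e2 le_eqVlt; apply/orP; left; apply/eqP; field.
Qed.

(** A linear form of the products of scores is the pairing of a symmetric matrix with the outer
    product; off-diagonal coefficients are halved, which is the source of the factor [2]. *)
Lemma cov_form (c : nat -> R) (m : R) : cc / 2 * \sum_(j < M) c j ^+ 2 <=
  Ex (fun w => (\sum_(j < M) c j * (z (tri j).1 w * z (tri j).2 w) - m) ^+ 2).
Proof.
pose Z w := \sum_(j < M) c j * (z (tri j).1 w * z (tri j).2 w).
have mZ : measurable_fun setT Z.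
  rewrite (_ : Z = fun w => \sum_(j <- enum 'I_M) c j * (z (tri j).1 w * z (tri j).2 w)); last first.
    by apply/funext => w; rewrite /Z big_enum.
  apply: measurable_sum => j; have [am bm] := tri_ltk (ltn_ord j).
  by apply: measurable_funM => //; apply: measurable_funM; exact: mz.
pose G w := \sum_(j < M) 2^-1 * (z (tri j).1 w ^+ 4 + z (tri j).2 w ^+ 4).
have iG : itg G.
  by apply: itg_sum => j; have [am bm] := tri_ltk (ltn_ord j); apply: itgZ; apply: itgD; exact: z4.
have S0 : 0 <= \sum_(j < M) c j ^+ 2 by apply: sumr_ge0 => j _; exact: sqr_ge0.
have iZ2 : itg (fun w => Z w ^+ 2).
  apply: (@itg_le _ _ _ P _ (fun w => (\sum_(j < M) c j ^+ 2) * G w)); last exact: itgZ.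
    exact: measurable_funX.
  move=> w; rewrite ger0_norm ?sqr_ge0 //.
  apply: (le_trans (fcs M c (fun j => z (tri j).1 w * z (tri j).2 w))); apply: ler_wpM2l => //.
  by apply: ler_sum => j _; exact: prod_amgm.
have iZ : itg Z.
  apply: (@itg_le _ _ _ P _ (fun w => 1 + Z w ^+ 2)) => //; last by apply: itgD => //; exact: itg_cst.
  move=> w; rewrite -[Z w ^+ 2]real_normK ?num_real //; move: `|Z w| => x.
  by rewrite -subr_ge0 (_ : _ - _ = (x - 2^-1) ^+ 2 + 3 / 4); [rewrite addr_ge0 ?sqr_ge0 ?divr_ge0|field].
pose k0 := Ex Z.
have i1 : itg (fun w => Z w - k0) by apply: itgB => //; exact: itg_cst.
have i2 : itg (fun w => (Z w - k0) ^+ 2).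
  rewrite (_ : (fun w => _) = fun w => Z w ^+ 2 + ((- 2 * k0) * Z w + k0 ^+ 2)); last by apply/funext => w; ring.
  by apply: itgD => //; apply: itgD; [exact: itgZ|exact: itg_cst].
have step : Ex (fun w => (Z w - k0) ^+ 2) <= Ex (fun w => (Z w - m) ^+ 2).
  rewrite [leRHS](_ : _ = Ex (fun w => (Z w - k0) ^+ 2 + (2 * (k0 - m) * (Z w - k0) + (k0 - m) ^+ 2))); last first.
    by congr Ex; apply/funext => w; exact: var_arith.
  have i3 := itgZ (2 * (k0 - m)) i1; have i4 := itg_cst P ((k0 - m) ^+ 2).
  rewrite (ExD i2 (itgD i3 i4)) (ExD i3 i4) (ExZ _ i1) (ExB iZ (itg_cst P k0)) !Ex_cst subrr mulr0 add0r.
  by rewrite lerDl sqr_ge0.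
apply: le_trans step.
have fJ x y : mxinner x (J y) = mxinner (J x) y.
  by apply: EFin_inj; rewrite [in RHS]mxinnerC !HJ covarianceC.
have fD (x y w : symmx R k) : mxinner (x + y) w = mxinner x w + mxinner y w.
  by rewrite /mxinner linearD /= mulmxDl linearD.
have fZ (a : R) (x y : symmx R k) : mxinner (a *: x) y = a * mxinner x y.
  by rewrite /mxinner linearZ /= -scalemxAl linearZ.
have ray := @rayleigh R _ (@mxinner R k) J fD fZ mxinnerC mxinner_gt0 fJ cc eig (A c).
apply: (@le_trans _ _ (mxinner (A c) (J (A c)))).
  apply: le_trans ray; rewrite -mulrA; apply: ler_wpM2l => //; exact: A_norm.
rewrite le_eqVlt; apply/orP; left; apply/eqP; apply: EFin_inj; rewrite HJ covariance.unlock.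
have ZE : (fun w => mxinner (A c) (outer (\col_(i < k) z i w))) = Z by apply/funext => w; exact: A_outer.
rewrite ZE expectation.unlock /Ex fineK; last by exact: (integrable_fin_num measurableT i2).
by apply: eq_integral => w _; rewrite expr2.
Qed.
End CovForm.

(** * The conclusion at a fixed sample size *)
Section Core.
Context {R : realType} {H : hilbertType R} {d : measure_display} {T : measurableType d} (P : probability T R).
Variables (n : nat) (X Xs : 'I_n.+1 -> T -> H) (Sig : {linear H -> H}) (lambda : nat -> R) (phi : nat -> H)
  (J : forall k, 'End(symmx R k)) (kappa : T -> probability (measurableTypeR R) R) (beta nu Ka Kb Kb' Kc : R).
Notation N := n.+1.
Notation pr := (pr P).
Notation itg := (itg P).
Notation Ex := (Ex P).
Notation Y := (X ord0).
Notation dim := (@dim_index R H).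
Let zeta := standardized P Y phi.
Hypotheses (beta2 : 2^-1 < beta) (Ka0 : 0 < Ka) (Kb0 : 0 < Kb) (Kb'0 : 0 < Kb') (Kc0 : 0 < Kc).
Hypotheses (sep : separable_space H) (rX : forall i, random_element (X i)).
Hypotheses (ind : independent P X) (idd : identically_distributed P X) (smo : second_moment_operator P Y Sig).
Hypotheses (cpt : compact_operator Sig) (spd : spectral_decomposition Sig lambda phi).
Hypothesis Ha : (ereal_sup [set ereal_sup [set ((q `^ (- nu))%:E * 'N[P]_q%:E [EFin \o zeta j])%E
  | q in [set q : R | (2 <= q)%R]] | j in dim] <= Ka%:E * 1)%E.
Hypothesis Hb : (1 <= Kb%:E * ereal_inf [set (lambda j * j%:R `^ (2 * beta))%:E | j in dim])%E.
Hypothesis Hb' : (ereal_sup [set (lambda j * j%:R `^ (2 * beta))%:E | j in dim] <= Kb'%:E * 1)%E.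
Hypothesis Hcov : forall k, dim k -> covariance_operator P (fun w => outer (\col_(i < k) zeta i.+1 w)) (J k).
Hypothesis Hc : (1 <= Kc%:E * ereal_inf [set lambda_min (J k) | k in dim])%E.
Hypotheses (rXs : forall i, random_element (Xs i)) (swr : sampled_with_replacement P X Xs).
Definition cstat w : R := Num.sqrt N%:R * opnorm (fun z => empirical_cov (fun i => X i w) z - Sig z).
Definition cstats w : R := Num.sqrt N%:R * opnorm (fun z => empirical_cov (fun i => Xs i w) z - empirical_cov (fun i => X i w) z).
Hypothesis rc : regular_cond_distribution P (sigma_generated X) cstats kappa.

Lemma dim_down i j : (0 < i)%N -> (i <= j)%N -> dim j -> dim i.
Proof. by move=> i0 ij [_ h]; split=> // k /h; exact: leq_trans ij. Qed.

Lemma dim_pos j : dim j -> (0 < j)%N. Proof. by case. Qed.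

Lemma lam_lo j : dim j -> Kb^-1 * j%:R `^ (- (2 * beta)) <= lambda j.
Proof.
move=> dj; have j0 : 0 < j%:R `^ (2 * beta) :> R by rewrite powR_gt0 // ltr0n dim_pos.
have : (1 <= Kb%:E * (lambda j * j%:R `^ (2 * beta))%:E)%E by apply: (inf_bound Kb0 Hb); exists j.
rewrite lee_fin mulrA => h; rewrite powRN ler_pdivrMl //.
by rewrite -[X in X <= _]mul1r ler_pdivrMr.
Qed.

Lemma lam_hi j : dim j -> lambda j <= Kb' * j%:R `^ (- (2 * beta)).
Proof.
move=> dj; have j0 : 0 < j%:R `^ (2 * beta) :> R by rewrite powR_gt0 // ltr0n dim_pos.
have : ((lambda j * j%:R `^ (2 * beta))%:E <= Kb'%:E)%E by apply: (sup_bound Hb'); exists j.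
by rewrite lee_fin powRN ler_pdivlMr.
Qed.

Lemma phi_orth i j : dim i -> dim j -> '<<phi i, phi j>> = (i == j)%:R.
Proof.
have [_ h2 h3 _] := spd; move=> di dj; case: eqP => [<-|ne]; last exact: h3.
by rewrite inner_normE h2 // expr1n.
Qed.

Lemma phi_eig i : dim i -> Sig (phi i) = lambda i *: phi i.
Proof.
move=> di; have [_ _ _ h4] := spd.
have cv2 : (fun M => \sum_(1 <= j < M.+1 | j \in dim) lambda j *: tensor (phi j) (phi j) (phi i)) @ \oo --> lambda i *: phi i.
  apply: cvg_near_cst; exists i => // M /= iM.
  rewrite big_mkcond (bigD1_seq i) /= ?iota_uniq ?mem_index_iota ?ltnS ?iM ?dim_pos // mem_set // big1 ?addr0.
    by rewrite /tensor phi_orth // eqxx scale1r.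
  move=> j ji; case: ifP => // /set_mem dj.
  by rewrite /tensor phi_orth // (negPf ji) scale0r scaler0.
have hh := @norm_hausdorff R H.
by rewrite -(cvg_lim hh (h4 (phi i))) (cvg_lim hh cv2).
Qed.

Lemma HS_core x y : itg (fun w => '<<x, Y w>> * '<<y, Y w>>) /\ Ex (fun w => '<<x, Y w>> * '<<y, Y w>>) = '<<x, Sig y>>.
Proof.
have [h1 h2] := smo x y.
have E : (fun w => '<<x, tensor (Y w) (Y w) y>>) = fun w => '<<x, Y w>> * '<<y, Y w>>.
  by apply/funext => w; rewrite /tensor ipZr mulrC (hipC (Y w)).
by rewrite E expectation.unlock in h2; rewrite -/(itg _) E in h1; split=> //; rewrite /Ex h2.
Qed.

(** The standard deviation of the score of index [j]. *)
Definition sc j : R := fine ('N[P]_2%:E [EFin \o (fun v => '<<Y v, phi j>>)])%E.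

Lemma sc_sq j : dim j -> sc j ^+ 2 = lambda j.
Proof.
move=> dj; have [h1 h2] := HS_core (phi j) (phi j).
rewrite phi_eig // ipZr phi_orth // eqxx mulr1 in h2.
pose f v := '<<Y v, phi j>>.
have q0 : (2 : R) != 0 by [].
have e1 : ('N[P]_2%:E[EFin \o f] `^ 2 = (lambda j)%:E)%E.
  rewrite (poweR_Lnorm P (EFin \o f) q0) -h2 /Ex fineK; last exact: (integrable_fin_num measurableT h1).
  apply: eq_integral => x _; rewrite /= powR_mulrn // real_normK ?num_real //.
  by rewrite expr2 /f (hipC (Y x)).
have n0 : (0 <= 'N[P]_2%:E[EFin \o f])%E by exact: Lnorm_ge0.
rewrite /sc -/f; case: ('N[P]_2%:E[EFin \o f])%E e1 n0 => [x|//|//] /= e1 x0.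
  by case: e1; rewrite powR_mulrn.
by move: e1; rewrite (negPf q0).
Qed.

Lemma sc_gt0 j : dim j -> 0 < sc j.
Proof.
move=> dj; have l0 : 0 < lambda j.
  apply: lt_le_trans (lam_lo dj); rewrite mulr_gt0 ?invr_gt0 // powR_gt0 // ltr0n; exact: dim_pos.
rewrite lt_def; apply/andP; split; last exact: fine_ge0 (Lnorm_ge0 _ _ _).
by apply/eqP => s0; move: l0; rewrite -sc_sq // s0 expr0n ltxx.
Qed.

Lemma Sig_bound : exists2 K, 0 <= K & forall x, `|Sig x| <= K * `|x|.
Proof.
have [M [_ hM]] := compact_bounded cpt.
have hb x : `|x| <= 1 -> `|Sig x| <= `|M| + 1.
  move=> x1; apply: (hM (`|M| + 1)); first by rewrite ltr_pwDr // ler_norm.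
  by apply: subset_closure; exists x.
exists (`|M| + 1); first by rewrite addr_ge0.
move=> x; have [->|x0] := eqVneq x 0; first by rewrite linear0 !normr0 mulr0.
have n0 : 0 < `|x| by rewrite normr_gt0.
have -> : x = `|x| *: (`|x|^-1 *: x) by rewrite scalerA divff ?gt_eqF // scale1r.
rewrite linearZ /= !normrZ !normr_id normfV normr_id mulVf ?gt_eqF // mulr1 mulrC.
apply: ler_wpM2r => //; apply: hb; by rewrite normrZ normfV normr_id mulVf ?gt_eqF.
Qed.

Definition mom k : R := (Ka * (2 * k)%:R `^ nu) ^+ (2 * k).
Let e a := phi a.+1.
Let s a := sc a.+1.
Let V a := dim a.+1.

Lemma score_moment a : V a -> forall k, itg (fun w => zs Y e s a w ^+ (2 * k)) /\ Ex (fun w => zs Y e s a w ^+ (2 * k)) <= mom k.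
Proof.
move=> da [|k].
  have E : (fun w => zs Y e s a w ^+ (2 * 0)) = fun=> 1 by apply/funext => w; rewrite muln0 expr0.
  by rewrite E Ex_cst /mom muln0 expr0; split=> //; exact: itg_cst.
have q2 : 2 <= (2 * k.+1)%:R :> R by rewrite ler_nat mulnS leq_addr.
have q0 : 0 < (2 * k.+1)%:R `^ nu :> R by rewrite powR_gt0 // (lt_le_trans _ q2).
have h1 : (ereal_sup [set ((q `^ (- nu))%:E * 'N[P]_q%:E [EFin \o zeta a.+1])%E | q in [set q : R | (2 <= q)%R]] <= Ka%:E)%E.
  by apply: (sup_bound Ha); exists a.+1.
have h2 : (((2 * k.+1)%:R `^ (- nu))%:E * 'N[P]_((2 * k.+1)%:R)%:E [EFin \o zeta a.+1] <= Ka%:E)%E.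
  by apply: le_trans h1; apply: ereal_sup_ubound; exists (2 * k.+1)%:R.
apply: (Lnorm_moment (k := k.+1) (C := Ka * (2 * k.+1)%:R `^ nu)) => //.
- by apply: zs_meas; exact: rX.
- by rewrite mulr_ge0 // ltW.
- by rewrite powRN lee_pdivrMl // -EFinM mulrC in h2.
Qed.

Lemma score_cov m' : V m' -> forall (c : nat -> R) k, Kc^-1 / 2 * \sum_(j < 'C(m'.+2, 2)) c j ^+ 2 <=
  Ex (fun w => (\sum_(j < 'C(m'.+2, 2)) c j * (zs Y e s (tri j).1 w * zs Y e s (tri j).2 w) - k) ^+ 2).
Proof.
move=> dm c k; have dV a : (a < m'.+1)%N -> V a by move=> am; exact: dim_down am dm.
apply: (@cov_form R d T P m'.+1 (fun a => zeta a.+1) (J m'.+1) Kc^-1) => //.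
- by move=> a am; apply: (@zs_meas R H d T Y e s (rX ord0) a).
- by move=> a am; exact: (score_moment (dV a am) 2).1.
- exact: Hcov.
- move=> a ea; have h1 : (1 <= Kc%:E * lambda_min (J m'.+1))%E by apply: (inf_bound Kc0 Hc); exists m'.+1.
  have : (1 <= Kc%:E * a%:E)%E by apply: (inf_bound Kc0 h1); exists a.
  by rewrite lee_fin -[Kc^-1]mulr1 ler_pdivrMl.
- by rewrite invr_ge0 ltW.
Qed.

Lemma spectral_tail u (del : R) : 0 < del -> exists N0, forall m', V m' -> (forall a, V a -> (a < N0)%N -> (a <= m')%N) ->
  `|Sig u - \sum_(a < m'.+1) (s a ^+ 2 * '<<u, e a>>) *: e a| <= del.
Proof.
move=> del0; have [_ _ _ h4] := spd.
have /cvgrPdist_le /(_ _ del0) [N0 _ hN] := h4 u.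
exists N0 => m' dm cov; have := hN (maxn N0 m'.+1) (leq_maxl _ _) => /=.
pose F a := lambda a.+1 *: tensor (phi a.+1) (phi a.+1) u.
have W := big_nat_widen 0 m'.+1 (maxn N0 m'.+1) xpredT F (leq_maxr _ _); rewrite /= in W.
have E : \sum_(1 <= j < (maxn N0 m'.+1).+1 | j \in dim) lambda j *: tensor (phi j) (phi j) u = \sum_(0 <= a < m'.+1) F a.
  rewrite W big_add1 /= big_nat_cond [RHS]big_nat_cond; apply: eq_bigl => a; apply: andb_id2l => /andP[_ aN].
  apply/idP/idP => [/set_mem da|am]; last by apply/mem_set; exact: dim_down am dm.
  rewrite ltnS; move: aN; rewrite leq_max => /orP[aN|]; [exact: cov|by rewrite ltnS].
rewrite E big_mkord (eq_bigr (fun a : 'I_m'.+1 => (s a ^+ 2 * '<<u, e a>>) *: e a)) // => a _.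
by rewrite /F /tensor scalerA sc_sq ?(hipC u) //; exact: dim_down (ltn_ord a) dm.
Qed.

Let p := 2 * beta - 1.

Section Main.
Variables (Cn r c : R).
Hypotheses (Cn0 : 0 <= Cn) (r0 : 0 < r) (c0 : 0 <= c).
Hypothesis ATn : forall (I : finType) (q : I -> R) y l mm M, (0 < M)%N ->
  admissible (wj p Kb') (fun k => 2 * 4 ^+ k * mom (2 * k)%N) (Kc^-1 / 2 / 4) (2 * Kb' / Kb^-1) q y l mm M ->
  En q N (fun s => (~~ `[< close (sumlaw q y l mm M N) (bootlaw y l mm M s) Cn r >])%:R) <= c / N%:R.

Let cst_meas : measurable_fun setT cstat.
Proof. have [K K0 SK] := Sig_bound; change (measurable_fun setT (dstat X Sig)).
by apply: dstat_meas; do ?[exact: rX|exact: sep|exact: SK|exact: K0|exact: HS_core]. Qed.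

Lemma core_positive_dim : dim 1%N -> ((1 - c / N%:R)%:E <= P [set w | (sup [set `|fine (P [set w' | (cstat w' <= t)%R]) -
      fine (kappa w `]-oo, t]%classic)| | t in [set: R]] <= 4 * r)%R])%E.
Proof.
move=> d1; have [K K0 SK] := Sig_bound.
have pE : - (p + 1) = - (2 * beta) by rewrite /p subrK.
have mst : measurable_fun setT cstat by exact: cst_meas.
have msts : measurable_fun setT cstats.
  change (measurable_fun setT (dstats X Xs)).
  by apply: dstats_meas; do ?[exact: rX|exact: rXs|exact: sep|exact: SK|exact: K0|exact: HS_core].
apply: (transfer rX rXs ind idd swr mst msts rc Cn0 r0) => eps del eps0 del0.
apply: (@finite_description R H d T P n X Xs rX rXs idd swr sep Sig K K0 SK HS_core V e s mom p Kb^-1 Kb' (Kc^-1 / 2)) => //.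
- by move=> a a' aa; exact: dim_down.
- by rewrite invr_gt0.
- by rewrite divr_gt0 ?invr_gt0.
- by move=> k; rewrite /mom exprM exprn_ge0 // sqr_ge0.
- exact: score_moment.
- by move=> a da; exact: sc_gt0.
- by move=> a a' da da'; rewrite phi_orth.
- by move=> a da; rewrite pE sc_sq //; exact: lam_lo.
- by move=> a da; rewrite pE sc_sq //; exact: lam_hi.
- move=> a da; rewrite sc_sq //; apply: (le_trans (lam_hi da)); apply: ler_piMr; first exact: ltW.
  rewrite powRN invf_le1 ?powR_gt0 //; apply: (@le_trans _ _ (1 `^ (2 * beta))); first by rewrite powR1.
  apply: ge0_ler_powR; rewrite ?nnegrE ?ler1n //.
  by rewrite mulr_ge0 // (le_trans _ (ltW beta2)).
- by move=> a da; rewrite phi_eig // sc_sq.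
- exact: score_cov.
- exact: spectral_tail.
Qed.

(** In the zero space both norms vanish. Their laws are not continuous, so this case is settled
    directly: the conditional law has mass one at zero almost surely. *)
Lemma core_zero_dim : ~ dim 1%N -> ((1 - c / N%:R)%:E <= P [set w | (sup [set `|fine (P [set w' | (cstat w' <= t)%R]) -
      fine (kappa w `]-oo, t]%classic)| | t in [set: R]] <= 4 * r)%R])%E.
Proof.
move=> nd; have x0 (x : H) : x = 0.
  apply: contrapT => nx; apply: nd; split=> // k [b hb]; rewrite lt0n; apply/eqP => k0.
  by move: b hb; rewrite k0 => b /(_ x) [a [xa _]]; apply: nx; rewrite xa big_ord0.
have op0 (A : H -> H) : opnorm A = 0.
  rewrite /opnorm (_ : [set _ | _ in _] = [set 0]) ?sup1 //; apply/seteqP; split => y /=.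
    by case=> x _ <-; rewrite (x0 (A x)) normr0.
  by move=> ->; exists 0; rewrite /= ?normr0 // (x0 (A 0)) normr0.
have st0 w : cstat w = 0 by rewrite /cstat op0 mulr0.
have sts0 w : cstats w = 0 by rewrite /cstats op0 mulr0.
have mst : measurable_fun setT cstat by exact: cst_meas.
have GT := @measurableT _ (g_sigma_algebraType [set B | exists i A, borel H A /\ B = X i @^-1` A]).
apply: (transfer_of_good rX mst rc) => ts th th0.
have lev t : measurable (~` good_at P cstat kappa r t) /\ pr (~` good_at P cstat kappa r t) <= 0.
  have mg := good_at_meas rX cstat rc r t.
  split; first exact: measurableC.
  have [h1 ik h3] := rc (measurable_itv `]-oo, t]).
  have {h3} := h3 setT GT; rewrite setTI => h3.
  pose D w := statF P cstat t - kap kappa t w.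
  have iD : itg D by apply: itgB => //; exact: itg_cst.
  have EK : Ex (kap kappa t) = statF P cstat t.
    rewrite /Ex /kap h3 /statF /pr; congr (fine (P _)); apply/funext => w /=.
    by rewrite in_itv /= sts0 st0.
  have ED : Ex D = 0 by rewrite ExB ?Ex_cst ?EK ?subrr //; exact: itg_cst.
  have ED2 : Ex (fun w => `|D w|) = 0.
    have k01 w : 0 <= kap kappa t w <= 1 by rewrite (pr_ge0 (kappa w)) (pr_le1 (kappa w)).
    have [t0|t0] := ltP t 0.
      have s0 : statF P cstat t = 0.
        rewrite /statF (_ : [set _ | _] = set0) ?pr_set0 //; apply/seteqP; split => w //=.
        by rewrite st0 leNgt t0.
      rewrite (_ : (fun w => _) = fun w => -1 * D w) ?ExZ ?ED ?mulr0 //.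
      apply/funext => w; rewrite /D s0 sub0r normrN mulN1r opprK ger0_norm //.
      by have /andP[] := k01 w.
    have s1 : statF P cstat t = 1.
      rewrite /statF (_ : [set _ | _] = setT) ?pr_setT //; apply/seteqP; split => w //= _.
      by rewrite st0.
    rewrite (_ : (fun w => _) = D) //; apply/funext => w.
    by rewrite ger0_norm // /D s1 subr_ge0; have /andP[] := k01 w.
  rewrite (_ : ~` _ = [set w | 4 * r < `|D w|]).
    by apply: (le_trans (pr_markov iD (mulr_gt0 (ltr0n _ 4) r0))); rewrite ED2 mul0r.
  by apply/funext => w; apply/propext; rewrite /good_at /= ltNge; split => /negP.
apply: (@le_trans _ _ (\sum_(t <- ts) pr (~` good_at P cstat kappa r t))).
  apply: pr_bigcup_seq => [|t|w].
  - apply: measurableC; rewrite (_ : [set _ | _] = \bigcap_(t in [set t | t \in ts]) good_at P cstat kappa r t) //.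
    by apply: fin_bigcap_measurable => [|t _]; [exact: finite_seq|exact: (good_at_meas rX cstat rc r t)].
  - exact: (lev t).1.
  - move=> hw; apply: contrapT => nex; apply: hw => t tts; apply: contrapT => ng; apply: nex.
    by exists t.
apply: (@le_trans _ _ (\sum_(t <- ts) 0)); first by apply: ler_sum => t _; exact: (lev t).2.
by rewrite big1 // addr_ge0 ?divr_ge0 // ltW.
Qed.

Lemma core : ((1 - c / N%:R)%:E <= P [set w | (sup [set `|fine (P [set w' | (cstat w' <= t)%R]) -
      fine (kappa w `]-oo, t]%classic)| | t in [set: R]] <= 4 * r)%R])%E.
Proof. by have [h|h] := pselect (dim 1%N); [exact: core_positive_dim|exact: core_zero_dim]. Qed.
End Main.
End Core.

(** * The rate *)
Lemma close_weaken (R : realType) (F G : R -> R) (C r1 r2 : R) : r1 <= r2 -> close F G C r1 -> close F G C r2.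
Proof. by move=> h cl t x x0; have [h1 h2] := cl t x x0; split; [apply: le_trans h1 _|apply: le_trans h2 _]; rewrite lerD2l. Qed.

Lemma wj_tail (R : realType) (p B : R) (M k : nat) : 0 < p -> (0 < k)%N ->
  \sum_(j < M) (if (j < k)%N then 0 else wj p B j) <= 4 * B ^+ 2 * pwc p * k%:R `^ (- (p / 2)).
Proof.
move=> p0 k0; rewrite (eq_bigr (fun j : 'I_M => 4 * B ^+ 2 * (if (j < k)%N then 0 else pw p j))); last first.
  by move=> j _; case: ifP => _; rewrite ?mulr0.
rewrite -mulr_sumr -[leRHS]mulrA; apply: ler_wpM2l; first by rewrite mulr_ge0 // sqr_ge0.
exact: pw_tail.
Qed.

Lemma wj_total (R : realType) (p B : R) (M : nat) : 0 < p -> 0 < B ->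
  \sum_(j < M) wj p B j <= wj p B 0 + 4 * B ^+ 2 * pwc p.
Proof.
move=> p0 B0; have := @wj_tail R p B M 1 p0 isT; rewrite powR1 mulr1.
case: M => [|M].
  by rewrite !big_ord0 => h; rewrite addr_ge0 // ltW // wj_gt0.
by rewrite !big_ord_recl /= add0r => h; rewrite lerD2l.
Qed.

Fact four_arith (R : realType) (a b : R) : 0 <= a -> 0 <= b -> a <= 4 * a + b + 1.
Proof. by move=> ? ?; lra. Qed.

Fact exponent_arith (R : realType) (beta eps : R) : 2^-1 < beta -> 0 < eps ->
  (beta - 2^-1) / (2 * beta + 4 + eps) <= (2 * beta - 1) / 2 / (2 * ((2 * beta - 1) / 2) + 5).
Proof.
move=> b2 e0; have h1 : 0 < beta - 2^-1 by rewrite subr_gt0.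
rewrite (_ : (2 * beta - 1) / 2 = beta - 2^-1); last by field.
rewrite (_ : 2 * (beta - 2^-1) + 5 = 2 * beta + 4); last by field.
have h2 : 0 < 2 * beta + 4 by lra.
apply: ler_wpM2l; first exact: ltW.
by rewrite lef_pV2 ?posrE // ?lerDl ?ltW // addr_gt0.
Qed.

(* Row n of the array has sample size n.+1, with X_1 = X n ord0. *)
Theorem theorem2p1 (R : realType) (eps beta nu : R)
    (Ka Kb Kb' Kc Kc' : R) (n0 : nat) :
  0 < eps < 1 -> 2^-1 < beta -> 0 < nu ->
  0 < Ka -> 0 < Kb -> 0 < Kb' -> 0 < Kc -> 0 < Kc' ->
  exists2 c : R, 0 < c &
  forall (H : nat -> hilbertType R)
    (disp : nat -> measure_display) (T : forall n, measurableType (disp n))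
    (P : forall n, probability (T n) R)
    (X Xs : forall n, 'I_n.+1 -> T n -> H n)
    (Sigma : forall n, {linear H n -> H n})
    (lambda : nat -> nat -> R) (phi : forall n, nat -> H n)
    (J : forall n k, 'End(symmx R k))
    (kappa : forall n, T n -> probability (measurableTypeR R) R),
  let zeta n := standardized (P n) (X n ord0) (phi n) in
  (forall n, separable_space (H n)) ->
  (forall n i, random_element (X n i)) ->
  (forall n i, centered (P n) (X n i)) ->
  (forall n, independent (P n) (X n)) ->
  (forall n, identically_distributed (P n) (X n)) ->
  (forall n, second_moment_operator (P n) (X n ord0) (Sigma n)) ->
  (forall n, compact_operator (Sigma n)) ->
  (forall n, spectral_decomposition (Sigma n) (lambda n) (phi n)) ->
  (* (a) *)
  lesssim Ka n0
    (fun n => ereal_sup [set ereal_sup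
       [set ((q `^ (- nu))%:E * 'N[P n]_q%:E [EFin \o zeta n j])%E
         | q in [set q : R | 2 <= q]] | j in dim_index (H n)])
    (fun=> 1%E) ->
  (* (b) *)
  lesssim Kb n0 (fun=> 1%E)
    (fun n => ereal_inf [set (lambda n j * j%:R `^ (2 * beta))%:E
                          | j in dim_index (H n)]) ->
  lesssim Kb' n0
    (fun n => ereal_sup [set (lambda n j * j%:R `^ (2 * beta))%:E
                          | j in dim_index (H n)])
    (fun=> 1%E) ->
  (* (c) *)
  (forall n k, dim_index (H n) k ->
     covariance_operator (P n)
       (fun w => outer (\col_(i < k) zeta n i.+1 w)) (J n k)) ->
  lesssim Kc n0 (fun=> 1%E)
    (fun n => ereal_inf [set lambda_min (J n k) | k in dim_index (H n)]) ->
  lesssim Kc' n0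
    (fun n => ereal_sup [set lambda_max (J n k) | k in dim_index (H n)])
    (fun=> 1%E) ->
  (* bootstrap *)
  (forall n i, random_element (Xs n i)) ->
  (forall n, sampled_with_replacement (P n) (X n) (Xs n)) ->
  let Sigmah n w := empirical_cov (fun i => X n i w) in
  let Sigmas n w := empirical_cov (fun i => Xs n i w) in
  let stat n w : R := Num.sqrt n.+1%:R *
    opnorm (fun z => Sigmah n w z - Sigma n z) in
  let stats n w : R := Num.sqrt n.+1%:R *
    opnorm (fun z => Sigmas n w z - Sigmah n w z) in
  (forall n, regular_cond_distribution (P n) (sigma_generated (X n))
     (stats n) (kappa n)) ->
  forall n,
    ((1 - c / n.+1%:R)%:E <= P n [set w |
       (sup [set `|fine (P n [set w' | stat n w' <= t])
                   - fine (kappa n w `]-oo, t]%classic)| | t in [set: R]]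
        <= c * n.+1%:R `^ (- ((beta - 2^-1) / (2 * beta + 4 + eps))))%R])%E.

Proof.
move=> /andP[eps0 _] b2 nu0 Ka0 Kb0 Kb'0 Kc0 _.
pose p := 2 * beta - 1; have p0 : 0 < p by rewrite subr_gt0 mulrC -ltr_pdivrMr // mul1r.
pose C := 4 * Kb' ^+ 2 * pwc p.
have C0 : 0 <= C by apply: mulr_ge0; [rewrite mulr_ge0 // sqr_ge0|rewrite /pwc sqr_ge0].
have cJ0 : 0 < Kc^-1 / 2 / 4 by rewrite !divr_gt0 // invr_gt0.
have cN0 : 0 < 2 * Kb' / Kb^-1 by rewrite divr_gt0 ?invr_gt0 // mulr_gt0.
have mom0 k : 0 <= 2 * 4 ^+ k * mom nu Ka (2 * k)%N.
  by apply: mulr_ge0; [rewrite mulr_ge0 // exprn_ge0|rewrite /mom exprM exprn_ge0 // sqr_ge0].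
have al0 : 0 < p / 2 by rewrite divr_gt0.
have [cA cA0 hA] := AT cJ0 cN0 al0 C0 (wj_gt0 p Kb'0) mom0 (fun M k k0 => wj_tail Kb' M p0 k0) (fun M => wj_total M p0 Kb'0).
pose c := 4 * cA + n0%:R + 1.
have c0 : 0 < c by rewrite addr_gt0 // ltr_wpDr // mulr_gt0.
exists c => // H disp T P X Xs Sigma lambda phi J kappa zeta sep rX _ ind idd smo cpt spd Ha Hb Hb' Hcov Hc _ rXs swr Sigmah Sigmas stat stats rc n.
have N0 : 0 < n.+1%:R :> R by rewrite ltr0n.
have [nn|nn] := ltnP n n0.
  apply: (@le_trans _ _ 0%E); last exact: measure_ge0.
  rewrite lee_fin subr_le0 ler_pdivlMr // mul1r /c (@le_trans _ _ n0%:R) ?ler_nat //.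
  by rewrite -addrA addrCA lerDl addr_ge0 // mulr_ge0 // ltW.
set ex := (beta - 2^-1) / _; pose r := c * n.+1%:R `^ (- ex) / 4.
have r0 : 0 < r by rewrite divr_gt0 // mulr_gt0 // powR_gt0.
have [Cn Cn0 hn] := hA n.+1 isT.
have cAc : cA <= c by apply: four_arith => //; exact: ltW.
apply: (@le_trans _ _ (1 - cA / n.+1%:R)%:E); first by rewrite lee_fin lerD2l lerN2 ler_wpM2r // invr_ge0 ltW.
have <- : 4 * r = c * n.+1%:R `^ (- ex) by rewrite /r mulrC divfK.
apply: (@core R (H n) _ (T n) (P n) n (X n) (Xs n) (Sigma n) (lambda n) (phi n) (J n) (kappa n) beta nu Ka Kb Kb' Kc) Cn0 r0 (ltW cA0) _ => //.
- exact: Ha.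
- exact: Hb.
- exact: Hb'.
- exact: Hcov.
- exact: Hc.
move=> I q y l mm M M0 adm; apply: le_trans (hn I q y l mm M M0 adm).
have [[q0 _] _ _ _ _] := adm.
apply: (En_le q0) => s _; case: asboolP => // nc; case: asboolP => // cl.
case: nc; apply: close_weaken cl; rewrite (_ : r = c / 4 * n.+1%:R `^ (- ex)); last by rewrite /r mulrAC.
apply: ler_pM; rewrite ?powR_ge0 ?(ltW cA0) //.
  by rewrite ler_pdivlMr // mulrC /c -addrA lerDl addr_ge0.
by apply: ler_powR; [rewrite ler1n|rewrite lerN2; exact: exponent_arith].
Qed.
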